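(* Let $\gamma<0$ be arbitrary and let $Z(f,t)=\frac{e^{-|\gamma|t}}{\sqrt{2|\gamma|}}B(f,e^{2|\gamma|t})$, $f\in 1_\pi^\perp$, $t\in\mathbb{R}$ (the stationary UGRF). Then: 1. $Z$ is a version of the unique (in the sense of equality of finite-dimensional distributions) OU$\mathcal{L}(1_\pi^\perp)$-process whose Itô characteristics are (i) the seminorm $p(f)=\sqrt{\frac{1}{|\gamma|}\langle f,(-A)^{-1}f\rangle_\pi}$, $f\in 1_\pi^\perp$, and (ii) the characteristic (dissipative) operator $\Gamma=-|\gamma|\mathbf{I}$. 2. Itô's deterministic component $Z^{(d)}$ of $Z$ is zero. 3. Itô's innovation process corresponding to $Z$ is given by the two-sided Brownian field $\{B(f,t):f\in 1_\pi^\perp,t\in\mathbb{R}\}$ (in the sense of equality of finite-dimensional distributions). 4. Let $I_n(f,t)=n^{-1/2}\int_0^{nt}f(X_s)\,ds$ and $$U_n(f,t)=\frac{e^{-|\gamma|t}}{\sqrt{2|\gamma|}}\,I_n(f,e^{2|\gamma|t}),\qquad f\in 1_\pi^\perp,\ t\ge0,\ n\ge1 .$$ Then the sequence of random fields $\{U_n\}_{n\ge1}$ converges under $P_\pi$ in finite-dimensional distribution to Itô's infinite dimensional Ornstein–Uhlenbeck $\mathcal{L}(1_\pi^\perp)$-process with characteristic (dissipative) operator $\Gamma=\gamma\mathbf{I}$ and $C=-2A^{-1}$ (that is, to the process described in part 1).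
   Context: Setting: $X=\{X(t):t\ge0\}$ is a progressively measurable Markov process on a measurable state space $(S,\mathcal{S})$, defined on a complete probability space with probability $P_\pi$, whose initial distribution is an ergodic invariant probability $\pi$. $L^2(S,\pi)$ is the real Hilbert space with inner product $\langle\cdot,\cdot\rangle_\pi$, and $1_\pi^\perp=\{f\in L^2(S,\pi):\int_S f\,d\pi=0\}$. Assumption on the generator: the transition semigroup of $X$ on $L^2(S,\pi)$ is strongly continuous, its infinitesimal generator $(A,\mathcal{D}(A))$ is densely defined and self-adjoint, its range is $\mathcal{R}(A)=1_\pi^\perp$, and $A^{-1}$ (the inverse of the bijection $A:\mathcal{D}(A)\cap 1_\pi^\perp\to 1_\pi^\perp$) is a bounded linear operator on $1_\pi^\perp$. Two-sided Brownian field: $\{B(f,t):f\in 1_\pi^\perp,t\in\mathbb{R}\}$ is the centered jointly Gaussian field, linear in $f$ (a.s.) and with continuous paths $t\mapsto B(f,t)$, $B(f,0)=0$, having $\mathbb{E}B(f,s)B(g,t)=(|s|\wedge|t|)(-2\langle f,A^{-1}g\rangle_\pi)$ if $st>0$ and $0$ if $st\le0$. Its restriction to $t\ge 0$ is the limit in distribution of $I_n$. Itô's notions: for a real vector space $E$, an $\mathcal{L}(E)$-process is a real process $\{Y(f,t):f\in E,t\in\mathbb{R}\}$ that is (a.s.) linear in $f$. It is an OU$\mathcal{L}(E)$-process if it is centered Gaussian, Markov (given the present $\sigma(Y(h,t):h\in E)$, the past $\sigma(Y(h,s):h\in E,s\le t)$ and the future are conditionally independent), stationary in $t$, and mean (i.e.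 $L^2$-) continuous in $t$. Its characteristics are: the seminorm $p(f)=\sqrt{\mathbb{E}Y(f,t)^2}$, with associated bilinear form $p(f,g)=\mathbb{E}Y(f,t)Y(g,t)$; and the generator $\Gamma$ (characteristic operator) of the contraction semigroup $S(t)$, $t\ge0$, determined by $\mathbb{E}[Y(f,t)\mid\sigma(Y(h,s):s\le0,h\in E)]=Y(S(t)f,0)$. The deterministic component is $Y^{(d)}(f,t)=\mathbb{E}\big[Y(f,t)\mid\bigcap_{s\in\mathbb{R}}\sigma(Y(h,u):u\le s,h\in E)\big]$, whose covariance form is $p^{(d)}(f,g)=\lim_{u\to\infty}p(S(u)f,S(u)g)$. When $\Gamma$ is defined on all of $E$, the innovation process is $\tilde B(f,t)=Y(f,t)-Y(f,0)-\int_0^tY(\Gamma f,u)\,du$. *)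

(* Defs.v *)
From HB Require Import structures.
From mathcomp Require Import all_boot all_order all_algebra.
From mathcomp Require Import all_classical all_reals all_analysis.

Set Implicit Arguments.
Unset Strict Implicit.
Unset Printing Implicit Defensive.
Import Order.TTheory GRing.Theory Num.Theory.
Import numFieldNormedType.Exports.

Local Open Scope classical_set_scope.
Local Open Scope ring_scope.

(** As in the library's [LfunType], elements of L^2 are square-integrable functions
  rather than classes; statements about them are made modulo pi-a.e. equality
  (through the L^2 norm, or through [ae_eq]). *)

Notation L2 pi := (LfunType pi (lee1n 2)).

Section L2.
Context (d : measure_display) (S : measurableType d) (R : realType)
  (pi : probability S R).

Definition L2norm (f : S -> R) : \bar R := ('N[pi]_2%:E [EFin \o f])%E.

Definition L2dot (f g : S -> R) : R := \int[pi]_x (f x * g x).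

Definition mean_zero : {pred L2 pi} := fun f => \int[pi]_x f x == 0.

Lemma L2_integrable (f : L2 pi) : pi.-integrable setT (EFin \o f).
Proof.
apply/Lfun1_integrable.
have := Lfun2_mul_Lfun1 (LfunP f) (Lfun_cst pi 1 2).
by rewrite (_ : f \* cst 1 = f)//; apply/funext => x /=; rewrite mulr1.
Qed.

Fact mean_zero_submod_closed : submod_closed mean_zero.
Proof.
split=> [|a f g].
  by rewrite unfold_in; apply/eqP; rewrite /Rintegral integral0.
rewrite !unfold_in => /eqP f0 /eqP g0; apply/eqP.
transitivity (\int[pi]_x (a * f x + g x)); first by apply: eq_Rintegral.
rewrite RintegralD//; last exact: L2_integrable.
  by rewrite RintegralZl// ?f0 ?g0 ?mulr0 ?addr0//; exact: L2_integrable.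
rewrite (_ : EFin \o _ = (fun x => a%:E * (f x)%:E)%E).
  by apply: integrableZl => //; exact: L2_integrable.
by apply/funext => x /=; rewrite EFinM.
Qed.

HB.instance Definition _ :=
  GRing.isSubmodClosed.Build R (L2 pi) mean_zero mean_zero_submod_closed.

(** 1_pi^perp *)
Record perp1 := Perp1 { perp1_val :> L2 pi ; _ : perp1_val \in mean_zero }.
HB.instance Definition _ := [isSub for perp1_val].
HB.instance Definition _ := [Choice of perp1 by <:].
HB.instance Definition _ := [SubChoice_isSubLmodule of perp1 by <:].

End L2.
Arguments mean_zero {d S R} pi.

Section conditioning.
Context (d : measure_display) (W : measurableType d) (R : realType)
  (P : probability W R).

Definition generated (d' : measure_display) (T : measurableType d') (I : Type)
    (J : set I) (Y : I -> W -> T) : set (set W) :=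
  <<s \bigcup_(i in J) preimage_set_system setT (Y i) measurable >>.

(** [V] is a version of E[U | G] *)
Definition is_cexp (G : set (set W)) (U V : W -> R) : Prop :=
  [/\ P.-integrable setT (EFin \o U), P.-integrable setT (EFin \o V),
      forall B : set R, measurable B -> G (V @^-1` B) &
      forall A, G A -> \int[P]_(w in A) V w = \int[P]_(w in A) U w].

(** P(A `&` B | G) = P(A | G) P(B | G) for all A in G1, B in G2 *)
Definition cond_independent (G G1 G2 : set (set W)) : Prop :=
  forall A B, G1 A -> G2 B -> exists u v : W -> R,
    [/\ is_cexp G \1_A u, is_cexp G \1_B v &
        is_cexp G \1_(A `&` B) (fun w => u w * v w)].

(** The point mass at 0 is treated apart, because [normal_prob 0 0] is not
  degenerate. *)
Definition centered_gaussian (U : W -> R) : Prop :=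
  measurable_fun setT U /\
  (P (U @^-1` [set 0]) = 1%E \/
   exists2 s : R, 0 < s &
     forall B : set R, measurable B -> P (U @^-1` B) = normal_prob 0 s B).

End conditioning.

Section markov.
Context (d dS : measure_display) (W : measurableType d) (S : measurableType dS)
  (R : realType) (P : probability W R) (pi : probability S R).

Record filtration (F : R -> set (set W)) : Prop := {
  filtration_sigma : forall t, 0 <= t -> sigma_algebra setT (F t) ;
  filtration_sub : forall t, 0 <= t -> F t `<=` measurable ;
  filtration_nondecreasing : forall s t, 0 <= s -> s <= t -> F s `<=` F t }.

(** measurability of (s, w) |-> X s w on [0, t] x W for B([0, t]) (x) F t *)
Definition progressively_measurable (F : R -> set (set W)) (X : R -> W -> S) :=
  forall (t : R) (B : set S), 0 <= t -> measurable B ->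
    <<s [set Q | exists I : set R, exists A : set W,
           [/\ measurable I, F t A & Q = I `*` A]] >>
      [set sw : R * W | 0 <= sw.1 <= t /\ B (X sw.1 sw.2)].

Variable K : R -> R.-pker S ~> S.

Record transition_function : Prop := {
  transition0 : forall x B, measurable B -> K 0 x B = \d_x B ;
  chapman_kolmogorov : forall s t x B, 0 <= s -> 0 <= t -> measurable B ->
    K (s + t) x B = (\int[K s x]_y K t y B)%E }.

Definition markov_property (F : R -> set (set W)) (X : R -> W -> S) : Prop :=
  forall s t B, 0 <= s -> 0 <= t -> measurable B ->
    is_cexp P (F s) \1_(X (s + t) @^-1` B) (fun w => fine (K t (X s w) B)).

Definition invariant_probability : Prop :=
  forall t B, 0 <= t -> measurable B -> (\int[pi]_x K t x B)%E = pi B.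

Definition ergodic : Prop :=
  forall B, measurable B ->
    (forall t, 0 <= t -> {ae pi, forall x, K t x B = (\1_B x)%:E}) ->
    pi B = 0%E \/ pi B = 1%E.

Record ergodic_markov_process (F : R -> set (set W)) (X : R -> W -> S) : Prop := {
  emp_filtration : filtration F ;
  emp_progressive : progressively_measurable F X ;
  emp_transition : transition_function ;
  emp_markov : markov_property F X ;
  emp_invariant : invariant_probability ;
  emp_ergodic : ergodic ;
  emp_initial : forall B, measurable B -> P (X 0 @^-1` B) = pi B }.

Definition transition_op (t : R) (f : S -> R) (x : S) : R :=
  \int[K t x]_y f y.

Definition strongly_continuous : Prop :=
  forall f : L2 pi,
    L2norm pi (fun x => transition_op t f x - f x) @[t --> 0^'+] --> 0%E.

(** graph of the generator A: f is in D(A) and A f = g *)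
Definition generator (f g : L2 pi) : Prop :=
  L2norm pi (fun x => t^-1 * (transition_op t f x - f x) - g x) @[t --> 0^'+]
    --> 0%E.

Definition densely_defined : Prop :=
  forall (f : L2 pi) (e : R), 0 < e -> exists f0 g0 : L2 pi,
    generator f0 g0 /\ (L2norm pi (fun x => (f x - f0 x)%R) < e%:E)%E.

(** the graph of A is that of its adjoint *)
Definition self_adjoint : Prop :=
  forall f g : L2 pi, generator f g <->
    (forall h k : L2 pi, generator h k -> L2dot pi k f = L2dot pi h g).

(** [Ainv] is the inverse of A : D(A) `&` 1_pi^perp -> 1_pi^perp *)
Definition generator_inverse (Ainv : perp1 pi -> perp1 pi) : Prop :=
  (forall g : perp1 pi, generator (Ainv g) g) /\
  (forall f g : perp1 pi, generator f g -> ae_eq pi setT (Ainv g) f).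

Definition bounded_linear (L : perp1 pi -> perp1 pi) : Prop :=
  (forall (a : R) (f g : perp1 pi),
     ae_eq pi setT (L (a *: f + g)) (fun x => a * L f x + L g x)) /\
  (exists M : R, forall f : perp1 pi,
     (L2norm pi (L f) <= M%:E * L2norm pi f)%E).

Record generator_assumption (Ainv : perp1 pi -> perp1 pi) : Prop := {
  ga_strongly_continuous : strongly_continuous ;
  ga_dense : densely_defined ;
  ga_self_adjoint : self_adjoint ;
  ga_range : forall g : L2 pi,
    (exists f : L2 pi, generator f g) <-> g \in mean_zero pi ;
  ga_inverse : generator_inverse Ainv ;
  ga_bounded : bounded_linear Ainv }.

Definition additive_functional (X : R -> W -> S) (n : nat) (f : perp1 pi)
    (t : R) (w : W) : R :=
  (Num.sqrt n%:R)^-1 *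
  \int[lebesgue_measure]_(s in `[0, n%:R * t]) f (X s w).

End markov.

Section finite_dimensional.
Context (R : realType) (E : Type).

Definition eq_fdd (d d' : measure_display) (W : measurableType d)
    (W' : measurableType d') (P : probability W R) (P' : probability W' R)
    (Y : E -> R -> W -> R) (Y' : E -> R -> W' -> R) : Prop :=
  forall (k : nat) (f : 'I_k -> E) (t : 'I_k -> R) (A : set (k.-tuple R)),
    measurable A ->
    P [set w | A [tuple Y (f i) (t i) w | i < k]] =
    P' [set w | A [tuple Y' (f i) (t i) w | i < k]].

(** convergence in distribution of all vectors
  (U_n (f_1, t_1), ..., U_n (f_k, t_k)) with nonnegative times t_i *)
Definition cvg_fdd (d d' : measure_display) (W : measurableType d)
    (W' : measurableType d') (P : probability W R) (P' : probability W' R)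
    (U : nat -> E -> R -> W -> R) (Y : E -> R -> W' -> R) : Prop :=
  forall (k : nat) (f : 'I_k -> E) (t : 'I_k -> R), (forall i, 0 <= t i) ->
    forall h : 'rV[R]_k -> R,
      continuous h -> (exists M : R, forall x, `|h x| <= M) ->
      'E_P[fun w => h (\row_i U n (f i) (t i) w)]%E @[n --> \oo] -->
      'E_P'[fun w => h (\row_i Y (f i) (t i) w)]%E.

End finite_dimensional.

Section fields.
Context (d : measure_display) (W : measurableType d) (R : realType)
  (P : probability W R) (E : lmodType R).
Implicit Types (Y : E -> R -> W -> R) (p : E -> R) (q : E -> E -> R)
  (G : E -> E).

Definition linear_process Y : Prop :=
  forall (a : R) (f g : E) (t : R),
    {ae P, forall w, Y (a *: f + g) t w = a * Y f t w + Y g t w}.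

Definition gaussian_process Y : Prop :=
  forall (k : nat) (c : 'I_k -> R) (f : 'I_k -> E) (t : 'I_k -> R),
    centered_gaussian P (fun w => \sum_i c i * Y (f i) (t i) w).

Definition two_sided_cov q (f g : E) (s t : R) : R :=
  if 0 < s * t then Num.min `|s| `|t| * q f g else 0.

Definition has_two_sided_cov q Y : Prop :=
  forall (f g : E) (s t : R),
    'E_P[fun w => (Y f s w * Y g t w)%R]%E = (two_sided_cov q f g s t)%:E.

Record brownian_field q Y : Prop := {
  bf_gaussian : gaussian_process Y ;
  bf_linear : linear_process Y ;
  bf_continuous : forall f w, continuous (fun t => Y f t w) ;
  bf_at0 : forall f w, Y f 0 w = 0 ;
  bf_cov : has_two_sided_cov q Y }.

Definition field_sigma Y (T : set R) : set (set W) :=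
  generated [set ft : E * R | T ft.2] (fun ft => Y ft.1 ft.2).

Definition field_past Y (t : R) := field_sigma Y [set s | s <= t].
Definition field_present Y (t : R) := field_sigma Y [set t].
Definition field_future Y (t : R) := field_sigma Y [set s | t <= s].

Definition markov_field Y : Prop :=
  forall t, cond_independent P
    (field_present Y t) (field_past Y t) (field_future Y t).

Definition stationary_field Y : Prop :=
  forall u : R, eq_fdd P P (fun f t => Y f (t + u)) Y.

Definition mean_continuous Y : Prop :=
  forall (f : E) (t : R),
    'E_P[fun w => ((Y f s w - Y f t w) ^+ 2)%R]%E @[s --> t] --> 0%E.

Record ou_process Y : Prop := {
  ou_linear : linear_process Y ;
  ou_gaussian : gaussian_process Y ;
  ou_markov : markov_field Y ;
  ou_stationary : stationary_field Y ;
  ou_mean_continuous : mean_continuous Y }.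

Definition char_seminorm Y p : Prop :=
  forall (f : E) (t : R),
    p f = Num.sqrt (fine 'E_P[fun w => (Y f t w ^+ 2)%R]%E).

(** The semigroup is only determined up to elements of zero seminorm. *)
Record contraction_semigroup p (T : R -> E -> E) : Prop := {
  cs_linear : forall t a f g, 0 <= t ->
    p (T t (a *: f + g) - (a *: T t f + T t g)) = 0 ;
  cs_contraction : forall t f, 0 <= t -> p (T t f) <= p f ;
  cs_0 : forall f, p (T 0 f - f) = 0 ;
  cs_D : forall s t f, 0 <= s -> 0 <= t -> p (T (s + t) f - T s (T t f)) = 0 ;
  cs_continuous : forall f, p (T t f - f) @[t --> 0^'+] --> (0 : R) }.

Definition char_semigroup Y p (T : R -> E -> E) : Prop :=
  contraction_semigroup p T /\
  (forall t f, 0 <= t -> is_cexp P (field_past Y 0) (Y f t) (Y (T t f) 0)).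

(** [G] is the (everywhere defined) generator of the characteristic semigroup *)
Definition char_operator Y G : Prop :=
  exists (p : E -> R) (T : R -> E -> E),
    [/\ char_seminorm Y p, char_semigroup Y p T &
        forall f, p (t^-1 *: (T t f - f) - G f) @[t --> 0^'+] --> (0 : R)].

Definition deterministic_component Y (Yd : E -> R -> W -> R) : Prop :=
  forall (f : E) (t : R),
    is_cexp P (\bigcap_(s in [set: R]) field_past Y s) (Y f t) (Yd f t).

Definition oriented_integral (h : R -> R) (t : R) : R :=
  if 0 <= t then \int[lebesgue_measure]_(u in `[0, t]) h u
  else - \int[lebesgue_measure]_(u in `[t, 0]) h u.

Definition innovation Y G : E -> R -> W -> R := fun f t w =>
  Y f t w - Y f 0 w - oriented_integral (fun u => Y (G f) u w) t.

End fields.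

Definition lamperti (R : realType) (E W : Type) (c : R)
    (Y : E -> R -> W -> R) : E -> R -> W -> R := fun f t w =>
  expR (- `|c| * t) / Num.sqrt (2 * `|c|) * Y f (expR (2 * `|c| * t)) w.

(* Main.v *)
Require Import Defs.
From HB Require Import structures.
From mathcomp Require Import all_boot all_order all_algebra.
From mathcomp Require Import all_classical all_reals all_analysis.
From mathcomp Require Import measurable_realfun.
From mathcomp Require Import ring lra zify.

(** For g in the range of the generator A, with A u = g, Dynkin's martingale
  u(X_b) - u(X_a) - int_a^b g(X_v) dv has orthogonal increments, whose conditional second
  moments over a long window L are, by the same fact applied to an approximation of
  u g - <u, g> in the range of A, asymptotic to -2 <u, g> L.  Composing blocks of length L and
  expanding cosines to second order (with a Lindeberg truncation) yields the limits of
  E cos(c + sum_i a_i I_n(f_i, t_i)), and these limits, tightness from uniform second moments,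
  and Bernstein approximation in the variables sin(v_i / b) yield convergence in distribution.

  On the Gaussian side, a uniformly bounded class of functions closed under pointwise limits
  and containing all cos(c + l), l in a linear space, contains the indicators of the generated
  sigma-algebra, so that laws and independence are detected by E cos(c + l).  The Lamperti
  transform turns the Brownian covariance into e^(-k|t-s|) q(f, g) / (2k); for this covariance
  the increments Y(f, t) - e^(-k(t-s)) Y(f, s) are independent of the past of s, which gives the
  Markov property, the semigroup e^(-kt) and the vanishing deterministic component.
  Conversely the characteristics determine the covariance, and the innovation is a limit of
  Riemann sums of such increments whose covariance converges to the two-sided Brownian one. *)

Set Implicit Arguments.
Unset Strict Implicit.
Unset Printing Implicit Defensive.
Import Order.TTheory GRing.Theory Num.Theory.
Import numFieldNormedType.Exports.

Local Open Scope classical_set_scope.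
Local Open Scope ring_scope.

(** * Taylor bounds for sine and cosine *)

Section trig_inequalities.
Context (R : realType).
Implicit Types (x c : R).

(** Complex characteristic functions are replaced by [E cos(c + l)] with a free phase [c]: a shift
    of [c] by [pi / 2] gives the sine, and product-to-sum formulas stay within the class, so that
    uniqueness of laws, independence and limits are real-valued statements.

    In the limit theorem, conditioning on [F a] is expressed by pairing with bounded adapted
    factors, and stationarity makes every such estimate uniform in the starting time.

    The averaging that an ergodic theorem would provide comes from the range of the generator: the
    time integral of an element [A f] has conditional expectations that stay bounded however long
    the window is, and such elements approximate every centered integrable function in [L^1]. Since
    [u] and [g] are only square integrable, and [u g] only integrable, truncations are needed; they
    are always taken of the form [n sin(x / n)].

    Two scales are separated: the block length [L] is fixed first, large enough for the second
    moments to be accurate up to a small fraction of [L], and only then does the factor [n^(-1/2)]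
    tend to zero. *)

Lemma is_derive_ge0 (f f' : R -> R) :
  (forall x : R, is_derive x 1 f (f' x)) -> f 0 = 0 ->
  (forall x, 0 <= x -> 0 <= f' x) -> forall x, 0 <= x -> 0 <= f x.
Proof.
move=> df f0 f'0 x; rewrite le_eqVlt => /predU1P[<-|x0]; first by rewrite f0.
have cf : {within `[0, x], continuous f}.
  apply: continuous_subspaceT => y; apply/differentiable_continuous/derivable1_diffP.
  by have [] := df y.
have [c] := MVT_segment (ltW x0) (fun y _ => df y) cf.
rewrite in_itv/= f0 !subr0 => /andP[c0 _] ->.
by rewrite mulr_ge0 ?f'0// ltW.
Qed.

Lemma is_derive_add (f g : R -> R) (x df dg : R) :
  is_derive x 1 f df -> is_derive x 1 g dg ->
  is_derive x 1 (fun y => f y + g y) (df + dg).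
Proof. by move=> hf hg; exact: (@is_deriveD _ _ _ f g x 1 df dg). Qed.

Lemma is_derive_sub (f g : R -> R) (x df dg : R) :
  is_derive x 1 f df -> is_derive x 1 g dg ->
  is_derive x 1 (fun y => f y - g y) (df - dg).
Proof. by move=> hf hg; exact: (@is_deriveB _ _ _ f g x 1 df dg). Qed.

Lemma is_derive_monomial (n : nat) (a x : R) :
  is_derive x 1 (fun y => a * y ^+ n.+1) (a * n.+1%:R * x ^+ n).
Proof.
have := @is_deriveZ _ _ _ _ a x 1 _ (@is_deriveX _ _ id n.+1 x 1 1 (is_derive_id x 1)).
rewrite (_ : _ *: _ = a * n.+1%:R * x ^+ n).
  by congr (is_derive _ _ _ _); apply/funext => y; rewrite /= fctE.
by rewrite -[RHS]mulrA; congr (_ * _); exact: mulr1.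
Qed.

Lemma sin_le_id x : 0 <= x -> 0 <= x - sin x.
Proof.
have df (y : R) : is_derive y 1 (fun x => x - sin x) (1 - cos y).
  by apply: is_derive_sub.
apply: (is_derive_ge0 df).
- by rewrite sin0 subrr.
- by move=> y _; rewrite subr_ge0 cos_le1.
Qed.

Lemma sin_ge_opp x : 0 <= x -> 0 <= x + sin x.
Proof.
have df (y : R) : is_derive y 1 (fun x => x + sin x) (1 + cos y).
  by apply: is_derive_add.
apply: (is_derive_ge0 df).
- by rewrite sin0 addr0.
- by move=> y _; have := cos_geN1 y; lra.
Qed.

Lemma cos_taylor2 x : 0 <= x -> 0 <= cos x - 1 + 2^-1 * x ^+ 2.
Proof.
have df (y : R) : is_derive y 1 (fun x => cos x - 1 + 2^-1 * x ^+ 2)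
    (- sin y - 0 + 2^-1 * 2%:R * y ^+ 1).
  by apply: is_derive_add (is_derive_monomial _ _ _); apply: is_derive_sub.
apply: (is_derive_ge0 df).
- by rewrite cos0; ring.
- by move=> y y0; have := sin_le_id y0; rewrite expr1; lra.
Qed.

Lemma sin_taylor3 x : 0 <= x -> 0 <= sin x - x + 6^-1 * x ^+ 3.
Proof.
have df (y : R) : is_derive y 1 (fun x => sin x - x + 6^-1 * x ^+ 3)
    (cos y - 1 + 6^-1 * 3%:R * y ^+ 2).
  by apply: is_derive_add (is_derive_monomial _ _ _); apply: is_derive_sub.
apply: (is_derive_ge0 df).
- by rewrite sin0; ring.
- by move=> y y0; have := cos_taylor2 y0; lra.
Qed.

Lemma cos_taylor4 x : 0 <= x -> 0 <= 24^-1 * x ^+ 4 - (cos x - 1 + 2^-1 * x ^+ 2).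
Proof.
have df (y : R) : is_derive y 1 (fun x => 24^-1 * x ^+ 4 - (cos x - 1 + 2^-1 * x ^+ 2))
    (24^-1 * 4%:R * y ^+ 3 - (- sin y - 0 + 2^-1 * 2%:R * y ^+ 1)).
  apply: is_derive_sub; first exact: is_derive_monomial.
  by apply: is_derive_add (is_derive_monomial _ _ _); apply: is_derive_sub.
apply: (is_derive_ge0 df).
- by rewrite cos0; ring.
- by move=> y y0; have := sin_taylor3 y0; rewrite expr1; lra.
Qed.

Lemma norm_sin_le x : `|sin x| <= `|x|.
Proof.
wlog x0 : x / 0 <= x.
  move=> h; have [|/ltW x0] := leP 0 x; first exact: h.
  by rewrite -normrN -sinN -[leRHS]normrN; apply: h; rewrite oppr_ge0.
rewrite (ger0_norm x0) ler_norml.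
by have := sin_le_id x0; have := sin_ge_opp x0; lra.
Qed.

Lemma sin_sub_id_le x : `|sin x - x| <= 6^-1 * `|x| ^+ 3.
Proof.
wlog x0 : x / 0 <= x.
  move=> h; have [|/ltW x0] := leP 0 x; first exact: h.
  have := h (- x); rewrite oppr_ge0 => /(_ x0).
  by rewrite sinN -opprB opprK normrN normrN addrC opprK || rewrite sinN -opprD !normrN.
by rewrite (ger0_norm x0) ler0_norm; have := sin_taylor3 x0; have := sin_le_id x0; lra.
Qed.

Lemma cos_taylor_le x : `|cos x - 1 + 2^-1 * x ^+ 2| <= 24^-1 * `|x| ^+ 4.
Proof.
wlog x0 : x / 0 <= x.
  move=> h; have [|/ltW x0] := leP 0 x; first exact: h.
  by have := h (- x); rewrite oppr_ge0 cosN sqrrN normrN => /(_ x0).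
by rewrite (ger0_norm x0) ger0_norm; have := cos_taylor2 x0; have := cos_taylor4 x0; lra.
Qed.

(** The minimum serves the Lindeberg argument: the cubic bound makes the error negligible at small
    scale wherever the variable is bounded, and the quadratic one stays integrable when only second
    moments exist. *)
Lemma cos_shift_taylor c x :
  `|cos (c + x) - cos c + sin c * x + 2^-1 * cos c * x ^+ 2| <=
  2 * Num.min (x ^+ 2) (`|x| ^+ 3).
Proof.
have h1 := sin_sub_id_le x; have h2 := cos_taylor_le x.
rewrite (_ : _ + _ = cos c * (cos x - 1 + 2^-1 * x ^+ 2) - sin c * (sin x - x)); last first.
  by rewrite cosD; field.
have hc : `|cos c| <= 1 by rewrite ler_norml cos_geN1 cos_le1.
have hs : `|sin c| <= 1 by rewrite ler_norml sin_geN1 sin_le1.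
apply: (@le_trans _ _ (`|cos x - 1 + 2^-1 * x ^+ 2| + `|sin x - x|)).
  by rewrite (le_trans (ler_normB _ _))// !normrM lerD// ler_piMl.
have h3 : `|cos x - 1 + 2^-1 * x ^+ 2| <= 2^-1 * `|x| ^+ 2.
  have : 0 <= cos x - 1 + 2^-1 * x ^+ 2.
    have [x0|/ltW x0] := leP 0 x; first exact: cos_taylor2.
    have := @cos_taylor2 (- x); rewrite oppr_ge0 => /(_ x0).
    by rewrite cosN sqrrN.
  move=> h; rewrite (ger0_norm h) real_normK ?num_real//.
  by have := cos_le1 x; lra.
have h4 : `|sin x - x| <= 2 * `|x|.
  by rewrite (le_trans (ler_normB _ _))//; have := norm_sin_le x; lra.
rewrite -(real_normK (num_real x)) in h2 h3 *.
move: h1 h2 h3 h4; set A := `|sin x - x|; set B := `|cos x - 1 + 2^-1 * `|x| ^+ 2|.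
move: (normr_ge0 x); set y := `|x| => y0 h1 h2 h3 h4.
have hy3 : y ^+ 3 = y * y ^+ 2 by rewrite exprS.
have hy4 : y ^+ 4 = y ^+ 2 * y ^+ 2 by rewrite -exprD.
have y2 : 0 <= y ^+ 2 by rewrite exprn_ge0.
(* Up to 3 the bound [y^3 / 6] is at most [y^2 / 2]; above 3 the bound [2 y] is at most [y^2]. *)
have hA : A <= y ^+ 2.
  have [h|h] := leP y 3.
    have : y * y ^+ 2 <= 3 * y ^+ 2 by rewrite ler_wpM2r.
    lra.
  have : 3 * y <= y ^+ 2 by rewrite expr2 ler_wpM2r// ltW.
  lra.
have [y1|y1] := leP y 1.
  have e1 : y * y ^+ 2 <= y ^+ 2 by rewrite ler_piMl.
  have e2 : y ^+ 2 * y ^+ 2 <= y * y ^+ 2.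
    by rewrite ler_wpM2r// expr2 ler_piMl.
  rewrite min_r; last by rewrite hy3.
  have aux (a b y3 y4 : R) : a <= 6^-1 * y3 -> b <= 24^-1 * y4 -> y4 <= y3 ->
    0 <= y4 -> b + a <= 2 * y3 by lra.
  rewrite hy3 in h1 *; rewrite hy4 in h2.
  by apply: (aux _ _ _ _ h1 h2 e2); exact: mulr_ge0.
have e1 : y ^+ 2 <= y * y ^+ 2 by rewrite ler_peMl// ltW.
have aux (a b y2' : R) : a <= y2' -> b <= 2^-1 * y2' -> 0 <= y2' -> b + a <= 2 * y2' by lra.
by rewrite min_l ?hy3//; exact: aux hA h3 y2.
Qed.

(** The truncation used throughout: [n sin(y / n)] is bounded by [n], dominated by [|y|], and
    measurable for every sigma-algebra for which [y] is. *)
Lemma cvg_sin_scaled (y : R) : n.+1%:R * sin (n.+1%:R^-1 * y) @[n --> \oo] --> y.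
Proof.
apply/cvgrPdist_le => e e0.
have : (6^-1 * `|y| ^+ 3) * n.+1%:R^-1 @[n --> \oo] --> (6^-1 * `|y| ^+ 3) * 0.
  by apply: cvgM; [exact: cvg_cst|exact: cvg_harmonic].
rewrite mulr0 => /cvgrPdist_le/(_ e e0); apply: filterS => n.
rewrite sub0r normrN; apply: le_trans; rewrite [leRHS]ger0_norm; last first.
  by rewrite mulr_ge0// mulr_ge0// exprn_ge0.
have n0 : 0 < n.+1%:R :> R by [].
rewrite distrC (_ : _ - y = n.+1%:R * (sin (n.+1%:R^-1 * y) - n.+1%:R^-1 * y)); last first.
  by rewrite mulrBr mulrA divff ?mul1r// gt_eqF.
rewrite normrM normr_nat.
apply: (@le_trans _ _ (n.+1%:R * (6^-1 * `|n.+1%:R^-1 * y| ^+ 3))).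
  by rewrite ler_pM2l// sin_sub_id_le.
rewrite normrM normfV normr_nat exprMn.
rewrite (_ : n.+1%:R * _ = (6^-1 * `|y| ^+ 3 * n.+1%:R^-1) * n.+1%:R^-1); last first.
  by set z := `|y|; field; rewrite gt_eqF// ltr0n.
rewrite ler_piMr ?invf_le1 ?ler1n// mulr_ge0 ?invr_ge0// mulr_ge0// exprn_ge0//.
Qed.

End trig_inequalities.

(** * Means and quadratic norms *)

Section mean.
Context (d : measure_display) (T : measurableType d) (R : realType)
  (P : probability T R).
Implicit Types (X Y : T -> R) (a M : R).

Definition L1 X := P.-integrable setT (EFin \o X).

Definition mean X : R := \int[P]_w X w.

Lemma L1_measurable X : L1 X -> measurable_fun setT X.
Proof. by move/integrableP => [/measurable_EFinP]. Qed.

Lemma L1_cst a : L1 (fun=> a).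
Proof. exact: finite_measure_integrable_cst. Qed.

Lemma L1D X Y : L1 X -> L1 Y -> L1 (fun w => X w + Y w).
Proof.
move=> hX hY; rewrite /L1 (_ : _ \o _ = ((EFin \o X) \+ (EFin \o Y))%E) //.
exact: integrableD.
Qed.

Lemma L1Z a X : L1 X -> L1 (fun w => a * X w).
Proof.
move=> hX; rewrite /L1 (_ : _ \o _ = (fun x => a%:E * (EFin \o X) x)%E) //.
exact: integrableZl.
Qed.

Lemma L1N X : L1 X -> L1 (fun w => - X w).
Proof.
move/(L1Z (-1)); rewrite (_ : (fun w => -1 * X w) = fun w => - X w) //.
by apply/funext => w; rewrite mulN1r.
Qed.

Lemma L1B X Y : L1 X -> L1 Y -> L1 (fun w => X w - Y w).
Proof. by move=> hX hY; apply: L1D => //; exact: L1N. Qed.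

Lemma L1_sum (I : Type) (s : seq I) (X : I -> T -> R) :
  (forall i, L1 (X i)) -> L1 (fun w => \sum_(i <- s) X i w).
Proof.
move=> hX; elim: s => [|i s ih].
  rewrite (_ : (fun w => _) = fun=> 0); first exact: L1_cst.
  by apply/funext => w; rewrite big_nil.
rewrite (_ : (fun w => _) = fun w => X i w + \sum_(j <- s) X j w).
  exact: L1D.
by apply/funext => w; rewrite big_cons.
Qed.

Lemma L1_norm X : L1 X -> L1 (fun w => `|X w|).
Proof. exact: integrable_norm. Qed.

Lemma L1_le X Y : measurable_fun setT X -> L1 Y ->
  (forall w, `|X w| <= Y w) -> L1 X.
Proof.
move=> mX hY le; apply: (@le_integrable _ _ _ P setT measurableT _ (EFin \o Y)).
- exact/measurable_EFinP.
- by move=> w _ /=; rewrite lee_fin (le_trans (le w))// ler_norm.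
- exact: hY.
Qed.

Lemma L1_bounded M X : measurable_fun setT X -> (forall w, `|X w| <= M) -> L1 X.
Proof. by move=> mX le; apply: (L1_le mX (L1_cst M)). Qed.

Lemma L1_mul_bounded M X Y : L1 X -> measurable_fun setT Y ->
  (forall w, `|Y w| <= M) -> L1 (fun w => X w * Y w).
Proof.
move=> hX mY le; apply: (@L1_le _ (fun w => M * `|X w|)).
- by apply: measurable_funM => //; exact: L1_measurable.
- by apply: L1Z; exact: L1_norm.
- by move=> w; rewrite normrM mulrC ler_wpM2r.
Qed.

Lemma eq_mean X Y : (forall w, X w = Y w) -> mean X = mean Y.
Proof. by move=> e; apply: eq_Rintegral => w _. Qed.

Lemma EFin_mean X : L1 X -> (mean X)%:E = (\int[P]_w (X w)%:E)%E.
Proof. by move=> hX; rewrite fineK//; exact: integrable_fin_num. Qed.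

Lemma expectation_mean X : L1 X -> ('E_P[X])%E = (mean X)%:E.
Proof. by move=> hX; rewrite EFin_mean// unlock. Qed.

Lemma mean_cst a : mean (fun=> a) = a.
Proof. by rewrite /mean Rintegral_cst// [X in fine X]probability_setT mulr1. Qed.

Lemma meanD X Y : L1 X -> L1 Y -> mean (fun w => X w + Y w) = mean X + mean Y.
Proof. exact: RintegralD. Qed.

Lemma meanB X Y : L1 X -> L1 Y -> mean (fun w => X w - Y w) = mean X - mean Y.
Proof. exact: RintegralB. Qed.

Lemma meanZ a X : L1 X -> mean (fun w => a * X w) = a * mean X.
Proof. exact: RintegralZl. Qed.

Lemma meanN X : L1 X -> mean (fun w => - X w) = - mean X.
Proof.
move=> hX; rewrite -mulN1r -meanZ//; apply: eq_mean => w; by rewrite mulN1r.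
Qed.

Lemma mean_sum (I : Type) (s : seq I) (X : I -> T -> R) :
  (forall i, L1 (X i)) ->
  mean (fun w => \sum_(i <- s) X i w) = \sum_(i <- s) mean (X i).
Proof.
move=> hX; elim: s => [|i s ih].
  by rewrite big_nil -[RHS]mean_cst; apply: eq_mean => w; rewrite big_nil.
rewrite big_cons -ih -meanD//; last exact: L1_sum.
by apply: eq_mean => w; rewrite big_cons.
Qed.

Lemma mean_le X Y : L1 X -> L1 Y -> (forall w, X w <= Y w) -> mean X <= mean Y.
Proof. by move=> hX hY le; apply: le_Rintegral. Qed.

Lemma mean_ge0 X : (forall w, 0 <= X w) -> 0 <= mean X.
Proof. by move=> le; apply: Rintegral_ge0. Qed.

Lemma mean_norm X : L1 X -> `|mean X| <= mean (fun w => `|X w|).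
Proof. by move=> hX; apply: le_normr_Rintegral. Qed.

Lemma mean_norm_le X Y : L1 X -> L1 Y -> (forall w, `|X w| <= Y w) ->
  `|mean X| <= mean Y.
Proof.
move=> hX hY le; apply: (le_trans (mean_norm hX)); apply: mean_le => //.
exact: L1_norm.
Qed.

Lemma ae_mean X Y : measurable_fun setT X -> measurable_fun setT Y ->
  {ae P, forall w, X w = Y w} -> mean X = mean Y.
Proof.
move=> mX mY XY; congr fine; apply: ae_eq_integral => //.
- exact/measurable_EFinP.
- exact/measurable_EFinP.
- by apply: filterS XY => w /= -> _.
Qed.

Lemma dominated_mean (X_ : nat -> T -> R) X Y :
  (forall n, measurable_fun setT (X_ n)) -> L1 Y ->
  (forall n w, `|X_ n w| <= Y w) ->
  (forall w, X_ n w @[n --> \oo] --> X w) ->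
  L1 X /\ (mean (X_ n) @[n --> \oo] --> mean X).
Proof.
move=> mX hY le cv.
have mX' : measurable_fun setT X.
  by apply: (measurable_fun_cvg mX) => w _; exact: cv.
have h1 n : measurable_fun setT (EFin \o X_ n) by exact/measurable_EFinP.
have h2 : {ae P, forall w, setT w -> (EFin \o X_ n) w @[n --> \oo] --> (EFin \o X) w}.
  by apply: aeW => w _; apply: cvg_EFin; [exact: nearW|exact: cv].
have h3 : {ae P, forall w n, setT w -> (`|(EFin \o X_ n) w| <= (EFin \o Y) w)%E}.
  by apply: aeW => w n _; rewrite /= lee_fin le.
have [i1 _ i3] := dominated_convergence measurableT h1
  ((measurable_EFinP _ _).2 mX') h2 hY h3.
by split => //; apply: fine_cvg; rewrite EFin_mean.
Qed.

Definition sqint X := measurable_fun setT X /\ L1 (fun w => X w ^+ 2).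

Definition nrm X : R := Num.sqrt (mean (fun w => X w ^+ 2)).

Lemma sqint_bounded M X :
  measurable_fun setT X -> (forall w, `|X w| <= M) -> sqint X.
Proof.
move=> mX le; split=> //; apply: (@L1_bounded (M ^+ 2)).
  exact: measurable_funX.
by move=> w; rewrite normrX ler_sqr ?nnegrE// (le_trans _ (le w)).
Qed.

Lemma sqint_cst a : sqint (fun=> a).
Proof. by split => //; exact: L1_cst. Qed.

Lemma sqint_le X Y : measurable_fun setT X -> sqint Y ->
  (forall w, `|X w| <= `|Y w|) -> sqint X.
Proof.
move=> mX [mY hY] le; split=> //; apply: (L1_le _ hY); first exact: measurable_funX.
by move=> w; rewrite normrX -[leRHS]real_normK ?num_real// ler_sqr ?nnegrE.
Qed.

Lemma sqintM X Y : sqint X -> sqint Y -> L1 (fun w => X w * Y w).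
Proof.
move=> [mX hX] [mY hY].
apply: (@L1_le _ (fun w => X w ^+ 2 + Y w ^+ 2)).
- exact: measurable_funM.
- exact: L1D.
- move=> w; rewrite ler_norml; apply/andP; split.
    by have := sqr_ge0 (X w + Y w); have := sqr_ge0 (X w - Y w); lra.
  by have := sqr_ge0 (X w + Y w); have := sqr_ge0 (X w - Y w); lra.
Qed.

Lemma sqintZ a X : sqint X -> sqint (fun w => a * X w).
Proof.
move=> [mX hX]; split; first exact: measurable_funM.
rewrite (_ : (fun w => _) = fun w => a ^+ 2 * X w ^+ 2); first exact: L1Z.
by apply/funext => w; rewrite exprMn.
Qed.

Lemma sqintD X Y : sqint X -> sqint Y -> sqint (fun w => X w + Y w).
Proof.
move=> hX hY; have [mX iX] := hX; have [mY iY] := hY.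
split; first exact: measurable_funD.
rewrite (_ : (fun w => _) =
  fun w => X w ^+ 2 + 2 * (X w * Y w) + Y w ^+ 2).
  by apply: L1D => //; apply: L1D => //; apply: L1Z; exact: sqintM.
by apply/funext => w; ring.
Qed.

Lemma sqintN X : sqint X -> sqint (fun w => - X w).
Proof.
move=> [mX hX]; split; first exact: measurable_funN.
by rewrite (_ : (fun w => _) = fun w => X w ^+ 2)//; apply/funext => w; ring.
Qed.

Lemma sqintB X Y : sqint X -> sqint Y -> sqint (fun w => X w - Y w).
Proof. by move=> hX hY; apply: sqintD => //; exact: sqintN. Qed.

Lemma sqint_sum (I : Type) (s : seq I) (X : I -> T -> R) :
  (forall i, sqint (X i)) -> sqint (fun w => \sum_(i <- s) X i w).
Proof.
move=> hX; elim: s => [|i s ih].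
  rewrite (_ : (fun w => _) = fun=> 0); first exact: sqint_cst.
  by apply/funext => w; rewrite big_nil.
rewrite (_ : (fun w => _) = fun w => X i w + \sum_(j <- s) X j w).
  exact: sqintD.
by apply/funext => w; rewrite big_cons.
Qed.

Lemma sqint_mul_bounded M X Y : sqint X -> measurable_fun setT Y ->
  (forall w, `|Y w| <= M) -> sqint (fun w => X w * Y w).
Proof.
move=> hX mY le; apply: (@sqint_le _ (fun w => M * X w)).
- by apply: measurable_funM => //; case: hX.
- exact: sqintZ.
- move=> w; rewrite !normrM mulrC ler_wpM2r//.
  by rewrite (le_trans (le w))// ler_norm.
Qed.

Lemma sqint_L1 X : sqint X -> L1 X.
Proof.
move=> hX; have := sqintM hX (sqint_cst 1).
by rewrite (_ : (fun w => _) = X)//; apply/funext => w; rewrite mulr1.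
Qed.

Lemma nrm_ge0 X : 0 <= nrm X.
Proof. exact: sqrtr_ge0. Qed.

Lemma sqr_nrm X : nrm X ^+ 2 = mean (fun w => X w ^+ 2).
Proof. by rewrite sqr_sqrtr// mean_ge0// => w; exact: sqr_ge0. Qed.

Lemma nrmZ a X : sqint X -> nrm (fun w => a * X w) = `|a| * nrm X.
Proof.
move=> [mX hX]; rewrite /nrm -sqrtr_sqr -sqrtrM ?sqr_ge0// -meanZ//.
by congr Num.sqrt; apply: eq_mean => w; rewrite exprMn.
Qed.

Lemma eq_nrm X Y : (forall w, X w = Y w) -> nrm X = nrm Y.
Proof. by move=> e; congr Num.sqrt; apply: eq_mean => w; rewrite e. Qed.

Lemma nrmN X : nrm (fun w => - X w) = nrm X.
Proof. by congr Num.sqrt; apply: eq_mean => w; rewrite sqrrN. Qed.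

Lemma ae_nrm X Y : measurable_fun setT X -> measurable_fun setT Y ->
  {ae P, forall w, X w = Y w} -> nrm X = nrm Y.
Proof.
move=> mX mY XY; congr Num.sqrt; apply: ae_mean; try exact: measurable_funX.
by apply: filterS XY => w /= ->.
Qed.

Lemma nrm_cst a : nrm (fun=> a) = `|a|.
Proof. by rewrite /nrm mean_cst sqrtr_sqr. Qed.

(** Integrating [(s X - Y)^2 >= 0] gives an inequality quadratic in [s], and [s = nrm Y / nrm X] is
    optimal. If one of the norms vanishes, a suitable [s] contradicts a positive mean of the
    product. *)
Lemma mean_mul_nrm X Y : sqint X -> sqint Y ->
  mean (fun w => X w * Y w) <= nrm X * nrm Y.
Proof.
move=> hX hY; have [mX iX] := hX; have [mY iY] := hY.
have key : forall s : R, 0 <= s ->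
    2 * s * mean (fun w => X w * Y w) <= s ^+ 2 * nrm X ^+ 2 + nrm Y ^+ 2.
  move=> s _; rewrite !sqr_nrm -!meanZ//; last exact: sqintM.
  rewrite -meanD//; last exact: L1Z.
  apply: mean_le; [exact/L1Z/sqintM|by apply: L1D => //; exact: L1Z|].
  by move=> w; have := sqr_ge0 (s * X w - Y w); lra.
have [x0|x0] := eqVneq (nrm X) 0.
  rewrite x0 mul0r leNgt; apply/negP => m0.
  set m := mean _ in key m0.
  have := key ((nrm Y ^+ 2 + 1) / m) (divr_ge0 (addr_ge0 (sqr_ge0 _) ler01) (ltW m0)).
  rewrite x0 expr0n mulr0 add0r (mulrC 2) -mulrA (mulrC 2) mulrA divfK ?gt_eqF//.
  by have := sqr_ge0 (nrm Y); lra.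
have xp : 0 < nrm X by rewrite lt_def x0 nrm_ge0.
have [y0|y0] := eqVneq (nrm Y) 0.
  rewrite y0 mulr0 leNgt; apply/negP => m0.
  set m := mean _ in key m0.
  have := key (m / nrm X ^+ 2) (divr_ge0 (ltW m0) (sqr_ge0 _)).
  rewrite y0 expr0n addr0.
  have -> : 2 * (m / nrm X ^+ 2) * m = 2 * (m ^+ 2 / nrm X ^+ 2).
    by rewrite expr2; ring.
  have -> : (m / nrm X ^+ 2) ^+ 2 * nrm X ^+ 2 = m ^+ 2 / nrm X ^+ 2.
    by field.
  have : 0 < m ^+ 2 / nrm X ^+ 2 by rewrite divr_gt0// exprn_gt0.
  by lra.
have yp : 0 < nrm Y by rewrite lt_def y0 nrm_ge0.
have := key (nrm Y / nrm X) (divr_ge0 (ltW yp) (ltW xp)).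
have -> : (nrm Y / nrm X) ^+ 2 * nrm X ^+ 2 = nrm Y ^+ 2 by field.
set m := mean _; move=> h.
have : 2 * (nrm Y / nrm X) * m * nrm X <= (nrm Y ^+ 2 + nrm Y ^+ 2) * nrm X.
  by rewrite ler_pM2r.
have -> : 2 * (nrm Y / nrm X) * m * nrm X = nrm Y * (2 * m) by field.
have -> : (nrm Y ^+ 2 + nrm Y ^+ 2) * nrm X = nrm Y * (2 * (nrm X * nrm Y)) by ring.
by rewrite ler_pM2l//; lra.
Qed.

Lemma norm_mean_mul_nrm X Y : sqint X -> sqint Y ->
  `|mean (fun w => X w * Y w)| <= nrm X * nrm Y.
Proof.
move=> hX hY; rewrite ler_norml mean_mul_nrm// andbT lerNl.
rewrite -(nrmN X) -meanN; last exact: sqintM.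
apply: le_trans (mean_mul_nrm (sqintN hX) hY).
by apply: mean_le => [||w]; [exact/L1N/sqintM|apply: sqintM => //; exact: sqintN|rewrite mulNr].
Qed.

Lemma norm_mean_nrm X : sqint X -> `|mean X| <= nrm X.
Proof.
move=> hX; have := norm_mean_mul_nrm hX (sqint_cst 1).
rewrite nrm_cst normr1 mulr1; congr (`|_| <= _).
by apply: eq_mean => w; rewrite mulr1.
Qed.

Lemma nrmD X Y : sqint X -> sqint Y ->
  nrm (fun w => X w + Y w) <= nrm X + nrm Y.
Proof.
move=> hX hY; rewrite -ler_sqr ?nnegrE ?addr_ge0 ?nrm_ge0//.
have [mX iX] := hX; have [mY iY] := hY.
rewrite sqr_nrm sqrrD !sqr_nrm -mulr_natl.
rewrite (_ : mean _ = mean (fun w => X w ^+ 2) + 2 * mean (fun w => X w * Y w)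
    + mean (fun w => Y w ^+ 2)).
  by have := mean_mul_nrm hX hY; lra.
rewrite -meanZ; last exact: sqintM.
rewrite -!meanD//; first by apply: eq_mean => w; ring.
- by apply: L1D => //; apply: L1Z; exact: sqintM.
- by apply: L1Z; exact: sqintM.
Qed.

Lemma nrmB X Y : sqint X -> sqint Y ->
  nrm (fun w => X w - Y w) <= nrm X + nrm Y.
Proof. by move=> hX hY; rewrite -(nrmN Y); apply: nrmD => //; exact: sqintN. Qed.

Lemma nrm_sum (I : Type) (s : seq I) (X : I -> T -> R) :
  (forall i, sqint (X i)) ->
  nrm (fun w => \sum_(i <- s) X i w) <= \sum_(i <- s) nrm (X i).
Proof.
move=> hX; elim: s => [|i s ih].
  rewrite big_nil (@eq_nrm _ (fun=> 0)) ?nrm_cst ?normr0//.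
  by move=> w; rewrite big_nil.
rewrite big_cons (@eq_nrm _ (fun w => X i w + \sum_(j <- s) X j w)).
  by apply: (le_trans (nrmD _ _)) => //; [exact: sqint_sum|rewrite lerD2l].
by move=> w; rewrite big_cons.
Qed.

Lemma nrm_le X Y : sqint X -> sqint Y -> (forall w, `|X w| <= `|Y w|) ->
  nrm X <= nrm Y.
Proof.
move=> [_ hX] [_ hY] le; rewrite ler_wsqrtr// mean_le// => w.
by rewrite -real_normK ?num_real// -[leRHS]real_normK ?num_real// ler_sqr ?nnegrE.
Qed.

Lemma nrm_le_bound X M : sqint X -> 0 <= M -> (forall w, `|X w| <= M) -> nrm X <= M.
Proof.
move=> hX M0 le; rewrite -[M]ger0_norm// -(nrm_cst M); apply: nrm_le => //.
- exact: sqint_cst.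
- by move=> w; rewrite (ger0_norm M0).
Qed.

End mean.

(** * Functions generated by cosines *)

Section trig_closure.
Context (T : Type) (R : realType) (L : set (T -> R)).

(** The constructors are the operations through which an identity between expectations passes; the
    uniform bound in [trig_lim] is the one that dominated convergence needs. Products are not built
    in: they are derived for linear [L]. *)
Inductive trig_closure : (T -> R) -> Prop :=
| trig_cos c l : L l -> trig_closure (fun w => cos (c + l w))
| trigD f g : trig_closure f -> trig_closure g ->
    trig_closure (fun w => f w + g w)
| trigZ a f : trig_closure f -> trig_closure (fun w => a * f w)
| trig_lim (f_ : nat -> T -> R) (f : T -> R) (M : R) : (forall n, trig_closure (f_ n)) ->
    (forall n w, `|f_ n w| <= M) -> (forall w, f_ n w @[n --> \oo] --> f w) ->
    trig_closure f.

Definition linear_set := L (fun=> 0) /\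
  forall a l m, L l -> L m -> L (fun w => a * l w + m w).

Lemma eq_trig f g : (forall w, f w = g w) -> trig_closure f -> trig_closure g.
Proof. by move=> /funext ->. Qed.

Lemma trig_bounded f : trig_closure f -> exists M : R, forall w, `|f w| <= M.
Proof.
elim=> {f} [c l _|f g _ [M hM] _ [N hN]|a f _ [M hM]|f_ f M _ _ le cv].
- by exists 1 => w; rewrite ler_norml cos_geN1 cos_le1.
- by exists (M + N) => w; rewrite (le_trans (ler_normD _ _))// lerD.
- by exists (`|a| * M) => w; rewrite normrM ler_wpM2l.
- exists M => w.
  have : `|f_ n w| @[n --> \oo] --> `|f w| by apply: cvg_norm; exact: cv.
  move=> h; apply: (@cvgr_to_le _ _ _ _ _ _ _ h).
  by apply: nearW => n; exact: le.
Qed.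

Hypothesis linL : linear_set.

Lemma linear_setZ a l : L l -> L (fun w => a * l w).
Proof.
case: linL => L0 LD hl; have := LD a l _ hl L0.
by rewrite (_ : (fun w => _) = fun w => a * l w)//; apply/funext => w; rewrite addr0.
Qed.

Lemma linear_setD l m : L l -> L m -> L (fun w => l w + m w).
Proof.
case: linL => L0 LD hl hm; have := LD 1 l _ hl hm.
by rewrite (_ : (fun w => _) = fun w => l w + m w)//; apply/funext => w; rewrite mul1r.
Qed.

Lemma trig_cst a : trig_closure (fun=> a).
Proof.
case: linL => L0 _; have := trigZ a (trig_cos 0 L0).
by apply: eq_trig => w; rewrite addr0 cos0 mulr1.
Qed.

(** A double induction whose base case is the product-to-sum formula. It needs [L] to be stable
    under sums and differences and the phases to be free. *)
Lemma trigM f g : trig_closure f -> trig_closure g ->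
  trig_closure (fun w => f w * g w).
Proof.
move=> hf hg; elim: hf => {f} [c l hl|f1 f2 _ h1 _ h2|a f _ h|f_ f M _ h le cv].
- elim: hg => {g} [c' l' hl'|f1 f2 _ h1 _ h2|a f _ h|f_ f M _ h le cv].
  + have hp : trig_closure (fun w => cos ((c + c') + (l w + l' w))).
      by apply: trig_cos; exact: linear_setD.
    have hm : trig_closure (fun w => cos ((c - c') + (l w + (-1) * l' w))).
      by apply: trig_cos; apply: linear_setD => //; exact: linear_setZ.
    apply: eq_trig (trigZ (2^-1) (trigD hp hm)) => w.
    rewrite (_ : c + c' + _ = (c + l w) + (c' + l' w)); last by ring.
    rewrite (_ : c - c' + _ = (c + l w) - (c' + l' w)); last by ring.
    by rewrite cosD cosB; field.
  + by apply: eq_trig (trigD h1 h2) => w; rewrite mulrDr.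
  + by apply: eq_trig (trigZ a h) => w; rewrite mulrCA.
  + apply: (trig_lim h (M := M)) => [n w|w].
      rewrite normrM -[leRHS]mul1r ler_pM//.
      by rewrite ler_norml cos_geN1 cos_le1.
    by apply: cvgM; [exact: cvg_cst|exact: cv].
- by apply: eq_trig (trigD h1 h2) => w; rewrite mulrDl.
- by apply: eq_trig (trigZ a h) => w; rewrite mulrA.
- have [N hN] := trig_bounded hg.
  apply: (trig_lim h (M := M * N)) => [n w|w].
    by rewrite normrM ler_pM.
  by apply: cvgM; [exact: cv|exact: cvg_cst].
Qed.

Lemma trigX f n : trig_closure f -> trig_closure (fun w => f w ^+ n).
Proof.
move=> hf; elim: n => [|n ih]; first exact: trig_cst.
by apply: eq_trig (trigM hf ih) => w; rewrite exprS.
Qed.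

Lemma trigB f g : trig_closure f -> trig_closure g ->
  trig_closure (fun w => f w - g w).
Proof.
by move=> hf hg; apply: eq_trig (trigD hf (trigZ (-1) hg)) => w; rewrite mulN1r.
Qed.

Lemma trig_sin c l : L l -> trig_closure (fun w => sin (c + l w)).
Proof.
move=> hl; apply: eq_trig (trig_cos (c - pi / 2) hl) => w.
by rewrite addrAC cosBpihalf.
Qed.

End trig_closure.

(** * Polynomials converging to a step at one half *)

Section step.
Context (R : realType).
Implicit Types (u x : R).

(** The polynomial known from elementary proofs of the Stone-Weierstrass theorem: the exponent
    [2 ^ n] places the jump at [1/2], where [2 ^ n * u ^ n] passes from tending to zero to tending
    to infinity. *)
Definition step_poly (n : nat) u : R := (1 - u ^+ n) ^+ (2 ^ n).

Lemma bernoulli_le x (m : nat) : x <= 1 -> 1 - m%:R * x <= (1 - x) ^+ m.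
Proof.
move=> x1; elim: m => [|m ih]; first by rewrite mul0r subr0 expr0.
have [x0|x0] := leP 0 x.
  have [mx|mx] := leP (m%:R * x) 1.
    rewrite exprS (@le_trans _ _ ((1 - x) * (1 - m%:R * x)))//; last first.
      by rewrite ler_wpM2l// subr_ge0.
    rewrite -natr1; have : 0 <= m%:R * x * x by rewrite !mulr_ge0.
    by lra.
  apply: (@le_trans _ _ 0); last by rewrite exprn_ge0// subr_ge0.
  by rewrite -natr1; lra.
rewrite exprS (@le_trans _ _ ((1 - x) * (1 - m%:R * x)))//; last first.
  by rewrite ler_wpM2l// subr_ge0.
rewrite -natr1; have : 0 <= m%:R * (x * x) by rewrite mulr_ge0// -expr2 sqr_ge0.
by lra.
Qed.

Lemma step_poly01 n u : 0 <= u <= 1 -> 0 <= step_poly n u <= 1.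
Proof.
move=> /andP[u0 u1]; rewrite exprn_ge0 ?exprn_ile1 ?subr_ge0 ?exprn_ile1//.
by rewrite gerBl exprn_ge0.
Qed.

Lemma cvg_step_poly_lt u : 0 <= u -> u < 2^-1 -> step_poly n u @[n --> \oo] --> (1 : R).
Proof.
move=> u0 u1; have u01 : 0 <= u <= 1 by lra.
apply: (@squeeze_cvgr _ _ _ _ (fun n => 1 - (2 * u) ^+ n) (fun=> 1)).
- apply: nearW => n; have /andP[_ ->] := step_poly01 n u01; rewrite andbT.
  rewrite exprMn (le_trans _ (@bernoulli_le (u ^+ n) (2 ^ n)%N _))//.
    by rewrite natrX.
  by rewrite exprn_ile1//; lra.
- rewrite -[X in _ --> X]subr0; apply: cvgB; first exact: cvg_cst.
  by apply: cvg_expr; rewrite ger0_norm; lra.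
- exact: cvg_cst.
Qed.

Lemma cvg_step_poly_gt u : u <= 1 -> 2^-1 < u -> step_poly n u @[n --> \oo] --> (0 : R).
Proof.
move=> u1 u0; have u01 : 0 <= u <= 1 by lra.
apply: (@squeeze_cvgr _ _ _ _ (fun=> 0) (fun n => (2 * u)^-1 ^+ n)).
- apply: nearW => n; have /andP[-> _] := step_poly01 n u01; rewrite andTb.
  have un : 0 <= u ^+ n by rewrite exprn_ge0//; lra.
  have un1 : u ^+ n <= 1 by rewrite exprn_ile1//; lra.
  (* Multiplied by [(1 + u^n)^(2^n)], which Bernoulli bounds from below by [(2 u)^n], the polynomial
     becomes [(1 - u^(2 n))^(2^n)], which is at most 1. *)
  have h : 2 ^+ n * u ^+ n <= (1 + u ^+ n) ^+ (2 ^ n).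
    have := @bernoulli_le (- u ^+ n) (2 ^ n)%N; rewrite opprK natrX mulrN.
    by rewrite opprK => /(_ _)/(le_trans _) -> //; lra.
  have h0 : 0 < 2 ^+ n * u ^+ n by rewrite mulr_gt0 ?exprn_gt0//; lra.
  rewrite exprVn exprMn -[leRHS]mul1r ler_pdivlMr//.
  apply: (@le_trans _ _ (step_poly n u * (1 + u ^+ n) ^+ (2 ^ n))).
    by rewrite ler_wpM2l// exprn_ge0// subr_ge0.
  rewrite -exprMn -subr_sqr expr1n exprn_ile1 ?gerBl ?sqr_ge0//.
  by rewrite subr_ge0 expr_le1.
- exact: cvg_cst.
- apply: cvg_expr; rewrite ger0_norm; last by rewrite invr_ge0; lra.
  by rewrite invf_lt1; lra.
Qed.

(** Monotonicity comes from [(1 - x / 2)^2 >= 1 - x]. Only the existence of the limit matters: it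
    becomes the value [step0] of the step at its jump. *)
Lemma cvg_step_poly_half : cvg (step_poly n (2^-1 : R) @[n --> \oo]).
Proof.
apply: nondecreasing_is_cvgn.
  apply/nondecreasing_seqP => n; rewrite /step_poly expnS exprM.
  set x : R := 2^-1 ^+ n.
  have x0 : 0 <= x by rewrite exprn_ge0// invr_ge0.
  have x1 : x <= 1 by rewrite exprn_ile1//; lra.
  apply: lerXn2r; rewrite ?nnegrE ?sqr_ge0 ?subr_ge0//.
  rewrite (_ : 2^-1 ^+ n.+1 = x / 2); last by rewrite exprSr.
  by have := sqr_ge0 x; rewrite !expr2; nra.
exists 1 => _ [n _ <-]; have /andP[_ ->]// := @step_poly01 n 2^-1 ltac:(lra).
Qed.

End step.

(** * Indicators as bounded limits of cosines *)

Section trig_indicator.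
Context (T : Type) (R : realType) (L : set (T -> R)).
Hypothesis linL : linear_set L.

Let step0 : R := lim (step_poly n (2^-1 : R) @[n --> \oo]).

Let step_sgn (x : R) : R := if 0 < x then 1 else if x == 0 then step0 else 0.

Let step_sgn_bound x : `|step_sgn x| <= 1.
Proof.
rewrite /step_sgn; case: ifP => _; first by rewrite normr1.
case: ifP => _; last by rewrite normr0.
rewrite ler_norml; apply/andP; split.
  apply: limr_ge; first exact: cvg_step_poly_half.
  apply: nearW => n; have /andP[+ _] := @step_poly01 R n 2^-1 ltac:(lra).
  by lra.
apply: limr_le; first exact: cvg_step_poly_half.
by apply: nearW => n; have /andP[_] := @step_poly01 R n 2^-1 ltac:(lra).
Qed.

(** The variable [u] lies in [[0, 1]] and is below one half exactly where the sine is positive, so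
    the step polynomials in [u] detect the sign of the sine. *)
Let trig_step_sin l a : L l ->
  trig_closure L (fun w => step_sgn (sin (a + l w))).
Proof.
move=> hl.
pose u w := (1 - sin (a + l w)) / 2.
have hu : trig_closure L u.
  apply: eq_trig (trigZ 2^-1 (trigB (trig_cst linL 1) (trig_sin a hl))) => w.
  by rewrite mulrC.
have u01 w : 0 <= u w <= 1.
  rewrite /u; have := sin_le1 (a + l w); have := sin_geN1 (a + l w).
  by move=> h1 h2; lra.
apply: (@trig_lim _ _ _ (fun n w => step_poly n (u w)) _ 1) => [n|n w|w].
- apply: trigX => //; apply: trigB; [exact: trig_cst|exact: trigX].
- by have /andP[h1 h2] := step_poly01 n (u01 w); rewrite ger0_norm.
- have /andP[h1 h2] := u01 w.
  rewrite /step_sgn; case: ltrgtP => [s|s|s].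
  + by apply: cvg_step_poly_lt => //; rewrite /u; lra.
  + by apply: cvg_step_poly_gt => //; rewrite /u; lra.
  + rewrite /u -s subr0 div1r; exact: cvg_step_poly_half.
Qed.

(** Rescaling removes the periodicity: for large [n] the argument lies in [(-1, 1)], where the sine
    has the sign of its argument. *)
Let trig_step_sgn l a : L l -> trig_closure L (fun w => step_sgn (l w - a)).
Proof.
move=> hl.
apply: (@trig_lim _ _ _ (fun n w => step_sgn (sin ((l w - a) / n.+1%:R))) _ 1).
- move=> n; apply: eq_trig (trig_step_sin (- a / n.+1%:R)
    (linear_setZ linL n.+1%:R^-1 hl)) => w.
  by congr (step_sgn (sin _)); rewrite mulrBl mulNr addrC mulrC.
- by move=> n w; exact: step_sgn_bound.
- move=> w; apply: cvg_near_cst.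
  set x := l w - a.
  near=> n.
  have xn : `|x / n.+1%:R| < 1.
    rewrite normrM normfV normr_nat ltr_pdivrMr// mul1r.
    rewrite (@lt_le_trans _ _ n%:R) ?ler_nat//; near: n.
    exact: nbhs_infty_gtr.
  have := @pi_ge2 R.
  rewrite /step_sgn => pi2.
  have [x0|x0|x0] := ltrgtP 0 x.
  + rewrite sin_gt0_pi// divr_gt0//= (lt_trans (le_lt_trans (ler_norm _) xn))//; lra.
  + have s0 : sin (x / n.+1%:R) < 0.
      rewrite -oppr_gt0 -sinN sin_gt0_pi// -mulNr divr_gt0 ?oppr_gt0//=.
      move: xn; rewrite ltr_norml mulNr => /andP[+ _]; set y := x / _; lra.
    by rewrite ltNge (ltW s0)/= lt_eqF.
  + by rewrite -x0 mul0r sin0 ltxx eqxx.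
Unshelve. all: by end_near. Qed.

(** Moving the threshold to [a + 1/n] and letting it decrease to [a] keeps the jump, where the value
    is uncontrolled, away from [l w] for all large [n]. *)
Lemma trig_gt l a : L l -> trig_closure L \1_[set w | a < l w].
Proof.
move=> hl.
apply: (@trig_lim _ _ _ (fun n w => step_sgn (l w - (a + n.+1%:R^-1))) _ 1).
- by move=> n; exact: trig_step_sgn.
- by move=> n w; exact: step_sgn_bound.
- move=> w; apply: cvg_near_cst; rewrite indicE.
  have [h|h] := ltP a (l w).
    have h' : 0 < l w - a by rewrite subr_gt0.
    rewrite mem_set//; near=> n; rewrite /step_sgn ifT//.
    suff : n.+1%:R^-1 < l w - a by set e := _^-1; lra.
    by near: n; exact: (near_infty_natSinv_lt (PosNum h')).
  rewrite memNset/=; last by apply/negP; rewrite -leNgt.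
  near=> n; rewrite /step_sgn.
  have n0 : 0 < n.+1%:R^-1 :> R by rewrite invr_gt0.
  have h2 : l w - (a + n.+1%:R^-1) < 0 by move: n0; set e := _^-1; lra.
  by rewrite ltNge (ltW h2) lt_eqF.
Unshelve. all: by end_near. Qed.

(** Finite unions use [1 - (1 - f) (1 - g)], which is where stability under products enters;
    countable unions are their pointwise limits. *)
Lemma trig_sigma_algebra : sigma_algebra setT [set A | trig_closure L \1_A].
Proof.
split => /=.
- by rewrite indic0; exact: trig_cst.
- move=> A hA; apply: eq_trig (trigB (trig_cst linL 1) hA) => w.
  by rewrite setTD !indicE in_setC; case: (_ \in _) => /=; lra.
- move=> A hA.
  have hU n : trig_closure L \1_(\bigcup_(i in `I_n) A i).
    elim: n => [|n ih].
      by rewrite II0 bigcup_set0 indic0; exact: trig_cst.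
    rewrite IIS bigcup_setU bigcup_set1.
    apply: eq_trig (trigB (trig_cst linL 1) (trigM linL
      (trigB (trig_cst linL 1) ih) (trigB (trig_cst linL 1) (hA n)))) => w.
    rewrite !indicE in_setU; case: (w \in _); case: (w \in _) => /=; lra.
  apply: (trig_lim hU (M := 1)) => [n w|w].
    by rewrite indicE; case: (_ \in _); rewrite ?normr1 ?normr0.
  apply: cvg_near_cst; rewrite !indicE.
  have [|h] := boolP (w \in \bigcup_k A k).
    rewrite inE => -[i _ Ai]; near=> n; congr (_%:R).
    rewrite mem_set//; exists i => //=.
    by near: n; exact: nbhs_infty_gt.
  near=> n; rewrite indicE memNset// => -[i _ Ai].
  by move/negP: h; apply; rewrite inE; exists i.
Unshelve. all: by end_near. Qed.

Lemma trig_smallest (G : set (set T)) : G `<=` [set A | trig_closure L \1_A] ->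
  <<s G >> `<=` [set A | trig_closure L \1_A].
Proof. by apply: smallest_sub; exact: trig_sigma_algebra. Qed.

Lemma trig_preimage l (B : set R) : L l -> measurable B ->
  trig_closure L \1_(l @^-1` B).
Proof.
move=> hl mB.
have hpre : sigma_algebra setT [set B | trig_closure L \1_(l @^-1` B)].
  have [h0 hC hU] := trig_sigma_algebra.
  split => /=.
  - by rewrite preimage_set0.
  - by move=> C hC'; rewrite setTD preimage_setC -setTD; exact: hC.
  - by move=> F hF; rewrite preimage_bigcup; exact: hU.
have {}mB : (@RGenOInfty.G R).-sigma.-measurable B.
  by rewrite -RGenOInfty.measurableE.
suff sub : @RGenOInfty.G R `<=` [set B | trig_closure L \1_(l @^-1` B)].
  exact: (smallest_sub hpre sub mB).
move=> _ [a ->] /=.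
rewrite (_ : _ @^-1` _ = [set w | a < l w]); first exact: trig_gt.
by apply/seteqP; split => w /=; rewrite in_itv/= andbT.
Qed.

Lemma trig_generated (I : Type) (J : set I) (Y : I -> T -> R) :
  (forall i, J i -> L (Y i)) ->
  <<s \bigcup_(i in J) preimage_set_system setT (Y i) measurable >> `<=`
    [set A | trig_closure L \1_A].
Proof.
move=> hJ; apply: trig_smallest => _ [i Ji [B mB <-]] /=.
by rewrite setTI; apply: trig_preimage => //; exact: hJ.
Qed.

End trig_indicator.

Section trig_measurable.
Context (d : measure_display) (W : measurableType d) (R : realType)
  (P : probability W R) (T : Type) (L : set (T -> R)) (Phi : W -> T).

Lemma measurable_cos (f : W -> R) : measurable_fun setT f ->
  measurable_fun setT (fun w => cos (f w)).
Proof.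
move=> mf; apply: measurableT_comp mf.
by apply: continuous_measurable_fun; exact: continuous_cos.
Qed.

Lemma trig_measurable f :
  (forall l, L l -> measurable_fun setT (l \o Phi)) ->
  trig_closure L f -> measurable_fun setT (f \o Phi).
Proof.
move=> mL; elim=> {f} [c l hl|f g _ hf _ hg|a f _ hf|f_ f M _ hf le cv].
- by apply: measurable_cos; apply: measurable_funD => //; exact: mL.
- exact: measurable_funD.
- by apply: measurable_funM.
- by apply: (measurable_fun_cvg hf) => w _; exact: cv.
Qed.

Lemma trig_L1 f :
  (forall l, L l -> measurable_fun setT (l \o Phi)) ->
  trig_closure L f -> L1 P (f \o Phi).
Proof.
move=> mL hf; have [M hM] := trig_bounded hf.
by apply: (@L1_bounded _ _ _ _ M) => [|w]; [exact: trig_measurable|exact: hM].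
Qed.

End trig_measurable.

Section trig_law.
Context (d d' : measure_display) (W : measurableType d) (W' : measurableType d')
  (R : realType) (P : probability W R) (P' : probability W' R)
  (T : Type) (L : set (T -> R)) (Phi : W -> T) (Phi' : W' -> T).

(** [Phi] and [Phi'] send two probability spaces to a common [T]; the induction on the closure then
    compares their laws on [T]. *)
Lemma trig_mean_eq :
  (forall l, L l -> measurable_fun setT (l \o Phi)) ->
  (forall l, L l -> measurable_fun setT (l \o Phi')) ->
  (forall c l, L l -> mean P (fun w => cos (c + l (Phi w))) =
                      mean P' (fun w => cos (c + l (Phi' w)))) ->
  forall f, trig_closure L f -> mean P (f \o Phi) = mean P' (f \o Phi').
Proof.
move=> mL mL' e f; elim=> {f} [c l hl|f g tf hf tg hg|a f tf hf|f_ f M tf hf le cv].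
- exact: e.
- rewrite [LHS]meanD; [|exact: trig_L1 tf|exact: trig_L1 tg].
  by rewrite [RHS]meanD ?hf ?hg//; [exact: trig_L1 tf|exact: trig_L1 tg].
- rewrite [LHS]meanZ; last exact: trig_L1 tf.
  by rewrite [RHS]meanZ ?hf//; exact: trig_L1 tf.
- have [_ h] := @dominated_mean _ _ _ P (fun n => f_ n \o Phi) (f \o Phi) (fun=> M)
    (fun n => trig_measurable mL (tf n)) (L1_cst P M) (fun n w => le n (Phi w))
    (fun w => cv (Phi w)).
  have [_ h'] := @dominated_mean _ _ _ P' (fun n => f_ n \o Phi') (f \o Phi') (fun=> M)
    (fun n => trig_measurable mL' (tf n)) (L1_cst P' M) (fun n w => le n (Phi' w))
    (fun w => cv (Phi' w)).
  have {}hf : (fun n => mean P (f_ n \o Phi)) = (fun n => mean P' (f_ n \o Phi')).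
    by apply/funext.
  by rewrite hf in h; exact: cvg_unique h h'.
Qed.

End trig_law.

Lemma mean_indic d (W : measurableType d) (R : realType) (P : probability W R)
  (A : set W) : measurable A -> mean P \1_A = fine (P A).
Proof. by move=> mA; rewrite /mean /Rintegral integral_indic// setIT. Qed.

(** * Independence from cosines *)

Section trig_independence.
Context (d : measure_display) (W : measurableType d)
  (R : realType) (P : probability W R) (L L' : set (W -> R)).
Hypothesis mL : forall l, L l -> measurable_fun setT l.
Hypothesis mL' : forall l, L' l -> measurable_fun setT l.

Let tm f (h : trig_closure L f) := @trig_measurable _ _ _ _ L id _ mL h.
Let tm' f (h : trig_closure L' f) := @trig_measurable _ _ _ _ L' id _ mL' h.
Let tl f (h : trig_closure L f) := @trig_L1 _ _ _ P _ L id _ mL h.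
Let tl' f (h : trig_closure L' f) := @trig_L1 _ _ _ P _ L' id _ mL' h.
Let tmul f g : trig_closure L f -> trig_closure L' g -> L1 P (fun w => f w * g w).
Proof.
move=> hf hg; have [M hM] := trig_bounded hg.
by apply: (@L1_mul_bounded _ _ _ _ M) => //; [exact: tl|exact: tm'].
Qed.

Lemma trig_independent :
  (forall c c' l l', L l -> L' l' ->
    mean P (fun w => cos (c + l w) * cos (c' + l' w)) =
    mean P (fun w => cos (c + l w)) * mean P (fun w => cos (c' + l' w))) ->
  forall f g, trig_closure L f -> trig_closure L' g ->
    mean P (fun w => f w * g w) = mean P f * mean P g.
Proof.
move=> e f g tf tg; elim: tf => {f} [c l hl|f1 f2 t1 h1 t2 h2|a f tf h|f_ f M tf h le cv].
- elim: tg => {g} [c' l' hl'|g1 g2 t1 h1 t2 h2|a g tg h|g_ g M tg h le cv].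
  + exact: e.
  + rewrite meanD; [|exact: tl'|exact: tl'].
    rewrite mulrDr -h1 -h2 -meanD; first by apply: eq_mean => w; rewrite mulrDr.
    * by apply: tmul => //; exact: trig_cos.
    * by apply: tmul => //; exact: trig_cos.
  + rewrite meanZ; last exact: tl'.
    rewrite mulrCA -h -meanZ; first by apply: eq_mean => w; rewrite mulrCA.
    by apply: tmul => //; exact: trig_cos.
  + have cl : trig_closure L (fun w => cos (c + l w)) by exact: trig_cos.
    have [_ h1] := @dominated_mean _ _ _ P g_ g (fun=> M)
      (fun n => tm' (tg n)) (L1_cst P M) le cv.
    have [||||_ h2] := @dominated_mean _ _ _ P (fun n w => cos (c + l w) * g_ n w)
        (fun w => cos (c + l w) * g w) (fun=> M).
    * by move=> n; apply: L1_measurable; exact: tmul.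
    * exact: L1_cst.
    * move=> n w; rewrite normrM -[leRHS]mul1r ler_pM//.
      by rewrite ler_norml cos_geN1 cos_le1.
    * by move=> w; apply: cvgM; [exact: cvg_cst|exact: cv].
    have {}h : (fun n => mean P (fun w => cos (c + l w) * g_ n w)) =
        fun n => mean P (fun w => cos (c + l w)) * mean P (g_ n) by apply/funext.
    rewrite h in h2; apply: (cvg_unique _ h2) => //.
    by apply: cvgM => //; exact: cvg_cst.
- rewrite meanD; [|exact: tl|exact: tl].
  rewrite mulrDl -h1 -h2 -meanD; first by apply: eq_mean => w; rewrite mulrDl.
  + exact: tmul.
  + exact: tmul.
- rewrite meanZ; last exact: tl.
  rewrite -mulrA -h -meanZ; first by apply: eq_mean => w; rewrite mulrA.
  exact: tmul.
- have [N hN] := trig_bounded tg.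
  have [_ h1] := @dominated_mean _ _ _ P f_ f (fun=> M)
    (fun n => tm (tf n)) (L1_cst P M) le cv.
  have [||||_ h2] := @dominated_mean _ _ _ P (fun n w => f_ n w * g w)
      (fun w => f w * g w) (fun=> M * N).
  + by move=> n; apply: L1_measurable; exact: tmul.
  + exact: L1_cst.
  + by move=> n w; rewrite normrM ler_pM.
  + by move=> w; apply: cvgM; [exact: cv|exact: cvg_cst].
  have {}h : (fun n => mean P (fun w => f_ n w * g w)) =
      fun n => mean P (f_ n) * mean P g by apply/funext.
  rewrite h in h2; apply: (cvg_unique _ h2) => //.
  by apply: cvgM => //; exact: cvg_cst.
Qed.

End trig_independence.

Section eq_fdd_cos.
Context (R : realType) (E : Type) (d d' : measure_display)
  (W : measurableType d) (W' : measurableType d')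
  (P : probability W R) (P' : probability W' R)
  (Y : E -> R -> W -> R) (Y' : E -> R -> W' -> R).

Lemma linear_set_span (T : Type) (I : finType) (x : I -> T -> R) :
  linear_set [set l | exists a : I -> R, l = fun w => \sum_i a i * x i w].
Proof.
split=> [|b l m [a ->] [a' ->]].
  exists (fun=> 0); apply/funext => w; rewrite big1// => i _; exact: mul0r.
exists (fun i => b * a i + a' i); apply/funext => w.
rewrite mulr_sumr -big_split; apply: eq_bigr => i _ /=.
by rewrite mulrDl mulrA.
Qed.

(** The Cramer-Wold device, with cosines of arbitrary phase as characteristic functions: the
    sigma-algebra of [k]-tuples is generated by the coordinates, so every measurable indicator
    belongs to the closure of the linear forms. *)
Lemma eq_fdd_cos :
  (forall f t, measurable_fun setT (Y f t)) ->
  (forall f t, measurable_fun setT (Y' f t)) ->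
  (forall k (f : 'I_k -> E) (t : 'I_k -> R) (a : 'I_k -> R) c,
    mean P (fun w => cos (c + \sum_i a i * Y (f i) (t i) w)) =
    mean P' (fun w => cos (c + \sum_i a i * Y' (f i) (t i) w))) ->
  eq_fdd P P' Y Y'.
Proof.
move=> mY mY' e k f t A mA.
pose Phi w := [tuple Y (f i) (t i) w | i < k].
pose Phi' w := [tuple Y' (f i) (t i) w | i < k].
pose L := [set l : k.-tuple R -> R |
  exists a : 'I_k -> R, l = fun x => \sum_i a i * tnth x i].
have linL : linear_set L by exact: (linear_set_span (fun i x => tnth x i)).
have mPhi : measurable_fun setT Phi.
  apply/measurable_fun_tnthP => i.
  rewrite (_ : _ \o _ = Y (f i) (t i))//.
  by apply/funext => w /=; rewrite tnth_mktuple.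
have mPhi' : measurable_fun setT Phi'.
  apply/measurable_fun_tnthP => i.
  rewrite (_ : _ \o _ = Y' (f i) (t i))//.
  by apply/funext => w /=; rewrite tnth_mktuple.
have ml : forall l, L l -> measurable_fun setT l.
  move=> _ [a ->]; apply: measurable_sum => i.
  by apply: measurable_funM => //; exact: measurable_tnth.
have mA1 : trig_closure L \1_A.
  suff : measurable `<=` [set A | trig_closure L \1_A] by move=> /(_ _ mA).
  apply: trig_smallest => // B; rewrite -bigcup_seq => -[i _ [C mC <-]] /=.
  rewrite setTI; apply: (trig_preimage linL) => //.
  exists (fun j => (i == j)%:R); apply/funext => x.
  rewrite (bigD1 i)//= eqxx mul1r big1 ?addr0// => j /negbTE.
  by rewrite eq_sym => ->; rewrite mul0r.
have := @trig_mean_eq _ _ W W' R P P' _ L Phi Phi' _ _ _ _ mA1.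
rewrite (_ : \1_A \o Phi = \1_(Phi @^-1` A))//.
rewrite (_ : \1_A \o Phi' = \1_(Phi' @^-1` A))//.
rewrite !mean_indic; last 2 first.
- by rewrite -[X in measurable X]setTI; exact: mPhi'.
- by rewrite -[X in measurable X]setTI; exact: mPhi.
move=> h; rewrite -[LHS]fineK ?fin_num_measure//; last first.
  by rewrite -[X in measurable X]setTI; exact: mPhi.
rewrite -[RHS]fineK ?fin_num_measure//; last first.
  by rewrite -[X in measurable X]setTI; exact: mPhi'.
congr EFin; apply: h.
- by move=> l /ml hl; exact: measurableT_comp.
- by move=> l /ml hl; exact: measurableT_comp.
- move=> c _ [a ->]; have := e k f t a c; rewrite /Phi /Phi'.
  under [X in mean P X = _]eq_fun do under eq_bigr do rewrite -[Y _ _ _](tnth_mktuple (fun i => Y (f i) (t i) _)).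
  under [X in _ = mean P' X -> _]eq_fun do under eq_bigr do rewrite -[Y' _ _ _](tnth_mktuple (fun i => Y' (f i) (t i) _)).
  by [].
Qed.

End eq_fdd_cos.

(** * Gaussian laws *)

Section gaussian.
Context (R : realType).
Local Notation mu := (@lebesgue_measure R).

(** Over [[- n, n]] the fundamental theorem gives a difference of boundary values, and dominated
    convergence lets [n] grow. The index 0 is set apart because its interval is a point. *)
Lemma integral_derive_eq0 (F f : R -> R) :
  (forall x : R, is_derive x 1 F (f x)) -> continuous f ->
  mu.-integrable setT (EFin \o f) ->
  F n%:R @[n --> \oo] --> 0 -> F (- n%:R) @[n --> \oo] --> 0 ->
  \int[mu]_x f x = 0.
Proof.
move=> dF cf iF F1 F2.
pose g n := (EFin \o f) \_ `[(- n%:R : R), n%:R].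
have [] := @dominated_convergence _ _ _ mu setT measurableT g (EFin \o f)
  (fun x => `|(EFin \o f) x|%E).
- move=> n; apply/(measurable_restrict _ _ _) => //.
  by rewrite setTI; apply: measurable_funTS; exact: measurable_int iF.
- exact: measurable_int iF.
- apply: aeW => x _; apply: cvg_near_cst.
  near=> n; rewrite /g patchE mem_set//= in_itv/= -ler_norml.
  by near: n; exact: nbhs_infty_ger.
- exact: integrable_abse.
- apply: aeW => x n _; rewrite /g patchE; case: ifP => //.
  by rewrite abse0.
move=> _ _ h.
suff h' : (\int[mu]_x g n x)%E @[n --> \oo] --> 0%:E.
  by rewrite /Rintegral (cvg_unique _ h h').
rewrite -(_ : (fun n => (F n%:R - F (- n%:R))%:E) = (fun n => \int[mu]_x g n x)%E).
  apply: cvg_EFin; first exact: nearW.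
  by rewrite -[X in _ --> X](subr0 0); exact: cvgB.
apply/funext => n; rewrite /g -integral_mkcond.
have [->|n0] := eqVneq n 0%N.
  by rewrite oppr0 subrr set_itv1 integral_set1.
have nn : (- n%:R : R) < n%:R by rewrite gtrN// ltr0n lt0n.
rewrite (@continuous_FTC2 _ f F) ?EFinB//.
- exact: continuous_subspaceT.
- have dF' x : derivable F x 1 by have [] := dF x.
  have cF x : F y @[y --> x] --> F x.
    exact/differentiable_continuous/derivable1_diffP.
  split=> [x _||]; [exact: dF'|exact/cvg_at_right_filter|exact/cvg_at_left_filter].
- by move=> x _; rewrite derive1E; have [_ ->] := dF x.
Unshelve. all: by end_near. Qed.

Lemma is_derive_mul (f g : R -> R) (x df dg : R) :
  is_derive x 1 f df -> is_derive x 1 g dg ->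
  is_derive x 1 (fun y => f y * g y) (f x * dg + g x * df).
Proof. by move=> hf hg; exact: (@is_deriveM _ _ f g x 1 df dg). Qed.

Lemma is_derive_affine (c a x : R) : is_derive x 1 (fun y : R => c + a * y) a.
Proof.
have := is_deriveD (is_derive_cst c x 1)
  (@is_deriveZ _ _ _ id a x 1 1 (is_derive_id _ _)).
by rewrite /GRing.scale /= mulr1 add0r.
Qed.

Lemma is_derive_sin_affine (c a x : R) :
  is_derive x 1 (fun y => sin (c + a * y)) (a * cos (c + a * x)).
Proof.
have := @is_derive1_comp _ (@sin R) _ x _ _ (is_derive_sin _) (is_derive_affine c a x).
by rewrite mulrC.
Qed.

Lemma is_derive_cos_affine (c a x : R) :
  is_derive x 1 (fun y => cos (c + a * y)) (- (a * sin (c + a * x))).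
Proof.
have := @is_derive1_comp _ (@cos R) _ x _ _ (is_derive_cos _) (is_derive_affine c a x).
by rewrite mulNr mulrC.
Qed.

Variable s : R.
Hypothesis s0 : 0 < s.
Let pdf := normal_pdf 0 s.

Lemma normal_pdf_expR x : pdf x = normal_peak s * expR (- x ^+ 2 / (s ^+ 2 *+ 2)).
Proof. by rewrite /pdf normal_pdfE ?gt_eqF//= /normal_fun subr0. Qed.

Lemma is_derive_normal_pdf (x : R) : is_derive x 1 pdf (- (x / s ^+ 2) * pdf x).
Proof.
rewrite (_ : pdf = fun x => normal_peak s * expR (- x ^+ 2 / (s ^+ 2 *+ 2))); last first.
  by apply/funext => y; exact: normal_pdf_expR.
rewrite (_ : (fun x => _) = normal_peak s *: (expR \o ((- (s ^+ 2 *+ 2)^-1) *: ((@GRing.exp R)^~ 2%N)))); last first.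
  by apply/funext => y /=; congr (_ * expR _); rewrite !fctE; rewrite /GRing.scale/= mulrC mulNr mulrN.
apply: is_derive_eq.
rewrite /= !fctE /GRing.scale /=.
have s2 : s ^+ 2 != 0 by rewrite expf_neq0// gt_eqF.
rewrite (_ : - (s ^+ 2 *+ 2)^-1 * x ^+ 2 = - x ^+ 2 / (s ^+ 2 *+ 2)); last by rewrite mulrC mulNr mulrN.
by field; rewrite gt_eqF.
Qed.

Lemma sqr_le_expR (a x : R) : 0 < a -> x ^+ 2 <= a * expR (x ^+ 2 / a).
Proof.
move=> a0; rewrite mulrC -ler_pdivrMr//.
by rewrite (le_trans _ (expR_ge1Dx _))// lerDr.
Qed.

Let s2 : 0 < s ^+ 2 *+ 2. Proof. by rewrite mulrn_wgt0// exprn_gt0. Qed.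

Lemma normal_pdf_sqr_bound x : 0 <= x ^+ 2 * pdf x <= normal_peak s * (s ^+ 2 *+ 2).
Proof.
rewrite mulr_ge0 ?sqr_ge0 ?normal_pdf_ge0//= normal_pdf_expR mulrCA.
rewrite ler_wpM2l ?normal_peak_ge0// mulNr expRN ler_pdivrMr ?expR_gt0//.
exact: sqr_le_expR.
Qed.

Let t : R := Num.sqrt 2 * s.
Let t0 : t != 0. Proof. by rewrite mulf_neq0 ?gt_eqF ?sqrtr_gt0. Qed.

(** Half of the Gaussian exponent absorbs [x^2]; the other half is the exponent of the density of
    variance [2 s^2], hence the choice of [t]. *)
Lemma normal_pdf_sqr_le (x : R) : x ^+ 2 * pdf x <=
  (normal_peak s * (2 * (s ^+ 2 *+ 2)) / normal_peak t) * normal_pdf 0 t x.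
Proof.
rewrite normal_pdfE//= /normal_fun subr0 normal_pdf_expR.
rewrite [leRHS](_ : _ = normal_peak s * (2 * (s ^+ 2 *+ 2)) * expR (- x ^+ 2 / (t ^+ 2 *+ 2))); last first.
  by rewrite mulrA divfK// gt_eqF// normal_peak_gt0.
rewrite mulrCA -mulrA ler_wpM2l ?normal_peak_ge0//.
rewrite (_ : t ^+ 2 *+ 2 = 2 * (s ^+ 2 *+ 2)); last first.
  by rewrite exprMn sqr_sqrtr// mulrnAr.
move: (s ^+ 2 *+ 2) s2 => a a0.
rewrite (_ : - x ^+ 2 / a = - (x ^+ 2 / (2 * a)) - (x ^+ 2 / (2 * a))); last first.
  by field; rewrite gt_eqF.
rewrite (mulNr (x ^+ 2)) expRD mulrA ler_wpM2r ?expR_ge0//.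
rewrite expRN ler_pdivrMr ?expR_gt0//.
by apply: sqr_le_expR; rewrite mulr_gt0.
Qed.

Lemma normal_pdf_sqr_integrable :
  mu.-integrable setT (EFin \o (fun x => x ^+ 2 * pdf x)).
Proof.
have iT := integrableZl measurableT
  (normal_peak s * (2 * (s ^+ 2 *+ 2)) / normal_peak t) (integrable_normal_pdf 0 t).
apply: (le_integrable measurableT _ _ iT).
  apply/measurable_EFinP/measurable_funM; first exact: measurable_funX.
  exact: measurable_normal_pdf.
move=> x _ /=; rewrite lee_fin ger0_norm; last first.
  by have /andP[] := normal_pdf_sqr_bound x.
by rewrite (le_trans _ (ler_norm _))//; exact: normal_pdf_sqr_le.
Qed.

Lemma normal_pdf_mul_integrable (h : R -> R) : measurable_fun setT h ->
  (forall x, `|h x| <= 1 + x ^+ 2) -> mu.-integrable setT (EFin \o (fun x => h x * pdf x)).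
Proof.
move=> mh hle.
have iT := integrableD measurableT (integrable_normal_pdf 0 s) normal_pdf_sqr_integrable.
apply: (le_integrable measurableT _ _ iT).
  by apply/measurable_EFinP/measurable_funM => //; exact: measurable_normal_pdf.
move=> x _ /=; rewrite lee_fin (le_trans _ (ler_norm _))//.
rewrite normrM (ger0_norm (normal_pdf_ge0 _ _ _)).
rewrite (@le_trans _ _ ((1 + x ^+ 2) * pdf x)) ?ler_wpM2r ?normal_pdf_ge0//.
by rewrite mulrDl mul1r.
Qed.

(* The boundary terms of the integrations by parts vanish since [x^2 pdf x] is
   bounded. *)
Lemma cvg_mul_normal_pdf (h : R -> R) (x : nat -> R) :
  (forall n, `|x n| = n%:R) -> (forall n, (0 < n)%N -> `|h (x n)| <= n%:R) ->
  h (x n) * pdf (x n) @[n --> \oo] --> (0 : R).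
Proof.
move=> xn hx; apply: norm_cvg0.
pose M := normal_peak s * (s ^+ 2 *+ 2).
apply: (@squeeze_cvgr _ _ _ _ (fun=> 0) (fun n => M * n.-1.+1%:R^-1)).
- near=> n; rewrite normr_ge0/=.
  have n0 : (0 < n)%N by near: n; exact: nbhs_infty_gt.
  rewrite prednK// ler_pdivlMr ?ltr0n//.
  have /andP[_] := normal_pdf_sqr_bound (x n); apply: le_trans.
  rewrite normrM (ger0_norm (normal_pdf_ge0 _ _ _)) mulrAC.
  rewrite ler_wpM2r ?normal_pdf_ge0// -real_normK ?num_real// xn expr2.
  by rewrite ler_wpM2r// hx.
- exact: cvg_cst.
- rewrite -[X in _ --> X](mulr0 M); apply: cvgM; first exact: cvg_cst.
  rewrite -(@cvg_shiftS _ (fun n => n.-1.+1%:R^-1 : R)) /=.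
  exact: cvg_harmonic.
Unshelve. all: by end_near. Qed.

Lemma normal_pdf_variance : \int[mu]_x (x ^+ 2 * pdf x) = s ^+ 2.
Proof.
have sn : s != 0 by rewrite gt_eqF.
have i1 := integrable_normal_pdf 0 s; have i2 := normal_pdf_sqr_integrable.
(* The integrand is the derivative of [x * pdf x]. *)
have : \int[mu]_x (pdf x - (s ^+ 2)^-1 * (x ^+ 2 * pdf x)) = 0.
  apply: (@integral_derive_eq0 (fun x => x * pdf x)).
  - move=> x; have := is_derive_normal_pdf x => dp.
    rewrite (_ : pdf x - _ = x * (- (x / s ^+ 2) * pdf x) + pdf x * 1).
      by apply: is_derive_mul => //; exact: is_derive_id.
    by field.
  - move=> x; have cp : pdf y @[y --> x] --> pdf x by exact: continuous_normal_pdf.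
    apply: cvgB => //; apply: cvgM; first exact: cvg_cst.
    by apply: cvgM => //; exact: exprn_continuous.
  - rewrite (_ : _ \o _ = (fun x => (pdf x)%:E - (s ^+ 2)^-1%:E * (x ^+ 2 * pdf x)%:E)%E)//.
    by apply: integrableB => //; exact: integrableZl.
  - by apply: (@cvg_mul_normal_pdf id) => n; rewrite normr_nat.
  - by apply: (@cvg_mul_normal_pdf id) => n; rewrite normrN normr_nat.
rewrite RintegralB//; last exact: integrableZl i2.
rewrite RintegralZl// {1}/Rintegral integral_normal_pdf/=.
by move/subr0_eq/(congr1 (fun x => s ^+ 2 * x)); rewrite mulr1 mulrA divff ?expf_neq0// mul1r.
Qed.

(** Gaussian integration by parts against [sin (c + a * x)]: the left integrand, up to the factor
    [s ^+ 2], is what differentiating [pdf] produces. It yields the differential equation of the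
    characteristic function. *)
Lemma normal_pdf_sin (c a : R) : \int[mu]_x (x * sin (c + a * x) * pdf x) =
  s ^+ 2 * a * \int[mu]_x (cos (c + a * x) * pdf x).
Proof.
have sn : s != 0 by rewrite gt_eqF.
have msin : measurable_fun setT (fun x : R => sin (c + a * x)).
  apply: (measurableT_comp (f := @sin R)); last first.
    by apply: measurable_funD => //; exact: measurable_funM.
  by apply: continuous_measurable_fun; exact: continuous_sin.
have mcos : measurable_fun setT (fun x : R => cos (c + a * x)).
  by apply: measurable_cos; apply: measurable_funD => //; exact: measurable_funM.
have i1 : mu.-integrable setT (EFin \o (fun x => x * sin (c + a * x) * pdf x)).
  apply: normal_pdf_mul_integrable => [|x]; first exact: measurable_funM.
  rewrite normrM (@le_trans _ _ `|x|)//.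
    by rewrite ler_piMr// ler_norml sin_geN1 sin_le1.
  by have := sqr_ge0 (`|x| - 1); rewrite -(real_normK (num_real x)); have := normr_ge0 x; nra.
have i2 : mu.-integrable setT (EFin \o (fun x => cos (c + a * x) * pdf x)).
  apply: normal_pdf_mul_integrable => [//|x].
  rewrite (@le_trans _ _ 1)//; first by rewrite ler_norml cos_geN1 cos_le1.
  by rewrite lerDl sqr_ge0.
have sin_le_nat n (x : R) : (0 < n)%N -> `|sin x| <= n%:R.
  by move=> n0; rewrite (@le_trans _ _ 1) ?ler1n// ler_norml sin_geN1 sin_le1.
have : \int[mu]_x (a * (cos (c + a * x) * pdf x) - (s ^+ 2)^-1 * (x * sin (c + a * x) * pdf x)) = 0.
  apply: (@integral_derive_eq0 (fun x => sin (c + a * x) * pdf x)).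
  - move=> x; have := is_derive_normal_pdf x => dp.
    rewrite (_ : _ - _ = sin (c + a * x) * (- (x / s ^+ 2) * pdf x)
      + pdf x * (a * cos (c + a * x))).
      by apply: is_derive_mul => //; exact: is_derive_sin_affine.
    by field.
  - move=> x; have cp : pdf y @[y --> x] --> pdf x by exact: continuous_normal_pdf.
    have ca : c + a * y @[y --> x] --> c + a * x.
      by apply: cvgD; [exact: cvg_cst|apply: cvgM; [exact: cvg_cst|exact: cvg_id]].
    apply: cvgB; (apply: cvgM; first exact: cvg_cst); apply: cvgM => //.
      exact: (cvg_comp _ (@cos R) ca (@continuous_cos R _)).
    apply: cvgM; first exact: cvg_id.
    exact: (cvg_comp _ (@sin R) ca (@continuous_sin R _)).
  - rewrite (_ : _ \o _ = (fun x => a%:E * (cos (c + a * x) * pdf x)%:E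
       - (s ^+ 2)^-1%:E * (x * sin (c + a * x) * pdf x)%:E)%E)//.
    by apply: integrableB => //; exact: integrableZl.
  - apply: (@cvg_mul_normal_pdf (fun x => sin (c + a * x))) => n; first by rewrite normr_nat.
    exact: sin_le_nat.
  - apply: (@cvg_mul_normal_pdf (fun x => sin (c + a * x))) => n; first by rewrite normrN normr_nat.
    exact: sin_le_nat.
rewrite RintegralB//; [|exact: integrableZl i2|exact: integrableZl i1].
rewrite !RintegralZl//.
by move/subr0_eq/(congr1 (fun x => s ^+ 2 * x)); rewrite !mulrA divff ?expf_neq0// mul1r => ->.
Qed.

Let nu := normal_prob (0 : R) s.

(** [pdf] is almost everywhere the Radon-Nikodym derivative of the normal law, since both have the
    same integrals over measurable sets; the change of variables formula then applies. *)
Lemma ge0_integral_normal_prob (h : R -> \bar R) : measurable_fun setT h ->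
  (forall x, 0 <= h x)%E -> (\int[nu]_x h x = \int[mu]_x (h x * (pdf x)%:E))%E.
Proof.
move=> mh h0.
have numu : nu `<< mu by apply: normal_prob_dominates; rewrite gt_eqF.
have f_pdf : ae_eq mu setT (Radon_Nikodym_SigmaFinite.f nu mu) (EFin \o pdf).
  apply: integral_ae_eq => //.
  - exact: Radon_Nikodym_SigmaFinite.f_integrable.
  - by apply/measurable_EFinP; exact: measurable_normal_pdf.
  - by move=> A _ mA; rewrite -Radon_Nikodym_SigmaFinite.f_integral.
rewrite -(Radon_Nikodym_SigmaFinite.change_of_variables numu)//.
apply: ae_eq_integral => //.
- apply: emeasurable_funM => //.
  exact: measurable_int (Radon_Nikodym_SigmaFinite.f_integrable numu).
- by apply: emeasurable_funM => //; apply/measurable_EFinP; exact: measurable_normal_pdf.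
- exact: ae_eqe_mul2l.
Qed.

End gaussian.

Section gaussian_law.
Context (R : realType) (d : measure_display) (W : measurableType d)
  (P : probability W R) (U : W -> R) (s : R).
Hypothesis s0 : 0 < s.
Hypothesis mU : measurable_fun setT U.
Hypothesis lawU : forall B : set R, measurable B -> P (U @^-1` B) = normal_prob 0 s B.
Local Notation mu := (@lebesgue_measure R).

Lemma ge0_integral_gaussian (h : R -> \bar R) : measurable_fun setT h ->
  (forall x, 0 <= h x)%E ->
  (\int[P]_w h (U w) = \int[mu]_x (h x * (normal_pdf 0 s x)%:E))%E.
Proof.
move=> mh h0; rewrite -ge0_integral_normal_prob//.
have mU' : @measurable_fun _ _ W (measurableTypeR R) setT U := mU.
rewrite -[LHS](@ge0_integral_pushforward _ _ W (measurableTypeR R) R U mU' P setT h)//.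
apply: (@eq_measure_integral _ _ R setT (normal_prob 0 s)).
by move=> A mA _; exact: lawU.
Qed.

Lemma gaussian_L1 (h : R -> R) : measurable_fun setT h ->
  (forall x, `|h x| <= 1 + x ^+ 2) -> L1 P (h \o U).
Proof.
move=> mh hle; apply/integrableP; split.
  by apply/measurable_EFinP; exact: measurableT_comp.
rewrite (ge0_integral_gaussian (h := fun x => `|(h x)%:E|%E))//; last first.
  by apply/measurableT_comp => //; exact/measurable_EFinP.
have /integrableP[_] := normal_pdf_mul_integrable s0 mh hle.
apply: le_lt_trans; apply: ge0_le_integral => //.
- by move=> x _; rewrite mule_ge0// lee_fin normal_pdf_ge0.
- apply: emeasurable_funM; last by apply/measurable_EFinP; exact: measurable_normal_pdf.
  by apply/measurableT_comp => //; exact/measurable_EFinP.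
- apply/measurableT_comp => //; apply/measurable_EFinP/measurable_funM => //.
  exact: measurable_normal_pdf.
- by move=> x _ /=; rewrite normrM EFinM lee_wpmul2l// lee_fin ler_norm.
Qed.

Lemma mean_gaussian (h : R -> R) : measurable_fun setT h ->
  (forall x, `|h x| <= 1 + x ^+ 2) ->
  mean P (h \o U) = \int[mu]_x (h x * normal_pdf 0 s x).
Proof.
move=> mh hle; have iU := gaussian_L1 mh hle.
have ih := normal_pdf_mul_integrable s0 mh hle.
rewrite /mean /Rintegral integralE [in RHS]integralE.
have pos (g : R -> \bar R) : measurable_fun setT g -> (\int[P]_w g^\+ (U w) =
    \int[mu]_x (g^\+ x * (normal_pdf 0 s x)%:E))%E.
  by move=> mg; apply: ge0_integral_gaussian => //; exact: measurable_funepos.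
have neg (g : R -> \bar R) : measurable_fun setT g -> (\int[P]_w g^\- (U w) =
    \int[mu]_x (g^\- x * (normal_pdf 0 s x)%:E))%E.
  by move=> mg; apply: ge0_integral_gaussian => //; exact: measurable_funeneg.
congr (fine (_ - _)%E).
- rewrite (_ : (fun w => ((h \o U) w)%:E)^\+%E = fun w => (EFin \o h)^\+%E (U w)); last first.
    by apply/funext => w; rewrite !funeposE.
  rewrite pos; last exact/measurable_EFinP.
  apply: eq_integral => x _; rewrite !funeposE /= EFinM.
  by rewrite maxeMl ?mul0e// lee_fin normal_pdf_ge0.
- rewrite (_ : (fun w => ((h \o U) w)%:E)^\-%E = fun w => (EFin \o h)^\-%E (U w)); last first.
    by apply/funext => w; rewrite !funenegE.
  rewrite neg; last exact/measurable_EFinP.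
  apply: eq_integral => x _; rewrite !funenegE /= -mulNr EFinM.
  by rewrite maxeMl ?mul0e// lee_fin normal_pdf_ge0.
Qed.

End gaussian_law.

Section gaussian_char.
Context (R : realType) (d : measure_display) (W : measurableType d)
  (P : probability W R).

Lemma measurable_sin (f : W -> R) : measurable_fun setT f ->
  measurable_fun setT (fun w => sin (f w)).
Proof.
move=> mf; apply: measurableT_comp mf.
by apply: continuous_measurable_fun; exact: continuous_sin.
Qed.

Lemma is_derive_mean_cos (U : W -> R) (c a : R) : L1 P U ->
  is_derive a 1 (fun a => mean P (fun w => cos (c + a * U w)))
    (- mean P (fun w => U w * sin (c + a * U w))).
Proof.
move=> iU; have mU := L1_measurable iU.
have mc b : measurable_fun setT (fun w => c + b * U w).
  by apply: measurable_funD => //; exact: measurable_funM.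
have dc (b y : R) : is_derive b 1 (fun b => cos (c + b * y)) (- (y * sin (c + b * y))).
  have := is_derive_cos_affine c y b; rewrite (mulrC b).
  by congr (is_derive _ _ _ _); apply/funext => z; rewrite mulrC.
have ab : `]a - 1, a + 1[%classic a by rewrite /= in_itv/=; lra.
pose f b w := cos (c + b * U w).
have f1 b w : partial1of2 f b w = - (U w * sin (c + b * U w)).
  by rewrite partial1of2E; have [_ ->] := dc b (U w).
have h1 x : `]a - 1, a + 1[%classic x -> P.-integrable setT (EFin \o f x).
  move=> _; apply: (@L1_bounded _ _ _ _ 1) => [|w]; first exact: measurable_cos.
  by rewrite ler_norml cos_geN1 cos_le1.
have h2 x y : `]a - 1, a + 1[%classic x -> [set: W] y -> derivable (f ^~ y) x 1.
  by move=> _ _; have [] := dc x (U y).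
have h3 x y : `]a - 1, a + 1[%classic x -> [set: W] y ->
    `|partial1of2 f x y| <= `|U y|.
  move=> _ _; rewrite f1 normrN normrM ler_piMr//.
  by rewrite ler_norml sin_geN1 sin_le1.
have d1 := @derivable_under_integral R _ W P f setT measurableT a _ _ ab
  h1 h2 (fun w => `|U w|) (fun w => normr_ge0 _) (L1_norm iU) h3.
have d2 := @differentiation_under_integral R _ W P f setT measurableT a _ _ ab
  h1 h2 (fun w => `|U w|) (fun w => normr_ge0 _) (L1_norm iU) h3.
apply: DeriveDef => //.
rewrite -derive1E [LHS]d2 -meanN; first by apply: eq_mean => w; rewrite f1.
apply: (L1_le _ (L1_norm iU)).
  by apply: measurable_funM => //; exact: measurable_sin.
by move=> w; rewrite normrM ler_piMr// ler_norml sin_geN1 sin_le1.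
Qed.

Lemma ler_norm_1Dsqr (x : R) : `|x| <= 1 + x ^+ 2.
Proof.
have := sqr_ge0 (`|x| - 1); rewrite -(real_normK (num_real x)).
by have := normr_ge0 x; nra.
Qed.

(** As a function of the frequency [b], the mean [phi] satisfies [phi' = - s^2 b phi], by
    differentiation under the integral and integration by parts. Hence [phi b * exp (s^2 b^2 / 2)]
    is constant. *)
Lemma mean_gaussian_cos (U : W -> R) (s c a : R) : 0 < s -> measurable_fun setT U ->
  (forall B : set R, measurable B -> P (U @^-1` B) = normal_prob 0 s B) ->
  mean P (fun w => cos (c + a * U w)) = cos c * expR (- (a ^+ 2 * s ^+ 2 / 2)).
Proof.
move=> s0 mU lawU.
have iU : L1 P U.
  by apply: (@gaussian_L1 _ _ _ _ _ _ s0 mU lawU id) => // x; exact: ler_norm_1Dsqr.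
pose phi b := mean P (fun w => cos (c + b * U w)).
have dphi (b : R) : is_derive b 1 phi (- (s ^+ 2 * b * phi b)).
  have -> : s ^+ 2 * b * phi b = mean P (fun w => U w * sin (c + b * U w)).
    rewrite /phi.
    have mcb : measurable_fun setT (fun x : R => c + b * x).
      by apply: measurable_funD => //; exact: measurable_funM.
    have msin : measurable_fun setT (fun x : R => x * sin (c + b * x)).
      apply: measurable_funM => //; apply: measurableT_comp mcb.
      by apply: continuous_measurable_fun; exact: continuous_sin.
    have mcos : measurable_fun setT (fun x : R => cos (c + b * x)).
      exact: measurable_cos.
    rewrite (mean_gaussian s0 mU lawU mcos); last first.
      move=> x; rewrite (@le_trans _ _ 1)//; first by rewrite ler_norml cos_geN1 cos_le1.
      by rewrite lerDl sqr_ge0.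
    rewrite (mean_gaussian s0 mU lawU msin) ?normal_pdf_sin// => x.
    rewrite normrM (le_trans _ (ler_norm_1Dsqr _))//.
    by rewrite ler_piMr// ler_norml sin_geN1 sin_le1.
  exact: is_derive_mean_cos.
pose g b := phi b * expR (s ^+ 2 / 2 * (b * b)).
have dg (b : R) : is_derive b 1 g 0.
  have dq : is_derive b 1 (fun b : R => s ^+ 2 / 2 * (b * b)) (s ^+ 2 * b).
    have := @is_deriveZ _ _ _ _ (s ^+ 2 / 2) b 1 _ (is_derive_mul (is_derive_id b 1) (is_derive_id b 1)).
    by rewrite /GRing.scale /= (_ : s ^+ 2 / 2 * _ = s ^+ 2 * b)//; field.
  have de := @is_derive1_comp _ (@expR R) _ b _ _ (is_derive_expR _) dq.
  rewrite (_ : 0 = phi b * (expR (s ^+ 2 / 2 * (b * b)) * (s ^+ 2 * b)) + expR (s ^+ 2 / 2 * (b * b)) * (- (s ^+ 2 * b * phi b))).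
    exact: is_derive_mul.
  by ring.
have := is_derive_0_is_cst a 0 dg.
rewrite /g !mulr0 expR0 mulr1 {2}/phi.
rewrite [in RHS](@eq_mean _ _ _ _ _ (fun=> cos c)) ?mean_cst; last first.
  by move=> w; rewrite mul0r addr0.
move=> <-; rewrite expRN (_ : s ^+ 2 / 2 * _ = a ^+ 2 * s ^+ 2 / 2); last by field.
by rewrite mulfK// gt_eqF// expR_gt0.
Qed.

(** Written in terms of the variance, one formula covers both the nondegenerate law and the point
    mass at 0. *)
Lemma centered_gaussian_char (U : W -> R) : centered_gaussian P U ->
  [/\ sqint P U &
      forall c, mean P (fun w => cos (c + U w)) =
        cos c * expR (- (mean P (fun w => U w ^+ 2) / 2))].
Proof.
move=> [mU [U0|[s s0 lawU]]].
  have mU0 : measurable (U @^-1` [set 0]).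
    by rewrite -[X in measurable X]setTI; exact: mU.
  have ae0 : {ae P, forall w, U w = 0}.
    exists (~` (U @^-1` [set 0])); split => //; first exact: measurableC.
    by rewrite probability_setC// U0 subee.
  have U2 : {ae P, forall w, U w ^+ 2 = 0}.
    by apply: filterS ae0 => w /= ->; rewrite expr0n.
  have mU2 : measurable_fun setT (fun w => U w ^+ 2) by exact: measurable_funX.
  split.
    split => //; apply/integrableP; split; first exact/measurable_EFinP.
    pose U2E w := (U w ^+ 2)%:E.
    have h1 : measurable_fun setT (fun w => `|U2E w|%E).
      by apply/measurableT_comp => //; exact/measurable_EFinP.
    have h2 : ae_eq P setT (fun w => `|U2E w|%E) (cst 0%E).
      by apply: filterS U2 => w /= -> _; rewrite normr0.
    rewrite [X in (X < _)%E](ae_eq_integral _ _ measurableT h1 _ h2)//.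
    by rewrite integral0 ltry.
  move=> c; rewrite (ae_mean mU2 _ U2)// mean_cst mul0r oppr0 expR0 mulr1.
  rewrite -[RHS](mean_cst P); apply: ae_mean => //.
    by apply: measurable_cos; exact: measurable_funD.
  by apply: filterS ae0 => w /= ->; rewrite addr0.
have iU2 : L1 P (fun w => U w ^+ 2).
  apply: (gaussian_L1 s0 mU lawU (h := fun x => x ^+ 2)).
    exact: measurable_funX.
  by move=> x; rewrite ger0_norm ?sqr_ge0// lerDr.
have vU : mean P (fun w => U w ^+ 2) = s ^+ 2.
  rewrite [LHS](mean_gaussian s0 mU lawU (h := fun x => x ^+ 2)).
  - exact: normal_pdf_variance.
  - exact: measurable_funX.
  - by move=> x; rewrite ger0_norm ?sqr_ge0// lerDr.
split=> // c; rewrite vU.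
have := mean_gaussian_cos c 1 s0 mU lawU; rewrite expr1n mul1r => <-.
by apply: eq_mean => w; rewrite mul1r.
Qed.

End gaussian_char.

(** * Conditional independence *)

Section sub_sigma_algebra.
Context (d : measure_display) (W : measurableType d) (R : realType)
  (P : probability W R) (G : set (set W)).
Hypothesis sG : sigma_algebra setT G.
Hypothesis GW : G `<=` measurable.
Implicit Types (M : R).

Definition adapted (f : W -> R) := forall B : set R, measurable B -> G (f @^-1` B).

Lemma adaptedP (f : W -> R) :
  adapted f <-> measurable_fun setT (f : g_sigma_algebraType G -> R).
Proof.
have e : <<s G>> = G by exact: sigma_algebra_id.
split=> [h _ B mB|h B mB].
  by rewrite setTI; rewrite /measurable/= e; exact: h.
by have := h measurableT B mB; rewrite setTI /measurable/= e.
Qed.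

Lemma adapted_measurable (f : W -> R) : adapted f -> measurable_fun setT f.
Proof. by move=> h _ B mB; rewrite setTI; apply: GW; exact: h. Qed.

Lemma adapted_indic A : G A -> adapted \1_A.
Proof.
move=> GA; apply/adaptedP; apply: measurable_indic.
by rewrite /measurable/= sigma_algebra_id.
Qed.

Lemma mean_indic_mul (X : W -> R) A : \int[P]_(w in A) X w = mean P (fun w => X w * \1_A w).
Proof.
rewrite Rintegral_mkcond; apply: eq_mean => w.
by rewrite patchE indicE; case: ifP => _; rewrite ?mulr1 ?mulr0.
Qed.

(* [b] is the uniform limit of its dyadic truncations, which are combinations of
   indicators of elements of [G]. *)
Let dyadic_approx (X b : W -> R) (n : nat) : L1 P X ->
  (forall A, G A -> mean P (fun w => X w * \1_A w) = 0) ->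
  adapted b -> (forall w, 0 <= b w <= 1) ->
  exists b' : W -> R, [/\ adapted b', mean P (fun w => X w * b' w) = 0,
    (forall w, 0 <= b' w) & forall w, 0 <= b w - b' w <= 2^-1 ^+ n].
Proof.
move=> iX h0 hb b01; elim: n => [|n [b' [ab' mb' b'0 bb']]].
  exists (fun=> 0); split => //.
  - by apply/adaptedP; exact: measurable_cst.
  - by rewrite (@eq_mean _ _ _ _ _ (fun=> 0)) ?mean_cst// => w; rewrite mulr0.
  - by move=> w; rewrite subr0 expr0.
pose e : R := 2^-1 ^+ n.+1.
have e0 : 0 < e by rewrite exprn_gt0.
have e2 : 2^-1 ^+ n = e + e by rewrite /e exprS; field.
pose A := [set w | e <= b w - b' w].
have GA : G A.
  have : adapted (fun w => b w - b' w).
    by apply/adaptedP; apply: measurable_funB; exact/adaptedP.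
  move=> /(_ `[e, +oo[%classic (measurable_itv _)).
  by congr G; apply/seteqP; split => w /=; rewrite in_itv/= andbT.
exists (fun w => b' w + e * \1_A w); split.
- apply/adaptedP; apply: measurable_funD; first exact/adaptedP.
  by apply: measurable_funM => //; apply/adaptedP/adapted_indic.
- rewrite (@eq_mean _ _ _ _ _ (fun w => X w * b' w + e * (X w * \1_A w))); last first.
    by move=> w; rewrite mulrDr mulrCA.
  rewrite meanD ?meanZ ?mb' ?h0 ?mulr0 ?addr0//.
  + apply: (@L1_mul_bounded _ _ _ _ 1) => //.
      by apply: measurable_indic; exact: GW.
    by move=> w; rewrite indicE; case: (_ \in _); rewrite ?normr1 ?normr0.
  + apply: (@L1_mul_bounded _ _ _ _ 1) => //; first exact: adapted_measurable.
    by move=> w; rewrite ger0_norm//; have := bb' w; have := b01 w; lra.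
  + apply: L1Z; apply: (@L1_mul_bounded _ _ _ _ 1) => //.
      by apply: measurable_indic; exact: GW.
    by move=> w; rewrite indicE; case: (_ \in _); rewrite ?normr1 ?normr0.
- by move=> w; rewrite addr_ge0// mulr_ge0// ltW.
- move=> w; rewrite indicE -/e; have := bb' w; rewrite e2.
  have [|] := boolP (w \in A); first by rewrite inE /A/=; lra.
  by rewrite notin_setE /A/= => /negP; rewrite -ltNge; lra.
Qed.

(** Orthogonality to indicators extends to dyadic approximations, then to their limits by dominated
    convergence. *)
Lemma mean_adapted_eq0 (X b : W -> R) M : L1 P X ->
  (forall A, G A -> mean P (fun w => X w * \1_A w) = 0) ->
  adapted b -> (forall w, `|b w| <= M) -> mean P (fun w => X w * b w) = 0.
Proof.
move=> iX h0 hb bM.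
(* An affine change of [b] is allowed because [X] itself has mean zero, by the hypothesis at the
   full set. *)
wlog b01 : b M hb bM / forall w, 0 <= b w <= 1.
  move=> hw; pose N : R := `|M| + 1; have N0 : 0 < N by rewrite ltr_pwDr.
  have bN w : - N <= b w <= N.
    by rewrite -ler_norml (le_trans (bM w))// (le_trans (ler_norm M))// lerDl.
  pose b1 w := (b w + N) / (2 * N).
  have ab1 : adapted b1.
    by apply/adaptedP; apply: measurable_funM => //; apply: measurable_funD => //; exact/adaptedP.
  have b101 w : 0 <= b1 w <= 1.
    rewrite /b1 divr_ge0 ?ler_pdivrMr ?mul1r ?mulr_gt0 ?mulr_ge0//=; have := bN w; lra.
  have h1 : mean P (fun w => X w * b1 w) = 0.
    by apply: (hw b1 1) => // w; rewrite ger0_norm; have := b101 w; lra.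
  rewrite (@eq_mean _ _ _ _ _ (fun w => (2 * N) * (X w * b1 w) - N * X w)); last first.
    by move=> w; rewrite /b1; field; rewrite gt_eqF.
  rewrite meanB ?meanZ ?h1 ?mulr0 ?sub0r//.
  - have := h0 setT; rewrite (@eq_mean _ _ _ _ (fun w => X w * \1_setT w) X).
      move=> ->; rewrite ?mulr0 ?oppr0//.
      by have [_ hC _] := sG; rewrite -(setD0 setT); apply: hC; case: sG.
    by move=> w; rewrite indicT mulr1.
  - apply: (@L1_mul_bounded _ _ _ _ 1) => //; first exact: adapted_measurable.
    by move=> w; rewrite ger0_norm; have := b101 w; lra.
  - apply: L1Z; apply: (@L1_mul_bounded _ _ _ _ 1) => //; first exact: adapted_measurable.
    by move=> w; rewrite ger0_norm; have := b101 w; lra.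
  - exact: L1Z.
have [b_ hb_] := choice (fun n => dyadic_approx n iX h0 hb b01).
have [||||_ h] := @dominated_mean _ _ _ P (fun n w => X w * b_ n w)
    (fun w => X w * b w) (fun w => `|X w|).
- move=> n; have [an _ _ _] := hb_ n; apply: measurable_funM; first exact: L1_measurable iX.
  exact: adapted_measurable.
- exact: L1_norm.
- move=> n w; have [_ _ p0 /(_ w) pb] := hb_ n; rewrite normrM ler_piMr//.
  by rewrite ger0_norm//; have := b01 w; lra.
- move=> w; apply: cvgM; first exact: cvg_cst.
  apply/cvgrPdist_le => e e0.
  have : 2^-1 ^+ n @[n --> \oo] --> (0 : R) by apply: cvg_expr; rewrite ger0_norm; lra.
  move/cvgrPdist_le => /(_ e e0); apply: filterS => n.
  rewrite sub0r normrN ger0_norm ?exprn_ge0//; apply: le_trans.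
  by have [_ _ _ /(_ w) pb] := hb_ n; rewrite ger0_norm; lra.
apply: (cvg_unique _ h) => //.
rewrite (_ : (fun n => _) = fun=> 0); first exact: cvg_cst.
by apply/funext => n; have [] := hb_ n.
Qed.

Lemma is_cexp_mean (U V b : W -> R) M : is_cexp P G U V ->
  adapted b -> (forall w, `|b w| <= M) ->
  mean P (fun w => V w * b w) = mean P (fun w => U w * b w).
Proof.
move=> [iU iV aV e] ab bM; apply/eqP; rewrite -subr_eq0 -meanB; last 2 first.
- by apply: (@L1_mul_bounded _ _ _ _ M) => //; exact: adapted_measurable.
- by apply: (@L1_mul_bounded _ _ _ _ M) => //; exact: adapted_measurable.
apply/eqP; rewrite (@eq_mean _ _ _ _ _ (fun w => (V w - U w) * b w)); last first.
  by move=> w; rewrite mulrBl.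
apply: (mean_adapted_eq0 _ _ ab bM); first exact: L1B.
move=> A GA; have := e A GA; rewrite !mean_indic_mul => eA.
rewrite (@eq_mean _ _ _ _ _ (fun w => V w * \1_A w - U w * \1_A w)); last first.
  by move=> w; rewrite mulrBl.
rewrite meanB ?eA ?subrr//.
- apply: (@L1_mul_bounded _ _ _ _ 1) => //.
    by apply: measurable_indic; exact: GW.
  by move=> w; rewrite indicE; case: (_ \in _); rewrite ?normr1 ?normr0.
- apply: (@L1_mul_bounded _ _ _ _ 1) => //.
    by apply: measurable_indic; exact: GW.
  by move=> w; rewrite indicE; case: (_ \in _); rewrite ?normr1 ?normr0.
Qed.

Variables (A : set W) (mA : measurable A).

(** Pushing [P] forward along this identity restricts it to the smaller sigma-algebra. *)
Definition sub_id : W -> g_sigma_algebraType G := id.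

Let measurable_sub_id : measurable_fun setT sub_id.
Proof.
move=> _ B; rewrite /measurable/= sigma_algebra_id// => GB.
by rewrite setTI; exact: GW.
Qed.

HB.instance Definition _ :=
  isMeasurableFun.Build _ _ W (g_sigma_algebraType G) sub_id measurable_sub_id.

Let gmeas (D : set (g_sigma_algebraType G)) : measurable D -> G D.
Proof. by rewrite {1}/measurable/= sigma_algebra_id. Qed.

(** As a measure on [G] it is dominated by the restriction of [P], and its density is the
    conditional probability of [A]. *)
Definition sub_trace (D : set (g_sigma_algebraType G)) : \bar R := P (A `&` D).

Let trace0 : sub_trace set0 = 0%E.
Proof. by rewrite /sub_trace setI0 measure0. Qed.

Let trace_ge0 D : (0 <= sub_trace D)%E.
Proof. exact: measure_ge0. Qed.

Let trace_sigma_additive : semi_sigma_additive sub_trace.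
Proof.
move=> F mF tF mUF; rewrite /sub_trace setI_bigcupr.
apply: measure_semi_sigma_additive.
- by move=> n; apply: measurableI => //; apply: GW; exact: gmeas.
- exact: trivIset_setIl.
- by apply: bigcup_measurable => n _; apply: measurableI => //; apply: GW; exact: gmeas.
Qed.

HB.instance Definition _ := isMeasure.Build _ _ _ sub_trace
  trace0 trace_ge0 trace_sigma_additive.

Let trace_fin : fin_num_fun sub_trace.
Proof.
move=> D mD; rewrite /sub_trace fin_num_measure//.
by apply: measurableI => //; apply: GW; exact: gmeas.
Qed.

HB.instance Definition _ := Measure_isFinite.Build _ _ _ sub_trace trace_fin.

Let PG : probability (g_sigma_algebraType G) R := distribution P sub_id.

Lemma cexp_indic_exists : exists u : W -> R,
  is_cexp P G \1_A u /\ forall w, 0 <= u w <= 1.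
Proof.
have dom : sub_trace `<< PG.
  apply/null_content_dominatesP => D mD D0; apply/eqP; rewrite eq_le measure_ge0 andbT.
  rewrite /sub_trace -D0; apply: le_measure; rewrite ?inE.
  - by apply: measurableI => //; apply: GW; exact: gmeas.
  - by apply: GW; exact: gmeas.
  - exact: subIsetr.
pose f := Radon_Nikodym_SigmaFinite.f sub_trace PG.
have f_int := Radon_Nikodym_SigmaFinite.f_integrable dom.
have f_fin := Radon_Nikodym_SigmaFinite.f_fin_num dom.
have f_ge0 := Radon_Nikodym_SigmaFinite.f_ge0 dom.
have f_eq := Radon_Nikodym_SigmaFinite.f_integral dom.
pose v (w : W) : R := fine (f w).
have fv w : f w = (v w)%:E by rewrite /v fineK.
have av : adapted v.
  apply/adaptedP; apply/measurable_EFinP.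
  rewrite (_ : _ \o _ = f); first exact: measurable_int f_int.
  by apply/funext => w; rewrite fv.
have mv : measurable_fun setT v := adapted_measurable av.
have v0 w : 0 <= v w by rewrite fine_ge0.
have intv D : G D -> (\int[P]_(w in D) (v w)%:E = P (A `&` D))%E.
  move=> GD; have mD : measurable (D : set (g_sigma_algebraType G)).
    by rewrite /measurable/= sigma_algebra_id.
  transitivity (sub_trace D) => //; rewrite (f_eq D mD).
  rewrite [RHS](ge0_integral_pushforward measurable_sub_id)//.
  - by apply: eq_integral => w _; rewrite -fv.
  - by apply: measurable_funTS; exact: measurable_int f_int.
have GT : G setT.
  by have [h0 hC _] := sG; rewrite -(setD0 setT); exact: hC.
have iv : L1 P v.
  apply/integrableP; split; first exact/measurable_EFinP.
  under eq_integral do rewrite /= ger0_norm//.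
  by rewrite intv// setIT ltey_eq fin_num_measure.
(* The density [v] is at most 1 only almost everywhere; truncation makes the bound hold everywhere.
   The excess [v - u] is nonnegative and its integral is [P (A]&[D) - P D <= 0] for [D] the set
   where [v > 1], so it vanishes almost everywhere. *)
pose u w := Num.min (v w) 1.
have u01 w : 0 <= u w <= 1 by rewrite /u le_min v0 ler01/= ge_min lexx orbT.
have au : adapted u.
  apply/adaptedP; apply: (@measurable_minr _ (g_sigma_algebraType G) R setT v (cst 1)).
    exact/adaptedP.
  exact: measurable_cst.
have mu' := adapted_measurable au.
have uv : {ae P, forall w, u w = v w}.
  pose D := [set w | 1 < v w].
  have GD : G D.
    have := av `]1, +oo[%classic (measurable_itv _).
    by congr G; apply/seteqP; split => w /=; rewrite in_itv/= andbT.
  have mD := GW GD.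
  have ivu : L1 P (fun w => v w - u w).
    apply: L1B => //; apply: (@L1_bounded _ _ _ _ 1) => // w.
    by have /andP[h1 h2] := u01 w; rewrite ger0_norm.
  have vu w : 0 <= v w - u w by rewrite subr_ge0 /u ge_min lexx.
  have vuE w : v w - u w = v w * \1_D w - \1_D w.
    rewrite /u indicE; have [|] := boolP (w \in D).
      rewrite inE /D/= => h; rewrite mulr1 min_r// ltW//.
    by rewrite notin_setE /D/= => /negP; rewrite -leNgt => h; rewrite min_l//; ring.
  have mvD : mean P (fun w => v w * \1_D w) = fine (P (A `&` D)).
    by rewrite -mean_indic_mul /Rintegral intv.
  have ivD : L1 P (fun w => v w * \1_D w).
    apply: (@L1_mul_bounded _ _ _ _ 1) => //.
    by move=> w; rewrite indicE; case: (_ \in _); rewrite ?normr1 ?normr0.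
  have m0 : mean P (fun w => v w - u w) = 0.
    apply/eqP; rewrite eq_le mean_ge0// andbT.
    rewrite (eq_mean _ vuE) meanB ?mvD ?mean_indic//; last first.
      by apply: (@L1_bounded _ _ _ _ 1) => // w;
        rewrite indicE; case: (_ \in _); rewrite ?normr1 ?normr0.
    rewrite subr_le0 fine_le ?fin_num_measure//; first exact: measurableI.
    by apply: le_measure; rewrite ?inE//; exact: measurableI.
  have D0 : {ae P, forall w, (v w - u w)%:E = 0%E}.
    have mvu : measurable_fun setT (fun w => (v w - u w)%:E).
      by apply/measurable_EFinP; exact: measurable_funB.
    have h : (\int[P]_w `|(v w - u w)%:E| = 0)%E.
      under eq_integral do rewrite gee0_abs ?lee_fin//.
      by rewrite -EFin_mean ?m0.
    have /(ae_eq_integral_abs P measurableT mvu) := h.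
    by apply: filterS => w /(_ I).
  by apply: filterS D0 => w /= [] /eqP; rewrite subr_eq0 => /eqP.
exists u; split => //; split => //.
- by apply: (@L1_bounded _ _ _ _ 1) => [|w]; [exact: measurable_indic|
    rewrite indicE; case: (_ \in _); rewrite ?normr1 ?normr0].
- by apply: (@L1_bounded _ _ _ _ 1) => // w; have /andP[h1 h2] := u01 w; rewrite ger0_norm.
- move=> D GD; rewrite !mean_indic_mul (@ae_mean _ _ _ _ _ (fun w => v w * \1_D w)).
  + rewrite -mean_indic_mul /Rintegral intv//.
    rewrite -[in RHS]mean_indic_mul /Rintegral.
    by rewrite integral_indic//; exact: GW.
  + apply: measurable_funM => //; apply: measurable_indic; exact: GW.
  + apply: measurable_funM => //; apply: measurable_indic; exact: GW.
  + by apply: filterS uv => w /= ->.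
Qed.

End sub_sigma_algebra.

Section conditional_independence.
Context (d : measure_display) (W : measurableType d) (R : realType)
  (P : probability W R) (G G1 G2 : set (set W)).
Hypotheses (sG : sigma_algebra setT G) (sG2 : sigma_algebra setT G2).
Hypotheses (GW : G `<=` measurable) (G1W : G1 `<=` measurable)
  (G2W : G2 `<=` measurable) (GG2 : G `<=` G2).

Lemma norm_indic_le1 (A : set W) w : `|\1_A w| <= 1 :> R.
Proof. by rewrite indicE; case: (_ \in _); rewrite ?normr1 ?normr0. Qed.

(** The hypothesis says that a version of the conditional probability of [A] given [G] also serves
    given the larger [G2]: the one-sided form of the Markov property. It is applied to [B]&[D] with
    [D] in [G], which lies in [G2]. *)
Lemma cond_independent_cexp :
  (forall A B (u : W -> R), G1 A -> G2 B -> is_cexp P G \1_A u ->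
    (forall w, 0 <= u w <= 1) ->
    mean P (fun w => \1_A w * \1_B w) = mean P (fun w => u w * \1_B w)) ->
  cond_independent P G G1 G2.
Proof.
move=> H A B G1A G2B.
have mA := G1W G1A; have mB := G2W G2B.
have [u [cu u01]] := cexp_indic_exists P sG GW mA.
have [v [cv v01]] := cexp_indic_exists P sG GW mB.
exists u, v; split => //.
have [_ iu au _] := cu; have [_ iv av _] := cv.
have un w : `|u w| <= 1 by have /andP[h1 h2] := u01 w; rewrite ger0_norm.
have vn w : `|v w| <= 1 by have /andP[h1 h2] := v01 w; rewrite ger0_norm.
split.
- apply: (@L1_bounded _ _ _ _ 1) => [|w]; last exact: norm_indic_le1.
  by apply: measurable_indic; exact: measurableI.
- by apply: (@L1_mul_bounded _ _ _ _ 1) => //; exact: adapted_measurable av.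
- by apply/(adaptedP sG); apply: measurable_funM; exact/(adaptedP sG).
- move=> D GD; rewrite !mean_indic_mul.
  have mD := GW GD.
  have auD : adapted G (fun w => u w * \1_D w).
    apply/(adaptedP sG); apply: measurable_funM; first exact/(adaptedP sG).
    by apply/(adaptedP sG); exact: adapted_indic.
  transitivity (mean P (fun w => v w * (u w * \1_D w))).
    by apply: eq_mean => w; rewrite mulrCA mulrA.
  rewrite (is_cexp_mean sG GW cv auD (M := 1)); last first.
    by move=> w; rewrite normrM mulr_ile1// norm_indic_le1.
  transitivity (mean P (fun w => u w * \1_(B `&` D) w)).
    by apply: eq_mean => w; rewrite indicI /= mulrCA.
  rewrite -(H A (B `&` D) u)//; last first.
    have := @measurableI _ (g_sigma_algebraType G2) B D.
    by rewrite /measurable/= sigma_algebra_id//; apply => //; exact: GG2.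
  by apply: eq_mean => w; rewrite !indicI /= mulrA.
Qed.

End conditional_independence.

(** * Processes with Ornstein-Uhlenbeck covariance *)

Section span.
Context (W : Type) (R : realType).

Definition span (I : eqType) (J : set I) (V : I -> W -> R) : set (W -> R) :=
  [set l | exists2 s : seq (R * I), (forall x, x \in s -> J x.2) &
    l = fun w => \sum_(x <- s) x.1 * V x.2 w].

Lemma span_linear (I : eqType) (J : set I) (V : I -> W -> R) : linear_set (span J V).
Proof.
split=> [|a _ _ [s hs ->] [s' hs' ->]].
  by exists [::] => //; apply/funext => w; rewrite big_nil.
exists ([seq (a * x.1, x.2) | x <- s] ++ s').
  move=> x; rewrite mem_cat => /orP[/mapP[y ys ->]/=|/hs'//]; exact: hs.
by apply/funext => w; rewrite big_cat big_map mulr_sumr/=; congr (_ + _);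
  apply: eq_bigr => x _; rewrite mulrA.
Qed.

Lemma span_gen (I : eqType) (J : set I) (V : I -> W -> R) i : J i -> span J V (V i).
Proof.
move=> Ji; exists [:: (1, i)] => [x|]; first by rewrite inE => /eqP ->.
by apply/funext => w; rewrite big_seq1 mul1r.
Qed.

Lemma linear_set_sum (L : set (W -> R)) (I : Type) (s : seq I) (a : I -> R)
  (V : I -> W -> R) : linear_set L -> (forall i, L (V i)) ->
  L (fun w => \sum_(x <- s) a x * V x w).
Proof.
move=> [L0 LD] hV; elim: s => [|i s ih].
  by rewrite (_ : (fun w => _) = fun=> 0)//; apply/funext => w; rewrite big_nil.
rewrite (_ : (fun w => _) = fun w => a i * V i w + \sum_(x <- s) a x * V x w).
  exact: LD.
by apply/funext => w; rewrite big_cons.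
Qed.

Lemma linear_set_sum_in (L : set (W -> R)) (I : eqType) (s : seq (R * I))
  (V : I -> W -> R) : linear_set L -> (forall x, x \in s -> L (V x.2)) ->
  L (fun w => \sum_(x <- s) x.1 * V x.2 w).
Proof.
move=> [L0 LD]; elim: s => [|i s ih] hV.
  by rewrite (_ : (fun w => _) = fun=> 0)//; apply/funext => w; rewrite big_nil.
rewrite (_ : (fun w => _) = fun w => i.1 * V i.2 w + \sum_(x <- s) x.1 * V x.2 w).
  apply: LD; first by apply: hV; exact: mem_head.
  by apply: ih => x xs; apply: hV; rewrite inE xs orbT.
by apply/funext => w; rewrite big_cons.
Qed.

Lemma span_sub (L : set (W -> R)) (I : eqType) (J : set I) (V : I -> W -> R) :
  linear_set L -> (forall i, J i -> L (V i)) -> span J V `<=` L.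
Proof.
move=> lL hJ _ [s hs ->]; apply: (linear_set_sum_in lL) => x xs; apply: hJ; exact: hs.
Qed.

End span.

Section gaussian_independence.
Context (d : measure_display) (W : measurableType d) (R : realType)
  (P : probability W R).

Lemma span_adapted (I : eqType) (J : set I) (V : I -> W -> R) l :
  span J V l -> adapted (generated J V) l.
Proof.
move=> [s hs ->]; apply/adaptedP; first exact: smallest_sigma_algebra.
apply: (@linear_set_sum_in _ _
  [set l | measurable_fun setT (l : g_sigma_algebraType (generated J V) -> R)]).
  split=> [|a l1 l2 h1 h2]; first exact: measurable_cst.
  by apply: measurable_funD => //; exact: measurable_funM.
move=> x xs; apply/adaptedP; first exact: smallest_sigma_algebra.
move=> B mB; apply: sub_sigma_algebra; exists x.2; first exact: hs.
by exists B => //; rewrite setTI.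
Qed.

Lemma generated_measurable (I : eqType) (J : set I) (V : I -> W -> R) :
  (forall i, J i -> measurable_fun setT (V i)) -> generated J V `<=` measurable.
Proof.
move=> mV; apply: smallest_sub; first exact: sigma_algebra_measurable.
by move=> _ [i Ji [B mB <-]]; exact: mV.
Qed.

Lemma span_orthogonal (I I' : eqType) (J : set I) (J' : set I')
  (V : I -> W -> R) (V' : I' -> W -> R) :
  (forall i, J i -> sqint P (V i)) -> (forall i, J' i -> sqint P (V' i)) ->
  (forall i i', J i -> J' i' -> mean P (fun w => V i w * V' i' w) = 0) ->
  forall l l', span J V l -> span J' V' l' -> mean P (fun w => l w * l' w) = 0.
Proof.
move=> hV hV' o l l' hl hl'.
have : [set l' | sqint P l' /\ forall i, J i -> mean P (fun w => V i w * l' w) = 0] l'.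
  apply: span_sub hl'.
    split=> [|a l1 l2 [h1 o1] [h2 o2]].
      split; first exact: sqint_cst.
      by move=> i Ji; rewrite (@eq_mean _ _ _ _ _ (fun=> 0)) ?mean_cst// => w; rewrite mulr0.
    split; first by apply: sqintD => //; exact: sqintZ.
    move=> i Ji; rewrite (@eq_mean _ _ _ _ _ (fun w => a * (V i w * l1 w) + V i w * l2 w)).
      have m1 := sqintM (hV _ Ji) h1; have m2 := sqintM (hV _ Ji) h2.
      by rewrite meanD ?meanZ ?o1 ?o2 ?mulr0 ?addr0//; exact: L1Z.
    by move=> w; rewrite mulrDr mulrCA.
  by move=> i' Ji'; split; [exact: hV'|move=> i Ji; exact: o].
move=> [sl' ol'].
have : [set l | sqint P l /\ mean P (fun w => l w * l' w) = 0] l.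
  apply: span_sub hl.
    split=> [|a l1 l2 [h1 o1] [h2 o2]].
      split; first exact: sqint_cst.
      by rewrite (@eq_mean _ _ _ _ _ (fun=> 0)) ?mean_cst// => w; rewrite mul0r.
    split; first by apply: sqintD => //; exact: sqintZ.
    rewrite (@eq_mean _ _ _ _ _ (fun w => a * (l1 w * l' w) + l2 w * l' w)).
      have m1 := sqintM h1 sl'; have m2 := sqintM h2 sl'.
      by rewrite meanD ?meanZ ?o1 ?o2 ?mulr0 ?addr0//; exact: L1Z.
    by move=> w; rewrite mulrDl mulrA.
  by move=> i Ji; split; [exact: hV|exact: ol'].
by case.
Qed.

(** By orthogonality [l + l'] and [l - l'] have the same variance, so after the product-to-sum
    formula a common exponential factors out and splits into two. *)
Lemma gaussian_cos_mul (l l' : W -> R) c c' :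
  centered_gaussian P l -> centered_gaussian P l' ->
  centered_gaussian P (fun w => l w + l' w) ->
  centered_gaussian P (fun w => l w - l' w) ->
  mean P (fun w => l w * l' w) = 0 ->
  mean P (fun w => cos (c + l w) * cos (c' + l' w)) =
  mean P (fun w => cos (c + l w)) * mean P (fun w => cos (c' + l' w)).
Proof.
move=> /centered_gaussian_char[sl hl] /centered_gaussian_char[sl' hl'].
move=> /centered_gaussian_char[sp hp] /centered_gaussian_char[sm hm] o.
rewrite (@eq_mean _ _ _ _ _ (fun w => 2^-1 * (cos ((c + c') + (l w + l' w)) +
    cos ((c - c') + (l w - l' w))))); last first.
  move=> w; rewrite (_ : c + c' + _ = (c + l w) + (c' + l' w)); last by ring.
  rewrite (_ : c - c' + _ = (c + l w) - (c' + l' w)); last by ring.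
  by set x := c + l w; set y := c' + l' w; rewrite cosD cosB; field.
have L1c (f : W -> R) c1 : sqint P f -> L1 P (fun w => cos (c1 + f w)).
  move=> [mf _]; apply: (@L1_bounded _ _ _ _ 1).
    by apply: measurable_cos; exact: measurable_funD.
  by move=> w; rewrite ler_norml cos_geN1 cos_le1.
rewrite meanZ; last by apply: L1D; exact: L1c.
rewrite meanD; [|exact: L1c|exact: L1c].
rewrite hp hm hl hl'.
have i1 := sl.2; have i2 := sl'.2; have i3 := sqintM sl sl'.
have -> : mean P (fun w => (l w + l' w) ^+ 2) =
    mean P (fun w => l w ^+ 2) + mean P (fun w => l' w ^+ 2).
  rewrite (@eq_mean _ _ _ _ _ (fun w => (l w ^+ 2 + l' w ^+ 2) + 2 * (l w * l' w))).
    by rewrite meanD ?meanD ?meanZ ?o ?mulr0 ?addr0//; [exact: L1D|exact: L1Z].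
  by move=> w; ring.
have -> : mean P (fun w => (l w - l' w) ^+ 2) =
    mean P (fun w => l w ^+ 2) + mean P (fun w => l' w ^+ 2).
  rewrite (@eq_mean _ _ _ _ _ (fun w => (l w ^+ 2 + l' w ^+ 2) - 2 * (l w * l' w))).
    by rewrite meanB ?meanD ?meanZ ?o ?mulr0 ?subr0//; [exact: L1D|exact: L1Z].
  by move=> w; ring.
set v := mean P _; set v' := mean P _.
rewrite mulrDl opprD expRD cosB cosD.
by set x := expR _; set y := expR _; field.
Qed.

End gaussian_independence.

Section gaussian_process_theory.
Context (d : measure_display) (W : measurableType d) (R : realType)
  (P : probability W R) (E : choiceType) (Y : E -> R -> W -> R).
Hypothesis gp : forall (k : nat) (c : 'I_k -> R) (f : 'I_k -> E) (t : 'I_k -> R),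
  centered_gaussian P (fun w => \sum_i c i * Y (f i) (t i) w).
Let V (x : E * R) := Y x.1 x.2.

Lemma span_gaussian l : span setT V l -> centered_gaussian P l.
Proof.
move=> [s _ ->].
have := gp (fun i => (tnth (in_tuple s) i).1) (fun i => (tnth (in_tuple s) i).2.1)
  (fun i => (tnth (in_tuple s) i).2.2).
congr centered_gaussian; apply/funext => w.
by rewrite [RHS](big_tnth _ _ _ _ _).
Qed.

Lemma gaussian_sqint f t : sqint P (Y f t).
Proof.
have /centered_gaussian_char[]// : centered_gaussian P (Y f t).
by apply: span_gaussian; exact: (@span_gen _ _ _ setT V (f, t)).
Qed.

Lemma gaussian_mean0_sin l a : span setT V l -> mean P (fun w => sin (a * l w)) = 0.
Proof.
move=> hl; have hl' : centered_gaussian P (fun w => a * l w).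
  by apply: span_gaussian; apply: linear_setZ => //; exact: span_linear.
have [_ h] := centered_gaussian_char hl'.
have := h (- (pi / 2)); rewrite cosN cos_pihalf mul0r => h0.
rewrite -[RHS]h0; apply: eq_mean => w.
by rewrite addrC cosBpihalf.
Qed.

Lemma gaussian_cos_sum (k : nat) (c : R) (a : 'I_k -> R) (f : 'I_k -> E) (t : 'I_k -> R) :
  mean P (fun w => cos (c + \sum_i a i * Y (f i) (t i) w)) =
  cos c * expR (- ((\sum_i \sum_j a i * a j *
    mean P (fun w => Y (f i) (t i) w * Y (f j) (t j) w)) / 2)).
Proof.
have [_ ->] := centered_gaussian_char (gp a f t).
have L i j : L1 P (fun w => a i * a j * (Y (f i) (t i) w * Y (f j) (t j) w)).
  by apply: L1Z; apply: sqintM; exact: gaussian_sqint.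
suff -> : mean P (fun w => (\sum_i a i * Y (f i) (t i) w) ^+ 2) =
  \sum_i \sum_j a i * a j * mean P (fun w => Y (f i) (t i) w * Y (f j) (t j) w) by [].
rewrite (@eq_mean _ _ _ _ _ (fun w => \sum_i \sum_j a i * a j *
    (Y (f i) (t i) w * Y (f j) (t j) w))).
  rewrite mean_sum; last by move=> i; exact: L1_sum.
  apply: eq_bigr => i _; rewrite mean_sum//; apply: eq_bigr => j _.
  by rewrite meanZ//; apply: sqintM; exact: gaussian_sqint.
move=> w; rewrite expr2 mulr_suml; apply: eq_bigr => i _.
by rewrite mulr_sumr; apply: eq_bigr => j _; rewrite mulrACA.
Qed.

Lemma gaussian_trig_independent (L L' : set (W -> R)) :
  L `<=` span setT V -> L' `<=` span setT V ->
  (forall l l', L l -> L' l' -> mean P (fun w => l w * l' w) = 0) ->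
  forall f g, trig_closure L f -> trig_closure L' g ->
    mean P (fun w => f w * g w) = mean P f * mean P g.
Proof.
move=> hL hL' o; apply: trig_independent.
- by move=> l /hL/span_gaussian[].
- by move=> l /hL'/span_gaussian[].
- move=> c c' l l' Ll Ll'.
  have sl := hL _ Ll; have sl' := hL' _ Ll'.
  apply: gaussian_cos_mul; [exact: span_gaussian|exact: span_gaussian| | |exact: o].
    by apply: span_gaussian; apply: linear_setD => //; exact: span_linear.
  apply: span_gaussian.
  have := linear_setD (span_linear _ _) sl (linear_setZ (span_linear _ _) (-1) sl').
  by congr (span _ _ _); apply/funext => w; rewrite mulN1r.
Qed.

End gaussian_process_theory.

Lemma eq_fdd_gaussian (R : realType) (E : choiceType) (d d' : measure_display)
  (W : measurableType d) (W' : measurableType d') (P : probability W R)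
  (P' : probability W' R) (Y : E -> R -> W -> R) (Y' : E -> R -> W' -> R) :
  (forall (k : nat) (c : 'I_k -> R) (f : 'I_k -> E) (t : 'I_k -> R),
    centered_gaussian P (fun w => \sum_i c i * Y (f i) (t i) w)) ->
  (forall (k : nat) (c : 'I_k -> R) (f : 'I_k -> E) (t : 'I_k -> R),
    centered_gaussian P' (fun w => \sum_i c i * Y' (f i) (t i) w)) ->
  (forall f g s t, mean P (fun w => Y f s w * Y g t w) =
    mean P' (fun w => Y' f s w * Y' g t w)) ->
  eq_fdd P P' Y Y'.
Proof.
move=> g g' e; apply: eq_fdd_cos.
- by move=> f t; have [] := gaussian_sqint g f t.
- by move=> f t; have [] := gaussian_sqint g' f t.
- move=> k f t a c; rewrite (gaussian_cos_sum g) (gaussian_cos_sum g').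
  by under eq_bigr do under eq_bigr do rewrite e.
Qed.

Lemma trig_mean_mul_eq0 (d : measure_display) (W : measurableType d) (R : realType)
  (P : probability W R) (L : set (W -> R)) (X : W -> R) :
  L1 P X -> (forall l, L l -> measurable_fun setT l) ->
  (forall c l, L l -> mean P (fun w => X w * cos (c + l w)) = 0) ->
  forall f, trig_closure L f -> mean P (fun w => X w * f w) = 0.
Proof.
move=> iX mL h0 f tf.
have mf g : trig_closure L g -> measurable_fun setT g.
  by move=> tg; exact: (@trig_measurable _ _ _ _ L id _ mL tg).
have iXf g : trig_closure L g -> L1 P (fun w => X w * g w).
  move=> tg; have [M hM] := trig_bounded tg.
  by apply: (@L1_mul_bounded _ _ _ _ M) => //; exact: mf.
elim: tf => {f} [c l hl|f1 f2 t1 h1 t2 h2|a f tf h|f_ f M tf h le cv].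
- exact: h0.
- rewrite (@eq_mean _ _ _ _ _ (fun w => X w * f1 w + X w * f2 w)).
    by rewrite meanD ?h1 ?h2 ?addr0//; exact: iXf.
  by move=> w; rewrite mulrDr.
- rewrite (@eq_mean _ _ _ _ _ (fun w => a * (X w * f w))).
    by rewrite meanZ ?h ?mulr0//; exact: iXf.
  by move=> w; rewrite mulrCA.
- have [||||_ hl] := @dominated_mean _ _ _ P (fun n w => X w * f_ n w)
      (fun w => X w * f w) (fun w => M * `|X w|).
  + by move=> n; apply: L1_measurable; exact: iXf.
  + by apply: L1Z; exact: L1_norm.
  + by move=> n w; rewrite normrM mulrC ler_wpM2r.
  + by move=> w; apply: cvgM; [exact: cvg_cst|exact: cv].
  have {}h : (fun n => mean P (fun w => X w * f_ n w)) = fun=> 0 by apply/funext.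
  by rewrite h in hl; apply: (cvg_unique _ hl) => //; exact: cvg_cst.
Qed.

(** * Increments and the Markov property for an exponential covariance *)

Section ou_covariance.
Context (d : measure_display) (W : measurableType d) (R : realType)
  (P : probability W R) (E : lmodType R) (Y : E -> R -> W -> R)
  (q : E -> E -> R) (k : R).
Hypothesis k0 : 0 < k.
Hypothesis gp : gaussian_process P Y.
Hypothesis lin : linear_process P Y.
Hypothesis cov : forall f g s t, mean P (fun w => Y f s w * Y g t w) =
  expR (- (k * `|t - s|)) / (2 * k) * q f g.

Let V (x : E * R) := Y x.1 x.2.
(** The residual of [Y x.1 x.2] after its linear prediction from the value at time [t]. *)
Let inc (t : R) (x : E * R) := fun w =>
  Y x.1 x.2 w - expR (- (k * (x.2 - t))) * Y x.1 t w.
Let past (t : R) : set (E * R) := [set x | x.2 <= t].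
Let present (t : R) : set (E * R) := [set x | x.2 = t].
Let future (t : R) : set (E * R) := [set x | t <= x.2].

Let Ysq f t : sqint P (Y f t) := gaussian_sqint gp f t.

Let mY f t : measurable_fun setT (Y f t). Proof. by have [] := Ysq f t. Qed.

Lemma ou_second_moment f t : mean P (fun w => Y f t w ^+ 2) = q f f / (2 * k).
Proof.
rewrite (@eq_mean _ _ _ _ _ (fun w => Y f t w * Y f t w)) ?cov//.
by rewrite subrr normr0 mulr0 oppr0 expR0 mulrAC mul1r.
Qed.

Lemma ou_inc_sqint t x : sqint P (inc t x).
Proof. by apply: sqintB => //; exact: sqintZ. Qed.

(** The exponential covariance is multiplicative across the intermediate time [t], so the prediction
    from time [t] has the full covariance with the past. *)
Lemma ou_inc_orthogonal t x y : past t x -> future t y ->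
  mean P (fun w => V x w * inc t y w) = 0.
Proof.
rewrite /past /future /= => xt ty.
rewrite (@eq_mean _ _ _ _ _ (fun w => Y x.1 x.2 w * Y y.1 y.2 w -
    expR (- (k * (y.2 - t))) * (Y x.1 x.2 w * Y y.1 t w))); last first.
  by move=> w; rewrite /V /inc; ring.
have i1 := sqintM (Ysq x.1 x.2) (Ysq y.1 y.2).
have i2 := sqintM (Ysq x.1 x.2) (Ysq y.1 t).
rewrite meanB ?meanZ ?cov//; last exact: L1Z.
rewrite !ger0_norm ?subr_ge0//; last exact: le_trans ty.
rewrite [X in _ - X](_ : _ = (expR (- (k * (y.2 - t))) * expR (- (k * (t - x.2)))) / (2 * k) * q x.1 y.1).
  by rewrite -expRD -opprD -mulrDr addrA subrK subrr.
by rewrite !mulrA.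
Qed.

Lemma ou_inc_orthogonal_span t l l' : span (past t) V l ->
  span (future t) (inc t) l' -> mean P (fun w => l w * l' w) = 0.
Proof.
apply: span_orthogonal => [x _|x _|x y]; [exact: Ysq|exact: ou_inc_sqint|].
exact: ou_inc_orthogonal.
Qed.

Let span_past t : span (past t) V `<=` span setT V.
Proof.
by apply: span_sub => [|x _]; [exact: span_linear|exact: span_gen].
Qed.

Let span_inc t : span (future t) (inc t) `<=` span setT V.
Proof.
apply: span_sub => [|x _]; first exact: span_linear.
have h1 : span setT V (V x) by exact: span_gen.
have h2 : span setT V (V (x.1, t)) by exact: span_gen.
have := linear_setD (span_linear _ _) h1
  (linear_setZ (span_linear _ _) (- expR (- (k * (x.2 - t)))) h2).
by congr (span _ _ _); apply/funext => w; rewrite mulNr.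
Qed.

Let past_trig t A : field_past Y t A -> trig_closure (span (past t) V) \1_A.
Proof.
apply: (@trig_generated _ _ _ (span_linear _ _) _ _ (fun x => Y x.1 x.2)) => x.
exact: span_gen.
Qed.

Lemma ou_past_inc_independent t f g : trig_closure (span (past t) V) f ->
  trig_closure (span (future t) (inc t)) g ->
  mean P (fun w => f w * g w) = mean P f * mean P g.
Proof.
move=> tf tg.
exact: (gaussian_trig_independent gp (@span_past t) (@span_inc t) (@ou_inc_orthogonal_span t) tf tg).
Qed.

(** Independence is available for the bounded functions of the closure, so [l] is replaced by
    [n sin(l / n)], whose mean vanishes by symmetry of the Gaussian law. *)
Lemma ou_inc_past_mean t l A : span (future t) (inc t) l -> field_past Y t A ->
  mean P (fun w => l w * \1_A w) = 0.
Proof.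
move=> hl pA.
have lg : centered_gaussian P l := span_gaussian gp (span_inc hl).
have [sl _] := centered_gaussian_char lg.
have mA : measurable A.
  by apply: (@generated_measurable _ _ R _ _ (fun x => Y x.1 x.2)) pA => x _; exact: mY.
have [||||_ h] := @dominated_mean _ _ _ P
    (fun n w => n.+1%:R * sin (n.+1%:R^-1 * l w) * \1_A w)
    (fun w => l w * \1_A w) (fun w => `|l w|).
- move=> n; apply: measurable_funM; last exact: measurable_indic.
  apply: measurable_funM => //; apply: measurable_sin; apply: measurable_funM => //.
  by case: sl.
- by apply: L1_norm; exact: sqint_L1.
- move=> n w; rewrite normrM (@le_trans _ _ (`|n.+1%:R * sin (n.+1%:R^-1 * l w)|))//.
    by rewrite ler_piMr// norm_indic_le1.
  rewrite normrM normr_nat.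
  have := norm_sin_le (n.+1%:R^-1 * l w).
  by rewrite normrM normfV normr_nat ler_pdivlMl.
- by move=> w; apply: cvgM; [exact: cvg_sin_scaled|exact: cvg_cst].
apply: (cvg_unique _ h) => //.
rewrite (_ : (fun n => _) = fun=> 0); first exact: cvg_cst.
apply/funext => n.
rewrite (@eq_mean _ _ _ _ _ (fun w => n.+1%:R * (\1_A w * sin (0 + (n.+1%:R^-1 * l w)))));
  last by move=> w; rewrite add0r; ring.
have hl' : span (future t) (inc t) (fun w => n.+1%:R^-1 * l w).
  by apply: linear_setZ => //; exact: span_linear.
have ts : trig_closure (span (future t) (inc t)) (fun w => sin (0 + n.+1%:R^-1 * l w)).
  exact: (trig_sin 0 hl').
rewrite meanZ.
  rewrite (ou_past_inc_independent (past_trig pA) ts).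
  under [X in _ * (_ * mean P X)]eq_fun do rewrite add0r.
  by rewrite (gaussian_mean0_sin gp _ (span_inc hl)) !mulr0.
apply: (@L1_bounded _ _ _ _ 1).
  apply: measurable_funM; first exact: measurable_indic.
  apply: measurable_sin; apply: measurable_funD => //; apply: measurable_funM => //.
  by case: sl.
move=> w; rewrite normrM mulr_ile1 ?norm_indic_le1//.
by rewrite ler_norml sin_geN1 sin_le1.
Qed.

(** A future value is a function of the present plus an increment independent of the past. Once
    future indicators are reduced to cosines of such sums, the increment factors out, and only the
    present is left for the conditional probability [u] to be tested on. *)
Lemma ou_markov_field : markov_field P Y.
Proof.
move=> t.
have mgen (J : set (E * R)) : generated J (fun x => Y x.1 x.2) `<=` measurable.
  by apply: generated_measurable => x _; exact: mY.
have sgen (J : set (E * R)) : sigma_algebra setT (generated J (fun x => Y x.1 x.2)).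
  exact: smallest_sigma_algebra.
apply: cond_independent_cexp; [exact: sgen|exact: sgen|exact: mgen|exact: mgen|exact: mgen| |].
  apply: smallest_sub; first exact: sgen.
  by move=> A [x /= xt hA]; apply: sub_sigma_algebra; exists x => //=; rewrite /= xt.
move=> A B u pA fB cu u01.
have [iA iu au _] := cu.
have mA : measurable A by exact: mgen pA.
have un w : `|u w| <= 1 by have /andP[h1 h2] := u01 w; rewrite ger0_norm.
pose X w := \1_A w - u w.
have iX : L1 P X by exact: L1B.
(* Every value of the field at a time after [t] is such a sum, so indicators of the future lie in
   the closure of [Lf]. *)
pose Lf := [set l | exists lp li, [/\ span (present t) V lp,
  span (future t) (inc t) li & l = fun w => lp w + li w]].
have linLf : linear_set Lf.
  split.
    exists (fun=> 0), (fun=> 0); split; [by case: (span_linear (present t) V)|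
      by case: (span_linear (future t) (inc t))|].
    by apply/funext => w; rewrite addr0.
  move=> a _ _ [lp [li [hp hi ->]]] [lp' [li' [hp' hi' ->]]].
  exists (fun w => a * lp w + lp' w), (fun w => a * li w + li' w); split.
  - by have [_] := span_linear (present t) V; apply.
  - by have [_] := span_linear (future t) (inc t); apply.
  - by apply/funext => w; ring.
have present_past l : span (present t) V l -> span (past t) V l.
  apply: span_sub; first exact: span_linear.
  by move=> x /= xt; apply: span_gen; rewrite /past/= xt.
have fB' : trig_closure Lf \1_B.
  move: B fB; apply: (@trig_generated _ _ _ linLf _ _ (fun x => Y x.1 x.2)) => x /= tx.
  exists (fun w => expR (- (k * (x.2 - t))) * Y x.1 t w), (inc t x); split.
  - apply: linear_setZ; first exact: span_linear.
    exact: (@span_gen _ _ _ (present t) V (x.1, t)).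
  - exact: span_gen.
  - by apply/funext => w; rewrite /inc addrC subrK.
suff H : mean P (fun w => X w * \1_B w) = 0.
  apply/eqP; rewrite -subr_eq0 -meanB.
  - by apply/eqP; rewrite -[RHS]H; apply: eq_mean => w; rewrite mulrBl.
  - by apply: (@L1_mul_bounded _ _ _ _ 1) => [//||w]; [apply: measurable_indic; exact: mgen fB|exact: norm_indic_le1].
  - by apply: (@L1_mul_bounded _ _ _ _ 1) => [//||w]; [apply: measurable_indic; exact: mgen fB|exact: norm_indic_le1].
have mspan l : span setT V l -> measurable_fun setT l.
  by move/(span_gaussian gp) => [].
apply: trig_mean_mul_eq0 fB' => //.
  move=> _ [lp [li [hp hi ->]]]; apply: measurable_funD; apply: mspan.
    exact/span_past/present_past.
  exact: span_inc hi.
move=> c _ [lp [li [hp hi ->]]].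
(* Both terms of [X] give the mean [m] of the increment factor times a mean against
   [cos (c1 + lp w)]; these agree because that cosine is measurable for the present. *)
have key c1 c2 : mean P (fun w => X w * (cos (c1 + lp w) * cos (c2 + li w))) = 0.
  have mp : measurable_fun setT (fun w => cos (c1 + lp w)).
    apply: measurable_cos; apply: measurable_funD => //; apply: mspan.
    exact/span_past/present_past.
  have mi : measurable_fun setT (fun w => cos (c2 + li w)).
    apply: measurable_cos; apply: measurable_funD => //; apply: mspan.
    exact: span_inc hi.
  have cn x : `|cos x| <= 1 :> R by rewrite ler_norml cos_geN1 cos_le1.
  have tp : trig_closure (span (past t) V) (fun w => cos (c1 + lp w)).
    exact/trig_cos/present_past.
  have ti : trig_closure (span (future t) (inc t)) (fun w => cos (c2 + li w)).
    exact: trig_cos.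
  have ap : adapted (field_present Y t) (fun w => cos (c1 + lp w)).
    apply/(adaptedP (sgen _)); apply: measurable_cos; apply: measurable_funD => //.
    apply/(adaptedP (sgen _)); exact: span_adapted hp.
  have aup : adapted (field_present Y t) (fun w => u w * cos (c1 + lp w)).
    by apply/(adaptedP (sgen _)); apply: measurable_funM; exact/(adaptedP (sgen _)).
  set m := mean P (fun w => cos (c2 + li w)).
  have ii : L1 P (fun w => cos (c2 + li w)) by exact: (@L1_bounded _ _ _ _ 1).
  have e1 : mean P (fun w => \1_A w * cos (c1 + lp w) * cos (c2 + li w)) =
      mean P (fun w => \1_A w * cos (c1 + lp w)) * m.
    apply: (@ou_past_inc_independent t _ _ _ ti).
    by apply: trigM => //; [exact: span_linear|exact: past_trig].
  (* [u] is only known to be adapted to the present, so the independence is used on indicators of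
     present events and then extended to bounded adapted factors. *)
  have e2 : mean P (fun w => (cos (c2 + li w) - m) * (u w * cos (c1 + lp w))) = 0.
    apply: (mean_adapted_eq0 (sgen _) (mgen _) (M := 1)) aup _.
    - by apply: L1B => //; exact: L1_cst.
    - move=> D hD; have tD : trig_closure (span (past t) V) \1_D.
        apply: past_trig; move: D hD; apply: smallest_sub; first exact: sgen.
        by move=> D [x /= xt hD]; apply: sub_sigma_algebra; exists x => //=; rewrite /= xt.
      have mD : measurable D by exact: mgen hD.
      have iD : L1 P \1_D.
        by apply: (@L1_bounded _ _ _ _ 1) => [|w]; [exact: measurable_indic|exact: norm_indic_le1].
      rewrite (@eq_mean _ _ _ _ _ (fun w => \1_D w * cos (c2 + li w) - m * \1_D w)); last first.
        by move=> w; rewrite mulrBl mulrC.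
      rewrite meanB ?meanZ ?(ou_past_inc_independent tD ti)//; last exact: L1Z.
        by rewrite mulrC subrr.
      by apply: (@L1_mul_bounded _ _ _ _ 1).
    - by move=> w; rewrite normrM mulr_ile1.
  have iup : L1 P (fun w => u w * cos (c1 + lp w)) by exact: (@L1_mul_bounded _ _ _ _ 1).
  have iAp : L1 P (fun w => \1_A w * cos (c1 + lp w)) by exact: (@L1_mul_bounded _ _ _ _ 1).
  have e3 := is_cexp_mean (sgen _) (mgen _) cu ap (fun w => cn _).
  have iupi : L1 P (fun w => u w * cos (c1 + lp w) * cos (c2 + li w)).
    by apply: (@L1_mul_bounded _ _ _ _ 1).
  have iApi : L1 P (fun w => \1_A w * cos (c1 + lp w) * cos (c2 + li w)).
    by apply: (@L1_mul_bounded _ _ _ _ 1).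
  have e4 : mean P (fun w => u w * cos (c1 + lp w) * cos (c2 + li w)) =
      mean P (fun w => u w * cos (c1 + lp w)) * m.
    apply/eqP; rewrite -subr_eq0 mulrC -meanZ// -meanB//; last exact: L1Z.
    by apply/eqP; rewrite -[RHS]e2; apply: eq_mean => w; ring.
  rewrite (@eq_mean _ _ _ _ _ (fun w => \1_A w * cos (c1 + lp w) * cos (c2 + li w)
    - u w * cos (c1 + lp w) * cos (c2 + li w))).
    by rewrite meanB// e1 e4 e3 subrr.
  by move=> w; rewrite /X; ring.
have mX : measurable_fun setT X by exact: L1_measurable iX.
have mcos c1 l : span setT V l -> measurable_fun setT (fun w => cos (c1 + l w)).
  by move=> hl; apply: measurable_cos; apply: measurable_funD => //; exact: mspan.
have iXc c1 c2 : L1 P (fun w => X w * (cos (c1 + lp w) * cos (c2 + li w))).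
  apply: (@L1_mul_bounded _ _ _ _ 1) => //.
    by apply: measurable_funM; apply: mcos; [exact/span_past/present_past|exact: span_inc hi].
  by move=> w; rewrite normrM mulr_ile1// ler_norml cos_geN1 cos_le1.
(* The addition formula, with both sines written as cosines of shifted phase so that [key] applies
   to each product. *)
rewrite (@eq_mean _ _ _ _ _ (fun w => X w * (cos (c + lp w) * cos (0 + li w)) -
  X w * (cos (c - pi / 2 + lp w) * cos (- (pi / 2) + li w)))).
  by rewrite meanB// !key subrr.
move=> w; rewrite addrA add0r (addrC (- (pi / 2))) cosBpihalf.
have e : cos (c - pi / 2 + lp w) = sin (c + lp w).
  by rewrite -cosBpihalf addrAC.
by rewrite e (cosD (c + lp w)) mulrBr.
Qed.

End ou_covariance.

(** * Transfer of moments between equal laws *)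

Section same_law.
Context (d d' e : measure_display) (W : measurableType d) (W' : measurableType d')
  (T : measurableType e) (R : realType) (P : probability W R) (P' : probability W' R)
  (X : W -> T) (X' : W' -> T) (h : T -> R).
Hypotheses (mX : measurable_fun setT X) (mX' : measurable_fun setT X').
Hypothesis law : forall A, measurable A -> P (X @^-1` A) = P' (X' @^-1` A).
Hypothesis mh : measurable_fun setT h.

Let Xp : {mfun W >-> T} := HB.pack X (isMeasurableFun.Build _ _ _ _ X mX).
Let Xp' : {mfun W' >-> T} := HB.pack X' (isMeasurableFun.Build _ _ _ _ X' mX').

Let same_integral (g : T -> \bar R) :
  (\int[pushforward P Xp]_x g x = \int[pushforward P' Xp']_x g x)%E.
Proof. by apply: eq_measure_integral => A mA _; exact: law. Qed.

Lemma same_law_L1 : L1 P (fun w => h (X w)) -> L1 P' (fun w => h (X' w)).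
Proof.
move=> /integrableP[_ fin]; apply/integrableP; split.
  exact/measurable_EFinP/measurableT_comp.
have mg : measurable_fun setT (abse \o (EFin \o h)).
  by apply: measurableT_comp => //; exact/measurable_EFinP.
have g0 : {in setT, forall y, 0 <= (abse \o (EFin \o h)) y}%E.
  by move=> y _; exact: abse_ge0.
have e1 := ge0_integral_pushforward mX P measurableT mg g0.
have e2 := ge0_integral_pushforward mX' P' measurableT mg g0.
rewrite preimage_setT in e1; rewrite preimage_setT in e2.
rewrite (_ : (\int[P']_w _)%E = (\int[P]_w `|(h (X w))%:E|)%E)//.
by have := same_integral (abse \o (EFin \o h)); rewrite e1 e2 => <-.
Qed.

Lemma same_law_mean : L1 P (fun w => h (X w)) ->
  mean P (fun w => h (X w)) = mean P' (fun w => h (X' w)).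
Proof.
move=> i1; have i2 := same_law_L1 i1.
have mg : measurable_fun setT (EFin \o h) by exact/measurable_EFinP.
have e1 := @integral_pushforward _ _ _ _ R X mX P setT _ mg i1 measurableT.
have e2 := @integral_pushforward _ _ _ _ R X' mX' P' setT _ mg i2 measurableT.
rewrite preimage_setT in e1; rewrite preimage_setT in e2.
by apply: EFin_inj; rewrite !EFin_mean// -e1 -e2; exact: same_integral.
Qed.

End same_law.

Section eq_fdd_mean.
Context (R : realType) (E : Type) (d d' : measure_display)
  (W : measurableType d) (W' : measurableType d')
  (P : probability W R) (P' : probability W' R)
  (Y : E -> R -> W -> R) (Y' : E -> R -> W' -> R).

Lemma eq_fdd_mean_mul f g s t :
  (forall f t, measurable_fun setT (Y f t)) ->
  (forall f t, measurable_fun setT (Y' f t)) ->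
  eq_fdd P P' Y Y' -> L1 P (fun w => Y f s w * Y g t w) ->
  L1 P' (fun w => Y' f s w * Y' g t w) /\
  mean P (fun w => Y f s w * Y g t w) = mean P' (fun w => Y' f s w * Y' g t w).
Proof.
move=> mY mY' law i1.
pose F (i : 'I_2) := if i == ord0 then f else g.
pose T (i : 'I_2) := if i == ord0 then s else t.
pose X w := [tuple Y (F i) (T i) w | i < 2].
pose X' w := [tuple Y' (F i) (T i) w | i < 2].
pose h (x : 2.-tuple R) := tnth x ord0 * tnth x ord_max.
have mX : measurable_fun setT X.
  apply/measurable_fun_tnthP => i; rewrite (_ : _ \o _ = Y (F i) (T i))//.
  by apply/funext => w /=; rewrite tnth_mktuple.
have mX' : measurable_fun setT X'.
  apply/measurable_fun_tnthP => i; rewrite (_ : _ \o _ = Y' (F i) (T i))//.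
  by apply/funext => w /=; rewrite tnth_mktuple.
have mh : measurable_fun setT h by apply: measurable_funM; exact: measurable_tnth.
have lawX A : measurable A -> P (X @^-1` A) = P' (X' @^-1` A).
  by move=> mA; exact: law.
have eX w : h (X w) = Y f s w * Y g t w by rewrite /h !tnth_mktuple.
have eX' w : h (X' w) = Y' f s w * Y' g t w by rewrite /h !tnth_mktuple.
have ih : L1 P (fun w => h (X w)) by rewrite (_ : (fun w => _) = (fun w => Y f s w * Y g t w))//; apply/funext.
have := same_law_L1 mX mX' lawX mh ih; have := same_law_mean mX mX' lawX mh ih.
rewrite (eq_mean _ eX) (eq_mean _ eX') => ->.
by rewrite (_ : (fun w => h (X' w)) = (fun w => Y' f s w * Y' g t w))//; apply/funext.
Qed.

End eq_fdd_mean.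

(** * Conditional expectations against square-integrable factors *)

Section is_cexp.
Context (d : measure_display) (W : measurableType d) (R : realType)
  (P : probability W R) (G : set (set W)).
Hypothesis sG : sigma_algebra setT G.
Hypothesis GW : G `<=` measurable.

Lemma cvg_mean_mul_sin (X Z : W -> R) : sqint P X -> sqint P Z ->
  mean P (fun w => X w * (n.+1%:R * sin (n.+1%:R^-1 * Z w))) @[n --> \oo] -->
  mean P (fun w => X w * Z w).
Proof.
move=> sX sZ; have [mX _] := sX; have [mZ _] := sZ.
have [||||_] := @dominated_mean _ _ _ P
  (fun n w => X w * (n.+1%:R * sin (n.+1%:R^-1 * Z w)))
  (fun w => X w * Z w) (fun w => `|X w * Z w|) => //.
- move=> n; apply: measurable_funM => //; apply: measurable_funM => //.
  by apply: measurable_sin; exact: measurable_funM.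
- by apply: L1_norm; exact: sqintM.
- move=> n w; rewrite !normrM ler_wpM2l// normr_nat.
  have := norm_sin_le (n.+1%:R^-1 * Z w).
  by rewrite normrM normfV normr_nat ler_pdivlMl.
- by move=> w; apply: cvgM; [exact: cvg_cst|exact: cvg_sin_scaled].
Qed.

Lemma adapted_scaled_sin (Z : W -> R) n : adapted G Z ->
  adapted G (fun w => n.+1%:R * sin (n.+1%:R^-1 * Z w)).
Proof.
move=> aZ; apply/(adaptedP sG); apply: measurable_funM => //.
by apply: measurable_sin; apply: measurable_funM => //; exact/(adaptedP sG).
Qed.

Lemma norm_scaled_sin (x : R) n : `|n.+1%:R * sin (n.+1%:R^-1 * x)| <= n.+1%:R.
Proof. by rewrite normrM normr_nat ler_piMr// ler_norml sin_geN1 sin_le1. Qed.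

(** The truncations [n sin(Z / n)] are bounded and still adapted, so the identity for bounded
    factors passes to the limit. *)
Lemma is_cexp_mean_sqint (U V Z : W -> R) : is_cexp P G U V ->
  sqint P U -> sqint P V -> sqint P Z -> adapted G Z ->
  mean P (fun w => V w * Z w) = mean P (fun w => U w * Z w).
Proof.
move=> ce sU sV sZ aZ; apply: (cvg_unique _ (cvg_mean_mul_sin sV sZ)) => //.
rewrite (_ : (fun n => _) = fun n =>
  mean P (fun w => U w * (n.+1%:R * sin (n.+1%:R^-1 * Z w)))).
  exact: cvg_mean_mul_sin.
apply/funext => n; apply: (is_cexp_mean sG GW ce (M := n.+1%:R)).
- exact: adapted_scaled_sin.
- by move=> w; exact: norm_scaled_sin.
Qed.

End is_cexp.

Lemma expR_taylor1 (R : realType) (k : R) :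
  t^-1 * (expR (- (k * t)) - 1) @[t --> (0 : R)^'] --> - k.
Proof.
have df (t : R) : is_derive t 1 (fun t => expR (- (k * t))) (- k * expR (- (k * t))).
  have h : is_derive t 1 (fun t => - k * t) (- k).
    have := @is_deriveZ _ _ _ _ (- k) t 1 _ (is_derive_id t 1).
    by rewrite /GRing.scale/= mulr1.
  have := @is_derive1_comp _ expR (fun t => - k * t) t _ _ (is_derive_expR _) h.
  rewrite mulrC (_ : expR \o _ = (fun t => expR (- (k * t)))) ?mulNr//.
  by apply/funext => x /=; rewrite mulNr.
have [dv ev] := df 0.
have : (fun h => h^-1 *: (expR (- (k * (h *: 1 + 0))) - expR (- (k * 0)))) @ (0 : R)^' -->
    'D_1 (fun t => expR (- (k * t))) 0 by exact: dv.
rewrite ev mulr0 oppr0 expR0 mulr1; apply: cvg_trans; apply: near_eq_cvg.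
by near=> t; rewrite /GRing.scale/= mulr1 addr0.
Unshelve. all: by end_near. Qed.

Section ou_process.
Context (d : measure_display) (W : measurableType d) (R : realType)
  (P : probability W R) (E : lmodType R) (Y : E -> R -> W -> R)
  (q : E -> E -> R) (k : R).
Hypothesis k0 : 0 < k.
Hypothesis gp : gaussian_process P Y.
Hypothesis lin : linear_process P Y.
Hypothesis cov : forall f g s t, mean P (fun w => Y f s w * Y g t w) =
  expR (- (k * `|t - s|)) / (2 * k) * q f g.

Let Ysq f t : sqint P (Y f t) := gaussian_sqint gp f t.

Let mY f t : measurable_fun setT (Y f t). Proof. by have [] := Ysq f t. Qed.

Lemma ou_stationary_field : stationary_field P Y.
Proof.
move=> u; apply: (@eq_fdd_gaussian _ E _ _ _ _ P P (fun f t => Y f (t + u)) Y).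
- by move=> n c f t; exact: (gp c f (fun i => t i + u)).
- exact: gp.
- by move=> f g s t; rewrite !cov opprD addrACA subrr addr0.
Qed.

Lemma ou_mean_continuous_field : mean_continuous P Y.
Proof.
move=> f t.
have e s : ('E_P[fun w => ((Y f s w - Y f t w) ^+ 2)%R] =
    (q f f / k * (1 - expR (- (k * `|t - s|))))%R%:E)%E.
  have [_ h] := sqintB (Ysq f s) (Ysq f t).
  have h1 := sqintM (Ysq f s) (Ysq f s); have h2 := sqintM (Ysq f s) (Ysq f t).
  have h3 := sqintM (Ysq f t) (Ysq f t).
  rewrite expectation_mean//; congr EFin.
  rewrite (@eq_mean _ _ _ _ _ (fun w => Y f s w * Y f s w - 2 * (Y f s w * Y f t w)
    + Y f t w * Y f t w)); last by move=> w; ring.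
  rewrite meanD//; last by apply: L1B => //; exact: L1Z.
  rewrite meanB//; last exact: L1Z.
  rewrite meanZ// !cov !subrr normr0 mulr0 oppr0 expR0.
  by field; rewrite gt_eqF.
under eq_fun do rewrite e.
apply: cvg_EFin; first by near=> s.
have h : expR (- (k * `|t - s|)) @[s --> t] --> expR (- (k * `|t - t|)).
  apply: continuous_cvg; first exact: continuous_expR.
  apply: cvgN; apply: cvgM; first exact: cvg_cst.
  by apply: cvg_norm; apply: cvgB; [exact: cvg_cst|exact: cvg_id].
have := cvgM (cvg_cst (q f f / k)) (cvgB (cvg_cst (1 : R)) h).
by rewrite subrr normr0 mulr0 oppr0 expR0 subrr mulr0; exact.
Unshelve. all: by end_near. Qed.

Lemma ou_process_of_cov : ou_process P Y.
Proof.
split => //.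
- exact: ou_markov_field gp cov.
- exact: ou_stationary_field.
- exact: ou_mean_continuous_field.
Qed.

Lemma nrm_process f t : nrm P (Y f t) = Num.sqrt (q f f / (2 * k)).
Proof. by rewrite /nrm (ou_second_moment cov). Qed.

Let p f := nrm P (Y f 0).

Lemma ou_char_seminorm : char_seminorm P Y p.
Proof.
move=> f t; rewrite expectation_mean; last by case: (Ysq f t).
by rewrite /p (nrm_process f 0) -(nrm_process f t).
Qed.

Let pZ a f : p (a *: f) = `|a| * p f.
Proof.
rewrite /p -nrmZ//; apply: ae_nrm => //; first exact: measurable_funM.
(* Linearity applied to [-1 *: 0 + 0] forces [Y 0 0 = 0] almost surely, which turns the affine
   relation into homogeneity. *)
have := lin a f 0 0; have := lin (-1) 0 0 0.
apply: filterS2 => w; rewrite scaler0 addr0 addr0 => h0 ->.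
have -> : Y 0 0 w = 0 by lra.
by rewrite addr0.
Qed.

Let p0 : p 0 = 0.
Proof. by rewrite -(scale0r (0 : E)) pZ normr0 mul0r. Qed.

Lemma ou_char_operator (G : E -> E) : (forall f, G f = - k *: f) ->
  char_operator P Y G.
Proof.
move=> hG; exists p, (fun t f => expR (- (k * t)) *: f).
have eT (t : R) f : t^-1 *: (expR (- (k * t)) *: f - f) - G f =
    (t^-1 * (expR (- (k * t)) - 1) + k) *: f.
  by rewrite hG scaleNr opprK -[in X in _ *: (_ - X)](scale1r f) -scalerBl scalerA -scalerDl.
split; [exact: ou_char_seminorm|split; [split|]|].
- move=> t a f g _; rewrite scalerDr !scalerA mulrC subrr; exact: p0.
- move=> t f t0; rewrite pZ ler_piMl ?nrm_ge0// ger0_norm ?expR_ge0//.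
  by rewrite -expR0 ler_expR oppr_le0 mulr_ge0// ltW.
- by move=> f; rewrite mulr0 oppr0 expR0 scale1r subrr p0.
- by move=> s t f _ _; rewrite scalerA -expRD -opprD -mulrDr subrr p0.
- move=> f; under eq_fun do rewrite -[in X in p (_ - X)](scale1r f) -scalerBl pZ.
  have h : expR (- (k * t)) @[t --> 0^'+] --> expR (- (k * 0)).
    apply: cvg_at_right_filter; apply: continuous_cvg; first exact: continuous_expR.
    by apply: cvgN; apply: cvgM; [exact: cvg_cst|exact: cvg_id].
  have := cvgM (cvg_norm (cvgB h (cvg_cst (1 : R)))) (cvg_cst (p f)).
  by rewrite mulr0 oppr0 expR0 subrr normr0 mul0r; exact.
- move=> t f t0.
  pose l w := Y f t w - expR (- (k * (t - 0))) * Y f 0 w.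
  have hl : span [set x | 0 <= x.2]
      (fun x w => Y x.1 x.2 w - expR (- (k * (x.2 - 0))) * Y x.1 0 w) l.
    exact: (@span_gen _ _ _ [set x : E * R | 0 <= x.2] _ (f, t)).
  have sp : sigma_algebra setT (field_past Y 0) by exact: smallest_sigma_algebra.
  have mp : field_past Y 0 `<=` measurable.
    by apply: generated_measurable => x _; exact: mY.
  split.
  + exact: sqint_L1.
  + exact: sqint_L1.
  + rewrite -/(adapted _ _); have : span [set x : E * R | x.2 <= 0] (fun x => Y x.1 x.2) (Y (expR (- (k * t)) *: f) 0).
      by apply: (@span_gen _ _ _ [set x : E * R | x.2 <= 0] (fun x => Y x.1 x.2) (_, 0)) => /=.
    exact: span_adapted.
  + move=> A pA; have mA := mp _ pA.
    have := ou_inc_past_mean gp cov hl pA; rewrite !mean_indic_mul /l subr0 => h.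
    have i1 : L1 P (fun w => Y f t w * \1_A w).
      by apply: (@L1_mul_bounded _ _ _ _ 1); [exact: sqint_L1|exact: measurable_indic|exact: norm_indic_le1].
    have i2 : L1 P (fun w => Y f 0 w * \1_A w).
      by apply: (@L1_mul_bounded _ _ _ _ 1); [exact: sqint_L1|exact: measurable_indic|exact: norm_indic_le1].
    transitivity (mean P (fun w => expR (- (k * t)) * (Y f 0 w * \1_A w))).
      apply: ae_mean.
      * by apply: measurable_funM => //; exact: measurable_indic.
      * by apply: measurable_funM => //; exact: L1_measurable i2.
      have := lin (expR (- (k * t))) f 0 0; have := lin (-1) 0 0 0.
      apply: filterS2 => w; rewrite scaler0 addr0 addr0 => h0 ->.
      have -> : Y 0 0 w = 0 by lra.
      by rewrite addr0 mulrA.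
    apply/esym/eqP; rewrite -subr_eq0 -meanB//; last exact: L1Z.
    by apply/eqP; rewrite -[RHS]h; apply: eq_mean => w; rewrite mulrBl mulrA.
- move=> f; under eq_fun do rewrite eT pZ.
  have h := cvg_dnbhs_at_right (@expR_taylor1 R k).
  have := cvgM (cvg_norm (cvgD h (cvg_cst k))) (cvg_cst (p f)).
  by rewrite addNr normr0 mul0r; exact.
Qed.

End ou_process.

(** * Uniqueness *)

Lemma cvg_ge_cst (R : realType) (u : nat -> R) (a l : R) :
  u n @[n --> \oo] --> l -> (forall n, a <= u n) -> a <= l.
Proof.
move=> ul h; rewrite -(cvg_lim _ ul)//; apply: limr_ge; first by apply/cvg_ex; exists l.
by near=> n; exact: h.
Unshelve. all: by end_near. Qed.

Section ou_uniqueness.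
Context (d : measure_display) (W : measurableType d) (R : realType)
  (P : probability W R) (E : lmodType R) (Y : E -> R -> W -> R)
  (p : E -> R) (k : R) (G : E -> E).
Hypothesis k0 : 0 < k.
Hypothesis ouY : ou_process P Y.
Hypothesis pY : char_seminorm P Y p.
Hypothesis hG : forall f, G f = - k *: f.
Hypothesis opY : char_operator P Y G.

Let lin : linear_process P Y := ou_linear ouY.
Let Ysq f t : sqint P (Y f t) := gaussian_sqint (ou_gaussian ouY) f t.
Let mY f t : measurable_fun setT (Y f t). Proof. by have [] := Ysq f t. Qed.

Let pE f t : p f = nrm P (Y f t).
Proof. by rewrite (pY f t) expectation_mean//; case: (Ysq f t). Qed.

Let Y0 : {ae P, forall w, Y 0 0 w = 0}.
Proof.
have := lin (-1) 0 0 0.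
by apply: filterS => w; rewrite scaler0 addr0 => h0; lra.
Qed.

Let p_lin a f g : p (a *: f + g) = nrm P (fun w => a * Y f 0 w + Y g 0 w).
Proof.
rewrite (pE _ 0); apply: ae_nrm => //.
by apply: measurable_funD => //; exact: measurable_funM.
Qed.

Let pZ a f : p (a *: f) = `|a| * p f.
Proof.
rewrite -[a *: f]addr0 p_lin (pE _ 0) -nrmZ//; apply: ae_nrm.
- by apply: measurable_funD => //; exact: measurable_funM.
- exact: measurable_funM.
- by apply: filterS Y0 => w /= ->; rewrite addr0.
Qed.

Let pD f g : p (f + g) <= p f + p g.
Proof.
rewrite -[in X in X <= _](scale1r f) p_lin (pE f 0) (pE g 0).
rewrite (@eq_nrm _ _ _ _ _ (fun w => Y f 0 w + Y g 0 w)); first exact: nrmD.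
by move=> w; rewrite mul1r.
Qed.

Let pN f : p (- f) = p f.
Proof. by rewrite -scaleN1r pZ normrN normr1 mul1r. Qed.

Let p_ge0 f : 0 <= p f. Proof. by rewrite (pE f 0) nrm_ge0. Qed.

(** The time [t] is cut into [n + 1] equal steps and [T] is compared with the exponential on each of
    them. Contractivity keeps earlier errors from growing, and a single step errs by [o(t / n)]
    since both semigroups have the same derivative at 0. Everything holds modulo the seminorm
    [p]. *)
Lemma semigroup_scale (T : R -> E -> E) : contraction_semigroup p T ->
  (forall f, p (t^-1 *: (T t f - f) - G f) @[t --> 0^'+] --> (0 : R)) ->
  forall t f, 0 <= t -> p (T t f - expR (- (k * t)) *: f) = 0.
Proof.
move=> csT gen t f; rewrite le_eqVlt => /predU1P[<-|t0].
  by rewrite mulr0 oppr0 expR0 scale1r (cs_0 csT).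
pose h (n : nat) := t / n.+1%:R.
have h0 n : 0 < h n by rewrite divr_gt0.
pose D n := p (T (h n) f - expR (- (k * h n)) *: f).
have step n j : p (T (h n *+ j) f - expR (- (k * (h n *+ j))) *: f) <= j%:R * D n.
  elim: j => [|j ih]; first by rewrite mulr0n mulr0 oppr0 expR0 scale1r (cs_0 csT) mul0r.
  set a := h n *+ j in ih *; have a0 : 0 <= a by rewrite mulrn_wge0// ltW.
  rewrite mulrSr -/a; set e := expR (- (k * h n)); set ea := expR (- (k * a)) in ih *.
  have -> : expR (- (k * (a + h n))) = e * ea by rewrite -expRD -opprD -mulrDr addrC.
  (* The error of one step. It is later transported by [T a], a contraction for [p], so it adds at
     most [D n]. *)
  pose g := T (h n) f - e *: f.
  have h1 := cs_D csT f a0 (ltW (h0 n)).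
  have h2 := cs_linear csT e f g a0.
  rewrite (_ : e *: f + g = T (h n) f) in h2; last by rewrite addrC subrK.
  rewrite (_ : T (a + h n) f - _ = (T (a + h n) f - T a (T (h n) f)) +
    ((T a (T (h n) f) - (e *: T a f + T a g)) + (e *: (T a f - ea *: f) + T a g))); last first.
    by rewrite scalerBr scalerA -(addrA (T a _)) subrKA (addrAC (e *: _)) addKr.
  apply: (le_trans (pD _ _)); rewrite h1 add0r; apply: (le_trans (pD _ _)); rewrite h2 add0r.
  apply: (le_trans (pD _ _)); rewrite -natr1 mulrDl mul1r lerD//; last exact: (cs_contraction csT g a0).
  rewrite pZ (le_trans _ ih)// ler_piMl// ger0_norm ?expR_ge0//.
  by rewrite -expR0 ler_expR oppr_le0 mulr_ge0// ltW.
(* The error of a step of length [x] per unit of time: the defect of the generator limit for [T],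
   plus that of the exponential. *)
pose v (x : R) := p (x^-1 *: (T x f - f) - G f) + `|x^-1 * (expR (- (k * x)) - 1) + k| * p f.
have Dv n : D n <= h n * v (h n).
  have hn0 : h n != 0 by rewrite gt_eqF.
  rewrite /D (_ : _ - _ = h n *: (((h n)^-1 *: (T (h n) f - f) - G f) -
     ((h n)^-1 * (expR (- (k * h n)) - 1) + k) *: f)).
    rewrite pZ gtr0_norm// ler_pM2l// (le_trans (pD _ _))// pN pZ//.
  move: (h n) hn0 => x x0.
  rewrite hG scaleNr opprK scalerDl -scalerA opprD addrACA subrr addr0 -scalerBr scalerA.
  by rewrite divff// scale1r scalerBl scale1r opprB addrA subrK.
have bound n : p (T t f - expR (- (k * t)) *: f) <= t * v (h n).
  have := step n n.+1; rewrite /h -mulr_natr divfK// => /le_trans; apply.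
  by rewrite (le_trans (ler_wpM2l _ (Dv n)))// mulrA (_ : _ * h n = t)// /h mulrC divfK.
have cv : v x @[x --> 0^'+] --> 0.
  have h1 := cvg_dnbhs_at_right (@expR_taylor1 R k).
  have := cvgD (gen f) (cvgM (cvg_norm (cvgD h1 (cvg_cst k))) (cvg_cst (p f))).
  by rewrite addNr normr0 mul0r addr0; exact.
have ch : h n @[n --> \oo] --> 0.
  have := cvgM (cvg_cst t) (@cvg_harmonic R); rewrite mulr0; exact.
have {}cv : v (h n) @[n --> \oo] --> 0.
  by move/cvg_at_rightP : cv; apply.
have := cvgM (cvg_cst t) cv; rewrite mulr0 => ct.
apply/eqP; rewrite eq_le p_ge0 andbT.
by apply: (cvg_ge_cst (ct _ _)) => n; exact: bound.
Qed.

(** Stationarity moves the earlier time to 0, conditioning on the past of 0 replaces the later value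
    by a multiple of the value at 0, and polarization recovers the remaining covariance from [p]. *)
Lemma ou_cov_of_char f g s t : mean P (fun w => Y f s w * Y g t w) =
  expR (- (k * `|t - s|)) * ((p (f + g) ^+ 2 - p f ^+ 2 - p g ^+ 2) / 2).
Proof.
wlog st : f g s t / t <= s.
  move=> hw; have [st|/ltW st] := leP t s; first exact: hw.
  rewrite (@eq_mean _ _ _ _ _ (fun w => Y g t w * Y f s w)).
    by rewrite hw// (distrC s) (addrC g) (addrAC _ (- p g ^+ 2)).
  by move=> w; rewrite mulrC.
have e1 : mean P (fun w => Y f s w * Y g t w) = mean P (fun w => Y f (s - t) w * Y g 0 w).
  have := eq_fdd_mean_mul (f := f) (g := g) (s := s - t) (t := 0) _ mY (ou_stationary ouY t).
  by rewrite subrK add0r => h; apply: (h _ _).2 => //; exact: sqintM.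
have [p' [T [pY' [csT ceT] gen]]] := opY.
have pp' : p' = p by apply/funext => h; rewrite (pY h 0) (pY' h 0).
rewrite pp' in csT gen.
have st0 : 0 <= s - t by rewrite subr_ge0.
have sp : sigma_algebra setT (field_past Y 0) by exact: smallest_sigma_algebra.
have mp : field_past Y 0 `<=` measurable.
  by apply: generated_measurable => x _; exact: mY.
have ag : adapted (field_past Y 0) (Y g 0).
  have : span [set x : E * R | x.2 <= 0] (fun x => Y x.1 x.2) (Y g 0).
    by apply: (@span_gen _ _ _ [set x : E * R | x.2 <= 0] (fun x => Y x.1 x.2) (_, 0)) => /=.
  exact: span_adapted.
have e2 := is_cexp_mean_sqint sp mp (ceT (s - t) f st0) (Ysq f _) (Ysq _ 0) (Ysq g 0) ag.
set a := expR (- (k * `|t - s|)).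
have := semigroup_scale csT gen f st0.
rewrite -[in X in expR (- (k * X))](ger0_norm st0) distrC -/a => T0.
have e3 : mean P (fun w => Y (T (s - t) f) 0 w * Y g 0 w) =
    a * mean P (fun w => Y f 0 w * Y g 0 w).
  apply/eqP; rewrite -subr_eq0 -meanZ; last exact: sqintM.
  rewrite -meanB; [|exact: sqintM|by apply: L1Z; exact: sqintM].
  rewrite -normr_le0 (@eq_mean _ _ _ _ _
    (fun w => (- a * Y f 0 w + Y (T (s - t) f) 0 w) * Y g 0 w)); last by move=> w; ring.
  rewrite (le_trans (norm_mean_mul_nrm _ _))//; first by apply: sqintD => //; exact: sqintZ.
  by rewrite -p_lin addrC scaleNr T0 mul0r.
rewrite e1 -e2 e3; congr (_ * _).
have := p_lin 1 f g; rewrite scale1r => ->.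
rewrite (pE f 0) (pE g 0) !sqr_nrm.
rewrite (@eq_mean _ _ _ _ (fun w => (1 * Y f 0 w + Y g 0 w) ^+ 2)
  (fun w => Y f 0 w ^+ 2 + 2 * (Y f 0 w * Y g 0 w) + Y g 0 w ^+ 2)); last by move=> w; ring.
have [_ i1] := Ysq f 0; have [_ i2] := Ysq g 0; have i3 := sqintM (Ysq f 0) (Ysq g 0).
rewrite meanD//; last by apply: L1D => //; exact: L1Z.
rewrite meanD//; last exact: L1Z.
by rewrite meanZ//; field.
Qed.

End ou_uniqueness.

Lemma ou_process_unique (R : realType) (E : lmodType R) (d d' : measure_display)
  (W : measurableType d) (W' : measurableType d') (P : probability W R)
  (P' : probability W' R) (Y : E -> R -> W -> R) (Y' : E -> R -> W' -> R)
  (p : E -> R) (k : R) (G : E -> E) : 0 < k -> (forall f, G f = - k *: f) ->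
  ou_process P Y -> char_seminorm P Y p -> char_operator P Y G ->
  ou_process P' Y' -> char_seminorm P' Y' p -> char_operator P' Y' G ->
  eq_fdd P P' Y Y'.
Proof.
move=> k0 hG oY pY gY oY' pY' gY'; apply: eq_fdd_gaussian.
- exact: ou_gaussian oY.
- exact: ou_gaussian oY'.
- by move=> f g s t; rewrite (ou_cov_of_char k0 oY pY hG gY) (ou_cov_of_char k0 oY' pY' hG gY').
Qed.

(** * Riemann sums and the innovation *)

Lemma segment_unif_continuous (R : realType) (h : R -> R) (a b e : R) :
  continuous h -> 0 < e ->
  \forall r \near 0^'+, forall x y, a <= x <= b -> `|x - y| <= r -> `|h x - h y| <= e.
Proof.
move=> ch e0.
have /compact_near_coveringP cov := @segment_compact R a b.
have : \forall r \near (0 : R)^'+,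
    `[a, b] `<=` (fun x => forall y, `|x - y| <= r -> `|h x - h y| <= e).
  apply: cov => x _.
  have /cvgrPdist_lt/(_ (e / 2)) := ch x; rewrite divr_gt0// => /(_ isT).
  move=> [/= r /= r0 hr].
  exists ([set x' | `|x - x'| < r / 2], [set r' | r' < r / 2]); first split => /=.
  - by exists (r / 2); rewrite /= ?divr_gt0.
  - by apply: nbhs_right_lt; rewrite divr_gt0.
  move=> [x' r'] /= [xx' rr'] y yr.
  have h1 : `|h x - h x'| < e / 2 by apply: hr => /=; rewrite (lt_trans xx')// ltr_pdivrMr// ltr_pMr// ltr1n.
  have h2 : `|h x - h y| < e / 2.
    apply: hr => /=; rewrite -(subrKA x') (le_lt_trans (ler_normD _ _))//.
    by rewrite [ltRHS]splitr ltrD// (le_lt_trans yr).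
  rewrite -(subrKA (h x)) (le_trans (ler_normD _ _))// [leRHS]splitr lerD//; last exact: ltW.
  by rewrite distrC ltW.
by apply: filterS => r hr x y xab; apply: hr; rewrite /= in_itv.
Qed.

Section riemann_sum.
Context (R : realType) (h : R -> R) (T : nat).
Hypothesis ch : continuous h.

(** The mesh starts at [- T], so that negative times also have natural indices; 0 is a mesh point,
    and integrals from 0 are differences of sums starting at [- T]. *)
Definition grid (n j : nat) : R := j%:R / n.+1%:R - T%:R.

Definition grid_index (n : nat) (t : R) : nat := Num.truncn ((t + T%:R) * n.+1%:R).

Lemma grid_index0 n : grid_index n 0 = (T * n.+1)%N.
Proof. by rewrite /grid_index add0r -natrM natrK. Qed.

Lemma gridS n j : grid n j.+1 = grid n j + n.+1%:R^-1.
Proof. by rewrite /grid -natr1 mulrDl mul1r addrAC. Qed.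

Lemma grid0 n : grid n 0 = - T%:R. Proof. by rewrite /grid mul0r add0r. Qed.

Lemma grid_le n : {homo grid n : i j / (i <= j)%N >-> i <= j}.
Proof. by move=> i j ij; rewrite lerD2r ler_pM2r ?invr_gt0// ler_nat. Qed.

Lemma grid_indexP n t : - T%:R <= t -> grid n (grid_index n t) <= t < grid n (grid_index n t).+1.
Proof.
move=> tT; have n0 : 0 < n.+1%:R :> R by [].
have : 0 <= (t + T%:R) * n.+1%:R by rewrite mulr_ge0// -lerBlDr sub0r.
move=> /truncn_itv /andP[h1 h2].
by rewrite /grid lerBlDr ltrBrDr ler_pdivrMr// ltr_pdivlMr// h1.
Qed.

Lemma cvg_grid t : - T%:R <= t -> grid n (grid_index n t) @[n --> \oo] --> t.
Proof.
move=> tT; apply/cvgrPdist_lt => e e0.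
have := @near_infty_natSinv_lt R (PosNum e0); apply: filterS => n /= ne.
have := grid_indexP n tT; rewrite gridS => /andP[h1 h2].
by rewrite ger0_norm ?subr_ge0// (lt_trans _ ne)// ltrBlDl.
Qed.

(** The lower limit of integration lies strictly below [- T], so that the primitive [H] is
    differentiable at [- T] too. *)
Let a : R := - T%:R - 1.
Let b : R := T%:R + 1.
Let H x := \int[lebesgue_measure]_(u in `[a, x]) h u.

Let hab x y : lebesgue_measure.-integrable `[x, y] (EFin \o h).
Proof.
apply: continuous_compact_integrable; first exact: segment_compact.
exact: continuous_subspaceT.
Qed.

Let dH (x : R) : a < x -> is_derive x 1 H (h x).
Proof.
move=> ax; have xb : x < x + 1 by rewrite ltrDl.
have [d1 d2] := continuous_FTC1_closed xb (hab a _) ax (@ch x).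
by split; [exact: d1|rewrite -derive1E].
Qed.

Let cH (x : R) : a < x -> {for x, continuous H}.
Proof.
by move=> ax; apply/differentiable_continuous/derivable1_diffP; have [] := dH ax.
Qed.

Let T_ge0 : 0 <= T%:R :> R. Proof. by []. Qed.

Let integral_diff x y : a < x -> x <= y -> \int[lebesgue_measure]_(u in `[x, y]) h u = H y - H x.
Proof.
move=> ax; rewrite le_eqVlt => /predU1P[<-|xy].
  by rewrite set_itv1 subrr Rintegral_set1.
rewrite /Rintegral (@continuous_FTC2 _ h H x y xy)//.
- exact: continuous_subspaceT.
- split.
  + by move=> z; rewrite in_itv/= => /andP[xz _]; have [] := dH (lt_trans ax xz).
  + by apply: cvg_at_right_filter; exact: cH.
  + by apply: cvg_at_left_filter; apply: cH; exact: lt_trans xy.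
- move=> z; rewrite in_itv/= => /andP[xz _]; rewrite derive1E.
  by have [] := dH (lt_trans ax xz).
Qed.

Lemma oriented_integralE t : - T%:R <= t -> oriented_integral h t = H t - H 0.
Proof.
move=> tT; rewrite /oriented_integral; have [t0|t0] := leP 0 t.
  rewrite integral_diff//; have := T_ge0; rewrite /a; lra.
rewrite integral_diff ?opprB// ?ltW//; move: tT; rewrite /a; lra.
Qed.

Lemma riemann_sum_le n m (e : R) :
  (forall x y, - T%:R <= x <= T%:R -> `|x - y| <= n.+1%:R^-1 -> `|h x - h y| <= e) ->
  grid n m <= T%:R ->
  `|\sum_(j < m) n.+1%:R^-1 * h (grid n j.+1) - (H (grid n m) - H (- T%:R))| <=
  m%:R / n.+1%:R * e.
Proof.
move=> he; elim: m => [_|m ih mT].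
  by rewrite big_ord0 grid0 subrr subr0 normr0 !mul0r.
have mT' : grid n m <= T%:R by rewrite (le_trans _ mT)// grid_le.
have am : a < grid n m.
  have : - T%:R <= grid n m by rewrite -(grid0 n) grid_le.
  by rewrite /a; lra.
have mm : grid n m <= grid n m.+1 by rewrite grid_le.
have cH' : {within `[grid n m, grid n m.+1], continuous H}.
  apply: continuous_in_subspaceT => x; rewrite inE/= in_itv/= => /andP[mx _].
  by apply: cH; exact: lt_le_trans mx.
have dH' x : x \in `]grid n m, grid n m.+1[ -> is_derive x 1 H (h x).
  by rewrite in_itv/= => /andP[mx _]; apply: dH; exact: lt_trans mx.
have [c] := MVT_segment mm dH' cH'.
rewrite in_itv/= => /andP[c1 c2] Hc.
have d : grid n m.+1 - grid n m = n.+1%:R^-1 by rewrite gridS addrAC subrr add0r.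
have hc : `|h (grid n m.+1) - h c| <= e.
  apply: he.
    by rewrite mT (le_trans _ mm)// -(grid0 n) grid_le.
  by rewrite -d ger0_norm ?subr_ge0// lerD2l lerN2.
rewrite big_ord_recr/= -[in leRHS]natr1 mulrDl mul1r (mulrDl _ _ e).
rewrite d in Hc.
rewrite (_ : _ - _ = (\sum_(j < m) n.+1%:R^-1 * h (grid n j.+1) -
    (H (grid n m) - H (- T%:R))) + n.+1%:R^-1 * (h (grid n m.+1) - h c)); last first.
  by rewrite mulrBr [n.+1%:R^-1 * h c]mulrC -Hc; ring.
rewrite (le_trans (ler_normD _ _))// lerD ?ih// normrM ger0_norm ?invr_ge0//.
by rewrite ler_wpM2l// invr_ge0.
Qed.

Lemma cvg_riemann_sum t : `|t| <= T%:R ->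
  \sum_(j < grid_index n t) n.+1%:R^-1 * h (grid n j.+1) -
  \sum_(j < grid_index n 0) n.+1%:R^-1 * h (grid n j.+1) @[n --> \oo] -->
  oriented_integral h t.
Proof.
rewrite ler_norml => /andP[tT1 tT2]; rewrite oriented_integralE//.
have at_ : a < t by move: tT1; rewrite /a; lra.
have cHt : H (grid n (grid_index n t)) @[n --> \oo] --> H t.
  by apply: continuous_cvg; [exact: cH|exact: cvg_grid].
apply/cvgrPdist_le => e e0.
(* Two Riemann sums are compared with integrals, each with error at most [2 T w]; the added 1 keeps
   the denominator nonzero when [T] is 0. *)
pose w := e / 2 / (2 * (T%:R + T%:R + 1)).
have w0 : 0 < w by rewrite divr_gt0 ?divr_gt0// mulr_gt0// ltr_wpDl// addr_ge0.
have [r /= r0 hr] := segment_unif_continuous (- T%:R) T%:R ch w0.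
near=> n.
have he : forall x y, - T%:R <= x <= T%:R -> `|x - y| <= n.+1%:R^-1 -> `|h x - h y| <= w.
  apply: hr => //=; rewrite sub0r normrN ger0_norm ?invr_ge0//.
  by near: n; exact: near_infty_natSinv_lt (PosNum r0).
have bound s : - T%:R <= s -> s <= T%:R ->
   `|\sum_(j < grid_index n s) n.+1%:R^-1 * h (grid n j.+1) -
     (H (grid n (grid_index n s)) - H (- T%:R))| <= (T%:R + T%:R) * w.
  move=> s1 s2; have /andP[g1 _] := grid_indexP n s1.
  apply: (le_trans (riemann_sum_le he (le_trans g1 s2))).
  rewrite ler_wpM2r ?(ltW w0)//; move: g1; rewrite /grid lerBlDr => h1.
  by rewrite (le_trans h1)// lerD2r.
have b1 := bound t tT1 tT2.
have g0 : grid n (grid_index n 0) = 0.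
  by rewrite grid_index0 /grid natrM mulfK ?subrr// pnatr_eq0.
have b3 : `|H t - H (grid n (grid_index n t))| <= e / 2.
  by near: n; move/cvgrPdist_le : cHt; apply; rewrite divr_gt0.
have b2 : `|\sum_(j < grid_index n 0) n.+1%:R^-1 * h (grid n j.+1) -
     (H 0 - H (- T%:R))| <= (T%:R + T%:R) * w.
  by rewrite -[in X in H X - _]g0; apply: bound; rewrite ?oppr_le0.
have hw : (T%:R + T%:R) * w + (T%:R + T%:R) * w <= e / 2.
  rewrite -mulrDl /w mulrCA ler_piMr ?divr_ge0 ?(ltW e0)//.
  by rewrite ler_pdivrMr ?mul1r; have := T_ge0; lra.
move: b1 b2 b3 hw; set A := \sum_(j < _) _; set B := \sum_(j < _) _.
set C := (_ + _) * w.
rewrite !ler_norml => /andP[? ?] /andP[? ?] /andP[? ?] ?; lra.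
Unshelve. all: by end_near. Qed.

End riemann_sum.

Lemma cvg_mean_cos (d : measure_display) (W : measurableType d) (R : realType)
  (P : probability W R) (X_ : nat -> W -> R) (X : W -> R) :
  (forall n, measurable_fun setT (X_ n)) ->
  (forall w, X_ n w @[n --> \oo] --> X w) ->
  mean P (fun w => cos (X_ n w)) @[n --> \oo] --> mean P (fun w => cos (X w)).
Proof.
move=> mX cv.
have [||||_] := @dominated_mean _ _ _ P (fun n w => cos (X_ n w))
  (fun w => cos (X w)) (fun=> 1) => //.
- by move=> n; exact: measurable_cos.
- exact: L1_cst.
- by move=> n w; rewrite ler_norml cos_geN1 cos_le1.
- by move=> w; apply: continuous_cvg; [exact: continuous_cos|exact: cv].
Qed.

Lemma sum_nat_lt (R : realType) (m m' : nat) :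
  \sum_(i < m) (i < m')%N%:R = (minn m m')%:R :> R.
Proof.
elim: m => [|m ih]; first by rewrite big_ord0 min0n.
rewrite big_ord_recr/= ih -natrD; congr (_%:R); lia.
Qed.

Lemma cvg_minr (R : realType) (u v : nat -> R) (a b : R) :
  u n @[n --> \oo] --> a -> v n @[n --> \oo] --> b ->
  Num.min (u n) (v n) @[n --> \oo] --> Num.min a b.
Proof.
move=> ua vb; rewrite minr_absE; under eq_fun do rewrite minr_absE.
apply: cvgM; last exact: cvg_cst.
by apply: cvgB; [exact: cvgD|apply: cvg_norm; exact: cvgB].
Qed.

Section cvg_sequences.
Context (R : realType).
Implicit Types (u v : nat -> R) (a b : R).

Lemma cvg_addn u v a b : u n @[n --> \oo] --> a -> v n @[n --> \oo] --> b ->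
  u n + v n @[n --> \oo] --> a + b.
Proof. by move=> ua vb; exact: cvgD. Qed.

Lemma cvg_subn u v a b : u n @[n --> \oo] --> a -> v n @[n --> \oo] --> b ->
  u n - v n @[n --> \oo] --> a - b.
Proof. by move=> ua vb; exact: cvgB. Qed.

Lemma cvg_muln u v a b : u n @[n --> \oo] --> a -> v n @[n --> \oo] --> b ->
  u n * v n @[n --> \oo] --> a * b.
Proof. by move=> ua vb; exact: cvgM. Qed.

Lemma cvg_cstn a : (fun=> a) n @[n --> \oo] --> a.
Proof. exact: cvg_cst. Qed.

Lemma cvg_sumn (I : Type) (s : seq I) (u : I -> nat -> R) (a : I -> R) :
  (forall i, u i n @[n --> \oo] --> a i) ->
  \sum_(i <- s) u i n @[n --> \oo] --> \sum_(i <- s) a i.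
Proof.
move=> h; elim: s => [|i s ih].
  by rewrite big_nil; under eq_fun do rewrite big_nil; exact: cvg_cst.
by rewrite big_cons; under eq_fun do rewrite big_cons; exact: cvg_addn.
Qed.

Lemma cvg_eqn u v a : u n @[n --> \oo] --> a -> (forall n, v n = u n) ->
  v n @[n --> \oo] --> a.
Proof. by move=> ua vu; rewrite (_ : v = u)//; apply/funext. Qed.

End cvg_sequences.

(** * The innovation as a limit of sums of orthogonal increments *)

Section innovation.
Context (d : measure_display) (W : measurableType d) (R : realType)
  (P : probability W R) (E : lmodType R) (Y : E -> R -> W -> R)
  (q : E -> E -> R) (k : R) (G : E -> E).
Hypothesis k0 : 0 < k.
Hypothesis gp : gaussian_process P Y.
Hypothesis lin : linear_process P Y.
Hypothesis cov : forall f g s t, mean P (fun w => Y f s w * Y g t w) =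
  expR (- (k * `|t - s|)) / (2 * k) * q f g.
Hypothesis cY : forall f w, continuous (fun t => Y f t w).
Hypothesis hG : forall f, G f = - k *: f.

Let V (x : E * R) := Y x.1 x.2.
Let Ysq f t : sqint P (Y f t) := gaussian_sqint gp f t.
Let mY f t : measurable_fun setT (Y f t). Proof. by have [] := Ysq f t. Qed.

Variable T : nat.
Let del (n : nat) : R := n.+1%:R^-1.
Let u := grid R T.
Let N (n : nat) (t : R) := grid_index T n t.
Let xi n j (f : E) := fun w => Y f (u n j.+1) w - expR (- (k * del n)) * Y f (u n j) w.
(** The weight is chosen so that each summand is [Y(u_(j+1)) - Y(u_j)] plus
    [(exp (k del) - 1) Y(u_(j+1))]: the sum telescopes into a discretized innovation while its terms
    stay orthogonal. *)
Let S n f (m : nat) := fun w => \sum_(j < m) expR (k * del n) * xi n j f w.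
Let D n f t := fun w => S n f (N n t) w - S n f (N n 0) w.

Let q_sym f g : q f g = q g f.
Proof.
have h : mean P (fun w => Y f 0 w * Y g 0 w) = mean P (fun w => Y g 0 w * Y f 0 w).
  by apply: eq_mean => w; rewrite mulrC.
move: h; rewrite !cov subrr normr0 mulr0 oppr0 expR0; apply: mulfI.
by rewrite mul1r invr_eq0 mulf_neq0// gt_eqF.
Qed.

Let xi_sqint n j f : sqint P (xi n j f).
Proof. by apply: sqintB => //; exact: sqintZ. Qed.

Let uS n j : u n j.+1 - u n j = del n.
Proof. by rewrite /u gridS addrAC subrr add0r. Qed.

Let del_ge0 n : 0 <= del n. Proof. by rewrite invr_ge0. Qed.

Let past_xi n j f g (r : R) : r <= u n j -> mean P (fun w => Y g r w * xi n j f w) = 0.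
Proof.
move=> rj; have h1 : (g, r).2 <= u n j by [].
have h2 : u n j <= (f, u n j.+1).2 by rewrite /= /u grid_le.
have := ou_inc_orthogonal gp cov h1 h2; rewrite /= uS; exact.
Qed.

(** The variance of one weighted increment in units of [q]; it is equivalent to the mesh size. *)
Let kap n : R := (expR (2 * (k * del n)) - 1) / (2 * k).

Let xi_mul n i j f g : mean P (fun w => xi n i f w * xi n j g w) =
  (i == j)%:R * (expR (- (2 * (k * del n))) * kap n * q f g).
Proof.
wlog ij : i j f g / (i <= j)%N.
  move=> hw; have [ij|/ltnW ij] := leqP i j; first exact: hw.
  rewrite (@eq_mean _ _ _ _ _ (fun w => xi n j g w * xi n i f w)); last first.
    by move=> w; rewrite mulrC.
  rewrite hw// eq_sym; congr (_ * (_ * _)).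
  exact: q_sym.
rewrite (@eq_mean _ _ _ _ _ (fun w => Y f (u n i.+1) w * xi n j g w -
  expR (- (k * del n)) * (Y f (u n i) w * xi n j g w))); last first.
  by move=> w; rewrite [in LHS]/xi mulrBl mulrA.
have L1xi r h : L1 P (fun w => Y h r w * xi n j g w) by exact: sqintM.
rewrite meanB//; last exact: L1Z.
rewrite meanZ// (past_xi _ _ (@grid_le R T n _ _ ij)) mulr0 subr0.
have [/eqP ->|ij'] := boolP (i == j); last first.
  by rewrite mul0r past_xi// grid_le// ltn_neqAle ij'.
rewrite mul1r (@eq_mean _ _ _ _ _ (fun w => Y f (u n j.+1) w * Y g (u n j.+1) w -
  expR (- (k * del n)) * (Y f (u n j.+1) w * Y g (u n j) w))); last first.
  by move=> w; rewrite /xi; ring.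
rewrite meanB ?meanZ ?cov; [|exact: sqintM|exact: sqintM|by apply: L1Z; exact: sqintM].
rewrite subrr normr0 distrC uS (ger0_norm (del_ge0 n)) mulr0 oppr0 expR0 /kap.
rewrite (_ : 2 * (k * del n) = k * del n + k * del n); last by ring.
rewrite opprD !expRD !expRN; field; rewrite !gt_eqF ?expR_gt0//.
Qed.

Let S_sqint n f m : sqint P (S n f m).
Proof. by apply: sqint_sum => j; exact: sqintZ. Qed.

Let D_sqint n f t : sqint P (D n f t).
Proof. exact: sqintB. Qed.

Let S_mul n f g m m' : mean P (fun w => S n f m w * S n g m' w) =
  (minn m m')%:R * (kap n * q f g).
Proof.
pose e := expR (k * del n).
rewrite (@eq_mean _ _ _ _ _ (fun w => \sum_(i < m) \sum_(j < m') e ^+ 2 * (xi n i f w * xi n j g w))); last first.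
  move=> w; rewrite /S mulr_suml; apply: eq_bigr => i _; rewrite mulr_sumr.
  by apply: eq_bigr => j _; rewrite /e; ring.
rewrite mean_sum => [|i]; last first.
  by apply: L1_sum => j; apply: L1Z; exact: sqintM.
rewrite -sum_nat_lt mulr_suml; apply: eq_bigr => i _.
rewrite mean_sum => [|j]; last by apply: L1Z; exact: sqintM.
have e2 : e ^+ 2 * expR (- (2 * (k * del n))) = 1.
  by rewrite /e expr2 -!expRD -[RHS](@expR0 R); congr expR; ring.
under eq_bigr => j _.
  rewrite meanZ ?xi_mul; last exact: sqintM.
  rewrite mulrCA (mulrA (e ^+ 2)) (mulrA (e ^+ 2)) e2 mul1r; over.
rewrite -mulr_suml; congr (_ * _).
have [im|mi] := ltnP i m'.
  rewrite (bigD1 (Ordinal im))//= eqxx big1 ?addr0// => j jm.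
  by case: eqP => // ij; move: jm; rewrite -val_eqE/= ij eqxx.
by rewrite big1// => j _; case: eqP => // ij; move: (ltn_ord j); rewrite -ij ltnNge mi.
Qed.

Let D_mul n f g s t : mean P (fun w => D n f s w * D n g t w) =
  ((minn (N n s) (N n t))%:R - (minn (N n s) (N n 0))%:R - (minn (N n 0) (N n t))%:R
   + (N n 0)%:R) * (kap n * q f g).
Proof.
have L m m' : L1 P (fun w => S n f m w * S n g m' w) by exact: sqintM.
rewrite (@eq_mean _ _ _ _ _ (fun w => S n f (N n s) w * S n g (N n t) w
  - S n f (N n s) w * S n g (N n 0) w - S n f (N n 0) w * S n g (N n t) w
  + S n f (N n 0) w * S n g (N n 0) w)); last by move=> w; rewrite /D; ring.
rewrite meanD ?meanB ?S_mul ?minnn//; first by rewrite !mulrDl !mulNr.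
  exact: L1B.
by apply: L1B => //; exact: L1B.
Qed.

Let cvg_kap : n.+1%:R * kap n @[n --> \oo] --> (1 : R).
Proof.
have h := cvg_dnbhs_at_right (@expR_taylor1 R (- (2 * k))).
have {h} : (del n)^-1 * (expR (- (- (2 * k) * del n)) - 1) @[n --> \oo] --> - - (2 * k).
  move/cvg_at_rightP : h => /(_ del); apply; split.
    by move=> n; rewrite invr_gt0.
  exact: cvg_harmonic.
rewrite opprK => h.
have := cvgM h (cvg_cst (2 * k)^-1); rewrite divff ?gt_eqF ?mulr_gt0// => h'.
apply: cvg_trans (h' _ _); apply: near_eq_cvg; near=> n => /=.
by rewrite invrK /kap mulNr opprK mulrA mulrA.
Unshelve. all: by end_near. Qed.

Let cvg_N t : - T%:R <= t -> (N n t)%:R / n.+1%:R @[n --> \oo] --> t + T%:R.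
Proof.
move=> tT; have := cvgD (@cvg_grid R T t tT) (cvg_cst (T%:R : R)).
by move=> h; apply: cvg_trans (h _ _); apply: near_eq_cvg; near=> n; rewrite /= subrK.
Unshelve. all: by end_near. Qed.

Let cvg_minN s t : - T%:R <= s -> - T%:R <= t ->
  (minn (N n s) (N n t))%:R / n.+1%:R @[n --> \oo] --> Num.min (s + T%:R) (t + T%:R).
Proof.
move=> sT tT; apply: cvg_trans (cvg_minr (cvg_N sT) (cvg_N tT)).
apply: near_eq_cvg; near=> n.
rewrite -minr_pMl ?invr_ge0//; congr (_ / _).
by rewrite -natr_min minEnat.
Unshelve. all: by end_near. Qed.

(** The right side is the covariance of [w (s + T) - w T] and [w (t + T) - w T] for a one-sided
    Brownian motion [w]: the form in which the limit of [D_mul] appears. *)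
Lemma two_sided_covE f g (s t : R) : - T%:R <= s -> - T%:R <= t ->
  two_sided_cov q f g s t = (Num.min (s + T%:R) (t + T%:R) - Num.min (s + T%:R) (0 + T%:R)
   - Num.min (0 + T%:R) (t + T%:R) + T%:R) * q f g.
Proof.
move=> sT tT; have -> : two_sided_cov q f g s t = (if 0 < s * t then Num.min `|s| `|t| else 0) * q f g.
  by rewrite /two_sided_cov; case: ifP => // _; rewrite mul0r.
congr (_ * _); rewrite /Num.min !ltrD2r.
have [s0|s0|s0] := ltrgt0P s; have [t0|t0|t0] := ltrgt0P t;
  rewrite ?(pmulr_rgt0 _ s0) ?(nmulr_rgt0 _ s0) ?s0 ?t0 ?mulr0 ?mul0r ?ltxx;
  repeat case: ltP => ?; lra.
Qed.

Let cvg_D_mul f g s t : - T%:R <= s -> - T%:R <= t ->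
  mean P (fun w => D n f s w * D n g t w) @[n --> \oo] --> two_sided_cov q f g s t.
Proof.
move=> sT tT; have T0 : - T%:R <= (0 : R) by rewrite oppr_le0.
rewrite two_sided_covE//.
have h := cvg_addn (cvg_subn (cvg_subn (cvg_minN sT tT) (cvg_minN sT T0)) (cvg_minN T0 tT)) (cvg_N T0).
have {}h := cvg_muln h (cvg_muln cvg_kap (@cvg_cstn R (q f g))).
rewrite [X in _ + X](_ : _ = T%:R) ?mul1r in h; last by rewrite add0r.
apply: cvg_eqn h _ => n.
rewrite D_mul; have n0 : n.+1%:R != 0 :> R by rewrite pnatr_eq0.
by field.
Qed.

Let D_span n f t : span setT V (D n f t).
Proof.
have sV g r : span setT V (Y g r) by exact: (@span_gen _ _ _ setT V (g, r)).
have lV := span_linear setT V.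
have sS m : span setT V (S n f m).
  apply: linear_set_sum => // j.
  have := linear_setD lV (sV f (u n j.+1)) (linear_setZ lV (- expR (- (k * del n))) (sV f (u n j))).
  by congr (span _ _ _); apply/funext => w; rewrite mulNr.
have := linear_setD lV (sS (N n t)) (linear_setZ lV (- 1) (sS (N n 0))).
by congr (span _ _ _); apply/funext => w; rewrite mulN1r.
Qed.

Let cvg_cos_D m (f : 'I_m -> E) (t : 'I_m -> R) (a : 'I_m -> R) c :
  (forall i, - T%:R <= t i) ->
  mean P (fun w => cos (c + \sum_i a i * D n (f i) (t i) w)) @[n --> \oo] -->
  cos c * expR (- ((\sum_i \sum_j a i * a j * two_sided_cov q (f i) (f j) (t i) (t j)) / 2)).
Proof.
move=> tT.
have e n : mean P (fun w => cos (c + \sum_i a i * D n (f i) (t i) w)) =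
    cos c * expR (- ((\sum_i \sum_j a i * a j *
      mean P (fun w => D n (f i) (t i) w * D n (f j) (t j) w)) / 2)).
  have hl : span setT V (fun w => \sum_i a i * D n (f i) (t i) w).
    by apply: (@linear_set_sum _ _ _ _ _ a (fun i => D n (f i) (t i))) => //; exact: span_linear.
  have [_ ->] := centered_gaussian_char (span_gaussian gp hl).
  suff -> : mean P (fun w => (\sum_i a i * D n (f i) (t i) w) ^+ 2) =
    \sum_i \sum_j a i * a j * mean P (fun w => D n (f i) (t i) w * D n (f j) (t j) w) by [].
  have L i j : L1 P (fun w => a i * a j * (D n (f i) (t i) w * D n (f j) (t j) w)).
    by apply: L1Z; exact: sqintM.
  rewrite (@eq_mean _ _ _ _ _ (fun w => \sum_i \sum_j a i * a j *
      (D n (f i) (t i) w * D n (f j) (t j) w))); last first.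
    move=> w; rewrite expr2 mulr_suml; apply: eq_bigr => i _; rewrite mulr_sumr.
    by apply: eq_bigr => j _; ring.
  rewrite mean_sum => [|i]; last by apply: L1_sum => j; exact: L.
  apply: eq_bigr => i _; rewrite mean_sum => [|j]; last exact: L.
  by apply: eq_bigr => j _; rewrite meanZ//; exact: sqintM.
under eq_fun do rewrite e.
apply: cvgM; first exact: cvg_cst.
apply: continuous_cvg; first exact: continuous_expR.
apply: cvgN; apply: cvgM; last exact: cvg_cst.
apply: cvg_sumn => i; apply: cvg_sumn => j.
by apply: cvgM; [exact: cvg_cst|exact: cvg_D_mul].
Qed.

(** The ratio of the telescoping coefficient [exp (k del) - 1] to the Riemann weight [k del]. *)
Let rho n : R := (expR (k * del n) - 1) / (k * del n).

(** [M] contains [G f] instead of [- k] times [f], so it converges to the innovation on every path,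
    while [D] has computable covariances. They agree almost surely because only finitely many mesh
    times, hence finitely many exceptional sets, are involved. *)
Let M n f t := fun w => Y f (u n (N n t)) w - Y f 0 w - rho n *
  (\sum_(j < N n t) del n * Y (G f) (u n j.+1) w
   - \sum_(j < N n 0) del n * Y (G f) (u n j.+1) w).

Let mM n f t : measurable_fun setT (M n f t).
Proof.
apply: measurable_funB; first exact: measurable_funB.
apply: measurable_funM => //; apply: measurable_funB;
  by apply: measurable_sum => j; exact: measurable_funM.
Qed.

Let cvg_rho : rho n @[n --> \oo] --> (1 : R).
Proof.
have h := cvg_dnbhs_at_right (@expR_taylor1 R (- k)).
have {h} : (del n)^-1 * (expR (- (- k * del n)) - 1) @[n --> \oo] --> - - k.
  move/cvg_at_rightP : h => /(_ del); apply; split.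
    by move=> n; rewrite invr_gt0.
  exact: cvg_harmonic.
rewrite opprK => h.
have := cvgM h (cvg_cst k^-1); rewrite divff ?gt_eqF// => h'.
apply: cvg_trans (h' _ _); apply: near_eq_cvg; near=> n => /=.
have d0 : del n != 0 by rewrite gt_eqF ?invr_gt0.
by rewrite /rho mulNr opprK; move: (expR _) => x; field; rewrite d0 gt_eqF.
Unshelve. all: by end_near. Qed.

Let cvg_M f t w : `|t| <= T%:R -> M n f t w @[n --> \oo] --> innovation Y G f t w.
Proof.
move=> tT; have := tT; rewrite ler_norml => /andP[t1 t2].
have h1 : Y f (u n (N n t)) w @[n --> \oo] --> Y f t w.
  exact: (cvg_comp _ _ (cvg_grid t1) (@cY f w t)).
have h2 := cvg_riemann_sum (@cY (G f) w) tT.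
have := cvgB (cvgB h1 (cvg_cst (Y f 0 w))) (cvgM cvg_rho h2).
rewrite mul1r; exact.
Qed.

Let S_tele n f m w : S n f m w = Y f (u n m) w - Y f (u n 0) w +
  (expR (k * del n) - 1) * \sum_(j < m) Y f (u n j.+1) w.
Proof.
rewrite /S; elim: m => [|m ih]; first by rewrite !big_ord0 subrr mulr0 addr0.
rewrite !big_ord_recr/= ih /xi.
have e : expR (k * del n) * expR (- (k * del n)) = 1 by rewrite expRxMexpNx_1.
by rewrite mulrBr mulrA e; ring.
Qed.

Let ae_Y f (s : seq R) : {ae P, forall w, forall r, r \in s -> Y (G f) r w = - k * Y f r w}.
Proof.
elim: s => [|r s ih]; first exact: aeW.
have := lin (- k) f 0 r; have := lin (-1) 0 0 r; move: ih.
apply: filterS3 => w ih; rewrite scaler0 addr0 addr0 => h0 h r'.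
rewrite inE => /predU1P[->|/ih//].
have e : Y 0 r w = 0 by lra.
by rewrite hG h e addr0.
Qed.

Let M_ae n f t : {ae P, forall w, M n f t w = D n f t w}.
Proof.
have := ae_Y f [seq u n j.+1 | j <- iota 0 (maxn (N n t) (N n 0))].
apply: filterS => w h.
have sum m : (m <= maxn (N n t) (N n 0))%N ->
    \sum_(j < m) del n * Y (G f) (u n j.+1) w = - (k * del n) * \sum_(j < m) Y f (u n j.+1) w.
  move=> mN; rewrite mulr_sumr; apply: eq_bigr => j _; rewrite h; first by ring.
  by apply/mapP; exists (nat_of_ord j) => //; rewrite mem_iota/= add0n (leq_trans (ltn_ord j)).
rewrite /M /D !S_tele !sum ?leq_maxl ?leq_maxr//.
have -> : u n (N n 0) = 0.
  by rewrite /u /N grid_index0 /grid natrM mulfK ?subrr// pnatr_eq0.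
have kd : k * del n != 0 by rewrite mulf_neq0 ?gt_eqF// invr_gt0.
rewrite /rho; move: kd; set x := k * del n => kd.
by field.
Qed.

(** The same sequence of means has two limits: through [M] by continuity of the paths, and through
    [D] by convergence of covariances. *)
Lemma mean_cos_innovation m (f : 'I_m -> E) (t : 'I_m -> R) (a : 'I_m -> R) c :
  (forall i, `|t i| <= T%:R) ->
  mean P (fun w => cos (c + \sum_i a i * innovation Y G (f i) (t i) w)) =
  cos c * expR (- ((\sum_i \sum_j a i * a j * two_sided_cov q (f i) (f j) (t i) (t j)) / 2)).
Proof.
move=> tT.
have tT' i : - T%:R <= t i by have := tT i; rewrite ler_norml => /andP[].
have mS n : measurable_fun setT (fun w => \sum_i a i * M n (f i) (t i) w).
  by apply: measurable_sum => i; exact: measurable_funM.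
have h1 : mean P (fun w => cos (c + \sum_i a i * M n (f i) (t i) w)) @[n --> \oo] -->
    mean P (fun w => cos (c + \sum_i a i * innovation Y G (f i) (t i) w)).
  apply: cvg_mean_cos => [n|w]; first exact: measurable_funD.
  apply: cvgD; first exact: cvg_cst.
  by apply: cvg_sumn => i; apply: cvgM; [exact: cvg_cst|exact: cvg_M].
apply: (cvg_unique _ h1) => //.
apply: (cvg_eqn (@cvg_cos_D _ f t a c tT')) => n.
have mD g s : measurable_fun setT (D n g s) by have [] := D_sqint n g s.
apply: ae_mean.
- by apply: measurable_cos; exact: measurable_funD.
- apply: measurable_cos; apply: measurable_funD => //.
  by apply: measurable_sum => i; exact: measurable_funM.
have : {ae P, forall w, forall i, M n (f i) (t i) w = D n (f i) (t i) w}.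
  by apply: filter_forall => i; exact: M_ae.
by apply: filterS => w h; congr (cos (_ + _)); apply: eq_bigr => i _; rewrite h.
Qed.

Lemma measurable_innovation f (t : R) : `|t| <= T%:R ->
  measurable_fun setT (innovation Y G f t).
Proof.
move=> tT; apply: (measurable_fun_cvg (fun n => mM n f t)) => w _; exact: cvg_M.
Qed.

End innovation.

(** * Deterministic component and Lamperti transform *)

Section deterministic.
Context (d : measure_display) (W : measurableType d) (R : realType)
  (P : probability W R) (E : lmodType R) (Y : E -> R -> W -> R)
  (q : E -> E -> R) (k : R).
Hypothesis k0 : 0 < k.
Hypothesis gp : gaussian_process P Y.
Hypothesis cov : forall f g s t, mean P (fun w => Y f s w * Y g t w) =
  expR (- (k * `|t - s|)) / (2 * k) * q f g.

Let Ysq f t : sqint P (Y f t) := gaussian_sqint gp f t.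
Let mY f t : measurable_fun setT (Y f t). Proof. by have [] := Ysq f t. Qed.

(** A tail event belongs to the past of [t - n] for every [n]; conditioning there leaves
    [exp (- k n)] times a quantity bounded by the constant norm of [Y f]. *)
Lemma ou_deterministic_component : deterministic_component P Y (fun _ _ _ => 0).
Proof.
move=> f t; split.
- exact: sqint_L1.
- exact: L1_cst.
- move=> B mB s _ /=.
  have [sg0 sgC _] : sigma_algebra setT (field_past Y s) by exact: smallest_sigma_algebra.
  have [B0|B0] := pselect (B 0).
    rewrite (_ : _ @^-1` _ = setT `\` set0); first exact: sgC.
    by apply/seteqP; split => // w _; split.
  by rewrite (_ : _ @^-1` _ = set0)//; apply/seteqP; split.
move=> A tailA; rewrite !mean_indic_mul.
have mA : measurable A.
  apply: (@generated_measurable _ _ R _ _ (fun x : E * R => Y x.1 x.2)) (tailA 0 I) => x _.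
  exact: mY.
rewrite (@eq_mean _ _ _ _ (fun w => 0 * _) (fun=> 0)) ?mean_cst//; last first.
  by move=> w; rewrite mul0r.
have iA g s : L1 P (fun w => Y g s w * \1_A w).
  by apply: (@L1_mul_bounded _ _ _ _ 1); [exact: sqint_L1|exact: measurable_indic|exact: norm_indic_le1].
have bound n : `|mean P (fun w => Y f t w * \1_A w)| <=
    expR (- k) ^+ n * nrm P (Y f 0).
  pose s := t - n%:R.
  pose l w := Y f t w - expR (- (k * (t - s))) * Y f s w.
  have hl : span [set x | s <= x.2]
      (fun x w => Y x.1 x.2 w - expR (- (k * (x.2 - s))) * Y x.1 s w) l.
    by apply: (@span_gen _ _ _ [set x : E * R | s <= x.2] _ (f, t)); rewrite /= /s gerBl.
  have h := ou_inc_past_mean gp cov hl (tailA s I).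
  rewrite (_ : mean P (fun w => Y f t w * \1_A w) =
      expR (- k) ^+ n * mean P (fun w => Y f s w * \1_A w)).
    rewrite normrM normrX (ger0_norm (expR_ge0 _)) ler_wpM2l ?exprn_ge0 ?expR_ge0//.
    rewrite (le_trans (norm_mean_mul_nrm (Ysq f s) _))//.
      by apply: (@sqint_bounded _ _ _ _ 1) => [|w]; [exact: measurable_indic|exact: norm_indic_le1].
    rewrite (nrm_process cov) -(nrm_process cov f 0) ler_piMr ?nrm_ge0//.
    apply: nrm_le_bound => // [|w]; last exact: norm_indic_le1.
    by apply: (@sqint_bounded _ _ _ _ 1) => [|w]; [exact: measurable_indic|exact: norm_indic_le1].
  apply/eqP; rewrite -subr_eq0 -meanZ// -meanB//; last exact: L1Z.
  apply/eqP; rewrite -[RHS]h; apply: eq_mean => w; rewrite /l mulrBl -expRM_natl.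
  by rewrite mulrA; congr (_ - expR _ * _ * _); rewrite /s; ring.
apply/esym/eqP; rewrite -normr_le0.
apply: (@cvg_ge_cst _ (fun n => expR (- k) ^+ n * nrm P (Y f 0))) => //.
rewrite -[X in _ --> X](mul0r (nrm P (Y f 0))).
apply: cvg_muln; last exact: cvg_cstn.
apply: cvg_expr; rewrite ger0_norm ?expR_ge0//.
by rewrite -[ltRHS]expR0 ltr_expR oppr_lt0.
Qed.

End deterministic.

Section lamperti.
Context (d : measure_display) (W : measurableType d) (R : realType)
  (P : probability W R) (E : lmodType R) (B : E -> R -> W -> R)
  (q : E -> E -> R) (c : R).
Hypothesis c0 : c != 0.
Hypothesis bfB : brownian_field P q B.

Let k := `|c|.
Let k0 : 0 < k. Proof. by rewrite normr_gt0. Qed.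
Let Z := lamperti c B.

Let Bsq f t : sqint P (B f t) := gaussian_sqint (bf_gaussian bfB) f t.

Lemma brownian_mean f g s t : mean P (fun w => B f s w * B g t w) = two_sided_cov q f g s t.
Proof.
apply: EFin_inj; rewrite -(bf_cov bfB) expectation_mean//; exact: sqintM.
Qed.

Lemma lamperti_gaussian : gaussian_process P Z.
Proof.
move=> n a f t.
have := bf_gaussian bfB (fun i => a i * (expR (- `|c| * t i) / Num.sqrt (2 * `|c|)))
  f (fun i => expR (2 * `|c| * t i)).
by congr centered_gaussian; apply/funext => w; apply: eq_bigr => i _; rewrite -mulrA.
Qed.

Lemma lamperti_linear : linear_process P Z.
Proof.
move=> a f g t; have := bf_linear bfB a f g (expR (2 * `|c| * t)).
by apply: filterS => w; rewrite /Z /lamperti => ->; ring.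
Qed.

Lemma lamperti_continuous f w : continuous (fun t => Z f t w).
Proof.
move=> t; have lin (a : R) : a * s @[s --> t] --> a * t.
  by apply: cvgM; [exact: cvg_cst|exact: cvg_id].
apply: cvgM.
  apply: cvgM; last exact: cvg_cst.
  exact: (cvg_comp _ _ (lin _) (@continuous_expR R _)).
have h : expR (2 * `|c| * s) @[s --> t] --> expR (2 * `|c| * t).
  exact: (cvg_comp _ _ (lin _) (@continuous_expR R _)).
exact: (cvg_comp _ _ h (@bf_continuous _ _ _ _ _ _ _ bfB f w _)).
Qed.

Lemma lamperti_cov f g s t : mean P (fun w => Z f s w * Z g t w) =
  expR (- (k * `|t - s|)) / (2 * k) * q f g.
Proof.
pose r := Num.sqrt (2 * k).
have r0 : r != 0 by rewrite sqrtr_eq0 -ltNge mulr_gt0.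
have r2 : r * r = 2 * k by rewrite -expr2 sqr_sqrtr// mulr_ge0// ltW.
rewrite (@eq_mean _ _ _ _ _ (fun w => (expR (- k * s) * expR (- k * t) / (r * r)) *
   (B f (expR (2 * k * s)) w * B g (expR (2 * k * t)) w))); last first.
  by move=> w; rewrite /Z /lamperti -/k -/r; field.
rewrite meanZ; last exact: sqintM.
rewrite brownian_mean /two_sided_cov mulr_gt0 ?expR_gt0// !(ger0_norm (expR_ge0 _)).
rewrite -expRD r2.
rewrite mulrA; congr (_ * _); rewrite mulrAC; congr (_ / _).
have [st|ts] := leP s t.
  rewrite min_l ?ler_expR ?ler_pM2l ?mulr_gt0// -expRD ger0_norm ?subr_ge0//.
  by congr expR; ring.
rewrite min_r ?ler_expR ?ler_pM2l ?mulr_gt0// ?(ltW ts)// -expRD ltr0_norm ?subr_lt0//.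
by congr expR; ring.
Qed.

End lamperti.

Lemma eq_fdd_innovation (d d' : measure_display) (W : measurableType d)
  (W' : measurableType d') (R : realType) (P : probability W R) (P' : probability W' R)
  (E : lmodType R) (Y : E -> R -> W -> R) (B : E -> R -> W' -> R)
  (q : E -> E -> R) (k : R) (G : E -> E) : 0 < k ->
  gaussian_process P Y -> linear_process P Y ->
  (forall f g s t, mean P (fun w => Y f s w * Y g t w) =
    expR (- (k * `|t - s|)) / (2 * k) * q f g) ->
  (forall f w, continuous (fun t => Y f t w)) -> (forall f, G f = - k *: f) ->
  brownian_field P' q B -> eq_fdd P P' (innovation Y G) B.
Proof.
move=> k0 gp lin cov cY hG bfB; apply: eq_fdd_cos.
- move=> f t; apply: (@measurable_innovation _ _ _ _ _ _ _ G k0 gp cY (Num.truncn `|t|).+1).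
  exact/ltW/truncnS_gt.
- by move=> f t; have [] := gaussian_sqint (bf_gaussian bfB) f t.
move=> n f t a c.
rewrite (gaussian_cos_sum (bf_gaussian bfB)).
(* The window [[- T, T]] is taken large enough for all the times [t i] at once. *)
rewrite (@mean_cos_innovation _ _ _ _ _ Y q k G k0 gp lin cov cY hG (\max_i (Num.truncn `|t i|).+1)%N).
  suff -> : \sum_i \sum_j a i * a j * mean P' (fun w => B (f i) (t i) w * B (f j) (t j) w) =
     \sum_i \sum_j a i * a j * two_sided_cov q (f i) (f j) (t i) (t j) by [].
  by apply: eq_bigr => i _; apply: eq_bigr => j _; rewrite (brownian_mean bfB).
move=> i; rewrite (le_trans (ltW (truncnS_gt _)))// ler_nat.
exact: (leq_bigmax i).
Qed.

(** * Occupation integrals of a Markov process *)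

Section integral_mixture.
Context (d dS dS' : measure_display) (W : measurableType d) (S : measurableType dS)
  (S' : measurableType dS') (R : realType) (mu : {measure set W -> \bar R}) (A : set W)
  (Z : W -> S) (Y : W -> S') (k : S' -> {measure set S -> \bar R}).
Hypotheses (mA : measurable A) (mZ : measurable_fun setT Z) (mY : measurable_fun setT Y).
Hypothesis mk : forall B, measurable B -> measurable_fun setT (k ^~ B).
Hypothesis hk : forall B, measurable B ->
  (\int[mu]_(w in A) (\1_B (Z w))%:E = \int[mu]_(w in A) k (Y w) B)%E.
Local Open Scope ereal_scope.

Import HBNNSimple.

Let mkY B : measurable B -> measurable_fun A (fun w => k (Y w) B).
Proof. by move=> mB; apply: measurable_funTS; exact: measurableT_comp (mk mB) mY. Qed.

Let integral_mixture_nnsfun (f : {nnsfun S >-> R}) :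
  \int[mu]_(w in A) (f (Z w))%:E = \int[mu]_(w in A) \int[k (Y w)]_z (f z)%:E.
Proof.
under [in LHS]eq_integral do rewrite fimfunE -fsumEFin//.
rewrite ge0_integral_fsum//; last 2 first.
  - move=> r; apply/measurable_EFinP; apply: measurable_funTS.
    by apply: measurable_funM => //; exact: measurableT_comp.
  - by move=> r z _; rewrite EFinM nnfun_muleindic_ge0.
under [in RHS]eq_integral.
  move=> y _.
  under eq_integral.
    by move=> z _; rewrite fimfunE -fsumEFin//; over.
  rewrite /= ge0_integral_fsum//; last 2 first.
    - by move=> r; exact/measurable_EFinP/measurableT_comp.
    - by move=> r z _; rewrite EFinM nnfun_muleindic_ge0.
  under eq_fsbigr.
    move=> r _.
    rewrite (integralZl_indic _ (fun r => f @^-1` [set r]))//; last first.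
      by move=> r0; rewrite preimage_nnfun0.
    rewrite integral_indic// setIT.
    over.
  over.
rewrite /= ge0_integral_fsum//; last 2 first.
  - by move=> r; apply: measurable_funeM; exact: mkY.
  - move=> n y _.
    have := mulemu_ge0 (fun n => f @^-1` [set n]).
    by apply; exact: preimage_nnfun0.
apply: eq_fsbigr => r _.
have [r0|r0] := leP 0%R r.
  rewrite ge0_integralZl//; last exact: mkY.
  rewrite -hk// -ge0_integralZl//.
  apply/measurable_EFinP; apply: measurable_funTS.
  by apply: measurableT_comp => //; exact: measurable_indic.
rewrite !integral0_eq// => y _; first by rewrite preimage_nnfun0// measure0 mule0.
by rewrite preimage_nnfun0// indic0 mulr0.
Qed.

(** The passage of the Markov property from indicators to nonnegative functions, through simple
    functions and monotone convergence on both sides. *)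
Lemma integral_mixture (f : S -> \bar R) : (forall z, 0 <= f z) ->
  measurable_fun setT f ->
  \int[mu]_(w in A) f (Z w) = \int[mu]_(w in A) \int[k (Y w)]_z f z.
Proof.
move=> f0 mf.
pose f_ := nnsfun_approx measurableT mf.
transitivity (\int[mu]_(w in A) (lim ((f_ n (Z w))%:E @[n --> \oo]))).
  by apply/eq_integral => w _; apply/esym/cvg_lim => //=; exact: cvg_nnsfun_approx.
rewrite monotone_convergence//; last 3 first.
  - by move=> n; apply/measurable_EFinP; apply: measurable_funTS; exact: measurableT_comp.
  - by move=> n z _; rewrite lee_fin.
  - by move=> z _ a b ab; rewrite lee_fin; exact/lefP/nd_nnsfun_approx.
rewrite (_ : (fun _ => _) =
    (fun n => \int[mu]_(w in A) (\int[k (Y w)]_z (f_ n z)%:E)))//; last first.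
  by apply/funext => n; rewrite integral_mixture_nnsfun.
transitivity (\int[mu]_(w in A) lim ((\int[k (Y w)]_z (f_ n z)%:E) @[n --> \oo])).
  rewrite -monotone_convergence//; last 3 first.
  - move=> n; apply: measurable_funTS.
    apply: (@measurableT_comp _ _ _ _ _ _ (fun y => \int[k y]_z (f_ n z)%:E)) => //.
    apply: measurable_fun_integral_kernel => //.
    + by move=> z; rewrite lee_fin.
    + exact/measurable_EFinP.
  - by move=> n y _; apply: integral_ge0 => // z _; rewrite lee_fin.
  - move=> y _ a b ab; apply: ge0_le_integral => //.
    + by move=> z _; rewrite lee_fin.
    + exact/measurable_EFinP.
    + exact/measurable_EFinP.
    + by move=> z _; rewrite lee_fin; exact/lefP/nd_nnsfun_approx.
apply: eq_integral => y _; rewrite -monotone_convergence//; last 3 first.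
  - by move=> n; exact/measurable_EFinP.
  - by move=> n z _; rewrite lee_fin.
  - by move=> z _ a b ab; rewrite lee_fin; exact/lefP/nd_nnsfun_approx.
by apply: eq_integral => z _; apply/cvg_lim => //; exact: cvg_nnsfun_approx.
Qed.

End integral_mixture.

Section progressive.
Context (d dS : measure_display) (W : measurableType d) (S : measurableType dS)
  (R : realType) (F : R -> set (set W)) (X : R -> W -> S).
Hypothesis filF : forall t, 0 <= t -> sigma_algebra setT (F t).
Hypothesis proX : progressively_measurable F X.

(** Freezing the path outside [[a, b]] makes it a total jointly measurable map for [F b], which is
    the form needed to apply Fubini's theorem to a progressively measurable process. *)
Definition clamp (a b v : R) : R := Num.max a (Num.min v b).

Lemma clamp_itv a b v : a <= b -> a <= clamp a b v <= b.
Proof. by move=> ab; rewrite /clamp le_max lexx/= ge_max ab ge_min lexx orbT. Qed.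

Lemma clamp_id a b v : a <= v <= b -> clamp a b v = v.
Proof. by move=> /andP[av vb]; rewrite /clamp min_l// max_r. Qed.

Lemma measurable_clamp a b : measurable_fun setT (clamp a b).
Proof. by apply: measurable_maxr => //; exact: measurable_minr. Qed.

Lemma progressive_joint (a b : R) : 0 <= a -> a <= b ->
  measurable_fun setT (fun vw : R * g_sigma_algebraType (F b) => X (clamp a b vw.1) vw.2).
Proof.
move=> a0 ab _ B mB; rewrite setTI.
have b0 := le_trans a0 ab.
set C := (C in measurable C).
have : <<s [set Q | exists I : set R, exists A : set W,
           [/\ measurable I, F b A & Q = I `*` A]] >>
     `<=` [set Q | measurable ((fun vw : R * g_sigma_algebraType (F b) =>
        (clamp a b vw.1, vw.2)) @^-1` Q)].
  apply: smallest_sub.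
    split.
    - by rewrite /= preimage_set0.
    - by move=> Q /= mQ; rewrite setTD preimage_setC; exact: measurableC.
    - by move=> Q mQ /=; rewrite preimage_bigcup; apply: bigcup_measurable => n _; exact: mQ.
  move=> _ [I [A [mI FA ->]]] /=.
  rewrite (_ : _ @^-1` _ = (clamp a b @^-1` I) `*` (A : set (g_sigma_algebraType (F b)))).
    apply: measurableX.
      by rewrite -[X in measurable X]setTI; exact: measurable_clamp.
    by rewrite /measurable/= sigma_algebra_id//; exact: filF.
  by apply/seteqP; split => -[v w].
move=> /(_ _ (proX b0 mB)) /=; congr (measurable _).
apply/seteqP; split => -[v w] /=; first by case.
move=> h; split => //; have /andP[h1 h2] := clamp_itv v ab.
by rewrite h2 (le_trans a0 h1).
Qed.

Lemma progressive_adapted t B : 0 <= t -> measurable B -> F t (X t @^-1` B).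
Proof.
move=> t0 mB.
pose ft (w : g_sigma_algebraType (F t)) := X (clamp t t t) w.
have h : measurable_fun setT ft.
  have := measurableT_comp (progressive_joint t0 (lexx t)) (pair1_measurable t); exact.
have := h measurableT B mB; rewrite setTI /measurable/= sigma_algebra_id; last exact: filF.
by rewrite /ft clamp_id ?lexx.
Qed.

End progressive.

(** * Stationarity and the Markov property for square-integrable functions *)

Section markov_process.
Context (d dS : measure_display) (W : measurableType d) (S : measurableType dS)
  (R : realType) (P : probability W R) (pi : probability S R)
  (K : R -> R.-pker S ~> S) (F : R -> set (set W)) (X : R -> W -> S).
Hypothesis emp : ergodic_markov_process P pi K F X.
Implicit Types (h : S -> R) (s t : R).

Let sF t : 0 <= t -> sigma_algebra setT (F t).
Proof. by have [h _ _] := emp_filtration emp; exact: h. Qed.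

Let FW t : 0 <= t -> F t `<=` measurable.
Proof. by have [_ h _] := emp_filtration emp; exact: h. Qed.

Lemma process_adapted t B : 0 <= t -> measurable B -> F t (X t @^-1` B).
Proof. by move=> t0 mB; exact: (progressive_adapted sF (emp_progressive emp) t0 mB). Qed.

Lemma process_measurable t : 0 <= t -> measurable_fun setT (X t).
Proof. by move=> t0 _ B mB; rewrite setTI; apply: (FW t0); exact: process_adapted. Qed.

Lemma adapted_process t h : 0 <= t -> measurable_fun setT h -> adapted (F t) (fun w => h (X t w)).
Proof.
move=> t0 mh B mB; rewrite (_ : _ @^-1` _ = X t @^-1` (h @^-1` B))//.
by apply: process_adapted => //; rewrite -[X in measurable X]setTI; exact: mh.
Qed.

Let mK t B : measurable B -> measurable_fun setT (fun x => K t x B).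
Proof. exact: measurable_kernel. Qed.

Let K_fin t x B : measurable B -> K t x B \is a fin_num.
Proof.
move=> mB; rewrite ge0_fin_numE ?measure_ge0//.
rewrite (@le_lt_trans _ _ (K t x setT))//; first by apply: le_measure; rewrite ?inE.
by rewrite prob_kernel ltry.
Qed.

Lemma mean_indic_preimage (Y : W -> S) B : measurable_fun setT Y -> measurable B ->
  (\int[P]_w (\1_B (Y w))%:E = P (Y @^-1` B))%E.
Proof.
move=> mY mB; rewrite (_ : (fun w => _) = (fun w => (\1_(Y @^-1` B) w)%:E))//.
rewrite integral_indic ?setIT//.
by rewrite -[X in measurable X]setTI; exact: mY.
Qed.

Lemma markov_indic s t B A : 0 <= s -> 0 <= t -> measurable B -> F s A ->
  (\int[P]_(w in A) (\1_B (X (s + t) w))%:E = \int[P]_(w in A) K t (X s w) B)%E.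
Proof.
move=> s0 t0 mB FA; have [iU iV _ h] := emp_markov emp s0 t0 mB.
have mA := FW s0 FA.
have iA U : P.-integrable setT U -> P.-integrable A U by apply: integrableS.
have := congr1 EFin (h A FA); rewrite /Rintegral.
have f1 := integrable_fin_num mA (iA _ iV); have f2 := integrable_fin_num mA (iA _ iU).
rewrite (fineK f1) (fineK f2).
move=> e; rewrite -[LHS]e; apply: eq_integral => w _ /=.
by rewrite fineK// K_fin.
Qed.

Lemma markov_integral s t A (f : S -> \bar R) : 0 <= s -> 0 <= t -> F s A ->
  (forall z, 0 <= f z)%E -> measurable_fun setT f ->
  (\int[P]_(w in A) f (X (s + t) w) = \int[P]_(w in A) \int[K t (X s w)]_z f z)%E.
Proof.
move=> s0 t0 FA f0 mf; apply: (@integral_mixture _ _ _ W S S R P A (X (s + t)) (X s)) => //.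
- exact: FW FA.
- by apply: process_measurable; exact: addr_ge0.
- exact: process_measurable.
- by move=> B mB; exact: mK.
- by move=> B mB; exact: markov_indic.
Qed.

Lemma process_law t B : 0 <= t -> measurable B -> P (X t @^-1` B) = pi B.
Proof.
move=> t0 mB.
have FT : F 0 setT by have [h0 hC _] := sF (lexx 0); rewrite -(setD0 setT); exact: hC.
have := markov_indic (lexx 0) t0 mB FT; rewrite add0r mean_indic_preimage//; last first.
  exact: process_measurable.
move=> ->; rewrite -(emp_invariant emp t0 mB).
have mX0 := process_measurable (lexx 0).
have g0 : {in setT, forall y, 0 <= K t y B}%E by move=> y _; exact: measure_ge0.
have := @ge0_integral_pushforward _ _ _ _ R _ mX0 P setT (fun x => K t x B) measurableT (mK t mB) g0.
rewrite preimage_setT => <-.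
pose Xp : {mfun W >-> S} := HB.pack (X 0) (isMeasurableFun.Build _ _ _ _ (X 0) mX0).
have : (\int[pushforward P Xp]_x K t x B = \int[pi]_x K t x B)%E.
  by apply: eq_measure_integral => A mA _; exact: (emp_initial emp mA).
exact.
Qed.

Let lawX t : 0 <= t -> forall A, measurable A -> pi (id @^-1` A) = P (X t @^-1` A).
Proof. by move=> t0 A mA; rewrite process_law. Qed.

Lemma process_L1 t h : 0 <= t -> L1 pi h -> L1 P (fun w => h (X t w)).
Proof.
move=> t0 ih; have mh := L1_measurable ih.
exact: (@same_law_L1 _ _ _ S W S R pi P id (X t) h (@measurable_id _ _ _) (process_measurable t0) (lawX t0) mh ih).
Qed.

Lemma process_mean t h : 0 <= t -> L1 pi h -> mean P (fun w => h (X t w)) = mean pi h.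
Proof.
move=> t0 ih; have mh := L1_measurable ih.
exact/esym/(@same_law_mean _ _ _ S W S R pi P id (X t) h (@measurable_id _ _ _) (process_measurable t0) (lawX t0) mh ih).
Qed.

Lemma process_sqint t h : 0 <= t -> sqint pi h -> sqint P (fun w => h (X t w)).
Proof.
move=> t0 [mh ih]; split; last exact: (process_L1 t0 ih).
by apply: measurableT_comp => //; exact: process_measurable.
Qed.

Lemma process_nrm t h : 0 <= t -> sqint pi h -> nrm P (fun w => h (X t w)) = nrm pi h.
Proof. by move=> t0 [_ ih]; rewrite /nrm (process_mean t0 ih). Qed.

Let integral_pos_neg (m : {measure set S -> \bar R}) h :
  (\int[m]_y (h y)%:E = \int[m]_y ((fun y => (Num.max (h y) 0)%:E) y) -
    \int[m]_y ((fun y => (Num.max (- h y) 0)%:E) y))%E.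
Proof.
rewrite integralE; congr (_ - _)%E; apply: eq_integral => y _.
  by rewrite funeposE /= EFin_max.
by rewrite funenegE /= EFin_max.
Qed.

Lemma measurable_transition_op t h : measurable_fun setT h ->
  measurable_fun setT (transition_op K t h).
Proof.
move=> mh; rewrite /transition_op /Rintegral.
have h1 (g : S -> R) : measurable_fun setT g -> (forall y, 0 <= g y) ->
    measurable_fun setT (fun x => \int[K t x]_y (g y)%:E)%E.
  move=> mg g0; apply: measurable_fun_integral_kernel => //.
  - by move=> U mU; exact: mK.
  - exact/measurable_EFinP.
apply: measurableT_comp => //.
under eq_fun do rewrite integral_pos_neg.
apply: emeasurable_funB; apply: h1.
- exact: measurable_maxr.
- by move=> y; rewrite le_max lexx orbT.
- by apply: measurable_maxr => //; exact: measurable_funN.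
- by move=> y; rewrite le_max lexx orbT.
Qed.

Lemma markov_cexp s t h : 0 <= s -> 0 <= t -> L1 pi h ->
  is_cexp P (F s) (fun w => h (X (s + t) w)) (fun w => transition_op K t h (X s w)).
Proof.
move=> s0 t0 ih; have mh := L1_measurable ih.
have st0 := addr_ge0 s0 t0.
pose hp y := Num.max (h y) 0; pose hn y := Num.max (- h y) 0.
have mhp : measurable_fun setT hp by exact: measurable_maxr.
have mhn : measurable_fun setT hn by apply: measurable_maxr => //; exact: measurable_funN.
have ihp : L1 pi hp.
  apply: (L1_le mhp (L1_norm ih)) => y; rewrite /hp; case: (leP (h y) 0) => h0.
    by rewrite normr0.
  by rewrite lexx.
have ihn : L1 pi hn.
  apply: (L1_le mhn (L1_norm ih)) => y; rewrite /hn; case: (leP (- h y) 0) => h0.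
    by rewrite normr0.
  by rewrite normrN.
have hp0 y : 0 <= hp y by rewrite /hp le_max lexx orbT.
have hn0 y : 0 <= hn y by rewrite /hn le_max lexx orbT.
pose Kp w := (\int[K t (X s w)]_y (hp y)%:E)%E.
pose Kn w := (\int[K t (X s w)]_y (hn y)%:E)%E.
have FT : F s setT by have [h0 hC _] := sF s0; rewrite -(setD0 setT); exact: hC.
have eA g A : L1 pi g -> (forall y, 0 <= g y) -> F s A ->
    (\int[P]_(w in A) (g (X (s + t) w))%:E = \int[P]_(w in A) \int[K t (X s w)]_y (g y)%:E)%E.
  move=> ig g0 FA; have mg := L1_measurable ig.
  by apply: (@markov_integral s t A (EFin \o g)) => //; exact/measurable_EFinP.
have iK g : L1 pi g -> (forall y, 0 <= g y) ->
    P.-integrable setT (fun w => \int[K t (X s w)]_y (g y)%:E)%E.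
  move=> ig g0; apply/integrableP; split.
    apply: (@measurableT_comp _ _ _ _ _ _ (fun x => \int[K t x]_y (g y)%:E)%E); last first.
      exact: process_measurable.
    apply: measurable_fun_integral_kernel => //.
    - by move=> U mU; exact: mK.
    - by apply/measurable_EFinP; exact: L1_measurable ig.
  under eq_integral => w _.
    rewrite gee0_abs; last by apply: integral_ge0 => y _; rewrite lee_fin.
    over.
  rewrite -eA//; have /integrableP[_] := process_L1 st0 ig.
  by congr (_ < _)%E; apply: eq_integral => w _; rewrite /= ger0_norm.
have iKp := iK hp ihp hp0; have iKn := iK hn ihn hn0.
have mT : measurable_fun setT (fun w => transition_op K t h (X s w)).
  by apply: measurableT_comp (process_measurable s0); exact: measurable_transition_op.
(* [transition_op] takes the finite part of an integral, so it is the difference of the two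
   integrals where both are finite, which is almost everywhere. *)
have ae : {ae P, forall w, (transition_op K t h (X s w))%:E = (Kp w - Kn w)%E}.
  have := integrable_ae measurableT iKn; have := integrable_ae measurableT iKp.
  apply: filterS2 => w /(_ I) f1 /(_ I) f2.
  by rewrite /transition_op /Rintegral integral_pos_neg fineK// fin_numB f1 f2.
have iKB : P.-integrable setT (fun w => Kp w - Kn w)%E by exact: integrableB.
split.
- exact: process_L1.
- apply/integrableP; split; first exact/measurable_EFinP.
  have /integrableP[_] := iKB; congr (_ < _)%E; apply: ae_eq_integral => //.
  + by apply: measurableT_comp => //; exact: measurable_int iKB.
  + by apply: measurableT_comp => //; exact/measurable_EFinP.
  + by apply: filterS ae => w h1 _; exact/esym/(congr1 abse h1).
- by apply: adapted_process => //; exact: measurable_transition_op.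
move=> A FA; have mA := FW s0 FA.
have iA U : P.-integrable setT U -> P.-integrable A U by apply: integrableS.
congr fine.
transitivity (\int[P]_(w in A) (Kp w - Kn w))%E.
  apply: ae_eq_integral => //.
  - by apply: measurable_funTS; exact/measurable_EFinP.
  - by apply: measurable_funTS; exact: measurable_int iKB.
  - by apply: filterS ae => w /= -> _.
rewrite integralB//; [|exact: iA|exact: iA].
rewrite /Kp /Kn -!eA// -integralB//.
- apply: eq_integral => w _; rewrite -EFinB /hp /hn; congr EFin.
  by rewrite /Num.max oppr_lt0; case: (ltrgt0P (h (X (s + t) w))); lra.
- by apply: iA; exact: process_L1.
- by apply: iA; exact: process_L1.
Qed.

Lemma markov_mean s t h (Phi : W -> R) : 0 <= s -> 0 <= t -> sqint pi h ->
  sqint pi (transition_op K t h) -> sqint P Phi -> adapted (F s) Phi ->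
  mean P (fun w => transition_op K t h (X s w) * Phi w) =
  mean P (fun w => h (X (s + t) w) * Phi w).
Proof.
move=> s0 t0 sh sT sPhi aPhi; have st0 := addr_ge0 s0 t0.
apply: (is_cexp_mean_sqint (sF s0) (FW s0) (markov_cexp s0 t0 _)) => //.
- exact: sqint_L1.
- exact: process_sqint.
- exact: (process_sqint s0).
Qed.

End markov_process.

(** * Averages of a measurable family of random variables *)

Section mixing.
Context (dT d : measure_display) (T : measurableType dT) (W : measurableType d)
  (R : realType) (mu : probability T R) (Y : T -> W -> R).
Hypothesis mY : measurable_fun setT (fun vw : T * W => Y vw.1 vw.2).

(** With [mu] uniform on a window this is the time average of a path. Using a probability in the
    time variable lets the same lemmas on means serve in both variables of Fubini's theorem. *)
Definition mix (w : W) : R := mean mu (fun v => Y v w).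

Let joint_pos_neg w : (\int[mu]_v (Y v w)%:E =
  \int[mu]_v (fun vw : T * W => (Num.max (Y vw.1 vw.2) 0)%:E) (v, w) -
  \int[mu]_v (fun vw : T * W => (Num.max (- Y vw.1 vw.2) 0)%:E) (v, w))%E.
Proof.
rewrite integralE; congr (_ - _)%E; apply: eq_integral => y _.
  by rewrite funeposE /= EFin_max.
by rewrite funenegE /= EFin_max.
Qed.

Lemma measurable_mix : measurable_fun setT mix.
Proof.
rewrite /mix /mean /Rintegral; apply: measurableT_comp => //.
under eq_fun do rewrite joint_pos_neg.
apply: emeasurable_funB.
- apply: (@measurable_fun_fubini_tonelli_G _ _ T W R mu
    (fun vw : T * W => (Num.max (Y vw.1 vw.2) 0)%:E)).
  + by apply/measurable_EFinP; exact: measurable_maxr.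
  + by move=> vw; rewrite lee_fin le_max lexx orbT.
- apply: (@measurable_fun_fubini_tonelli_G _ _ T W R mu
    (fun vw : T * W => (Num.max (- Y vw.1 vw.2) 0)%:E)).
  by apply/measurable_EFinP; apply: measurable_maxr => //; exact: measurable_funN.
  + by move=> vw; rewrite lee_fin le_max lexx orbT.
Qed.

Variables (P : probability W R) (C : R).
Hypothesis sY : forall v, sqint P (Y v).
Hypothesis nY : forall v, nrm P (Y v) <= C.

Hypothesis C0 : 0 <= C.

Let C2 v : mean P (fun w => Y v w ^+ 2) <= C ^+ 2.
Proof. by rewrite -sqr_nrm ler_sqr ?nnegrE ?nrm_ge0. Qed.

Let joint_int (Phi : W -> R) : sqint P Phi ->
  (mu \x P)%E.-integrable setT (fun vw : T * W => (Y vw.1 vw.2 * Phi vw.2)%:E).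
Proof.
move=> sPhi; have [mPhi _] := sPhi.
apply/integrable12ltyP.
  apply/measurable_EFinP; apply: measurable_funM => //.
  exact: (measurableT_comp mPhi).
rewrite (@le_lt_trans _ _ (\int[mu]_v (C * nrm P Phi)%:E)%E)//; last first.
  by rewrite integral_cst//= probability_setT mule1 ltry.
apply: ge0_le_integral => //.
- by move=> v _; exact: integral_ge0.
- apply: (@measurable_fun_fubini_tonelli_F _ _ T W R P
    (fun vw : T * W => `|(Y vw.1 vw.2 * Phi vw.2)%:E|%E)) => //.
  apply: measurableT_comp => //; apply/measurable_EFinP; apply: measurable_funM => //.
  exact: (measurableT_comp mPhi).
- move=> v _; have iv := sqintM (sY v) sPhi.
  rewrite (_ : (\int[P]_y _)%E = (mean P (fun w => `|Y v w * Phi w|))%:E); last first.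
    by rewrite EFin_mean; [exact: eq_integral|exact: L1_norm].
  rewrite lee_fin.
  have mYv : measurable_fun setT (Y v) by case: (sY v).
  have sn (Z : W -> R) : sqint P Z -> sqint P (fun w => `|Z w|).
    move=> sZ; have [mZ _] := sZ; apply: (sqint_le _ sZ).
      exact: measurableT_comp.
    by move=> w; rewrite normr_id.
  have en (Z : W -> R) : nrm P (fun w => `|Z w|) = nrm P Z.
    by congr Num.sqrt; apply: eq_mean => w; rewrite real_normK ?num_real.
  rewrite (@eq_mean _ _ _ _ _ (fun w => `|Y v w| * `|Phi w|)); last first.
    by move=> w; rewrite normrM.
  apply: (le_trans (mean_mul_nrm (sn _ (sY v)) (sn _ sPhi))).
  by rewrite !en ler_wpM2r ?nrm_ge0.
Qed.

Let joint_int1 : (mu \x P)%E.-integrable setT (fun vw : T * W => (Y vw.1 vw.2)%:E).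
Proof.
have := joint_int (sqint_cst P 1); congr (integrable _ _ _).
by apply/funext => vw; rewrite mulr1.
Qed.

Lemma mix_L1 : {ae P, forall w, L1 mu (fun v => Y v w)}.
Proof. exact: (ae_integrable2 joint_int1). Qed.

Lemma mean_mix (Phi : W -> R) : sqint P Phi ->
  L1 mu (fun v => mean P (fun w => Y v w * Phi w)) /\
  mean P (fun w => mix w * Phi w) = mean mu (fun v => mean P (fun w => Y v w * Phi w)).
Proof.
move=> sPhi; have [mPhi _] := sPhi; have iJ := joint_int sPhi.
have e1 v : (\int[P]_w (Y v w * Phi w)%:E)%E = (mean P (fun w => Y v w * Phi w))%:E.
  by rewrite EFin_mean//; exact: sqintM.
have L : L1 mu (fun v => mean P (fun w => Y v w * Phi w)).
  have := integrable_fubini_F iJ; congr (integrable _ _ _).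
  by apply/funext => v; rewrite /fubini_F /= e1.
split => //.
apply: EFin_inj; rewrite (EFin_mean L).
under eq_integral => v _ do rewrite -e1.
have -> : (\int[mu]_v \int[P]_w (Y v w * Phi w)%:E = \int[P]_w \int[mu]_v (Y v w * Phi w)%:E)%E.
  exact: (Fubini iJ).
have ae : {ae P, forall w, (mix w * Phi w)%:E = (\int[mu]_v (Y v w * Phi w)%:E)%E}.
  apply: filterS mix_L1 => w iw.
  rewrite mulrC /mix -meanZ// EFin_mean; last exact: L1Z.
  by apply: eq_integral => v _; rewrite mulrC.
have mG : measurable_fun setT (fun w => (\int[mu]_v (Y v w * Phi w)%:E)%E).
  exact: (measurable_fubini_G iJ).
have mMP : measurable_fun setT (fun w => (mix w * Phi w)%:E).
  by apply/measurable_EFinP; apply: measurable_funM => //; exact: measurable_mix.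
have eI : (\int[P]_w (mix w * Phi w)%:E = \int[P]_w \int[mu]_v (Y v w * Phi w)%:E)%E.
  by apply: ae_eq_integral => //; apply: filterS ae => w h _.
rewrite -eI /mean /Rintegral fineK//.
rewrite eI -(Fubini iJ); under eq_integral => v _ do rewrite e1.
exact: (integrable_fin_num measurableT L).
Qed.

(** Jensen's inequality in [v] at almost every [w], then Tonelli's theorem. *)
Lemma mix_sqint : sqint P mix /\ nrm P mix <= C.
Proof.
have mY2 : measurable_fun setT (fun vw : T * W => (Y vw.1 vw.2 ^+ 2)%:E).
  by apply/measurable_EFinP; exact: measurable_funX.
have t1 := @fubini_tonelli _ _ T W R mu P _ mY2 (fun vw => _).
have {t1}t1 : (\int[mu]_v \int[P]_w (Y v w ^+ 2)%:E = \int[P]_w \int[mu]_v (Y v w ^+ 2)%:E)%E.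
  by apply: t1 => vw; rewrite lee_fin sqr_ge0.
have b : (\int[P]_w \int[mu]_v (Y v w ^+ 2)%:E <= (C ^+ 2)%:E)%E.
  rewrite -t1; apply: (@le_trans _ _ (\int[mu]_v (C ^+ 2)%:E)%E); last first.
    by rewrite integral_cst//= probability_setT mule1.
  apply: ge0_le_integral => //.
  - by move=> v _; apply: integral_ge0 => w _; rewrite lee_fin sqr_ge0.
  - by apply: (@measurable_fun_fubini_tonelli_F _ _ T W R P
      (fun vw : T * W => (Y vw.1 vw.2 ^+ 2)%:E)) => // vw; rewrite lee_fin sqr_ge0.
  - by move=> v _; rewrite -EFin_mean ?lee_fin//; case: (sY v).
have iJ2 : (mu \x P)%E.-integrable setT (fun vw : T * W => (Y vw.1 vw.2 ^+ 2)%:E).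
  apply/integrable21ltyP => //; apply: le_lt_trans (ltry (C ^+ 2)).
  apply: le_trans b; rewrite le_eqVlt; apply/orP; left; apply/eqP.
  by apply: eq_integral => w _; apply: eq_integral => v _ /=; rewrite ger0_norm// sqr_ge0.
have ae : {ae P, forall w, setT w -> (mix w ^+ 2)%:E <= \int[mu]_v (Y v w ^+ 2)%:E}%E.
  apply: filterS (ae_integrable2 iJ2) => w iw _.
  have mYw : measurable_fun setT (fun v => Y v w).
    exact: (measurableT_comp mY (pair2_measurable w)).
  have sw : sqint mu (fun v => Y v w) by split.
  rewrite -EFin_mean// lee_fin -sqr_nrm -(real_normK (num_real (mix w))).
  by rewrite ler_sqr ?nnegrE ?nrm_ge0//; exact: norm_mean_nrm.
have mm : measurable_fun setT mix := measurable_mix.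
have le2 : (\int[P]_w (mix w ^+ 2)%:E <= (C ^+ 2)%:E)%E.
  apply: le_trans b; apply: ae_ge0_le_integral => //.
  - by move=> w _; rewrite lee_fin sqr_ge0.
  - by apply/measurable_EFinP; exact: measurable_funX.
  - by move=> w _; apply: integral_ge0 => v _; rewrite lee_fin sqr_ge0.
  - by apply: (@measurable_fun_fubini_tonelli_G _ _ T W R mu
      (fun vw : T * W => (Y vw.1 vw.2 ^+ 2)%:E)) => // vw; rewrite lee_fin sqr_ge0.
have i2 : L1 P (fun w => mix w ^+ 2).
  apply/integrableP; split; first by apply/measurable_EFinP; exact: measurable_funX.
  apply: le_lt_trans (ltry (C ^+ 2)); apply: le_trans le2.
  rewrite le_eqVlt; apply/orP; left; apply/eqP.
  by apply: eq_integral => w _ /=; rewrite ger0_norm// sqr_ge0.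
split; first by split.
rewrite -ler_sqr ?nnegrE ?nrm_ge0// sqr_nrm -lee_fin EFin_mean//.
Qed.

Lemma mean_mix_le (Phi : W -> R) c e : sqint P Phi ->
  (forall v, `|mean P (fun w => Y v w * Phi w) - c| <= e) ->
  `|mean P (fun w => mix w * Phi w) - c| <= e.
Proof.
move=> sPhi h; have [L ->] := mean_mix sPhi.
rewrite -[X in `|_ - X|](mean_cst mu c) -meanB//; last exact: L1_cst.
rewrite -(mean_cst mu e); apply: mean_norm_le => //; last exact: L1_cst.
by apply: L1B => //; exact: L1_cst.
Qed.

End mixing.

Section uniform_mean.
Context (R : realType) (a b : R) (ab : a < b) (f : R -> R).
Hypothesis mf : measurable_fun setT f.
Let U : probability _ R := uniform_prob ab.

Let ba0 : 0 < b - a. Proof. by rewrite subr_gt0. Qed.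

Let uniform_integral (g : R -> \bar R) : measurable_fun setT g -> (forall x, 0 <= g x)%E ->
  (\int[lebesgue_measure]_(x in `[a, b]) g x = (b - a)%:E * \int[U]_x g x)%E.
Proof.
move=> mg g0; rewrite /U integral_uniform// muleA -EFinM divff ?mul1e//.
by rewrite gt_eqF.
Qed.

Lemma Rintegral_uniform :
  \int[lebesgue_measure]_(x in `[a, b]) f x = (b - a) * mean U f.
Proof.
have mg : measurable_fun setT (EFin \o f) by exact/measurable_EFinP.
have mp := measurable_funepos mg; have mn := measurable_funeneg mg.
rewrite /mean /Rintegral [in LHS]integralE.
rewrite (@uniform_integral (fun x => (EFin \o f)^\+%E x)) //.
rewrite (@uniform_integral (fun x => (EFin \o f)^\-%E x)) //.
rewrite [in RHS]integralE.
have p0 : (0 <= \int[U]_x (EFin \o f)^\+%E x)%E by exact: integral_ge0.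
have n0 : (0 <= \int[U]_x (EFin \o f)^\-%E x)%E by exact: integral_ge0.
(* The integral of the positive or the negative part may be infinite; [fine] then sends both sides
   to 0. *)
move: p0 n0; case: (\int[U]_x _)%E => [p| |]//; case: (\int[U]_x _)%E => [n| |]// _ _.
- by rewrite -!EFinM -EFinB /= mulrBr.
- by rewrite gt0_muley ?lte_fin//= mulr0.
- by rewrite gt0_muley ?lte_fin//= mulr0.
- by rewrite gt0_muley ?lte_fin//= mulr0.
Qed.

Lemma integrable_uniform : L1 U f -> lebesgue_measure.-integrable `[a, b] (EFin \o f).
Proof.
move=> /integrableP[_ fin]; apply/integrableP; split.
  by apply/measurable_EFinP; exact: measurable_funTS.
rewrite uniform_integral//; last by apply: measurableT_comp => //; exact/measurable_EFinP.
by rewrite lte_mul_pinfty// lee_fin ltW.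
Qed.

End uniform_mean.

(** * Time integrals along the path *)

Section occupation.
Context (d dS : measure_display) (W : measurableType d) (S : measurableType dS)
  (R : realType) (P : probability W R) (pi : probability S R)
  (K : R -> R.-pker S ~> S) (F : R -> set (set W)) (X : R -> W -> S).
Hypothesis emp : ergodic_markov_process P pi K F X.
Implicit Types (g : S -> R) (a b c : R).

Let sF t : 0 <= t -> sigma_algebra setT (F t).
Proof. by have [h _ _] := emp_filtration emp; exact: h. Qed.

Let FW t : 0 <= t -> F t `<=` measurable.
Proof. by have [_ h _] := emp_filtration emp; exact: h. Qed.

Definition occ g a b (w : W) : R := \int[lebesgue_measure]_(v in `[a, b]) g (X v w).

Let Y g a b v (w : W) := g (X (clamp a b v) w).

Let joint_adapted g a b : 0 <= a -> a <= b -> measurable_fun setT g ->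
  measurable_fun setT (fun vw : R * g_sigma_algebraType (F b) => Y g a b vw.1 vw.2).
Proof.
move=> a0 ab mg; apply: (measurableT_comp mg).
exact: (progressive_joint sF (emp_progressive emp) a0 ab).
Qed.

Let joint g a b : 0 <= a -> a <= b -> measurable_fun setT g ->
  measurable_fun setT (fun vw : R * W => Y g a b vw.1 vw.2).
Proof.
move=> a0 ab mg; have b0 := le_trans a0 ab.
have ms : measurable_fun setT (sub_id (F b) : W -> g_sigma_algebraType (F b)).
  move=> _ B; rewrite /measurable/= sigma_algebra_id; last exact: sF.
  by rewrite setTI => FB; exact: (FW b0).
have mh : measurable_fun setT (fun vw : R * W => (vw.1, (sub_id (F b) vw.2 : g_sigma_algebraType (F b)))).
  apply/measurable_fun_pair; first exact: measurable_fst.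
  exact: (measurableT_comp ms measurable_snd).
exact: (measurableT_comp (joint_adapted a0 ab mg) mh).
Qed.

Let path g a b w : 0 <= a -> a <= b -> measurable_fun setT g ->
  measurable_fun setT (fun v => Y g a b v w).
Proof. by move=> a0 ab mg; exact: (measurableT_comp (joint a0 ab mg) (pair2_measurable w)). Qed.

Let occ_clamp g a b w : occ g a b w = \int[lebesgue_measure]_(v in `[a, b]) Y g a b v w.
Proof.
apply: eq_Rintegral => v; rewrite inE/= in_itv/= => vab.
by rewrite /Y clamp_id.
Qed.

Let occ_mix g a b (ab : a < b) w : 0 <= a -> measurable_fun setT g ->
  occ g a b w = (b - a) * mix (uniform_prob ab) (Y g a b) w.
Proof.
by move=> a0 mg; rewrite occ_clamp (Rintegral_uniform ab (path w a0 (ltW ab) mg)).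
Qed.

Lemma occ_refl g a w : occ g a a w = 0.
Proof. by rewrite /occ set_itv1 Rintegral_set1. Qed.

Lemma occ_adapted g a b : 0 <= a -> a <= b -> measurable_fun setT g ->
  adapted (F b) (occ g a b).
Proof.
move=> a0 ab mg; have b0 := le_trans a0 ab.
apply/(adaptedP (sF b0)).
move: ab; rewrite le_eqVlt => /predU1P[ab|ab].
  by rewrite (_ : occ g a b = fun=> 0)//; apply/funext => w; rewrite ab occ_refl.
rewrite (_ : occ g a b = fun w => (b - a) * mix (uniform_prob ab) (Y g a b) w); last first.
  by apply/funext => w; exact: occ_mix.
apply: measurable_funM => //.
exact: (measurable_mix (uniform_prob ab) (joint_adapted a0 (ltW ab) mg)).
Qed.

Let Ysq g a b v : 0 <= a -> a <= b -> sqint pi g -> sqint P (Y g a b v).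
Proof.
move=> a0 ab sg; have /andP[h _] := clamp_itv v ab.
by apply: (process_sqint emp _ sg); exact: le_trans h.
Qed.

Let Ynrm g a b v : 0 <= a -> a <= b -> sqint pi g -> nrm P (Y g a b v) <= nrm pi g.
Proof.
move=> a0 ab sg; have /andP[h _] := clamp_itv v ab.
by rewrite (process_nrm emp (le_trans a0 h) sg).
Qed.

Lemma occ_sqint g a b : 0 <= a -> a <= b -> sqint pi g ->
  sqint P (occ g a b) /\ nrm P (occ g a b) <= (b - a) * nrm pi g.
Proof.
move=> a0 ab sg; have [mg _] := sg.
have := ab; rewrite le_eqVlt => /predU1P[e|ab'].
  rewrite (_ : occ g a b = fun=> 0); last by apply/funext => w; rewrite e occ_refl.
  by split; [exact: sqint_cst|rewrite nrm_cst normr0 e subrr mul0r].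
rewrite (_ : occ g a b = fun w => (b - a) * mix (uniform_prob ab') (Y g a b) w); last first.
  by apply/funext => w; exact: occ_mix.
have [h1 h2] := @mix_sqint _ _ _ W R (uniform_prob ab') (Y g a b) (joint a0 ab mg) P (nrm pi g)
  (fun v => Ysq v a0 ab sg) (fun v => Ynrm v a0 ab sg) (nrm_ge0 _ _).
split; first exact: sqintZ.
by rewrite nrmZ// ger0_norm ?subr_ge0// ler_wpM2l ?subr_ge0.
Qed.

Lemma mean_occ_le g a b (Phi : W -> R) c e : 0 <= a -> a <= b -> sqint pi g -> sqint P Phi ->
  (forall v, a <= v <= b -> `|mean P (fun w => g (X v w) * Phi w) - c| <= e) ->
  `|mean P (fun w => occ g a b w * Phi w) - (b - a) * c| <= (b - a) * e.
Proof.
move=> a0 ab sg sPhi h; have [mg _] := sg; have [mPhi _] := sPhi.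
have := ab; rewrite le_eqVlt => /predU1P[eab|ab'].
  rewrite (@eq_mean _ _ _ _ _ (fun=> 0)); first by rewrite mean_cst eab subrr !mul0r subrr normr0.
  by move=> w; rewrite eab occ_refl mul0r.
have [h1 _] := @mix_sqint _ _ _ W R (uniform_prob ab') (Y g a b) (joint a0 ab mg) P (nrm pi g)
  (fun v => Ysq v a0 ab sg) (fun v => Ynrm v a0 ab sg) (nrm_ge0 _ _).
rewrite (@eq_mean _ _ _ _ _ (fun w => (b - a) * (mix (uniform_prob ab') (Y g a b) w * Phi w))); last first.
  by move=> w; rewrite (occ_mix ab' _ a0 mg) mulrA.
rewrite meanZ; last exact: sqintM.
rewrite -mulrBr normrM ger0_norm ?subr_ge0// ler_wpM2l ?subr_ge0//.
apply: (@mean_mix_le _ _ _ W R (uniform_prob ab') (Y g a b) (joint a0 ab mg) P (nrm pi g)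
  (fun v => Ysq v a0 ab sg) (fun v => Ynrm v a0 ab sg) Phi c e sPhi) => v.
by apply: h; exact: clamp_itv.
Qed.

Lemma occ_integrable g a b : 0 <= a -> a <= b -> sqint pi g ->
  {ae P, forall w, lebesgue_measure.-integrable `[a, b] (EFin \o (fun v => g (X v w)))}.
Proof.
move=> a0 ab sg; have [mg _] := sg.
have := ab; rewrite le_eqVlt => /predU1P[eab|ab'].
  apply: aeW => w; rewrite eab set_itv1; apply/integrableP; split.
    exact: measurable_fun_set1.
  by rewrite integral_set1 ltry.
have := @mix_L1 _ _ _ W R (uniform_prob ab') (Y g a b) (joint a0 ab mg) P (nrm pi g)
  (fun v => Ysq v a0 ab sg) (fun v => Ynrm v a0 ab sg).
apply: filterS => w iw.
have := integrable_uniform (path w a0 ab mg) iw.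
apply: eq_integrable => // v; rewrite inE/= in_itv/= => vab.
by rewrite /Y clamp_id.
Qed.

Lemma occ_bounded g a b M w : 0 <= a -> a <= b -> measurable_fun setT g ->
  (forall x, `|g x| <= M) -> `|occ g a b w| <= (b - a) * M.
Proof.
move=> a0 ab mg gM.
have := ab; rewrite le_eqVlt => /predU1P[e|ab'].
  by rewrite e occ_refl normr0 subrr mul0r.
rewrite (occ_mix ab' w a0 mg) normrM ger0_norm ?subr_ge0// ler_wpM2l ?subr_ge0//.
rewrite -(mean_cst (uniform_prob ab') M) /mix; apply: mean_norm_le.
- by apply: (@L1_bounded _ _ _ _ M) => [|v]; [exact: path|exact: gM].
- exact: L1_cst.
- by move=> v; exact: gM.
Qed.

Lemma occ_add g a b c : 0 <= a -> a <= b -> b <= c -> sqint pi g ->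
  {ae P, forall w, occ g a c w = occ g a b w + occ g b c w}.
Proof.
move=> a0 ab bc sg; have := occ_integrable a0 (le_trans ab bc) sg.
apply: filterS => w iw.
have := Rintegral_itvB iw.
move=> /(_ b); rewrite !bnd_simp => /(_ ab bc) e.
have ibc : lebesgue_measure.-integrable `]b, c] (EFin \o (fun v => g (X v w))).
  by apply: integrableS iw => //; apply: subset_itvr; rewrite bnd_simp.
have e2 := Rintegral_itv_obnd_cbnd ibc.
by rewrite /occ -e2 -e addrC subrK.
Qed.

Lemma occ_linear (r : R) f g a b : 0 <= a -> a <= b -> sqint pi f -> sqint pi g ->
  {ae P, forall w, occ (fun x => r * f x + g x) a b w = r * occ f a b w + occ g a b w}.
Proof.
move=> a0 ab sf sg; have := occ_integrable a0 ab sg; have := occ_integrable a0 ab sf.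
apply: filterS2 => w iF iG; rewrite /occ RintegralD//.
  by rewrite RintegralZl.
rewrite (_ : EFin \o _ = (fun v => r%:E * (EFin \o (fun v => f (X v w))) v)%E)//.
exact: integrableZl.
Qed.

End occupation.

(** * Dynkin's martingale *)

Lemma cvge0_near_lt (R : realType) (f : R -> \bar R) (e : R) :
  f x @[x --> 0^'+] --> 0%E -> 0 < e -> \forall x \near 0^'+, (f x < e%:E)%E.
Proof.
move=> f0 e0.
have : nbhs (0%E : \bar R) [set x | (x < e%:E)%E].
  by apply: open_nbhs_nbhs; split; [exact: open_ereal_lt_ereal|rewrite /= lte_fin].
by move=> /f0.
Qed.

Section L2norm.
Context (d : measure_display) (S : measurableType d) (R : realType) (pi : probability S R).

Lemma L2_sqint (f : L2 pi) : sqint pi f.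
Proof.
split; first exact: measurable_funP.
exact: (Lfun2_integrable_sqr (LfunP f)).
Qed.

Lemma L2norm_lt_sqint (f : S -> R) (e : R) : measurable_fun setT f ->
  (L2norm pi f < e%:E)%E -> sqint pi f /\ nrm pi f <= e.
Proof.
move=> mf fe.
have e0 : 0 < e by rewrite -lte_fin (le_lt_trans _ fe)// Lnorm_ge0.
have N2 : (\int[pi]_x (f x ^+ 2)%:E = L2norm pi f `^ 2)%E.
  rewrite /L2norm poweR_Lnorm//; apply: eq_integral => x _.
  by rewrite /= powR_mulrn// real_normK// num_real.
have lt2 : (\int[pi]_x (f x ^+ 2)%:E <= (e ^+ 2)%:E)%E.
  rewrite N2; move: fe; have := Lnorm_ge0 pi 2%:E (EFin \o f); rewrite -/(L2norm pi f).
  case: (L2norm pi f) => [r| |]// r0 re; rewrite poweR_EFin lee_fin powR_mulrn//.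
  by rewrite ler_sqr ?nnegrE ?(ltW e0)// ltW.
have i2 : L1 pi (fun x => f x ^+ 2).
  apply/integrableP; split; first by apply/measurable_EFinP; exact: measurable_funX.
  apply: le_lt_trans (ltry (e ^+ 2)); apply: le_trans lt2.
  rewrite le_eqVlt; apply/orP; left; apply/eqP.
  by apply: eq_integral => w _ /=; rewrite ger0_norm// sqr_ge0.
split; first by split.
by rewrite -ler_sqr ?nnegrE ?nrm_ge0 ?(ltW e0)// sqr_nrm -lee_fin EFin_mean.
Qed.

End L2norm.

Section dynkin.
Context (d dS : measure_display) (W : measurableType d) (S : measurableType dS)
  (R : realType) (P : probability W R) (pi : probability S R)
  (K : R -> R.-pker S ~> S) (F : R -> set (set W)) (X : R -> W -> S).
Hypothesis emp : ergodic_markov_process P pi K F X.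
Hypothesis scK : strongly_continuous pi K.

Let sF t : 0 <= t -> sigma_algebra setT (F t).
Proof. by have [h _ _] := emp_filtration emp; exact: h. Qed.

Let FW t : 0 <= t -> F t `<=` measurable.
Proof. by have [_ h _] := emp_filtration emp; exact: h. Qed.

Let Fle s t A : 0 <= s -> s <= t -> F s A -> F t A.
Proof. by move=> s0 st; have [_ _ h] := emp_filtration emp; exact: h. Qed.

Lemma adapted_le s t (f : W -> R) : 0 <= s -> s <= t -> adapted (F s) f -> adapted (F t) f.
Proof. by move=> s0 st af B mB; apply: (Fle s0 st); exact: af. Qed.

Section semigroup_increment.
Variable g : L2 pi.
Let sg : sqint pi g := L2_sqint g.
Let mg : measurable_fun setT g. Proof. by case: sg. Qed.

Lemma transition_op_near (e : R) : 0 < e -> \forall h \near 0^'+,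
  sqint pi (fun x => transition_op K h g x - g x) /\
  nrm pi (fun x => transition_op K h g x - g x) <= e.
Proof.
move=> e0; have := cvge0_near_lt (f := fun t => L2norm pi (fun x => transition_op K t g x - g x)) (scK g) e0; apply: filterS => t ht.
apply: L2norm_lt_sqint ht; apply: measurable_funB => //.
exact: measurable_transition_op.
Qed.

Lemma mean_transition_op s t (Phi : W -> R) : 0 <= s -> 0 <= t ->
  sqint pi (fun x => transition_op K t g x - g x) ->
  sqint P Phi -> adapted (F s) Phi ->
  mean P (fun w => g (X (s + t) w) * Phi w) - mean P (fun w => g (X s w) * Phi w) =
  mean P (fun w => (transition_op K t g (X s w) - g (X s w)) * Phi w).
Proof.
move=> s0 t0 sT sPhi aPhi.
have sT' : sqint pi (transition_op K t g).
  have := sqintD sT sg; congr (sqint _ _); apply/funext => x; exact: subrK.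
have h1 := process_sqint emp s0 sg; have h2 := process_sqint emp s0 sT'.
rewrite -(markov_mean emp s0 t0 sg sT' sPhi aPhi) -meanB; [|exact: sqintM|exact: sqintM].
by apply: eq_mean => w; rewrite mulrBl.
Qed.

(** The threshold for [h] is uniform in [s] because [X s] has law [pi] for every [s]: the error is
    controlled by the norm of [P_t g - g] in [L^2(pi)] alone. *)
Lemma mean_occ_near (e : R) : 0 < e -> \forall h \near 0^'+,
  forall s (Phi : W -> R), 0 <= s -> sqint P Phi -> adapted (F s) Phi ->
  `|mean P (fun w => occ X g s (s + h) w * Phi w) - h * mean P (fun w => g (X s w) * Phi w)| <=
  h * (e * nrm P Phi).
Proof.
move=> e0; have [r /= r0 hr] := transition_op_near e0.
exists r => //= h hh h0 s Phi s0 sPhi aPhi.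
have := @mean_occ_le _ _ _ _ _ _ _ _ _ _ emp g s (s + h) Phi
   (mean P (fun w => g (X s w) * Phi w)) (e * nrm P Phi) s0 _ sg sPhi.
rewrite (_ : s + h - s = h); last by ring.
apply; first by rewrite lerDl ltW.
move=> v /andP[sv vh].
have : exists2 t, 0 <= t <= h & v = s + t.
  by exists (v - s); [rewrite subr_ge0 sv lerBlDr addrC|rewrite addrC subrK].
case=> t /andP[t0 th] ->.
have [<-|t00] := eqVneq 0 t.
  by rewrite addr0 subrr normr0 mulr_ge0// ?nrm_ge0 ?ltW.
have tpos : 0 < t by rewrite lt_def eq_sym t00.
have [|sT nT] := hr t _ tpos.
  rewrite /= sub0r normrN gtr0_norm// (le_lt_trans th)//.
  by move: hh; rewrite /= sub0r normrN gtr0_norm.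
rewrite (mean_transition_op s0 t0)//.
apply: (le_trans (norm_mean_mul_nrm (process_sqint emp s0 sT) sPhi)).
by rewrite (process_nrm emp s0 sT) ler_wpM2r ?nrm_ge0.
Qed.

End semigroup_increment.

Variables u g : L2 pi.
Hypothesis ug : generator K u g.
Let su : sqint pi u := L2_sqint u.
Let sg : sqint pi g := L2_sqint g.
Let mu : measurable_fun setT u. Proof. by case: su. Qed.
Let mg : measurable_fun setT g. Proof. by case: sg. Qed.

Definition dynkin a b (w : W) : R := u (X b w) - u (X a w) - occ X g a b w.

Lemma dynkin_adapted a b : 0 <= a -> a <= b -> adapted (F b) (dynkin a b).
Proof.
move=> a0 ab; have b0 := le_trans a0 ab.
apply/(adaptedP (sF b0)); apply: measurable_funB; first apply: measurable_funB.
- by apply/(adaptedP (sF b0)); exact: (adapted_process emp).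
- by apply/(adaptedP (sF b0)); apply: (adapted_le a0 ab); exact: (adapted_process emp).
- by apply/(adaptedP (sF b0)); exact: (occ_adapted emp).
Qed.

Lemma dynkin_sqint a b : 0 <= a -> a <= b ->
  sqint P (dynkin a b) /\ nrm P (dynkin a b) <= 2 * nrm pi u + (b - a) * nrm pi g.
Proof.
move=> a0 ab; have b0 := le_trans a0 ab.
have h1 := process_sqint emp b0 su; have h2 := process_sqint emp a0 su.
have [h3 n3] := occ_sqint emp a0 ab sg.
split; first by apply: sqintB => //; exact: sqintB.
apply: (le_trans (nrmB (sqintB h1 h2) h3)); apply: lerD => //.
apply: (le_trans (nrmB h1 h2)).
have -> : 2 * nrm pi u = nrm pi u + nrm pi u by ring.
by rewrite (process_nrm emp b0 su) (process_nrm emp a0 su).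
Qed.

Lemma dynkin_add a b c : 0 <= a -> a <= b -> b <= c ->
  {ae P, forall w, dynkin a c w = dynkin a b w + dynkin b c w}.
Proof.
move=> a0 ab bc; have := occ_add emp a0 ab bc sg.
by apply: filterS => w e; rewrite /dynkin e; ring.
Qed.

(** Both the increment of [u] and the occupation integral equal [h g(X_s)] up to [o(h)] against
    adapted factors, so they cancel. *)
Lemma mean_dynkin_near (e : R) : 0 < e -> \forall h \near 0^'+,
  forall s (Phi : W -> R), 0 <= s -> sqint P Phi -> adapted (F s) Phi ->
  `|mean P (fun w => dynkin s (s + h) w * Phi w)| <= h * (e * nrm P Phi).
Proof.
move=> e0; have e20 : 0 < e / 2 by rewrite divr_gt0.
have hu := cvge0_near_lt (f := fun t => L2norm pi (fun x => t^-1 * (transition_op K t u x - u x) - g x)) ug e20.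
near=> h => s Phi s0 sPhi aPhi.
have h0 : 0 < h by near: h; exact: nbhs_right_gt.
have b1 : `|mean P (fun w => occ X g s (s + h) w * Phi w) - h * mean P (fun w => g (X s w) * Phi w)| <=
  h * (e / 2 * nrm P Phi).
  by move: s Phi s0 sPhi aPhi; near: h; exact: mean_occ_near.
have hv : (L2norm pi (fun x => (h^-1 * (transition_op K h u x - u x) - g x)%R) < (e / 2)%:E)%E.
  by near: h.
pose v x := h^-1 * (transition_op K h u x - u x) - g x.
have mv : measurable_fun setT v.
  apply: measurable_funB => //; apply: measurable_funM => //; apply: measurable_funB => //.
  exact: measurable_transition_op.
have [sv nv] : sqint pi v /\ nrm pi v <= e / 2.
  exact: L2norm_lt_sqint.
have sT : sqint pi (fun x => transition_op K h u x - u x).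
  have := sqintZ h (sqintD sv sg); congr (sqint _ _); apply/funext => x.
  by rewrite /v subrK mulrA divff ?mul1r// gt_eqF.
have b2 := mean_transition_op s0 (ltW h0) sT sPhi aPhi.
have sX := process_sqint emp s0; have sh0 : 0 <= s + h by rewrite addr_ge0// ltW.
have ssh : s <= s + h by rewrite lerDl ltW.
have [so _] := occ_sqint emp s0 ssh sg.
rewrite (@eq_mean _ _ _ _ _ (fun w => u (X (s + h) w) * Phi w - u (X s w) * Phi w
  - occ X g s (s + h) w * Phi w)); last by move=> w; rewrite /dynkin !mulrBl.
have i1 := sqintM (process_sqint emp sh0 su) sPhi.
have i2 := sqintM (sX _ su) sPhi; have i3 := sqintM so sPhi.
rewrite meanB//; last exact: L1B.
rewrite meanB// b2.
have e3 : mean P (fun w => (transition_op K h u (X s w) - u (X s w)) * Phi w) =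
    h * mean P (fun w => v (X s w) * Phi w) + h * mean P (fun w => g (X s w) * Phi w).
  have j1 := sqintM (sX _ sv) sPhi; have j2 := sqintM (sX _ sg) sPhi.
  rewrite -(meanZ _ j1) -(meanZ _ j2) -(meanD (L1Z _ j1) (L1Z _ j2)).
  apply: eq_mean => w; rewrite /v.
  have hh : h * h^-1 = 1 by rewrite divff// gt_eqF.
  by rewrite -mulrDr -mulrDl subrK mulrA mulrA hh mul1r.
rewrite e3 -addrA (le_trans (ler_normD _ _))//.
rewrite [X in h * (X * _)](splitr e) mulrDl mulrDr lerD//; last by rewrite distrC.
rewrite normrM gtr0_norm// ler_pM2l//.
apply: (le_trans (norm_mean_mul_nrm (sX _ sv) sPhi)).
by rewrite (process_nrm emp s0 sv) ler_wpM2r ?nrm_ge0.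
Unshelve. all: by end_near. Qed.

(** The window is cut into steps so short that each contributes [h e'] times the norm of [Phi];
    these contributions sum to at most [e]. The uniformity in the starting time of the one-step
    bound is essential. *)
Lemma mean_dynkin a b (Phi : W -> R) : 0 <= a -> a <= b -> sqint P Phi -> adapted (F a) Phi ->
  mean P (fun w => dynkin a b w * Phi w) = 0.
Proof.
move=> a0; rewrite le_eqVlt => /predU1P[<-|ab] sPhi aPhi.
  rewrite (@eq_mean _ _ _ _ _ (fun=> 0)) ?mean_cst// => w.
  by rewrite /dynkin occ_refl !subrr mul0r.
apply/eqP; rewrite -normr_le0; apply/ler_addgt0Pl => e e0; rewrite addr0.
have n1 : 0 < (b - a) * (nrm P Phi + 1) by rewrite mulr_gt0 ?subr_gt0// ltr_wpDl// nrm_ge0.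
pose e' := e / ((b - a) * (nrm P Phi + 1)).
have e'0 : 0 < e' by rewrite divr_gt0.
have [r /= r0 hr] := mean_dynkin_near e'0.
pose n := Num.truncn ((b - a) / r); pose h := (b - a) / n.+1%:R.
have nr : h < r by rewrite ltr_pdivrMr// mulrC -ltr_pdivrMr// truncnS_gt.
have h0 : 0 < h by rewrite divr_gt0 ?subr_gt0.
have key k : `|mean P (fun w => dynkin a (a + k%:R * h) w * Phi w)| <=
    k%:R * (h * (e' * nrm P Phi)).
  elim: k => [|k ih].
    rewrite mul0r addr0 mul0r (@eq_mean _ _ _ _ _ (fun=> 0)) ?mean_cst ?normr0// => w.
    by rewrite /dynkin occ_refl !subrr mul0r.
  set c := a + k%:R * h in ih.
  have ac : a <= c by rewrite lerDl mulr_ge0// ltW.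
  have cc : c <= c + h by rewrite lerDl ltW.
  have c0 := le_trans a0 ac.
  rewrite (_ : a + k.+1%:R * h = c + h); last by rewrite /c -natr1; ring.
  have [s1 _] := dynkin_sqint a0 ac; have [s2 _] := dynkin_sqint c0 cc.
  have [s3 _] := dynkin_sqint a0 (le_trans ac cc).
  have -> : mean P (fun w => dynkin a (c + h) w * Phi w) =
      mean P (fun w => dynkin a c w * Phi w) + mean P (fun w => dynkin c (c + h) w * Phi w).
    rewrite -meanD; [|exact: sqintM|exact: sqintM].
    apply: ae_mean.
    - by apply: (@L1_measurable _ _ _ P); exact: sqintM.
    - by apply: (@L1_measurable _ _ _ P); apply: L1D; exact: sqintM.
    - by apply: filterS (dynkin_add a0 ac cc) => w ->; rewrite mulrDl.
  rewrite (le_trans (ler_normD _ _))// -natr1 mulrDl mul1r lerD//.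
  apply: (hr h) => //=; first by rewrite sub0r normrN gtr0_norm.
  exact: (adapted_le a0 ac).
have := key n.+1; rewrite (_ : a + _ = b); last first.
  by rewrite /h mulrC divfK ?pnatr_eq0// addrC subrK.
move/le_trans; apply.
rewrite mulrA (_ : n.+1%:R * h = b - a); last by rewrite /h mulrC divfK ?pnatr_eq0.
rewrite /e'; move: (nrm P Phi) (nrm_ge0 P Phi) n1 => N N0 n1.
have ba0 : b - a != 0 by rewrite gt_eqF ?subr_gt0.
have N1 : N + 1 != 0 by rewrite gt_eqF// ltr_wpDl.
rewrite [leLHS](_ : _ = e * (N / (N + 1))); last by field; rewrite N1 ba0.
by rewrite ler_piMr ?(ltW e0)// ler_pdivrMr ?ltr_wpDl// mul1r lerDl.
Qed.

End dynkin.

(** * Conditional second moments of Dynkin's martingale *)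

Section second_moment.
Context (d dS : measure_display) (W : measurableType d) (S : measurableType dS)
  (R : realType) (P : probability W R) (pi : probability S R)
  (K : R -> R.-pker S ~> S) (F : R -> set (set W)) (X : R -> W -> S).
Hypothesis emp : ergodic_markov_process P pi K F X.
Hypothesis scK : strongly_continuous pi K.
Implicit Types (Phi : W -> R).

Let sF t : 0 <= t -> sigma_algebra setT (F t).
Proof. by have [h _ _] := emp_filtration emp; exact: h. Qed.

Let FW t : 0 <= t -> F t `<=` measurable.
Proof. by have [_ h _] := emp_filtration emp; exact: h. Qed.

(** The admissible weights at time [s]: an estimate uniform over them replaces an estimate of a
    conditional expectation given [F s]. *)
Definition test (s : R) Phi := adapted (F s) Phi /\ forall w, `|Phi w| <= 1.

Lemma test_le s t Phi : 0 <= s -> s <= t -> test s Phi -> test t Phi.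
Proof. by move=> s0 st [aPhi bPhi]; split => //; exact: (adapted_le emp s0 st). Qed.

Lemma test_measurable s Phi : 0 <= s -> test s Phi -> measurable_fun setT Phi.
Proof. by move=> s0 [aPhi _]; exact: (adapted_measurable (FW s0) aPhi). Qed.

Lemma test_sqint s Phi : 0 <= s -> test s Phi -> sqint P Phi.
Proof.
move=> s0 tPhi; apply: (@sqint_bounded _ _ _ _ 1); first exact: test_measurable tPhi.
by case: tPhi.
Qed.

Lemma test_nrm s Phi : 0 <= s -> test s Phi -> nrm P Phi <= 1.
Proof.
by move=> s0 tPhi; apply: nrm_le_bound => //; [exact: test_sqint tPhi|case: tPhi].
Qed.

Lemma test_mul_sqint s Phi (Z : W -> R) : 0 <= s -> test s Phi -> sqint P Z ->
  sqint P (fun w => Z w * Phi w) /\ nrm P (fun w => Z w * Phi w) <= nrm P Z.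
Proof.
move=> s0 tPhi sZ.
have h : sqint P (fun w => Z w * Phi w).
  by apply: (@sqint_mul_bounded _ _ _ _ 1) => //; [exact: test_measurable tPhi|case: tPhi].
split => //; apply: nrm_le => // w; rewrite normrM ler_piMr//; by case: tPhi.
Qed.

Lemma test_mul_adapted s t Phi (Z : W -> R) : 0 <= s -> s <= t -> test s Phi ->
  adapted (F t) Z -> adapted (F t) (fun w => Z w * Phi w).
Proof.
move=> s0 st tPhi aZ; have t0 := le_trans s0 st.
have [aPhi _] := test_le s0 st tPhi.
by apply/(adaptedP (sF t0)); apply: measurable_funM; exact/(adaptedP (sF t0)).
Qed.

Lemma test_mean_mul s Phi (Z : W -> R) : 0 <= s -> test s Phi -> L1 P Z ->
  L1 P (fun w => Z w * Phi w) /\ `|mean P (fun w => Z w * Phi w)| <= mean P (fun w => `|Z w|).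
Proof.
move=> s0 tPhi iZ.
have h : L1 P (fun w => Z w * Phi w).
  by apply: (@L1_mul_bounded _ _ _ _ 1) => //; [exact: test_measurable tPhi|case: tPhi].
split => //; apply: mean_norm_le => //; first exact: L1_norm.
by move=> w; rewrite normrM ler_piMr//; case: tPhi.
Qed.

Section one_function.
Variables u g : L2 pi.
Hypothesis ug : generator K u g.
Let su : sqint pi u := L2_sqint u.
Let sg : sqint pi g := L2_sqint g.
Let D := dynkin X u g.

Let mean_dynkin0 a b Phi := @mean_dynkin _ _ _ _ _ _ _ _ _ _ emp scK u g ug a b Phi.
Let D_sqint a b (a0 : 0 <= a) (ab : a <= b) : sqint P (D a b) :=
  (dynkin_sqint emp u g a0 ab).1.

(** A squared increment of [u] is the increment of [u^2] minus twice [u(X_s)] times the increment of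
    [u]; against an adapted factor the latter increment is interchangeable with the occupation
    integral of [g]. *)
Lemma dynkin_sqr_step s h Phi : 0 <= s -> 0 <= h -> test s Phi ->
  let U w := u (X (s + h) w) - u (X s w) in
  mean P (fun w => U w ^+ 2 * Phi w) =
  mean P (fun w => (u (X (s + h) w) ^+ 2 - u (X s w) ^+ 2) * Phi w)
  - 2 * mean P (fun w => occ X g s (s + h) w * (u (X s w) * Phi w)).
Proof.
move=> s0 h0 tPhi U; have sh0 := addr_ge0 s0 h0.
have ssh : s <= s + h by rewrite lerDl.
have s1 := process_sqint emp s0 su; have s2 := process_sqint emp sh0 su.
have [so _] := occ_sqint emp s0 ssh sg.
have [sup _] := test_mul_sqint s0 tPhi s1.
have aup : adapted (F s) (fun w => u (X s w) * Phi w).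
  by apply: (test_mul_adapted s0 (lexx s) tPhi); apply: (adapted_process emp s0); case: su.
have D0 := mean_dynkin0 s0 ssh sup aup.
have sD := D_sqint s0 ssh.
have i1 := sqintM sD sup; have i2 := sqintM so sup.
have e1 : mean P (fun w => U w * (u (X s w) * Phi w)) =
    mean P (fun w => occ X g s (s + h) w * (u (X s w) * Phi w)).
  rewrite (@eq_mean _ _ _ _ _ (fun w => D s (s + h) w * (u (X s w) * Phi w) +
    occ X g s (s + h) w * (u (X s w) * Phi w))); last by move=> w; rewrite -mulrDl subrK.
  by rewrite meanD// D0 add0r.
have iU := sqintM (sqintB s2 s1) sup.
have isq : L1 P (fun w => u (X (s + h) w) ^+ 2 - u (X s w) ^+ 2).
  by apply: L1B; [case: s2|case: s1].
have [iq _] := test_mean_mul s0 tPhi isq.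
rewrite -e1 -(meanZ 2 iU) -(meanB iq (L1Z 2 iU)).
by apply: eq_mean => w; rewrite /U; ring.
Qed.

(** For [Phi = 1] the increment of [u^2] has mean zero by stationarity. The resulting order [sqrt h]
    of an increment is what makes its product with the occupation integral an [o(h)]. *)
Lemma nrm_increment s h : 0 <= s -> 0 <= h ->
  nrm P (fun w => u (X (s + h) w) - u (X s w)) ^+ 2 <= 2 * (h * (nrm pi u * nrm pi g)).
Proof.
move=> s0 h0; have sh0 := addr_ge0 s0 h0; have ssh : s <= s + h by rewrite lerDl.
have t1 : test s (fun=> 1).
  split; last by move=> w; rewrite normr1.
  by apply/(adaptedP (sF s0)); exact: measurable_cst.
have := dynkin_sqr_step s0 h0 t1; move=> /= e.
rewrite sqr_nrm.
have {e}-> : mean P (fun w => (u (X (s + h) w) - u (X s w)) ^+ 2) =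
    - 2 * mean P (fun w => occ X g s (s + h) w * u (X s w)).
  transitivity (mean P (fun w => (u (X (s + h) w) - u (X s w)) ^+ 2 * 1)).
    by apply: eq_mean => w; rewrite mulr1.
  rewrite e (@eq_mean _ _ _ _ (fun w => (_ - _) * 1) (fun w => u (X (s + h) w) ^+ 2 - u (X s w) ^+ 2)); last first.
    by move=> w; rewrite mulr1.
  have [_ iu] := su.
  rewrite meanB; [|exact: (process_L1 emp sh0 iu)|exact: (process_L1 emp s0 iu)].
  rewrite (process_mean emp sh0 iu) (process_mean emp s0 iu) subrr sub0r mulNr.
  by congr (- (_ * _)); apply: eq_mean => w; rewrite mulr1.
have s1 := process_sqint emp s0 su.
have [so no] := occ_sqint emp s0 ssh sg.
apply: (le_trans (ler_norm _)); rewrite normrM normrN normr_nat ler_pM2l//.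
apply: (le_trans (norm_mean_mul_nrm so s1)).
rewrite (process_nrm emp s0 su) mulrA mulrAC ler_wpM2r ?nrm_ge0//.
by apply: le_trans no _; rewrite addrAC subrr add0r.
Qed.

(** The infinitesimal bracket of the martingale. The increment of [u^2] is kept as it stands, for
    [u^2] lies only in [L^1(pi)]; it is to be telescoped later. *)
Lemma dynkin_sqr_near (e : R) : 0 < e -> \forall h \near 0^'+,
  forall s Phi, 0 <= s -> test s Phi ->
  `|mean P (fun w => D s (s + h) w ^+ 2 * Phi w)
    - mean P (fun w => (u (X (s + h) w) ^+ 2 - u (X s w) ^+ 2) * Phi w)
    + 2 * (h * mean P (fun w => (u (X s w) * g (X s w)) * Phi w))| <= h * e.
Proof.
move=> e0.
pose nu := nrm pi u; pose ng := nrm pi g.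
have nu0 : 0 <= nu := nrm_ge0 _ _. have ng0 : 0 <= ng := nrm_ge0 _ _.
(* Three errors are collected: [2 nu e'] from the occupation integral against [u], [2 ng e'] from
   the cross term and [ng e'] from the squared occupation integral, all times [h]. *)
pose e' := e / (2 * nu + 3 * ng + 1).
have den0 : 0 < 2 * nu + 3 * ng + 1 by rewrite ltr_wpDl// addr_ge0// mulr_ge0.
have e'0 : 0 < e' by rewrite divr_gt0.
have p0 : 0 < 2 * (nu * ng) + 1 by rewrite ltr_wpDl// !mulr_ge0.
have q0 : 0 < e' ^+ 2 / (2 * (nu * ng) + 1) := divr_gt0 (exprn_gt0 2 e'0) p0.
near=> h => s Phi s0 tPhi.
have h0 : 0 < h by near: h; exact: nbhs_right_gt.
have h1 : h * ng <= e'.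
  have : h <= e' / (ng + 1) by near: h; apply: nbhs_right_le; rewrite divr_gt0// ltr_wpDl.
  rewrite ler_pdivlMr ?ltr_wpDl// => /(le_trans _); apply.
  by rewrite ler_pM2l// lerDl.
have h2 : 2 * (h * (nu * ng)) <= e' ^+ 2.
  have : h <= e' ^+ 2 / (2 * (nu * ng) + 1).
    by near: h; exact: nbhs_right_le.
  rewrite ler_pdivlMr// => /(le_trans _); apply.
  by rewrite mulrCA ler_pM2l// lerDl.
have b1 : forall s Phi, 0 <= s -> sqint P Phi -> adapted (F s) Phi ->
  `|mean P (fun w => occ X g s (s + h) w * Phi w) - h * mean P (fun w => g (X s w) * Phi w)| <=
  h * (e' * nrm P Phi).
  by near: h; exact: (mean_occ_near emp scK).
have hh0 := ltW h0; have sh0 := addr_ge0 s0 hh0; have ssh : s <= s + h by rewrite lerDl.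
have s1 := process_sqint emp s0 su; have s2 := process_sqint emp sh0 su.
have [so no] := occ_sqint emp s0 ssh sg; rewrite (addrAC s) subrr add0r in no.
have [sup nup] := test_mul_sqint s0 tPhi s1; rewrite (process_nrm emp s0 su) in nup.
have aup : adapted (F s) (fun w => u (X s w) * Phi w).
  by apply: (test_mul_adapted s0 (lexx s) tPhi); apply: (adapted_process emp s0); case: su.
have {}b1 := b1 s _ s0 sup aup.
pose U w := u (X (s + h) w) - u (X s w).
pose o := occ X g s (s + h).
have sU : sqint P U by exact: sqintB.
have nU : nrm P U <= e'.
  rewrite -ler_sqr ?nnegrE ?nrm_ge0 ?(ltW e'0)//.
  by apply: le_trans h2; exact: nrm_increment.
have eU := dynkin_sqr_step s0 hh0 tPhi.
have [sop nop] := test_mul_sqint s0 tPhi so.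
have iU2 : L1 P (fun w => U w ^+ 2 * Phi w) by apply: (test_mean_mul s0 tPhi _).1; case: sU.
have iUo := sqintM sU sop; have ioo := sqintM so sop.
have eD : mean P (fun w => D s (s + h) w ^+ 2 * Phi w) =
    mean P (fun w => U w ^+ 2 * Phi w) - 2 * mean P (fun w => U w * (o w * Phi w))
    + mean P (fun w => o w * (o w * Phi w)).
  rewrite -(meanZ 2 iUo) -(meanB iU2 (L1Z 2 iUo)) -(meanD (L1B iU2 (L1Z 2 iUo)) ioo).
  by apply: eq_mean => w; rewrite /D /dynkin -/(U w) -/(o w); ring.
have bUo : `|mean P (fun w => U w * (o w * Phi w))| <= e' * (h * ng).
  apply: (le_trans (norm_mean_mul_nrm sU sop)); apply: ler_pM; rewrite ?nrm_ge0//.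
  exact: le_trans no.
have boo : `|mean P (fun w => o w * (o w * Phi w))| <= (h * ng) * e'.
  apply: (le_trans (norm_mean_mul_nrm so sop)); apply: ler_pM; rewrite ?nrm_ge0//.
  by apply: le_trans (le_trans nop no) _.
have eg : mean P (fun w => g (X s w) * (u (X s w) * Phi w)) =
    mean P (fun w => (u (X s w) * g (X s w)) * Phi w).
  by apply: eq_mean => w; rewrite mulrCA mulrA.
rewrite eg in b1.
have b2 : h * (e' * nrm P (fun w => u (X s w) * Phi w)) <= h * (e' * nu).
  by rewrite ler_pM2l// ler_pM2l.
have {}b1 := le_trans b1 b2.
rewrite eD eU.
move: b1 bUo boo.
set A := mean P (fun w => o w * (u _ * _)).
set B := mean P (fun w => U w * _); set C := mean P (fun w => o w * (o w * _)).
set G := h * mean P _; set Q := mean P (fun w => (_ - _) * _).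
move=> b1 bUo boo.
rewrite (_ : _ + _ = - (2 * (A - G)) - 2 * B + C); last by ring.
apply: (@le_trans _ _ (2 * (h * (e' * nu)) + 2 * (e' * (h * ng)) + h * ng * e')).
  apply: (le_trans (ler_normD _ _)); apply: lerD => //.
  apply: (le_trans (ler_normB _ _)); rewrite normrN !normrM normr_nat.
  by apply: lerD; rewrite ler_pM2l.
rewrite (_ : _ + _ = h * (e' * (2 * nu + 3 * ng))); last by ring.
rewrite ler_pM2l// /e' mulrAC ler_pdivrMr// ler_pM2l// lerDl//.
Unshelve. all: by end_near. Qed.

(** The cross terms vanish: the martingale accumulated so far, times [Phi], is an adapted
    square-integrable factor for the next increment. *)
Lemma dynkin_sqr_sum (a h : R) (n : nat) Phi : 0 <= a -> 0 <= h -> test a Phi ->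
  mean P (fun w => D a (a + n%:R * h) w ^+ 2 * Phi w) =
  \sum_(k < n) mean P (fun w => D (a + k%:R * h) (a + k%:R * h + h) w ^+ 2 * Phi w).
Proof.
move=> a0 h0 tPhi; elim: n => [|n ih].
  rewrite big_ord0 mul0r addr0 (@eq_mean _ _ _ _ _ (fun=> 0)) ?mean_cst// => w.
  by rewrite /D /dynkin occ_refl !subrr expr0n mul0r.
rewrite big_ord_recr/= -ih.
set c := a + n%:R * h.
have ac : a <= c by rewrite lerDl mulr_ge0.
have cc : c <= c + h by rewrite lerDl.
have c0 := le_trans a0 ac.
rewrite (_ : a + n.+1%:R * h = c + h); last by rewrite /c -natr1; ring.
have s1 := D_sqint a0 ac; have s2 := D_sqint c0 cc.
have s3 := D_sqint a0 (le_trans ac cc).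
have [t1 _] := test_mul_sqint a0 tPhi s1.
have at1 := test_mul_adapted a0 ac tPhi (dynkin_adapted emp u g a0 ac).
have := mean_dynkin0 c0 cc t1 at1; rewrite -/D => cross.
have isq a' b' : sqint P (D a' b') -> L1 P (fun w => D a' b' w ^+ 2 * Phi w).
  by move=> [_ i]; exact: (test_mean_mul a0 tPhi i).1.
have ix := sqintM s2 t1.
have -> : mean P (fun w => D a (c + h) w ^+ 2 * Phi w) =
    mean P (fun w => (D a c w ^+ 2 * Phi w + D c (c + h) w ^+ 2 * Phi w)
      + 2 * (D c (c + h) w * (D a c w * Phi w))).
  apply: ae_mean.
  - exact: (L1_measurable (isq _ _ s3)).
  - apply: (@L1_measurable _ _ _ P); apply: L1D (L1Z 2 ix).
    exact: L1D (isq _ _ s1) (isq _ _ s2).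
  - apply: filterS (dynkin_add emp u g a0 ac cc) => w; rewrite -/D => ->; ring.
rewrite (meanD (L1D (isq _ _ s1) (isq _ _ s2)) (L1Z 2 ix)) (meanZ 2 ix) cross mulr0 addr0.
by rewrite (meanD (isq _ _ s1) (isq _ _ s2)).
Qed.

Lemma test_increment (f : S -> R) a b Phi : 0 <= a -> a <= b -> test a Phi -> L1 pi f ->
  `|mean P (fun w => (f (X b w) - f (X a w)) * Phi w)| <= 2 * mean pi (fun x => `|f x|).
Proof.
move=> a0 ab tPhi i_f; have b0 := le_trans a0 ab.
have ia := process_L1 emp a0 i_f; have ib := process_L1 emp b0 i_f.
apply: (le_trans (test_mean_mul a0 tPhi (L1B ib ia)).2).
apply: (@le_trans _ _ (mean P (fun w => `|f (X b w)| + `|f (X a w)|))).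
  apply: mean_le; [exact/L1_norm/L1B|by apply: L1D; exact: L1_norm|].
  by move=> w; exact: ler_normB.
rewrite (meanD (L1_norm ib) (L1_norm ia)).
rewrite (process_mean emp b0 (L1_norm i_f)) (process_mean emp a0 (L1_norm i_f)).
by rewrite le_eqVlt; apply/orP; left; apply/eqP; ring.
Qed.

Lemma telescope_increment (f : S -> R) a h n Phi : 0 <= a -> 0 <= h -> test a Phi -> L1 pi f ->
  \sum_(k < n) mean P (fun w => (f (X (a + k%:R * h + h) w) - f (X (a + k%:R * h) w)) * Phi w) =
  mean P (fun w => (f (X (a + n%:R * h) w) - f (X a w)) * Phi w).
Proof.
move=> a0 h0 tPhi i_f; elim: n => [|n ih].
  rewrite big_ord0 mul0r addr0 (@eq_mean _ _ _ _ _ (fun=> 0)) ?mean_cst// => w.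
  by rewrite subrr mul0r.
rewrite big_ord_recr/= ih.
have c0 k : 0 <= a + k%:R * h by rewrite addr_ge0// mulr_ge0.
have iX t : 0 <= t -> L1 P (fun w => f (X t w)) by move=> t0; exact: (process_L1 emp t0 i_f).
have e1 : a + n.+1%:R * h = a + n%:R * h + h by rewrite -natr1; ring.
have j1 := (test_mean_mul a0 tPhi (L1B (iX _ (c0 n)) (iX _ a0))).1.
have j2 := (test_mean_mul a0 tPhi (L1B (iX _ (c0 n.+1)) (iX _ (c0 n)))).1.
rewrite e1 in j2 *.
by rewrite -(meanD j1 j2); apply: eq_mean => w; ring.
Qed.

(* [sum_k D_k^2] is compared with the telescoping sum of [u(X)^2], whose
  expectation stays bounded. *)
Lemma dynkin_sqr_riemann (e : R) : 0 < e -> \forall h \near 0^'+,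
  forall a (n : nat) Phi, 0 <= a -> test a Phi ->
  `|mean P (fun w => D a (a + n%:R * h) w ^+ 2 * Phi w)
    + 2 * (h * \sum_(k < n) mean P (fun w =>
        (u (X (a + k%:R * h) w) * g (X (a + k%:R * h) w)) * Phi w))| <=
  2 * nrm pi u ^+ 2 + n%:R * h * e.
Proof.
move=> e0; near=> h => a n Phi a0 tPhi.
have h0 : 0 < h by near: h; exact: nbhs_right_gt.
have hstep : forall s Phi, 0 <= s -> test s Phi ->
  `|mean P (fun w => D s (s + h) w ^+ 2 * Phi w)
    - mean P (fun w => (u (X (s + h) w) ^+ 2 - u (X s w) ^+ 2) * Phi w)
    + 2 * (h * mean P (fun w => (u (X s w) * g (X s w)) * Phi w))| <= h * e.
  by near: h; exact: dynkin_sqr_near.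
have hh0 := ltW h0.
have [_ iu2] := su.
rewrite (dynkin_sqr_sum n a0 hh0 tPhi).
have tele := telescope_increment n a0 hh0 tPhi iu2.
have binc : `|mean P (fun w => (u (X (a + n%:R * h) w) ^+ 2 - u (X a w) ^+ 2) * Phi w)| <=
    2 * nrm pi u ^+ 2.
  have an : a <= a + n%:R * h by rewrite lerDl mulr_ge0.
  apply: (le_trans (test_increment a0 an tPhi iu2)).
  by rewrite sqr_nrm ler_pM2l// le_eqVlt; apply/orP; left; apply/eqP; apply: eq_mean => x; rewrite ger0_norm// sqr_ge0.
rewrite -tele in binc.
set s1 := \sum_(k < n) _; set s3 := \sum_(k < n) _.
set s2 := \sum_(k < n) _ in binc.
rewrite (_ : s1 + _ = s2 + (s1 - s2 + 2 * (h * s3))); last by ring.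
apply: (le_trans (ler_normD _ _)); apply: lerD => //.
rewrite /s1 /s2 /s3 -sumrB !mulr_sumr -big_split/=.
apply: (le_trans (ler_norm_sum _ _ _)).
rewrite (_ : n%:R * h * e = \sum_(k < n) h * e); last first.
  by rewrite sumr_const card_ord -mulrA mulr_natl.
apply: ler_sum => k _; apply: hstep; first by rewrite addr_ge0// mulr_ge0.
by apply: (test_le a0) tPhi; rewrite lerDl mulr_ge0.
Unshelve. all: by end_near. Qed.

(** The substitute for an ergodic theorem: against a test weight, the time integral of [g] has the
    same mean as an increment of [u], whose size does not depend on the length of the window. *)
Lemma generator_riemann (e : R) : 0 < e -> \forall h \near 0^'+,
  forall a (n : nat) Phi, 0 <= a -> test a Phi ->
  `|h * \sum_(k < n) mean P (fun w => g (X (a + k%:R * h) w) * Phi w)| <=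
  2 * nrm pi u + n%:R * h * e.
Proof.
move=> e0; near=> h => a n Phi a0 tPhi.
have h0 : 0 < h by near: h; exact: nbhs_right_gt.
have hstep : forall s Phi, 0 <= s -> sqint P Phi -> adapted (F s) Phi ->
  `|mean P (fun w => occ X g s (s + h) w * Phi w) - h * mean P (fun w => g (X s w) * Phi w)| <=
  h * (e * nrm P Phi).
  by near: h; exact: (mean_occ_near emp scK).
have hh0 := ltW h0; have iu := sqint_L1 su.
have tele := telescope_increment n a0 hh0 tPhi iu.
have binc : `|mean P (fun w => (u (X (a + n%:R * h) w) - u (X a w)) * Phi w)| <= 2 * nrm pi u.
  have an : a <= a + n%:R * h by rewrite lerDl mulr_ge0.
  apply: (le_trans (test_increment a0 an tPhi iu)); rewrite ler_pM2l//.
  have sa : sqint pi (fun x => `|u x|).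
    by apply: (sqint_le _ su) => [|x]; [apply: measurableT_comp => //; case: su|rewrite normr_id].
  apply: (le_trans (ler_norm _)); apply: (le_trans (norm_mean_nrm sa)).
  by apply: nrm_le => // x; rewrite normr_id.
rewrite -tele in binc.
set s2 := \sum_(k < n) _ in binc; set s3 := \sum_(k < n) _.
rewrite -(subrK s2 (h * s3)) addrC.
apply: (le_trans (ler_normD _ _)); apply: lerD => //.
rewrite distrC /s2 /s3 mulr_sumr -sumrB.
apply: (le_trans (ler_norm_sum _ _ _)).
rewrite (_ : n%:R * h * e = \sum_(k < n) h * e); last first.
  by rewrite sumr_const card_ord -mulrA mulr_natl.
apply: ler_sum => k _; have k0 : 0 <= a + k%:R * h by rewrite addr_ge0// mulr_ge0.
have ak : a <= a + k%:R * h by rewrite lerDl mulr_ge0.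
have kk : a + k%:R * h <= a + k%:R * h + h by rewrite lerDl.
have tk := test_le a0 ak tPhi.
have sPhi := test_sqint a0 tPhi; have [aPhi _] := tk.
have D0 := mean_dynkin0 k0 kk sPhi aPhi.
have [so _] := occ_sqint emp k0 kk sg.
have sU : sqint P (fun w => u (X (a + k%:R * h + h) w) - u (X (a + k%:R * h) w)).
  by apply: sqintB; apply: (process_sqint emp _ su) => //; exact: le_trans kk.
rewrite (_ : mean P (fun w => (_ - _) * _) = mean P (fun w => occ X g (a + k%:R * h) (a + k%:R * h + h) w * Phi w)); last first.
  apply/eqP; rewrite -subr_eq0 -(meanB (sqintM sU sPhi) (sqintM so sPhi)).
  by apply/eqP; rewrite -[RHS]D0; apply: eq_mean => w; rewrite /dynkin; ring.
apply: (le_trans (hstep _ _ k0 sPhi aPhi)); rewrite ler_pM2l// ler_piMr ?(ltW e0)//.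
exact: test_nrm tPhi.
Unshelve. all: by end_near. Qed.

End one_function.
Hypothesis ranK : forall g : L2 pi, (exists f : L2 pi, generator K f g) <-> g \in mean_zero pi.

Lemma bounded_L2 (b : S -> R) (M : R) : measurable_fun setT b -> (forall x, `|b x| <= M) ->
  exists f : L2 pi, forall x, f x = b x.
Proof.
move=> mb bM.
have sb : sqint pi b by exact: (@sqint_bounded _ _ _ _ M).
have bL : b \in Lfun pi 2%:E.
  rewrite inE; apply/andP; split; rewrite inE//= /finite_norm.
  rewrite (@lty_poweRy _ _ 2)// poweR_Lnorm//.
  have [_ /integrableP[_]] := sb; congr (_ < _)%E; apply: eq_integral => x _.
  by rewrite /= powR_mulrn// real_normK ?num_real// ger0_norm// sqr_ge0.
by exists (Lfun_Sub (lee1n 2) bL) => x; rewrite Lfun_valP.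
Qed.

(** Truncating [v] and subtracting the mean of the truncation gives a bounded function of mean zero,
    hence an element of the range of the generator; both changes are small in [L^1]. *)
Lemma L1_approx_generator (v : S -> R) (e : R) : L1 pi v -> 0 < e ->
  exists f g : L2 pi, generator K f g /\
    mean pi (fun x => `|v x - mean pi v - g x|) <= e.
Proof.
move=> iv e0; have mv := L1_measurable iv.
pose b (n : nat) x := n.+1%:R * sin (n.+1%:R^-1 * v x).
have mb n : measurable_fun setT (b n).
  by apply: measurable_funM => //; apply: measurable_sin; exact: measurable_funM.
have ib n : L1 pi (b n).
  by apply: (@L1_bounded _ _ _ _ n.+1%:R) => // x; exact: norm_scaled_sin.
have bv n x : `|b n x| <= `|v x|.
  rewrite /b normrM normr_nat; have := norm_sin_le (n.+1%:R^-1 * v x).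
  by rewrite normrM normfV normr_nat ler_pdivlMl.
have [||||_ h1] := @dominated_mean _ _ _ pi (fun n x => `|v x - b n x|) (fun=> 0)
    (fun x => `|v x| + `|v x|).
- by move=> n; apply: measurableT_comp => //; exact: measurable_funB.
- by apply: L1D; exact: L1_norm.
- by move=> n x; rewrite normr_id (le_trans (ler_normB _ _))// lerD2l.
- move=> x; rewrite -[X in _ --> X](normr0 R) -[in X in _ --> X](subrr (v x)).
  by apply: cvg_norm; apply: cvgB; [exact: cvg_cst|exact: cvg_sin_scaled].
rewrite mean_cst in h1; have e20 : 0 < e / 2 by rewrite divr_gt0.
move/cvgrPdist_le : h1 => /(_ _ e20)[n _ /(_ n (leqnn n)) hn].
rewrite /= sub0r normrN ger0_norm ?mean_ge0// in hn.
have [||g hg] := @bounded_L2 (fun x => b n x - mean pi (b n)) (n.+1%:R + `|mean pi (b n)|).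
- exact: measurable_funB.
- by move=> x; rewrite (le_trans (ler_normB _ _))// lerD2r; exact: norm_scaled_sin.
have gz : g \in mean_zero pi.
  rewrite unfold_in; apply/eqP.
  have := @meanB _ _ _ pi _ _ (ib n) (L1_cst pi (mean pi (b n))).
  rewrite mean_cst subrr => <-.
  by apply: eq_Rintegral => x _; rewrite hg.
have [f hf] := (ranK g).2 gz.
exists f, g; split => //.
have ivb : L1 pi (fun x => v x - b n x) by exact: L1B.
have mvb : `|mean pi (fun x => v x - b n x)| <= e / 2.
  exact: le_trans (mean_norm ivb) hn.
apply: (@le_trans _ _ (mean pi (fun x => `|v x - b n x| + `|mean pi (fun x => v x - b n x)|))).
  apply: mean_le.
  - apply: L1_norm; apply: L1B; first by apply: L1B => //; exact: L1_cst.
    by apply: sqint_L1; exact: L2_sqint.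
  - by apply: L1D; [exact: L1_norm|exact: L1_cst].
  - move=> x; rewrite hg meanB//.
    rewrite (_ : _ - _ - _ = (v x - b n x) - (mean pi v - mean pi (b n))); last by ring.
    exact: ler_normB.
rewrite (meanD (L1_norm ivb) (L1_cst pi _)) mean_cst [leRHS]splitr.
by apply: lerD.
Qed.

(** The sums of [u g] along a mesh, produced by [dynkin_sqr_riemann], are compared with those of its
    mean plus an element [k] of the range, which [generator_riemann] controls on the same mesh.
    Errors are either constants or small multiples of [L]. *)
Lemma dynkin_second_moment (u g : L2 pi) (e : R) : generator K u g -> 0 < e ->
  exists2 L0 : R, 0 < L0 & forall L a Phi, L0 <= L -> 0 <= a -> test a Phi ->
  `|mean P (fun w => dynkin X u g a (a + L) w ^+ 2 * Phi w)
    + 2 * mean pi (fun x => u x * g x) * L * mean P Phi| <= L * e.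
Proof.
move=> ug e0.
have su := L2_sqint u; have sg := L2_sqint g.
pose v x := u x * g x; have iv : L1 pi v by exact: sqintM.
(* Five errors [L * e'] arise in total: one for the martingale, two for the approximation of [u g]
   and two for [k]. Together with [c <= L * e / 2] they stay below [L * e]. *)
pose e' := e / 16; have e'0 : 0 < e' by rewrite divr_gt0.
have [f [k [fk ek]]] := L1_approx_generator iv e'0.
(* The boundary terms of the two telescoping sums, independent of [L]; the threshold [L0] makes them
   at most [L * e / 2]. *)
pose c := 2 * nrm pi u ^+ 2 + 4 * nrm pi f.
have c0 : 0 <= c by rewrite addr_ge0 ?mulr_ge0 ?exprn_ge0 ?nrm_ge0.
exists (2 * (c + 1) / e) => [|L a Phi LL a0 tPhi].
  by rewrite divr_gt0// mulr_gt0// ltr_wpDl.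
have L0 : 0 < L by apply: lt_le_trans LL; rewrite divr_gt0// mulr_gt0// ltr_wpDl.
have [r /= r0 hr] := filterI (dynkin_sqr_riemann ug e'0) (generator_riemann fk e'0).
pose n := Num.truncn (L / r); pose h := L / n.+1%:R.
have nr : h < r by rewrite ltr_pdivrMr// mulrC -ltr_pdivrMr// truncnS_gt.
have h0 : 0 < h by rewrite divr_gt0.
have [] := hr h _ h0; first by rewrite /= sub0r normrN gtr0_norm.
move=> /(_ a n.+1 Phi a0 tPhi) b1 /(_ a n.+1 Phi a0 tPhi) b2.
have nh : n.+1%:R * h = L by rewrite /h mulrC divfK ?pnatr_eq0.
rewrite nh in b1 b2.
have t0 j : 0 <= a + j%:R * h by rewrite addr_ge0// mulr_ge0// ltW.
have iPhi := sqint_L1 (test_sqint a0 tPhi).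
have b3 : `|h * (\sum_(j < n.+1) mean P (fun w => v (X (a + j%:R * h) w) * Phi w)) - mean pi v * L * mean P Phi
   - h * (\sum_(j < n.+1) mean P (fun w => k (X (a + j%:R * h) w) * Phi w))| <= L * e'.
  rewrite (_ : mean pi v * L * mean P Phi = h * \sum_(j < n.+1) mean pi v * mean P Phi); last first.
    by rewrite sumr_const card_ord -mulr_natl -nh; ring.
  rewrite -!mulrBr normrM gtr0_norm// -!sumrB -nh -mulrA [h * e']mulrC mulrA [leRHS]mulrC.
  rewrite ler_pM2l//.
  apply: (le_trans (ler_norm_sum _ _ _)).
  rewrite (_ : n.+1%:R * e' = \sum_(j < n.+1) e'); last by rewrite sumr_const card_ord mulr_natl.
  apply: ler_sum => j _.
  have iv' := process_L1 emp (t0 j) iv.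
  have ik := sqint_L1 (L2_sqint k); have ik' := process_L1 emp (t0 j) ik.
  have j1 := (test_mean_mul a0 tPhi iv').1; have j2 := (test_mean_mul a0 tPhi ik').1.
  have iz : L1 pi (fun x => v x - mean pi v - k x).
    by apply: L1B => //; apply: L1B => //; exact: L1_cst.
  have iz' := process_L1 emp (t0 j) iz.
  rewrite -(meanZ (mean pi v) iPhi) -(meanB j1 (L1Z _ iPhi)) -(meanB (L1B j1 (L1Z _ iPhi)) j2).
  rewrite (@eq_mean _ _ _ _ _ (fun w => (fun x => v x - mean pi v - k x) (X (a + j%:R * h) w) * Phi w)); last first.
    by move=> w /=; ring.
  apply: (le_trans (test_mean_mul a0 tPhi iz').2).
  by rewrite (process_mean emp (t0 j) (L1_norm iz)).
have cL : c <= L * (e / 2).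
  have : 2 * (c + 1) <= L * e by rewrite -ler_pdivrMr.
  lra.
move: b1 b2 b3; rewrite -/v.
set A := mean P _; set B := h * _; set C := h * _; set G := mean pi v * L * mean P Phi.
move=> b1 b2 b3.
rewrite (_ : A + _ = (A + 2 * B) - 2 * (B - G - C) - 2 * C); last by rewrite /G; ring.
apply: (le_trans (ler_normB _ _)).
have b4 : `|A + 2 * B - 2 * (B - G - C)| <= (2 * nrm pi u ^+ 2 + L * e') + 2 * (L * e').
  by apply: (le_trans (ler_normB _ _)); apply: lerD => //; rewrite normrM normr_nat ler_pM2l.
apply: (le_trans (lerD b4 (lexx _))); rewrite normrM normr_nat.
have b5 : 2 * `|C| <= 2 * (2 * nrm pi f + L * e') by rewrite ler_pM2l.
apply: (le_trans (lerD (lexx _) b5)).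
move: cL; rewrite /c /e'; have := mulr_gt0 L0 e0.
set N := nrm pi u ^+ 2; set M := nrm pi f => Le cL.
have e5 : L * (e / 16) = L * e / 16 by rewrite mulrA.
have e6 : L * (e / 2) = L * e / 2 by rewrite mulrA.
rewrite e5; rewrite e6 in cL; lra.
Qed.

End second_moment.

(** * Central limit theorem by blocks *)

Section truncation.
Context (d : measure_display) (S : measurableType d) (R : realType) (pi : probability S R).

Lemma sqint_truncation (f : S -> R) (e : R) : sqint pi f -> 0 < e ->
  exists n : nat, nrm pi (fun x => f x - n.+1%:R * sin (n.+1%:R^-1 * f x)) <= e.
Proof.
move=> sf e0; have [mf i_f] := sf.
pose b (n : nat) x := n.+1%:R * sin (n.+1%:R^-1 * f x).
have mb n : measurable_fun setT (b n).
  by apply: measurable_funM => //; apply: measurable_sin; exact: measurable_funM.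
have bf n x : `|b n x| <= `|f x|.
  rewrite /b normrM normr_nat; have := norm_sin_le (n.+1%:R^-1 * f x).
  by rewrite normrM normfV normr_nat ler_pdivlMl.
have [||||_ h1] := @dominated_mean _ _ _ pi (fun n x => (f x - b n x) ^+ 2) (fun=> 0)
    (fun x => 4 * f x ^+ 2).
- by move=> n; apply: measurable_funX; exact: measurable_funB.
- exact: L1Z.
- move=> n x; rewrite ger0_norm ?sqr_ge0// -real_normK ?num_real//.
  have -> : 4 * f x ^+ 2 = (`|f x| + `|f x|) ^+ 2.
    by rewrite -(real_normK (num_real (f x))); ring.
  by rewrite ler_sqr ?nnegrE ?addr_ge0// (le_trans (ler_normB _ _))// lerD2l.
- move=> x; have h := cvg_subn (@cvg_cstn R (f x)) (@cvg_sin_scaled R (f x)).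
  have := cvg_muln h h; rewrite subrr mul0r => h2.
  by apply: (cvg_eqn h2) => n; rewrite expr2.
rewrite mean_cst in h1; have e20 : 0 < e ^+ 2 by rewrite exprn_gt0.
move/cvgrPdist_le : h1 => /(_ _ e20)[n _ /(_ n (leqnn n)) hn].
exists n; rewrite -ler_sqr ?nnegrE ?nrm_ge0 ?(ltW e0)// sqr_nrm.
by apply: le_trans hn; rewrite sub0r normrN ler_norm.
Qed.

End truncation.

(** The cubic bound is used when [y] dominates and the quadratic one when [z] does; in the
    application [y] is bounded and [z] small in [L^2]. *)
Lemma min_cubic_add (R : realType) (y z s : R) : 0 <= s ->
  Num.min ((y + z) ^+ 2) (s * `|y + z| ^+ 3) <= 8 * (s * `|y| ^+ 3) + 4 * z ^+ 2.
Proof.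
move=> s0; have [yz|/ltW zy] := leP `|z| `|y|.
  apply: (@le_trans _ _ (s * `|y + z| ^+ 3)); first by rewrite ge_min lexx orbT.
  apply: (@le_trans _ _ (8 * (s * `|y| ^+ 3))); last by rewrite lerDl mulr_ge0// sqr_ge0.
  have -> : 8 * (s * `|y| ^+ 3) = s * (`|y| + `|y|) ^+ 3 by ring.
  by rewrite ler_wpM2l// lerXn2r ?nnegrE ?addr_ge0// (le_trans (ler_normD _ _))// lerD2l.
apply: (@le_trans _ _ ((y + z) ^+ 2)); first by rewrite ge_min lexx.
apply: (@le_trans _ _ (4 * z ^+ 2)); last by rewrite lerDr mulr_ge0// mulr_ge0// exprn_ge0.
rewrite -(real_normK (num_real (y + z))) -(real_normK (num_real z)).
have -> : 4 * `|z| ^+ 2 = (`|z| + `|z|) ^+ 2 by ring.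
by rewrite ler_sqr ?nnegrE ?addr_ge0// (le_trans (ler_normD _ _))// lerD2r.
Qed.

Lemma expR_taylor2 (R : realType) (y : R) : 0 <= y ->
  `|expR (- y) - (1 - y)| <= 2^-1 * y ^+ 2.
Proof.
move=> y0.
have h1 : 1 - y <= expR (- y) by have := expR_ge1Dx (- y); rewrite addrC; lra.
rewrite ger0_norm ?subr_ge0//.
have df (x : R) : is_derive x 1 (fun x => 2^-1 * x ^+ 2 - (expR (- x) - (1 - x)))
    (2^-1 * 2%:R * x ^+ 1 - (- expR (- x) - (0 - 1))).
  apply: is_derive_sub; first exact: is_derive_monomial.
  have hB : is_derive x 1 (fun y => 1 - y) (0 - 1).
    exact: is_derive_sub (is_derive_cst _ _ _) (is_derive_id _ _).
  apply: is_derive_sub hB.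
  have h : is_derive x 1 (fun t : R => - t) (- 1) by exact: is_deriveN.
  have := @is_derive1_comp _ expR (fun t => - t) x _ _ (is_derive_expR _) h.
  by rewrite mulrN1.
have := is_derive_ge0 df _ _ y0; rewrite subr_ge0; apply.
- by rewrite oppr0 expR0; ring.
- by move=> x x0; have := expR_ge1Dx (- x); rewrite expr1; lra.
Qed.

(** * One block: Lindeberg bound and cosine expansion *)

Section block.
Context (d dS : measure_display) (W : measurableType d) (S : measurableType dS)
  (R : realType) (P : probability W R) (pi : probability S R)
  (K : R -> R.-pker S ~> S) (F : R -> set (set W)) (X : R -> W -> S).
Hypothesis emp : ergodic_markov_process P pi K F X.
Hypothesis scK : strongly_continuous pi K.
Hypothesis ranK : forall g : L2 pi, (exists f : L2 pi, generator K f g) <-> g \in mean_zero pi.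

Let sF t : 0 <= t -> sigma_algebra setT (F t).
Proof. by have [h _ _] := emp_filtration emp; exact: h. Qed.

Let FW t : 0 <= t -> F t `<=` measurable.
Proof. by have [_ h _] := emp_filtration emp; exact: h. Qed.

Variables u g : L2 pi.
Hypothesis ug : generator K u g.
Let su : sqint pi u := L2_sqint u.
Let sg : sqint pi g := L2_sqint g.
Let D := dynkin X u g.
Let sig2 : R := - 2 * mean pi (fun x => u x * g x).

(** The martingale over a block splits into [D1], built from truncations of [u] and [g] and hence
    bounded, and [D2], small in [L^2]. By stationarity neither bound depends on the position [a]. *)
Lemma lindeberg_block (L e : R) : 0 <= L -> 0 < e -> exists2 M : R, 0 <= M &
  forall a s, 0 <= a -> 0 <= s ->
  mean P (fun w => Num.min (D a (a + L) w ^+ 2) (s * `|D a (a + L) w| ^+ 3)) <= e + M * s.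
Proof.
move=> L0 e0.
(* Chosen so that the norm [(2 + L) * r] of [D2] is [sqrt e / 2], hence [4] times its square is
   [e]. *)
pose r := Num.sqrt e / (2 * (2 + L)).
have L2 : 0 < 2 * (2 + L) by rewrite mulr_gt0// ltr_pwDl.
have r0 : 0 < r by rewrite divr_gt0 ?sqrtr_gt0.
have [n1 hn1] := sqint_truncation su r0; have [n2 hn2] := sqint_truncation sg r0.
pose N : R := (maxn n1 n2).+1%:R.
pose u1 x := n1.+1%:R * sin (n1.+1%:R^-1 * u x); pose g1 x := n2.+1%:R * sin (n2.+1%:R^-1 * g x).
have [mu _] := su; have [mg _] := sg.
have mu1 : measurable_fun setT u1.
  by apply: measurable_funM => //; apply: measurable_sin; exact: measurable_funM.
have mg1 : measurable_fun setT g1.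
  by apply: measurable_funM => //; apply: measurable_sin; exact: measurable_funM.
have u1N x : `|u1 x| <= N.
  by rewrite (le_trans (norm_scaled_sin _ _))// ler_nat ltnS leq_maxl.
have g1N x : `|g1 x| <= N.
  by rewrite (le_trans (norm_scaled_sin _ _))// ler_nat ltnS leq_maxr.
have su1 : sqint pi u1 by exact: (@sqint_bounded _ _ _ _ N).
have sg1 : sqint pi g1 by exact: (@sqint_bounded _ _ _ _ N).
pose C := 2 * N + L * N.
have C0 : 0 <= C by rewrite addr_ge0// mulr_ge0.
exists (8 * C ^+ 3) => [|a s a0 s0]; first by rewrite mulr_ge0// exprn_ge0.
have b0 : 0 <= a + L by rewrite addr_ge0.
have ab : a <= a + L by rewrite lerDl.
pose D1 w := u1 (X (a + L) w) - u1 (X a w) - occ X g1 a (a + L) w.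
pose D2 w := D a (a + L) w - D1 w.
have D1C w : `|D1 w| <= C.
  rewrite /D1 /C (le_trans (ler_normB _ _))// lerD//.
    by rewrite (le_trans (ler_normB _ _))// mulr_natl mulr2n lerD.
  apply: (le_trans (occ_bounded emp w a0 ab mg1 g1N)).
  by rewrite addrAC subrr add0r.
have [sD _] := dynkin_sqint emp u g a0 ab.
have [so1 _] := occ_sqint emp a0 ab sg1; have [so _] := occ_sqint emp a0 ab sg.
have sX f t : 0 <= t -> sqint pi f -> sqint P (fun w => f (X t w)).
  by move=> t0; exact: (process_sqint emp t0).
have sD1 : sqint P D1 by apply: sqintB => //; apply: sqintB; exact: sX.
have sD2 : sqint P D2 by exact: sqintB.
have suB : sqint pi (fun x => u x - u1 x) by exact: sqintB.
have sgB : sqint pi (fun x => g x - g1 x) by exact: sqintB.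
have nD2 : nrm P D2 <= (2 + L) * r.
  have [sob nob] := occ_sqint emp a0 ab sgB.
  have e1 : nrm P D2 = nrm P (fun w => ((fun x => u x - u1 x) (X (a + L) w)
      - (fun x => u x - u1 x) (X a w)) - occ X (fun x => g x - g1 x) a (a + L) w).
    apply: ae_nrm; first by case: sD2.
      have : sqint P (fun w => ((fun x => u x - u1 x) (X (a + L) w)
        - (fun x => u x - u1 x) (X a w)) - occ X (fun x => g x - g1 x) a (a + L) w).
        by apply: sqintB => //; apply: sqintB; exact: (sX (fun x => u x - u1 x)).
      by case.
    have := occ_linear emp (-1) a0 ab sg1 sg.
    apply: filterS => w /= ew; rewrite /D2 /D1 /D /dynkin.
    rewrite (_ : (fun x => g x - g1 x) = (fun x => -1 * g1 x + g x)); last first.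
      by apply/funext => x; rewrite mulN1r addrC.
    by rewrite ew; ring.
  rewrite e1; have s1 := sX _ _ b0 suB; have s2 := sX _ _ a0 suB.
  apply: (le_trans (nrmB (sqintB s1 s2) sob)).
  rewrite mulrDl; apply: lerD.
    apply: (le_trans (nrmB s1 s2)).
    rewrite (process_nrm emp b0 suB) (process_nrm emp a0 suB).
    have -> : 2 * r = r + r by ring.
    exact: lerD.
  by rewrite (le_trans nob)// addrAC subrr add0r ler_wpM2l.
have mD : measurable_fun setT (D a (a + L)) by case: sD.
have i1 : L1 P (fun w => 8 * (s * `|D1 w| ^+ 3) + 4 * D2 w ^+ 2).
  apply: L1D; last by apply: L1Z; case: sD2.
  apply: (@L1_bounded _ _ _ _ (8 * (s * C ^+ 3))).
    apply: measurable_funM => //; apply: measurable_funM => //; apply: measurable_funX.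
    by apply: measurableT_comp => //; case: sD1.
  move=> w; rewrite ger0_norm ?mulr_ge0 ?exprn_ge0// ler_pM2l// ler_wpM2l//.
  by rewrite lerXn2r ?nnegrE.
have le w : Num.min (D a (a + L) w ^+ 2) (s * `|D a (a + L) w| ^+ 3) <=
    8 * (s * `|D1 w| ^+ 3) + 4 * D2 w ^+ 2.
  have := min_cubic_add (D1 w) (D2 w) s0.
  by rewrite (_ : D1 w + D2 w = D a (a + L) w)// /D2; ring.
have i0 : L1 P (fun w => Num.min (D a (a + L) w ^+ 2) (s * `|D a (a + L) w| ^+ 3)).
  apply: (L1_le _ i1) => [|w].
    apply: measurable_minr; first exact: measurable_funX.
    by apply: measurable_funM => //; apply: measurable_funX; exact: measurableT_comp.
  by rewrite ger0_norm// le_min sqr_ge0 mulr_ge0// exprn_ge0.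
apply: (le_trans (mean_le i0 i1 le)).
have iD2 : L1 P (fun w => D2 w ^+ 2) by case: sD2.
have i3 : L1 P (fun w => 8 * (s * `|D1 w| ^+ 3)).
  apply: (@L1_bounded _ _ _ _ (8 * (s * C ^+ 3))).
    apply: measurable_funM => //; apply: measurable_funM => //; apply: measurable_funX.
    by apply: measurableT_comp => //; case: sD1.
  move=> w; rewrite ger0_norm ?mulr_ge0 ?exprn_ge0// ler_pM2l// ler_wpM2l//.
  by rewrite lerXn2r ?nnegrE.
rewrite (meanD i3 (L1Z 4 iD2)) (meanZ 4 iD2) -sqr_nrm addrC; apply: lerD.
  have : nrm P D2 ^+ 2 <= ((2 + L) * r) ^+ 2.
    have h : 0 <= (2 + L) * r by apply: mulr_ge0; [exact: addr_ge0|exact: ltW].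
    by rewrite ler_sqr ?nnegrE ?nrm_ge0.
  have -> : ((2 + L) * r) ^+ 2 = e / 4.
    rewrite /r exprMn expr_div_n exprMn sqr_sqrtr ?(ltW e0)//.
    by field; rewrite gt_eqF// ltr_pwDl.
  by lra.
rewrite -(mean_cst P (8 * C ^+ 3 * s)); apply: mean_le => //; first exact: L1_cst.
by move=> w; rewrite -mulrA ler_pM2l// mulrC ler_wpM2r// lerXn2r ?nnegrE.
Qed.

(** By the asymptotics of the second moment with [Phi = 1], it is a limit of nonnegative
    quantities. *)
Lemma sig2_ge0 : 0 <= sig2.
Proof.
apply/ler_addgt0Pl => e e0.
have [L L0 hL] := dynkin_second_moment emp scK ranK ug e0.
have t1 : test F 0 (fun=> 1 : R).
  split; last by move=> w; rewrite normr1.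
  by apply/(adaptedP (sF (lexx 0))); exact: measurable_cst.
have := hL L 0 _ (lexx L) (lexx 0) t1; rewrite mean_cst mulr1 ler_norml => /andP[_].
have : 0 <= mean P (fun w => dynkin X u g 0 (0 + L) w ^+ 2 * 1).
  by apply: mean_ge0 => w; rewrite mulr1 sqr_ge0.
rewrite /sig2; set m := mean pi _; set A := mean P _ => A0 h.
have : 2 * m * L <= e * L by lra.
by rewrite ler_pM2r//; lra.
Qed.

(** In the second-order expansion of the cosine, the linear term vanishes because [sin C] is
    adapted, and the quadratic one is known because [cos C] is a test weight. The block length is
    fixed before [s], as the cubic remainder depends on [L]. The error is proportional to [s^2 L],
    so with [s^2 = 1/n] the [n t / L] blocks of a window contribute [t e]. *)
Lemma cos_block (e : R) : 0 < e -> \forall L \near +oo, \forall s \near 0^'+,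
  forall a (C : W -> R), 0 <= a -> adapted (F a) C ->
  `|mean P (fun w => cos (C w + s * D a (a + L) w))
    - mean P (fun w => cos (C w)) * expR (- (s ^+ 2 * L * sig2 / 2))| <= s ^+ 2 * L * e.
Proof.
move=> e0; have e20 : 0 < e / 2 by rewrite divr_gt0.
have [L0 L00 hL] := dynkin_second_moment emp scK ranK ug e20.
near=> L.
have LL0 : L0 <= L by near: L; exact: nbhs_pinfty_ge (num_real _).
have Lp : 0 < L := lt_le_trans L00 LL0.
have e80 : 0 < L * (e / 8) by rewrite mulr_gt0// divr_gt0.
have [M M0 hM] := lindeberg_block (ltW Lp) e80.
(* The remainders that improve with [s], namely [2 M s] from the Lindeberg bound and
   [s^2 L^2 sig2^2 / 8] from the exponential, are at most [s] times this constant; the threshold on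
   [s] brings them below [L * e / 4]. *)
have p0 : 0 < 2 * M + L ^+ 2 * sig2 ^+ 2 / 8 + 1.
  have : 0 <= L ^+ 2 * sig2 ^+ 2 / 8.
    by apply: divr_ge0 => //; apply: mulr_ge0; exact: sqr_ge0.
  by move: (L ^+ 2 * _ / 8) => x x0; lra.
have q0 : 0 < L * (e / 4) / (2 * M + L ^+ 2 * sig2 ^+ 2 / 8 + 1).
  by rewrite divr_gt0// mulr_gt0// divr_gt0.
near=> s => a C a0 aC.
have s0 : 0 < s by near: s; exact: nbhs_right_gt.
have s1 : s <= 1 by near: s; exact: nbhs_right_le.
have s2 : s <= L * (e / 4) / (2 * M + L ^+ 2 * sig2 ^+ 2 / 8 + 1).
  by near: s; exact: nbhs_right_le.
have ab : a <= a + L by rewrite lerDl ltW.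
have mC := adapted_measurable (FW a0) aC.
have tc : test F a (fun w => cos (C w)).
  split; last by move=> w; rewrite ler_norml cos_geN1 cos_le1.
  by apply/(adaptedP (sF a0)); apply: measurable_cos; exact/(adaptedP (sF a0)).
have ts : test F a (fun w => sin (C w)).
  split; last by move=> w; rewrite ler_norml sin_geN1 sin_le1.
  by apply/(adaptedP (sF a0)); apply: measurable_sin; exact/(adaptedP (sF a0)).
have h2 := hL L a _ LL0 a0 tc.
have [sD _] := dynkin_sqint emp u g a0 ab; rewrite -/D in sD.
have [ats _] := ts.
have h1 := mean_dynkin emp scK ug a0 ab (test_sqint emp a0 ts) ats; rewrite -/D in h1.
have h3 := hM a s a0 (ltW s0).
pose DD := D a (a + L).
pose err w := cos (C w + s * DD w) - cos (C w) + sin (C w) * (s * DD w) + 2^-1 * cos (C w) * (s * DD w) ^+ 2.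
have berr w : `|err w| <= s ^+ 2 * (2 * Num.min (DD w ^+ 2) (s * `|DD w| ^+ 3)).
  apply: (le_trans (cos_shift_taylor _ _)).
  rewrite normrM (gtr0_norm s0) !exprMn.
  rewrite (_ : s ^+ 3 * _ = s ^+ 2 * (s * `|DD w| ^+ 3)); last by rewrite (exprSr s 2) mulrA.
  by rewrite -minr_pMr ?sqr_ge0// mulrCA.
have iD2 : L1 P (fun w => DD w ^+ 2) by case: sD.
have mDD : measurable_fun setT DD by case: sD.
pose err' w := 2 * Num.min (DD w ^+ 2) (s * `|DD w| ^+ 3).
have mmin : measurable_fun setT (fun w => Num.min (DD w ^+ 2) (s * `|DD w| ^+ 3)).
  apply: measurable_minr; first exact: measurable_funX.
  by apply: measurable_funM => //; apply: measurable_funX; exact: measurableT_comp.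
have imin : L1 P (fun w => Num.min (DD w ^+ 2) (s * `|DD w| ^+ 3)).
  apply: (L1_le mmin iD2) => w.
  by rewrite ger0_norm ?ge_min ?lexx// le_min sqr_ge0 mulr_ge0 ?(ltW s0)// exprn_ge0.
have ic1 : L1 P (fun w => cos (C w + s * DD w)).
  apply: (@L1_bounded _ _ _ _ 1); last by move=> w; rewrite ler_norml cos_geN1 cos_le1.
  by apply: measurable_cos; apply: measurable_funD => //; exact: measurable_funM.
have ic : L1 P (fun w => cos (C w)) := sqint_L1 (test_sqint emp a0 tc).
have isD : L1 P (fun w => DD w * sin (C w)) := sqintM sD (test_sqint emp a0 ts).
have icD : L1 P (fun w => DD w ^+ 2 * cos (C w)) := (test_mean_mul emp a0 tc iD2).1.
have ierr : L1 P err.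
  have := L1D (L1D (L1B ic1 ic) (L1Z s isD)) (L1Z (2^-1 * s ^+ 2) icD).
  by congr (L1 _ _); apply/funext => w; rewrite /err; ring.
have berr1 : `|mean P err| <= s ^+ 2 * (2 * (L * (e / 8) + M * s)).
  apply: (le_trans (mean_norm_le ierr (L1Z (s ^+ 2) (L1Z 2 imin)) berr)).
  rewrite (meanZ _ (L1Z 2 imin)) (meanZ 2 imin).
  by rewrite ler_pM2l ?exprn_gt0// ler_pM2l.
pose y := s ^+ 2 * L * sig2 / 2.
have y0 : 0 <= y by rewrite divr_ge0// mulr_ge0 ?sig2_ge0// mulr_ge0 ?sqr_ge0// ltW.
have hy := expR_taylor2 y0.
have ec : mean P (fun w => cos (C w + s * DD w)) = mean P err + mean P (fun w => cos (C w))
    - 2^-1 * s ^+ 2 * mean P (fun w => DD w ^+ 2 * cos (C w)).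
  have e1 : mean P err = mean P (fun w => cos (C w + s * DD w)) - mean P (fun w => cos (C w))
      + s * mean P (fun w => DD w * sin (C w)) + 2^-1 * s ^+ 2 * mean P (fun w => DD w ^+ 2 * cos (C w)).
    rewrite -(meanB ic1 ic) -(meanZ s isD) -(meanZ (2^-1 * s ^+ 2) icD).
    rewrite -(meanD (L1B ic1 ic) (L1Z s isD)).
    rewrite -(meanD (L1D (L1B ic1 ic) (L1Z s isD)) (L1Z (2^-1 * s ^+ 2) icD)).
    by apply: eq_mean => w; rewrite /err; ring.
  by rewrite e1 h1; ring.
rewrite ec -/y.
have ce1 : `|mean P (fun w => cos (C w))| <= 1.
  by rewrite -(mean_cst P 1); apply: mean_norm_le => //; [exact: L1_cst|case: tc].
move: berr1 h2 hy ce1; rewrite -/DD.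
set A := mean P err; set B := mean P (fun w => DD w ^+ 2 * _).
set G := mean P (fun w => cos (C w)) => berr1 h2 hy ce1.
rewrite (_ : A + G - _ - _ = A - 2^-1 * s ^+ 2 * (B + 2 * mean pi (fun x => u x * g x) * L * G)
   - G * (expR (- y) - (1 - y))); last by rewrite /y /sig2; field.
apply: (le_trans (ler_normB _ _)); rewrite (normrM G).
have b3 : `|G| * `|expR (- y) - (1 - y)| <= 2^-1 * y ^+ 2.
  by rewrite -[leRHS]mul1r ler_pM.
have b2 : `|A - 2^-1 * s ^+ 2 * (B + 2 * mean pi (fun x => u x * g x) * L * G)| <=
   s ^+ 2 * (2 * (L * (e / 8) + M * s)) + 2^-1 * s ^+ 2 * (L * (e / 2)).
  apply: (le_trans (ler_normB _ _)); apply: lerD => //.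
  rewrite normrM (ger0_norm (_ : 0 <= 2^-1 * s ^+ 2)) ?mulr_ge0 ?sqr_ge0//.
  by rewrite ler_wpM2l// mulr_ge0// sqr_ge0.
apply: (le_trans (lerD b2 b3)).
have b4 : 2^-1 * y ^+ 2 = s ^+ 2 * (s ^+ 2 * (L ^+ 2 * sig2 ^+ 2 / 8)) by rewrite /y; field.
have b5 : s ^+ 2 * (L ^+ 2 * sig2 ^+ 2 / 8) <= s * (L ^+ 2 * sig2 ^+ 2 / 8).
  rewrite ler_wpM2r//; first by apply: divr_ge0 => //; apply: mulr_ge0; exact: sqr_ge0.
  by rewrite expr2 ler_piMl// ltW.
have b6 : s * (2 * M + L ^+ 2 * sig2 ^+ 2 / 8) <= L * (e / 4).
  move: s2; rewrite ler_pdivlMr// => /(le_trans _); apply.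
  by rewrite ler_pM2l// lerDl.
rewrite b4 [leLHS](_ : _ = s ^+ 2 * (L * (e / 2) + (2 * M * s + s ^+ 2 * (L ^+ 2 * sig2 ^+ 2 / 8)))); last first.
  by field.
rewrite -[leRHS]mulrA ler_pM2l ?exprn_gt0//.
move: b5 b6; rewrite mulrDr; set x := L ^+ 2 * sig2 ^+ 2 / 8 => b5 b6.
have e2 : L * (e / 2) = L * e / 2 by rewrite mulrA.
have e4 : L * (e / 4) = L * e / 4 by rewrite mulrA.
have e8 : s * (2 * M) = 2 * M * s by rewrite mulrC.
rewrite e2; rewrite e4 e8 in b6; have := mulr_gt0 Lp e0; lra.
Unshelve. all: by end_near. Qed.

End block.

Lemma cos_lipschitz (R : realType) (x y : R) : `|cos x - cos y| <= `|x - y|.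
Proof.
pose m := (x + y) / 2; pose h := (x - y) / 2.
have -> : cos x - cos y = - (2 * (sin m * sin h)).
  have -> : x = m + h by rewrite /m /h; field.
  rewrite [in cos y](_ : y = m - h); last by rewrite /m /h; field.
  by rewrite cosD cosB; ring.
have -> : x - y = 2 * h by rewrite /h; field.
rewrite normrN (normrM 2 h) (normrM 2) (normrM (sin m)) ler_pM2l ?normr_gt0//.
rewrite -[leRHS]mul1r; apply: ler_pM => //; last exact: norm_sin_le.
by rewrite ler_norml sin_geN1 sin_le1.
Qed.

Lemma mean_cos_le_nrm (d : measure_display) (W : measurableType d) (R : realType)
  (P : probability W R) (Y Z : W -> R) : sqint P Y -> sqint P Z ->
  `|mean P (fun w => cos (Y w)) - mean P (fun w => cos (Z w))| <= nrm P (fun w => Y w - Z w).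
Proof.
move=> sY sZ; have [mY _] := sY; have [mZ _] := sZ.
have i f : measurable_fun setT f -> L1 P (fun w => cos (f w)).
  move=> mf; apply: (@L1_bounded _ _ _ _ 1); first exact: measurable_cos.
  by move=> w; rewrite ler_norml cos_geN1 cos_le1.
have sB := sqintB sY sZ; have [mB _] := sB.
rewrite -(meanB (i _ mY) (i _ mZ)).
have sN : sqint P (fun w => `|Y w - Z w|).
  by apply: (sqint_le _ sB) => [|w]; [exact: measurableT_comp|rewrite normr_id].
apply: (le_trans (mean_norm_le (L1B (i _ mY) (i _ mZ)) (sqint_L1 sN)
  (fun w => cos_lipschitz _ _))).
apply: (le_trans (ler_norm _)); apply: (le_trans (norm_mean_nrm sN)).
by apply: nrm_le => // w; rewrite normr_id.
Qed.

(** * The approximating martingale as a linear function of [f] *)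

Section corrector.
Context (d dS : measure_display) (W : measurableType d) (S : measurableType dS)
  (R : realType) (P : probability W R) (pi : probability S R)
  (K : R -> R.-pker S ~> S) (F : R -> set (set W)) (X : R -> W -> S)
  (Ainv : perp1 pi -> perp1 pi).
Hypothesis emp : ergodic_markov_process P pi K F X.
Hypothesis ga : generator_assumption K Ainv.

Let sF t : 0 <= t -> sigma_algebra setT (F t).
Proof. by have [h _ _] := emp_filtration emp; exact: h. Qed.

Let FW t : 0 <= t -> F t `<=` measurable.
Proof. by have [_ h _] := emp_filtration emp; exact: h. Qed.

Let sp (f : perp1 pi) : sqint pi f := L2_sqint f.

(* The martingale approximating the integral of [- f (X _)] over [[a, b]]. *)
Definition corrector (f : perp1 pi) := dynkin X (Ainv f) f.

(** The covariance of the Brownian field per unit of time; on the diagonal it is the asymptotic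
    variance [sig2] of the block estimate with [u = Ainv f]. *)
Definition form (f g : perp1 pi) : R := - 2 * L2dot pi f (Ainv g).

(** [Ainv] is linear only modulo [pi]-null sets; this carries the relation over to the paths, where
    [X t] has law [pi]. *)
Lemma process_ae t (h h' : S -> R) : 0 <= t -> ae_eq pi setT h h' ->
  {ae P, forall w, h (X t w) = h' (X t w)}.
Proof.
move=> t0 [N [mN N0 sub]]; exists (X t @^-1` N); split.
- by rewrite -[X in measurable X]setTI; exact: (process_measurable emp t0).
- by have := process_law emp t0 mN; rewrite N0.
- by move=> w /= hw; apply: sub => /= h0; exact: hw (h0 I).
Qed.

Lemma corrector_linear r f g a b : 0 <= a -> a <= b ->
  {ae P, forall w, corrector (r *: f + g) a b w = r * corrector f a b w + corrector g a b w}.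
Proof.
move=> a0 ab; have b0 := le_trans a0 ab.
have lin := (ga_bounded ga).1 r f g.
have := occ_linear emp r a0 ab (sp f) (sp g).
have := process_ae a0 lin; have := process_ae b0 lin.
apply: filterS3 => w e1 e2 e3; rewrite /corrector /dynkin e1 e2.
rewrite (_ : occ X (r *: f + g) a b w = occ X (fun x => r * f x + g x) a b w)// e3.
by ring.
Qed.

Lemma corrector_sum (k : nat) (c : 'I_k -> R) (f : 'I_k -> perp1 pi) a b : 0 <= a -> a <= b ->
  {ae P, forall w, corrector (\sum_i c i *: f i) a b w = \sum_i c i * corrector (f i) a b w}.
Proof.
move=> a0 ab; elim: (index_enum _) => [|i s ih].
  have := corrector_linear (-1) 0 0 a0 ab; apply: filterS => w.
  by rewrite !big_nil scaler0 addr0 mulN1r addNr.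
have := corrector_linear (c i) (f i) (\sum_(i <- s) c i *: f i) a0 ab.
by move: ih; apply: filterS2 => w e1 e2; rewrite !big_cons e2 e1.
Qed.

Lemma formE f g : form f g = - 2 * mean pi (fun x => Ainv g x * f x).
Proof. by congr (_ * _); apply: eq_mean => x; rewrite mulrC. Qed.

Lemma form_linearl r f g h : form (r *: f + g) h = r * form f h + form g h.
Proof.
rewrite !formE (@eq_mean _ _ _ _ _ (fun x => r * (Ainv h x * f x) + Ainv h x * g x)).
  by rewrite meanD ?meanZ; [ring|exact: sqintM|apply: L1Z; exact: sqintM|exact: sqintM].
by move=> x; rewrite (_ : (r *: f + g : perp1 pi) x = r * f x + g x)//; ring.
Qed.

Lemma form_linearr r f g h : form h (r *: f + g) = r * form h f + form h g.
Proof.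
rewrite !formE (@ae_mean _ _ _ _ _ (fun x => r * (Ainv f x * h x) + Ainv g x * h x)).
- by rewrite meanD ?meanZ; [ring|exact: sqintM|apply: L1Z; exact: sqintM|exact: sqintM].
- exact: L1_measurable (sqintM (sp (Ainv (r *: f + g))) (sp h)).
- have h1 := L1_measurable (sqintM (sp (Ainv f)) (sp h)).
  have h2 := L1_measurable (sqintM (sp (Ainv g)) (sp h)).
  by apply: measurable_funD => //; exact: measurable_funM.
- have := (ga_bounded ga).1 r f g; apply: filterS => x /(_ I) ->.
  by ring.
Qed.

Lemma form_sum (k : nat) (c : 'I_k -> R) (f : 'I_k -> perp1 pi) :
  form (\sum_i c i *: f i) (\sum_i c i *: f i) = \sum_i \sum_j c i * c j * form (f i) (f j).
Proof.
have z1 h : form 0 h = 0.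
  have := form_linearl (-1) 0 0 h; rewrite scaler0 addr0 mulN1r addNr//.
have z2 h : form h 0 = 0.
  have := form_linearr (-1) 0 0 h; rewrite scaler0 addr0 mulN1r addNr//.
have e1 h : form (\sum_i c i *: f i) h = \sum_i c i * form (f i) h.
  elim/big_rec2 : _ => [|i y g _ ih]; first exact: z1.
  by rewrite form_linearl ih.
have e2 h : form h (\sum_i c i *: f i) = \sum_i c i * form h (f i).
  elim/big_rec2 : _ => [|i y g _ ih]; first exact: z2.
  by rewrite form_linearr ih.
rewrite e1; apply: eq_bigr => i _; rewrite e2 mulr_sumr.
by apply: eq_bigr => j _; rewrite mulrA.
Qed.

Lemma form_ge0 f : 0 <= form f f.
Proof.
rewrite formE.
exact: (sig2_ge0 emp (ga_strongly_continuous ga) (ga_range ga) ((ga_inverse ga).1 f)).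
Qed.

Lemma corrector_block f (e : R) : 0 < e -> \forall L \near +oo, \forall s \near 0^'+,
  forall a (C : W -> R), 0 <= a -> adapted (F a) C ->
  `|mean P (fun w => cos (C w + s * corrector f a (a + L) w))
    - mean P (fun w => cos (C w)) * expR (- (s ^+ 2 * L * form f f / 2))| <= s ^+ 2 * L * e.
Proof.
move=> e0; rewrite formE.
exact: (cos_block emp (ga_strongly_continuous ga) (ga_range ga) ((ga_inverse ga).1 f) e0).
Qed.

(** Induction peels off the last block: the earlier ones are adapted at its left end and take the
    place of [C]. Since its exponential factor is at most 1, the accumulated error is not amplified.
    [G] may vary with the block, which accommodates several time horizons at once. *)
Lemma cos_blocks (L s e c : R) (G : nat -> perp1 pi) : 0 <= L ->
  (forall j a (C : W -> R), 0 <= a -> adapted (F a) C ->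
    `|mean P (fun w => cos (C w + s * corrector (G j) a (a + L) w))
      - mean P (fun w => cos (C w)) * expR (- (s ^+ 2 * L * form (G j) (G j) / 2))| <=
    s ^+ 2 * L * e) ->
  forall m, `|mean P (fun w => cos (c + s * \sum_(j < m) corrector (G j) (j%:R * L) (j%:R * L + L) w))
    - cos c * expR (- (s ^+ 2 * L * (\sum_(j < m) form (G j) (G j)) / 2))| <=
  m%:R * (s ^+ 2 * L * e).
Proof.
move=> L0 hG; elim=> [|m ih].
  rewrite (@eq_mean _ _ _ _ _ (fun=> cos c)).
    by rewrite mean_cst big_ord0 mulr0 mul0r oppr0 expR0 mulr1 subrr normr0 mul0r.
  by move=> w; rewrite big_ord0 mulr0 addr0.
have a0 n : 0 <= n%:R * L by rewrite mulr_ge0.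
have aC : adapted (F (m%:R * L))
    (fun w => c + s * \sum_(j < m) corrector (G j) (j%:R * L) (j%:R * L + L) w).
  apply/(adaptedP (sF (a0 m))); apply: measurable_funD => //; apply: measurable_funM => //.
  apply: measurable_sum => j; apply/(adaptedP (sF (a0 m))).
  have jL : 0 <= j%:R * L + L by rewrite addr_ge0.
  apply: (adapted_le emp jL); last by apply: (dynkin_adapted emp) => //; rewrite lerDl.
  by rewrite -[X in _ + X]mul1r -mulrDl natr1 ler_wpM2r// ler_nat.
have := hG m _ _ (a0 m) aC.
have -> : mean P (fun w => cos (c + s * \sum_(j < m.+1) corrector (G j) (j%:R * L) (j%:R * L + L) w)) =
    mean P (fun w => cos (c + s * \sum_(j < m) corrector (G j) (j%:R * L) (j%:R * L + L) w +
      s * corrector (G m) (m%:R * L) (m%:R * L + L) w)).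
  by apply: eq_mean => w; rewrite big_ord_recr/= mulrDr addrA.
rewrite big_ord_recr/=.
have -> : - (s ^+ 2 * L * (\sum_(j < m) form (G j) (G j) + form (G m) (G m)) / 2) =
    - (s ^+ 2 * L * (\sum_(j < m) form (G j) (G j)) / 2) + - (s ^+ 2 * L * form (G m) (G m) / 2).
  by rewrite mulrDr mulrDl opprD.
rewrite expRD; move: ih.
set A := mean P _; set x := expR _; set B := mean P _; set y := expR (- (_ * _ * form _ _ / _)).
move=> h1 h2.
have y1 : 0 <= y <= 1.
  rewrite expR_ge0 /= -expR0 ler_expR oppr_le0 divr_ge0// mulr_ge0 ?form_ge0//.
  by rewrite mulr_ge0// sqr_ge0.
have -> : B - cos c * (x * y) = (B - A * y) + (A - cos c * x) * y by ring.
apply: (le_trans (ler_normD _ _)); rewrite -natr1 [leRHS]mulrDl mul1r [leRHS]addrC.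
apply: lerD => //; rewrite normrM; case/andP : y1 => y0 y1; rewrite (ger0_norm y0).
by apply: le_trans h1; rewrite ler_piMr.
Qed.

Lemma corrector_telescope f L N : 0 <= L -> {ae P, forall w,
  corrector f 0 (N%:R * L) w = \sum_(j < N) corrector f (j%:R * L) (j%:R * L + L) w}.
Proof.
move=> L0; elim: N => [|N ih].
  apply: aeW => w; rewrite big_ord0 mul0r /corrector /dynkin occ_refl.
  by rewrite !subrr.
have NL : 0 <= N%:R * L by rewrite mulr_ge0.
have h : N%:R * L <= N%:R * L + L by rewrite lerDl.
have := dynkin_add emp (Ainv f) f (lexx 0) NL h.
move: ih; apply: filterS2 => w e1 e2.
by rewrite big_ord_recr/= -e1 -natr1 mulrDl mul1r -e2.
Qed.

End corrector.

Lemma sum_lt_ord (R : realType) (N M : nat) (F : nat -> R) : (N <= M)%N ->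
  \sum_(j < M) (j < N)%N%:R * F j = \sum_(j < N) F j.
Proof.
move=> NM; rewrite (big_ord_widen _ F NM) [RHS]big_mkcond/=; apply: eq_bigr => j _.
by case: ifP; rewrite ?mul1r ?mul0r.
Qed.

Lemma cvg_invsqrt (R : realType) (x : R) : (Num.sqrt n%:R)^-1 * x @[n --> \oo] --> (0 : R).
Proof.
have h : (Num.sqrt n%:R)^-1 @[n --> \oo] --> (0 : R).
  apply/cvgrPdist_le => e e0; near=> n.
  have n0 : 0 < Num.sqrt n%:R :> R.
    by rewrite sqrtr_gt0 ltr0n; near: n; exists 1%N => // n /= ; rewrite lt0n -lt0n.
  rewrite sub0r normrN ger0_norm ?invr_ge0 ?sqrtr_ge0//.
  rewrite -[e]invrK lef_pV2 ?posrE ?invr_gt0//.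
  rewrite -[leLHS]ger0_norm ?invr_ge0 ?(ltW e0)// -sqrtr_sqr ler_sqrt.
    by near: n; exact: nbhs_infty_ger.
  by rewrite ler0n.
by have := cvg_muln h (@cvg_cstn R x); rewrite mul0r.
Unshelve. all: by end_near. Qed.

Lemma truncn_div_bounds (R : realType) (L t : R) (n : nat) : 0 < L -> 0 <= t ->
  (0 < n)%N -> let N := Num.truncn (n%:R * t / L) in
  N%:R * L <= n%:R * t <= N%:R * L + L /\ t - n%:R^-1 * L <= n%:R^-1 * L * N%:R <= t.
Proof.
move=> L0 t0 n0 N.
have n0' : 0 < n%:R :> R by rewrite ltr0n.
have x0 : 0 <= n%:R * t / L by rewrite divr_ge0 ?(ltW L0)// mulr_ge0.
have h1 : N%:R * L <= n%:R * t by rewrite -ler_pdivlMr// truncn_le.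
have h2 : n%:R * t <= N%:R * L + L.
  have := truncnS_gt (n%:R * t / L); rewrite -/N ltr_pdivrMr// -natr1 mulrDl mul1r.
  exact: ltW.
split; first by rewrite h1.
have -> : t = n%:R^-1 * (n%:R * t) by rewrite mulKf// gt_eqF.
rewrite -mulrA -mulrBr !ler_pM2l ?invr_gt0//.
by rewrite [L * _]mulrC h1 andbT lerBlDr.
Qed.

Lemma cvg_truncn_div (R : realType) (L t : R) : 0 < L -> 0 <= t ->
  n%:R^-1 * L * (Num.truncn (n%:R * t / L))%:R @[n --> \oo] --> t.
Proof.
move=> L0 t0; apply/cvgrPdist_le => e e0; near=> n.
have n0 : (0 < n)%N by near: n; exists 1%N.
have n0' : 0 < n%:R :> R by rewrite ltr0n.
have [_ /andP[h1 h2]] := truncn_div_bounds L0 t0 n0.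
rewrite ger0_norm ?subr_ge0//; move: h1; rewrite lerBlDr -lerBlDl => /le_trans; apply.
rewrite mulrC ler_pdivrMr// -ler_pdivrMl//.
by near: n; exact: nbhs_infty_ger.
Unshelve. all: by end_near. Qed.

Lemma near_invsqrt (R : realType) (Q : R -> Prop) : (\forall s \near 0^'+, Q s) ->
  \forall n \near \oo, Q (Num.sqrt n%:R)^-1.
Proof.
move=> [r /= r0 hr]; near=> n; apply: hr => /=; last first.
  by rewrite invr_gt0 sqrtr_gt0 ltr0n; near: n; exists 1%N.
rewrite sub0r normrN ger0_norm ?invr_ge0 ?sqrtr_ge0//.
have : `|0 - (Num.sqrt n%:R)^-1 * 1| < r.
  by near: n; move: (r) r0; apply/cvgrPdist_lt; exact: cvg_invsqrt.
by rewrite mulr1 sub0r normrN ger0_norm ?invr_ge0 ?sqrtr_ge0.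
Unshelve. all: by end_near. Qed.

(** * Joint limits of cosines of the normalized functionals *)

Section central_limit.
Context (d dS : measure_display) (W : measurableType d) (S : measurableType dS)
  (R : realType) (P : probability W R) (pi : probability S R)
  (K : R -> R.-pker S ~> S) (F : R -> set (set W)) (X : R -> W -> S)
  (Ainv : perp1 pi -> perp1 pi).
Hypothesis emp : ergodic_markov_process P pi K F X.
Hypothesis ga : generator_assumption K Ainv.

Let sp (f : perp1 pi) : sqint pi f := L2_sqint f.
Let D := corrector X Ainv.

(** The bound must be uniform in [n], for tightness. With [n] windows of length [t], orthogonality
    gives a martingale of norm at most [sqrt n] times that of one window, and the boundary values of
    [Ainv f] add a constant. *)
Lemma additive_functional_sqint n f t : 0 <= t ->
  sqint P (additive_functional X n f t) /\
  nrm P (additive_functional X n f t) <= 4 * nrm pi (Ainv f) + t * nrm pi f.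
Proof.
move=> t0.
have n0 : 0 <= n%:R * t by rewrite mulr_ge0.
have [so _] := occ_sqint emp (lexx 0) n0 (sp f).
rewrite /additive_functional; split; first exact: sqintZ.
rewrite nrmZ//; set u := nrm pi (Ainv f); set v := nrm pi f.
have u0 : 0 <= u by exact: nrm_ge0.
have v0 : 0 <= v by exact: nrm_ge0.
(* For [n = 0] the normalization is the inverse of 0, which is 0, so the functional vanishes. *)
have [->|n1] := posnP n.
  rewrite sqrtr0 invr0 normr0 mul0r addr_ge0// mulr_ge0//.
have sn : 0 < Num.sqrt n%:R :> R by rewrite sqrtr_gt0 ltr0n.
pose c := 2 * u + t * v; have c0 : 0 <= c by rewrite addr_ge0// mulr_ge0.
have nb a : 0 <= a -> sqint P (D f a (a + t)) /\ nrm P (D f a (a + t)) <= c.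
  move=> a0; have h : a <= a + t by rewrite lerDl.
  have [h1 h2] := dynkin_sqint emp (Ainv f) f a0 h.
  by split => //; apply: le_trans h2 _; rewrite /c addrAC subrr add0r.
have key m : sqint P (D f 0 (m%:R * t)) /\ nrm P (D f 0 (m%:R * t)) ^+ 2 <= m%:R * c ^+ 2.
  elim: m => [|m [ih1 ih2]].
    rewrite (_ : D f 0 (0 * t) = fun=> 0).
      by rewrite nrm_cst normr0 expr0n mul0r; split => //; exact: sqint_cst.
    by apply/funext => w; rewrite mul0r /D /corrector /dynkin occ_refl !subrr.
  have m0 : 0 <= m%:R * t by rewrite mulr_ge0.
  have mt : 0 <= m%:R * t + t by rewrite addr_ge0.
  have mm : m%:R * t <= m%:R * t + t by rewrite lerDl.
  have [h1 h2] := nb _ m0.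
  rewrite -natr1 !mulrDl !mul1r; have [s1 _] := dynkin_sqint emp (Ainv f) f (lexx 0) mt.
  split => //; rewrite !sqr_nrm.
  rewrite (@ae_mean _ _ _ _ _ (fun w => D f 0 (m%:R * t) w ^+ 2 + (2 *
      (D f (m%:R * t) (m%:R * t + t) w * D f 0 (m%:R * t) w) + D f (m%:R * t) (m%:R * t + t) w ^+ 2))).
  - have i1 := sqintM h1 ih1.
    rewrite (meanD ih1.2 (L1D (L1Z 2 i1) h1.2)) (meanD (L1Z 2 i1) h1.2) (meanZ 2 i1).
    have ad := dynkin_adapted emp (Ainv f) f (lexx 0) m0.
    have := mean_dynkin emp (ga_strongly_continuous ga) ((ga_inverse ga).1 f) m0 mm ih1 ad.
    rewrite -/D => ->; rewrite mulr0 add0r -!sqr_nrm; apply: lerD => //.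
    by rewrite ler_sqr ?nnegrE ?nrm_ge0.
  - by have [] := s1 => + _; exact: measurable_funX.
  - apply: measurable_funD; first by have [m1 _] := ih1; exact: measurable_funX.
    apply: measurable_funD; last by have [m1 _] := h1; exact: measurable_funX.
    by apply: measurable_funM => //; exact: L1_measurable (sqintM h1 ih1).
  - have := dynkin_add emp (Ainv f) f (lexx 0) m0 mm.
    by apply: filterS => w e; rewrite /D /corrector e; ring.
have [sD nD] := key n.
have nD' : nrm P (D f 0 (n%:R * t)) <= Num.sqrt n%:R * c.
  have h : 0 <= Num.sqrt n%:R * c by rewrite mulr_ge0// ltW.
  rewrite -ler_sqr ?nnegrE ?nrm_ge0// (le_trans nD)//.
  by rewrite exprMn sqr_sqrtr.
have sB : sqint P (fun w => Ainv f (X (n%:R * t) w) - Ainv f (X 0 w)).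
  by apply: sqintB; [exact: (process_sqint emp n0)|exact: (process_sqint emp (lexx 0))].
have nB : nrm P (fun w => Ainv f (X (n%:R * t) w) - Ainv f (X 0 w)) <= 2 * u.
  have -> : 2 * u = u + u by ring.
  apply: (le_trans (nrmB (process_sqint emp n0 (sp _)) (process_sqint emp (lexx 0) (sp _)))).
  by rewrite (process_nrm emp n0 (sp _)) (process_nrm emp (lexx 0) (sp _)).
have : nrm P (occ X f 0 (n%:R * t)) <= 2 * u + Num.sqrt n%:R * c.
  have e w : occ X f 0 (n%:R * t) w = (Ainv f (X (n%:R * t) w) - Ainv f (X 0 w)) - D f 0 (n%:R * t) w.
    by rewrite /D /corrector /dynkin; ring.
  by rewrite (eq_nrm _ e); apply: (le_trans (nrmB sB sD)); exact: lerD.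
set o := nrm P (occ _ _ _ _) => ho.
rewrite ger0_norm ?invr_ge0 ?sqrtr_ge0// ler_pdivrMl//.
apply: (le_trans ho).
have s1 : 1 <= Num.sqrt n%:R :> R by rewrite -[leLHS]sqrtr1 ler_wsqrtr// ler1n.
have -> : Num.sqrt n%:R * (4 * u + t * v) = 2 * u * Num.sqrt n%:R + Num.sqrt n%:R * c.
  by rewrite /c; ring.
by rewrite lerD2r ler_peMr// mulr_ge0.
Qed.

Section cosine_functional.
Variables (k : nat) (f : 'I_k -> perp1 pi) (t : 'I_k -> R) (a : 'I_k -> R) (c : R).
Hypothesis t0 : forall i, 0 <= t i.

Let Y n i w := additive_functional X n (f i) (t i) w.
Let v : R := \sum_i \sum_j a i * a j * (Num.min (t i) (t j) * form Ainv (f i) (f j)).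

(** Only combinations of the [a i *: f i] over subsets [J] of the indices occur in the blocks. There
    are finitely many, so a single threshold on [s] serves all blocks. *)
Let block (L e : R) (J : {set 'I_k}) (s : R) : Prop :=
  let g := \sum_i ((i \in J)%:R * a i) *: f i in
  forall b (C : W -> R), 0 <= b -> adapted (F b) C ->
    `|mean P (fun w => cos (C w + s * D g b (b + L) w))
      - mean P (fun w => cos (C w)) * expR (- (s ^+ 2 * L * form Ainv g g / 2))| <= s ^+ 2 * L * e.

Section scale.
Variable L : R.
Hypothesis L0 : 0 < L.
Let N n i := Num.truncn (n%:R * t i / L).
(** A convenient common upper bound for the numbers of blocks: beyond all the horizons [G n j] is
    the zero combination. *)
Let M n := (\sum_i N n i)%N.
(** Block [j] carries exactly those [f i] whose window [[0, n t_i]] contains the whole block. *)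
Let G n j : perp1 pi := \sum_i ((j < N n i)%N%:R * a i) *: f i.
Let vn n : R := \sum_i \sum_j a i * a j *
  (Num.min (n%:R^-1 * L * (N n i)%:R) (n%:R^-1 * L * (N n j)%:R) * form Ainv (f i) (f j)).

Let NM n i : (N n i <= M n)%N.
Proof. by rewrite /M (bigD1 i)//= leq_addr. Qed.

Let NL n i : 0 <= (N n i)%:R * L.
Proof. by rewrite mulr_ge0// ltW. Qed.

Lemma cvg_block_variance : vn n @[n --> \oo] --> v.
Proof.
apply: cvg_sumn => i; apply: cvg_sumn => j.
apply: cvg_muln; first exact: cvg_cstn.
apply: cvg_muln; last exact: cvg_cstn.
by apply: cvg_minr; exact: cvg_truncn_div.
Qed.

(** Exactly the first [minn (N n i) (N n j)] blocks involve both [i] and [j]; this is the origin of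
    the minimum of the times in the Brownian covariance. *)
Lemma block_variance n :
  n%:R^-1 * L * (\sum_(j < M n) form Ainv (G n j) (G n j)) = vn n.
Proof.
under eq_bigr do rewrite (form_sum ga).
rewrite exchange_big mulr_sumr; apply: eq_bigr => i _.
rewrite exchange_big mulr_sumr; apply: eq_bigr => j _.
rewrite -minr_pMr; last by rewrite mulr_ge0 ?invr_ge0// ltW.
have -> : Num.min (N n i)%:R (N n j)%:R = (minn (N n i) (N n j))%:R :> R.
  by rewrite natr_min.
have -> : \sum_(m < M n) (m < N n i)%N%:R * a i * ((m < N n j)%N%:R * a j) * form Ainv (f i) (f j) =
   \sum_(m < M n) (m < minn (N n i) (N n j))%N%:R * (a i * a j * form Ainv (f i) (f j)).
  apply: eq_bigr => m _; rewrite leq_min; case: (m < N n i)%N; case: (m < N n j)%N => /=; ring.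
rewrite -mulr_suml sum_nat_lt (minn_idPr _); last by rewrite (leq_trans (geq_minl _ _))//.
by ring.
Qed.

Lemma block_corrector n s : {ae P, forall w,
  s * \sum_(j < M n) D (G n j) (j%:R * L) (j%:R * L + L) w =
  \sum_i a i * (s * D (f i) 0 ((N n i)%:R * L) w)}.
Proof.
have h1 : {ae P, forall w, forall j : 'I_(M n), D (G n j) (j%:R * L) (j%:R * L + L) w =
    \sum_i (j < N n i)%N%:R * a i * D (f i) (j%:R * L) (j%:R * L + L) w}.
  apply: filter_forall => j; apply: (corrector_sum emp ga).
    by rewrite mulr_ge0// ltW.
  by rewrite lerDl ltW.
have h2 : {ae P, forall w, forall i, D (f i) 0 ((N n i)%:R * L) w =
    \sum_(j < N n i) D (f i) (j%:R * L) (j%:R * L + L) w}.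
  by apply: filter_forall => i; have := corrector_telescope Ainv emp (f i) (N n i) (ltW L0); exact.
move: h1 h2; apply: filterS2 => w e1 e2.
rewrite (eq_bigr _ (fun j _ => e1 j)) exchange_big mulr_sumr; apply: eq_bigr => i _.
rewrite e2 -(sum_lt_ord (fun j => D (f i) (j%:R * L) (j%:R * L + L) w) (NM n i)).
rewrite !mulr_sumr; apply: eq_bigr => j _.
by ring.
Qed.

(** The martingale approximates minus the integral, hence a sum rather than a difference. What
    remains is an increment of [Ainv (f i)] and the integral over an incomplete block, both bounded
    in [L^2] independently of [n]. *)
Lemma corrector_additive_functional n : (0 < n)%N ->
  nrm P (fun w => \sum_i a i * ((Num.sqrt n%:R)^-1 * D (f i) 0 ((N n i)%:R * L) w)
    + \sum_i a i * Y n i w) <=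
  (Num.sqrt n%:R)^-1 * \sum_i `|a i| * (2 * nrm pi (Ainv (f i)) + L * nrm pi (f i)).
Proof.
move=> n0; set s := (Num.sqrt n%:R)^-1.
have s0 : 0 <= s by rewrite invr_ge0 sqrtr_ge0.
pose Z i w := Ainv (f i) (X ((N n i)%:R * L) w) - Ainv (f i) (X 0 w)
  + occ X (f i) ((N n i)%:R * L) (n%:R * t i) w.
have nt i : (N n i)%:R * L <= n%:R * t i <= (N n i)%:R * L + L.
  by have [] := truncn_div_bounds L0 (t0 i) n0.
have sZ i : sqint P (Z i) /\ nrm P (Z i) <= 2 * nrm pi (Ainv (f i)) + L * nrm pi (f i).
  have /andP[l1 l2] := nt i.
  have [so no] := occ_sqint emp (NL n i) l1 (sp (f i)).
  have s1 := process_sqint emp (NL n i) (sp (Ainv (f i))).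
  have s2 := process_sqint emp (lexx 0) (sp (Ainv (f i))).
  split; first by apply: sqintD => //; exact: sqintB.
  apply: (le_trans (nrmD (sqintB s1 s2) so)); apply: lerD.
    apply: (le_trans (nrmB s1 s2)).
    rewrite (process_nrm emp (NL n i) (sp _)) (process_nrm emp (lexx 0) (sp _)).
    by set x := nrm _ _; have -> : 2 * x = x + x by ring.
  apply: (le_trans no); rewrite ler_wpM2r ?nrm_ge0//.
  by rewrite lerBlDl.
have sS : sqint P (fun w => \sum_i s * a i * Z i w).
  by apply: sqint_sum => i; apply: sqintZ; exact: (sZ i).1.
have sD i : sqint P (D (f i) 0 ((N n i)%:R * L)).
  by have [] := dynkin_sqint emp (Ainv (f i)) (f i) (lexx 0) (NL n i).
have sY i : sqint P (Y n i) by have [] := additive_functional_sqint n (f i) (t0 i).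
rewrite (@ae_nrm _ _ _ _ _ (fun w => \sum_i s * a i * Z i w)).
- apply: (le_trans (nrm_sum _ (fun i => sqintZ (s * a i) (sZ i).1))).
  rewrite mulr_sumr; apply: ler_sum => i _.
  rewrite (nrmZ _ (sZ i).1) normrM (ger0_norm s0) -mulrA ler_wpM2l// ler_wpM2l//.
  exact: (sZ i).2.
- apply: measurable_funD; apply: measurable_sum => i; apply: measurable_funM => //.
    by apply: measurable_funM => //; case: (sD i).
  by case: (sY i).
- by case: sS.
- have : {ae P, forall w, forall i, occ X (f i) 0 (n%:R * t i) w =
      occ X (f i) 0 ((N n i)%:R * L) w + occ X (f i) ((N n i)%:R * L) (n%:R * t i) w}.
    apply: filter_forall => i; have /andP[l1 _] := nt i.
    exact: (occ_add emp (lexx 0) (NL n i) l1 (sp (f i))).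
  apply: filterS => w e; rewrite -big_split; apply: eq_bigr => i _ /=.
  rewrite /Y /additive_functional -/s -/(occ X (f i) 0 (n%:R * t i) w) e.
  by rewrite /D /corrector /dynkin /Z; ring.
Qed.

(** The factor of [e] is made of the block errors, at most [M n * L / n <= \sum_i t i], and two
    units, for the replacement of the functional by the martingale and for the convergence of the
    variances. *)
Lemma cvg_cosine_block (e : R) : 0 < e ->
  (forall J, \forall s \near 0^'+, block L e J s) ->
  \forall n \near \oo,
    `|mean P (fun w => cos (c + \sum_i - a i * Y n i w)) - cos c * expR (- (v / 2))| <=
    (\sum_i t i + 2) * e.
Proof.
move=> e0 hJ.
have v1 : \forall n \near \oo, `|cos c * expR (- (v / 2)) - cos c * expR (- (vn n / 2))| <= e.
  move: (e) e0; apply/cvgrPdist_le; apply: cvg_muln; first exact: cvg_cstn.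
  apply: continuous_cvg; first exact: continuous_expR.
  apply: cvgN; apply: cvg_muln; last exact: cvg_cstn.
  exact: cvg_block_variance.
pose kap := \sum_i `|a i| * (2 * nrm pi (Ainv (f i)) + L * nrm pi (f i)).
have v2 : \forall n \near \oo, `|0 - (Num.sqrt n%:R)^-1 * kap| <= e.
  by move: (e) e0; apply/cvgrPdist_le; exact: cvg_invsqrt.
have v3 : \forall n \near \oo, forall J, block L e J (Num.sqrt n%:R)^-1.
  by apply: (near_invsqrt (Q := fun s => forall J, block L e J s)); exact: filter_forall.
near=> n.
have n0 : (0 < n)%N by near: n; exists 1%N.
have n0' : 0 < n%:R :> R by rewrite ltr0n.
have hb : forall J, block L e J (Num.sqrt n%:R)^-1 by near: n.
pose s := (Num.sqrt n%:R)^-1 : R.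
have s2 : s ^+ 2 = n%:R^-1 by rewrite exprVn sqr_sqrtr.
have hs : forall j b (C : W -> R), 0 <= b -> adapted (F b) C ->
    `|mean P (fun w => cos (C w + s * D (G n j) b (b + L) w))
      - mean P (fun w => cos (C w)) * expR (- (s ^+ 2 * L * form Ainv (G n j) (G n j) / 2))| <=
    s ^+ 2 * L * e.
  move=> j.
  have -> : G n j = \sum_i ((i \in [set i | (j < N n i)%N]%SET)%:R * a i) *: f i.
    by apply: eq_bigr => i _; rewrite inE.
  exact: hb.
have b1 := cos_blocks emp ga c (ltW L0) hs (M n).
rewrite s2 block_variance in b1.
have bM : (M n)%:R * (n%:R^-1 * L * e) <= (\sum_i t i) * e.
  rewrite mulrA ler_wpM2r ?(ltW e0)// /M natr_sum mulr_suml; apply: ler_sum => i _.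
  by have [_ /andP[_]] := truncn_div_bounds L0 (t0 i) n0; rewrite mulrC.
have sD i : sqint P (D (f i) 0 ((N n i)%:R * L)).
  by have [] := dynkin_sqint emp (Ainv (f i)) (f i) (lexx 0) (NL n i).
have sY i : sqint P (Y n i) by have [] := additive_functional_sqint n (f i) (t0 i).
pose A w := c + \sum_i a i * (s * D (f i) 0 ((N n i)%:R * L) w).
pose B w := c + \sum_i - a i * Y n i w.
have sA : sqint P A.
  apply: sqintD; first exact: sqint_cst.
  by apply: sqint_sum => i; do 2 apply: sqintZ.
have sB : sqint P B.
  apply: sqintD; first exact: sqint_cst.
  by apply: sqint_sum => i; apply: sqintZ.
have b2 : `|mean P (fun w => cos (A w)) - mean P (fun w => cos (B w))| <= e.
  apply: (le_trans (mean_cos_le_nrm sA sB)).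
  rewrite (@eq_nrm _ _ _ _ _ (fun w => \sum_i a i * ((Num.sqrt n%:R)^-1 * D (f i) 0 ((N n i)%:R * L) w)
    + \sum_i a i * Y n i w)); last first.
    move=> w; rewrite /A /B.
    have -> : \sum_i - a i * Y n i w = - \sum_i a i * Y n i w.
      by rewrite -sumrN; apply: eq_bigr => i _; rewrite mulNr.
    by rewrite -/s; ring.
  apply: (le_trans (corrector_additive_functional n0)).
  apply: (@le_trans _ _ `|0 - (Num.sqrt n%:R)^-1 * kap|); last by near: n.
  by rewrite sub0r normrN ler_norm.
have b3 : `|cos c * expR (- (v / 2)) - cos c * expR (- (vn n / 2))| <= e by near: n.
have e1 : mean P (fun w => cos (c + s * \sum_(j < M n) D (G n j) (j%:R * L) (j%:R * L + L) w)) =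
    mean P (fun w => cos (A w)).
  apply: ae_mean.
  - apply: measurable_cos; apply: measurable_funD => //; apply: measurable_funM => //.
    apply: measurable_sum => j.
    have j0 : 0 <= j%:R * L by rewrite mulr_ge0// ltW.
    have jj : j%:R * L <= j%:R * L + L by rewrite lerDl ltW.
    by have [[]] := dynkin_sqint emp (Ainv (G n j)) (G n j) j0 jj.
  - by apply: measurable_cos; case: sA.
  - by have := block_corrector n s; apply: filterS => w ew; rewrite ew.
move: b1 bM b2 b3; rewrite -/D e1 mulrDl.
set x := mean P _; set y := mean P _; set z := cos c * _; set u := cos c * _.
rewrite !ler_norml => /andP[p1 p2] p3 /andP[p4 p5] /andP[p6 p7].
move: p1 p2 p3; set m := (M n)%:R * _; set q := _ * e => p1 p2 p3.
by apply/andP; split; lra.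
Unshelve. all: by end_near. Qed.

End scale.

Lemma cvg_mean_cos_additive_functional :
  mean P (fun w => cos (c + \sum_i - a i * Y n i w)) @[n --> \oo] --> cos c * expR (- (v / 2)).
Proof.
apply/cvgrPdist_le => e e0.
have T0 : 0 < \sum_i t i + 2 by rewrite ltr_wpDl// sumr_ge0.
pose e' := e / (\sum_i t i + 2); have e'0 : 0 < e' by rewrite divr_gt0.
have : \forall L \near +oo, 0 < L /\ forall J, \forall s \near 0^'+, block L e' J s.
  apply: filterI; first exact: nbhs_pinfty_gt.
  apply: (@filter_forall _ _ (fun J L => \forall s \near 0^'+, block L e' J s) (pinfty_nbhs R) _) => J.
  exact: (corrector_block emp ga).
move=> /filter_ex[L [L0 hL]].
have := cvg_cosine_block L0 e'0 hL; apply: filterS => n.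
have -> : (\sum_i t i + 2) * e' = e by rewrite /e' mulrC divfK// gt_eqF.
by rewrite distrC.
Qed.

End cosine_functional.

End central_limit.

(** * Weak convergence from cosines *)

Lemma rV_box_unif_continuous (R : realType) (k : nat) (h : 'rV[R]_k -> R) (r e : R) :
  continuous h -> 0 < e ->
  \forall s \near 0^'+, forall u v : 'rV[R]_k, (forall i, `|u 0 i| <= r) ->
    (forall i, `|u 0 i - v 0 i| <= s) -> `|h u - h v| <= e.
Proof.
move=> ch e0.
have /compact_near_coveringP cov : compact [set v : 'rV[R]_k | forall i, `[- r, r]%classic (v ord0 i)].
  by apply: (@rV_compact R k (fun=> `[- r, r]%classic)) => i; exact: segment_compact.
have : \forall s \near (0 : R)^'+,
    [set v : 'rV[R]_k | forall i, `[- r, r]%classic (v ord0 i)] `<=`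
    (fun u => forall v : 'rV[R]_k, (forall i, `|u 0 i - v 0 i| <= s) -> `|h u - h v| <= e).
  apply: cov => x _.
  have /cvgrPdist_lt/(_ (e / 2)) := ch x; rewrite divr_gt0// => /(_ isT).
  move=> /nbhs_ballP[/= s /= s0 hs].
  have hs' (v : 'rV[R]_k) : (forall i, `|x 0 i - v 0 i| < s) -> `|h x - h v| < e / 2.
    by move=> xv; apply: hs; split => // i j; rewrite (ord1 i); exact: xv.
  exists ([set x' : 'rV[R]_k | forall i, `|x 0 i - x' 0 i| < s / 2], [set s' | s' < s / 2]).
    split => /=; last by apply: nbhs_right_lt; rewrite divr_gt0.
    apply/nbhs_ballP; exists (s / 2); first by rewrite /= divr_gt0.
    by move=> v [_ xv] i /=; exact: xv.
  move=> [x' r'] /= [xx' rr'] y yr.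
  have h1 : `|h x - h x'| < e / 2.
    apply: hs' => i; rewrite (lt_trans (xx' i))// ltr_pdivrMr// ltr_pMr// ltr1n//.
  have h2 : `|h x - h y| < e / 2.
    apply: hs' => i; rewrite -(subrKA (x' 0 i)) (le_lt_trans (ler_normD _ _))//.
    by rewrite [ltRHS]splitr ltrD// (le_lt_trans (yr i)).
  rewrite -(subrKA (h x)) (le_trans (ler_normD _ _))// [leRHS]splitr lerD//; last exact: ltW.
  by rewrite distrC ltW.
apply: filterS => s hs u v ur; apply: hs => i /=.
by rewrite in_itv/= -ler_norml.
Qed.

(** * Bernstein polynomials as expectations of a walk *)

Section bernstein.
Context (R : realType) (k : nat).
Implicit Types (s : 'I_k -> R) (l : seq 'I_k) (J : 'I_k -> nat) (phi psi : ('I_k -> nat) -> R).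

Definition incr J i : 'I_k -> nat := fun j => (J j + (j == i))%N.

(* Expectation of [phi] at the end of the walk started at [J] which, for each [i] in
  [l], moves one step in direction [i] with probability [s i]. *)
Fixpoint walk_mean s l phi J : R :=
  if l is i :: l' then (1 - s i) * walk_mean s l' phi J + s i * walk_mean s l' phi (incr J i)
  else phi J.

Lemma walk_mean_cst s l J a : walk_mean s l (fun=> a) J = a.
Proof. by elim: l J => //= i l ih J; rewrite !ih; ring. Qed.

Lemma walk_meanD s l J phi psi :
  walk_mean s l (fun J => phi J + psi J) J = walk_mean s l phi J + walk_mean s l psi J.
Proof. by elim: l J => //= i l ih J; rewrite !ih; ring. Qed.

Lemma walk_meanZ s l J a phi :
  walk_mean s l (fun J => a * phi J) J = a * walk_mean s l phi J.
Proof. by elim: l J => //= i l ih J; rewrite !ih; ring. Qed.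

Lemma walk_mean_sum s l J (f : 'I_k -> ('I_k -> nat) -> R) :
  walk_mean s l (fun J => \sum_i f i J) J = \sum_i walk_mean s l (f i) J.
Proof.
elim: l J => //= i l ih J.
by rewrite !ih !mulr_sumr -big_split.
Qed.

Lemma walk_mean_le s l J phi psi : (forall i, 0 <= s i <= 1) ->
  (forall J, phi J <= psi J) -> walk_mean s l phi J <= walk_mean s l psi J.
Proof.
move=> s01 le; elim: l J => //= i l ih J; have /andP[s0 s1] := s01 i.
by apply: lerD; apply: ler_wpM2l; rewrite ?subr_ge0.
Qed.

Lemma walk_mean_norm_le s l J phi psi : (forall i, 0 <= s i <= 1) ->
  (forall J, `|phi J| <= psi J) -> `|walk_mean s l phi J| <= walk_mean s l psi J.
Proof.
move=> s01 le; rewrite ler_norml; apply/andP; split.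
  rewrite -mulN1r -walk_meanZ; apply: walk_mean_le => // J'.
  by rewrite mulN1r; have := le J'; rewrite ler_norml => /andP[].
by apply: walk_mean_le => // J'; apply: le_trans (le J'); exact: ler_norm.
Qed.

(** Squared bias plus the binomial variance of the number of steps taken in direction [i]. *)
Lemma walk_mean_sqr s l J i (c : R) :
  walk_mean s l (fun J => ((J i)%:R - c) ^+ 2) J =
  ((J i)%:R + (count_mem i l)%:R * s i - c) ^+ 2 + (count_mem i l)%:R * (s i * (1 - s i)).
Proof.
elim: l J => [|j l ih] J /=; first by rewrite !mul0r !addr0.
rewrite !ih /incr eq_sym; have [->|ji] := eqVneq i j; last by rewrite addn0 add0n; ring.
by rewrite !natrD/=; ring.
Qed.

End bernstein.

(** * Test functions built from sines *)

Section cosine_test_functions.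
Context (R : realType) (k : nat) (d d' : measure_display) (W : measurableType d)
  (W' : measurableType d') (P : probability W R) (P' : probability W' R)
  (x : nat -> 'I_k -> W -> R) (y : 'I_k -> W' -> R).
Hypothesis mx : forall n i, measurable_fun setT (x n i).
Hypothesis my : forall i, measurable_fun setT (y i).
Hypothesis cvg_cos : forall (a : 'I_k -> R) c,
  mean P (fun w => cos (c + \sum_i a i * x n i w)) @[n --> \oo] -->
  mean P' (fun w => cos (c + \sum_i a i * y i w)).

(** Convergence is required against every cosine, not just of the means: this is what survives
    multiplication by a further sine. *)
Record test_function (f : ('I_k -> R) -> R) : Prop := {
  test_measurable_x : forall n, measurable_fun setT (fun w => f (x n ^~ w)) ;
  test_measurable_y : measurable_fun setT (fun w => f (y ^~ w)) ;
  test_bounded : exists M : R, forall v, `|f v| <= M ;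
  test_cvg : forall (a : 'I_k -> R) c,
    mean P (fun w => f (x n ^~ w) * cos (c + \sum_i a i * x n i w)) @[n --> \oo] -->
    mean P' (fun w => f (y ^~ w) * cos (c + \sum_i a i * y i w)) }.

Let mcx n (a : 'I_k -> R) c : measurable_fun setT (fun w => cos (c + \sum_i a i * x n i w)).
Proof.
apply: measurable_cos; apply: measurable_funD => //; apply: measurable_sum => i.
exact: measurable_funM.
Qed.

Let mcy (a : 'I_k -> R) c : measurable_fun setT (fun w => cos (c + \sum_i a i * y i w)).
Proof.
apply: measurable_cos; apply: measurable_funD => //; apply: measurable_sum => i.
exact: measurable_funM.
Qed.

Let cosL1 (u : R) : `|cos u| <= 1. Proof. by rewrite ler_norml cos_geN1 cos_le1. Qed.

Let Lx f n a c : test_function f -> L1 P (fun w => f (x n ^~ w) * cos (c + \sum_i a i * x n i w)).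
Proof.
move=> tf; have [M hM] := test_bounded tf.
apply: (@L1_mul_bounded _ _ _ _ 1) => //; apply: (@L1_bounded _ _ _ _ M) => //.
exact: test_measurable_x tf _.
Qed.

Let Ly f a c : test_function f -> L1 P' (fun w => f (y ^~ w) * cos (c + \sum_i a i * y i w)).
Proof.
move=> tf; have [M hM] := test_bounded tf.
apply: (@L1_mul_bounded _ _ _ _ 1) => //; apply: (@L1_bounded _ _ _ _ M) => //.
exact: test_measurable_y tf.
Qed.

Lemma test_cst r : test_function (fun=> r).
Proof.
split => [n| | |a c]; [exact: measurable_cst|exact: measurable_cst|by exists `|r| => _|].
have i1 n : L1 P (fun w => cos (c + \sum_i a i * x n i w)) by exact: (@L1_bounded _ _ _ _ 1).
have i2 : L1 P' (fun w => cos (c + \sum_i a i * y i w)) by exact: (@L1_bounded _ _ _ _ 1).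
rewrite (meanZ r i2).
apply: (cvg_eqn (cvg_muln (@cvg_cstn R r) (@cvg_cos a c))) => n.
by rewrite (meanZ r (i1 n)).
Qed.

Lemma test_linear r f g : test_function f -> test_function g ->
  test_function (fun v => r * f v + g v).
Proof.
move=> tf tg; split => [n| | |a c].
- by apply: measurable_funD; [apply: measurable_funM => //; exact: test_measurable_x tf _|exact: test_measurable_x tg _].
- by apply: measurable_funD; [apply: measurable_funM => //; exact: test_measurable_y tf|exact: test_measurable_y tg].
- have [M hM] := test_bounded tf; have [N hN] := test_bounded tg.
  exists (`|r| * M + N) => v; rewrite (le_trans (ler_normD _ _))// lerD// normrM.
  by rewrite ler_wpM2l.
- rewrite (@eq_mean _ _ _ _ _ (fun w => r * (f (y ^~ w) * cos (c + \sum_i a i * y i w)) +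
    g (y ^~ w) * cos (c + \sum_i a i * y i w))); last by move=> w; ring.
  rewrite (meanD (L1Z r (Ly a c tf)) (Ly a c tg)) (meanZ r (Ly a c tf)).
  apply: (cvg_eqn (cvg_addn (cvg_muln (@cvg_cstn R r) (@test_cvg _ tf a c)) (@test_cvg _ tg a c))) => n.
  rewrite -(meanZ r (Lx n a c tf)) -(meanD (L1Z r (Lx n a c tf)) (Lx n a c tg)).
  by apply: eq_mean => w; ring.
Qed.

(** By the product-to-sum formula, the extra sine only shifts the frequency [a i] by [b] in either
    direction and the phase by [pi / 2]. *)
Lemma test_mul_sin f i b : test_function f -> test_function (fun v => f v * sin (b * v i)).
Proof.
move=> tf; split => [n| | |a c].
- apply: measurable_funM; first exact: test_measurable_x tf _.
  by apply: measurable_sin; exact: measurable_funM.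
- apply: measurable_funM; first exact: test_measurable_y tf.
  by apply: measurable_sin; exact: measurable_funM.
- have [M hM] := test_bounded tf; exists M => v; rewrite normrM.
  rewrite -[leRHS]mulr1 ler_pM//; by rewrite ler_norml sin_geN1 sin_le1.
pose ap j := a j + b * (j == i)%:R; pose am j := a j - b * (j == i)%:R.
have ed (v : 'I_k -> R) : \sum_j b * (j == i)%:R * v j = b * v i.
  rewrite (bigD1 i)//= eqxx mulr1 big1 ?addr0// => j /negPf ->.
  by rewrite mulr0 mul0r.
have ep (v : 'I_k -> R) : \sum_j ap j * v j = \sum_j a j * v j + b * v i.
  by rewrite -ed -big_split; apply: eq_bigr => j _; rewrite mulrDl.
have em (v : 'I_k -> R) : \sum_j am j * v j = \sum_j a j * v j - b * v i.
  by rewrite -ed -sumrB; apply: eq_bigr => j _; rewrite mulrBl.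
have key (v : 'I_k -> R) : f v * sin (b * v i) * cos (c + \sum_j a j * v j) =
    2^-1 * (f v * cos (c - pi / 2 + \sum_j ap j * v j)) +
    2^-1 * (f v * cos (c + pi / 2 + \sum_j am j * v j)).
  rewrite ep em; set u := b * v i; set C := \sum_j _.
  have -> : c - pi / 2 + (C + u) = (c + C + u) - pi / 2 by ring.
  have -> : c + pi / 2 + (C - u) = (c + C - u) + pi / 2 by ring.
  by rewrite cosDpihalf cosBpihalf (sinD (c + C) u) (sinB (c + C) u); field.
rewrite (@eq_mean _ _ _ _ _ (fun w => 2^-1 * (f (y ^~ w) * cos (c - pi / 2 + \sum_j ap j * y j w)) +
    2^-1 * (f (y ^~ w) * cos (c + pi / 2 + \sum_j am j * y j w)))); last by move=> w; rewrite key.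
rewrite (meanD (L1Z 2^-1 (Ly ap (c - pi / 2) tf)) (L1Z 2^-1 (Ly am (c + pi / 2) tf))).
rewrite (meanZ 2^-1 (Ly ap (c - pi / 2) tf)) (meanZ 2^-1 (Ly am (c + pi / 2) tf)).
apply: (cvg_eqn (cvg_addn (cvg_muln (@cvg_cstn R 2^-1) (@test_cvg _ tf ap (c - pi / 2)))
  (cvg_muln (@cvg_cstn R 2^-1) (@test_cvg _ tf am (c + pi / 2))))) => n.
rewrite -(meanZ 2^-1 (Lx n ap (c - pi / 2) tf)) -(meanZ 2^-1 (Lx n am (c + pi / 2) tf)).
rewrite -(meanD (L1Z 2^-1 (Lx n ap (c - pi / 2) tf)) (L1Z 2^-1 (Lx n am (c + pi / 2) tf))).
by apply: eq_mean => w; rewrite key.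
Qed.

(** Each step of the walk is affine in one sine, so induction on the list of steps replaces an
    expansion into binomial coefficients. *)
Lemma test_walk_mean b l phi J :
  test_function (fun v => walk_mean (fun i => (1 + sin (b * v i)) / 2) l phi J).
Proof.
elim: l J => [|i l ih] J /=; first exact: test_cst.
have h0 := ih J; have h1 := ih (incr J i).
have := test_linear (2^-1) (test_linear (-1) (test_mul_sin i b h0) h0)
  (test_linear (2^-1) (test_linear 1 (test_mul_sin i b h1) h1) (test_cst 0)).
by congr test_function; apply/funext => v; field.
Qed.

Lemma test_mean_cvg f : test_function f ->
  mean P (fun w => f (x n ^~ w)) @[n --> \oo] --> mean P' (fun w => f (y ^~ w)).
Proof.
move=> tf; have := @test_cvg _ tf (fun=> 0) 0.
have e (v : 'I_k -> R) : f v * cos (0 + \sum_i 0 * v i) = f v.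
  by rewrite big1 ?addr0 ?cos0 ?mulr1// => i _; rewrite mul0r.
rewrite (eq_mean _ (fun w => e (y ^~ w))) => h.
by apply: (cvg_eqn h) => n; apply: eq_mean => w; rewrite e.
Qed.

End cosine_test_functions.

Section weak_convergence.
Context (R : realType) (k : nat) (h : 'rV[R]_k -> R) (M : R).
Hypothesis ch : continuous h.
Hypothesis hM : forall v, `|h v| <= M.

(* Bernstein approximation in the variables [(1 + sin (v i / b)) / 2], for which
  [v i] is nearly affine when [b] is large. *)
Definition bernstein (b : R) (N : nat) (v : 'I_k -> R) : R :=
  walk_mean (fun i => (1 + sin (b^-1 * v i)) / 2) (flatten (nseq N (enum 'I_k)))
    (fun J => h (\row_i (b * (2 * ((J i)%:R / N%:R) - 1)))) (fun=> 0%N).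

Let s01 b (v : 'I_k -> R) i : 0 <= (1 + sin (b * v i)) / 2 <= 1.
Proof. by have := sin_geN1 (b * v i); have := sin_le1 (b * v i); move: (sin _) => z; lra. Qed.

Lemma bernstein_bounded b N v : `|bernstein b N v| <= M.
Proof.
rewrite -[leRHS](walk_mean_cst (fun i => (1 + sin (b^-1 * v i)) / 2)
  (flatten (nseq N (enum 'I_k))) (fun=> 0%N)).
by apply: walk_mean_norm_le.
Qed.

Let count_walk N (i : 'I_k) : count_mem i (flatten (nseq N (enum 'I_k))) = N.
Proof.
rewrite count_flatten map_nseq sumn_nseq.
by rewrite (count_uniq_mem i (enum_uniq _)) mem_enum mul1n.
Qed.

Let M0 : 0 <= M. Proof. exact: le_trans (normr_ge0 _) (hM 0). Qed.

(** A Chebyshev argument: if every coordinate of the endpoint is within [delta] of [v], uniform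
    continuity of [h] applies; otherwise the trivial bound [2 M] is charged to a squared deviation,
    whose mean is small for long walks. *)
Lemma bernstein_approx (r e : R) : 0 < r -> 0 < e -> exists b N,
  forall v, (forall i, `|v i| <= r) -> `|bernstein b N v - h (\row_i v i)| <= e.
Proof.
move=> r0 e0; have e20 : 0 < e / 2 by rewrite divr_gt0.
have /filter_ex[delta [d0 hd]] : \forall s \near (0 : R)^'+, 0 < s /\
    forall u v : 'rV[R]_k, (forall i, `|u 0 i| <= r) ->
    (forall i, `|u 0 i - v 0 i| <= s) -> `|h u - h v| <= e / 2.
  apply: filterI; first exact: nbhs_right_gt.
  exact: rV_box_unif_continuous.
have d20 : 0 < delta / 2 by rewrite divr_gt0.
(* With [r^3 <= b delta] the cubic Taylor bound gives [|b sin (z / b) - z| <= delta / 2] on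
   [[- r, r]], so the mean endpoint of the walk is close to [v]. *)
have [n hn] : exists n : nat, r ^+ 3 / delta <= n.+1%:R.
  by exists (Num.truncn (r ^+ 3 / delta)); exact: (ltW (truncnS_gt _)).
pose b : R := n.+1%:R; have b1 : 1 <= b by rewrite ler1n.
have b0 : 0 < b by exact: lt_le_trans b1.
have lin (z : R) : `|z| <= r -> `|b * sin (b^-1 * z) - z| <= delta / 2.
  move=> zr.
  have -> : b * sin (b^-1 * z) - z = b * (sin (b^-1 * z) - b^-1 * z) by field; rewrite gt_eqF.
  rewrite normrM gtr0_norm//.
  apply: (@le_trans _ _ (b * (6^-1 * `|b^-1 * z| ^+ 3))).
    by rewrite ler_pM2l// sin_sub_id_le.
  rewrite normrM ger0_norm ?invr_ge0 ?(ltW b0)//.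
  have z3 : `|z| ^+ 3 <= b * delta.
    apply: (@le_trans _ _ (r ^+ 3)); first by rewrite lerXn2r ?nnegrE ?(ltW r0).
    by rewrite -ler_pdivrMr.
  have -> : b * (6^-1 * (b^-1 * `|z|) ^+ 3) = (6^-1 * b^-1 ^+ 2) * `|z| ^+ 3.
    by field; rewrite gt_eqF.
  apply: (@le_trans _ _ (6^-1 * b^-1 ^+ 2 * (b * delta))).
    by rewrite ler_wpM2l// mulr_ge0// exprn_ge0// invr_ge0 ltW.
  have -> : 6^-1 * b^-1 ^+ 2 * (b * delta) = b^-1 * (delta / 6) by field; rewrite gt_eqF.
  rewrite ler_pdivrMl//; apply: (@le_trans _ _ (1 * (delta / 2))); first by lra.
  by rewrite ler_pM2r.
(* A coordinate off by more than [delta] is at least [delta / 2] away from its mean; undoing the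
   scaling, the number of steps deviates by at least [N delta / (4 b)], so [2 M] is at most the
   penalty [q i J]. *)
pose kap := (4 * b / delta) ^+ 2.
have kap0 : 0 < kap by rewrite exprn_gt0// divr_gt0// mulr_gt0.
(* The walk has [N = m + 1] chances in each direction, and each penalty has mean at most
   [2 M kap / N]; their sum over the [k] coordinates is then at most [e / 2]. *)
have [m hm] : exists m : nat, k%:R * (2 * M * kap) / (e / 2) <= m.+1%:R.
  by exists (Num.truncn (k%:R * (2 * M * kap) / (e / 2))); exact: (ltW (truncnS_gt _)).
pose N := m.+1; have N0 : 0 < N%:R :> R by rewrite ltr0n.
exists b, N => v vr.
pose s i := (1 + sin (b^-1 * v i)) / 2.
have -> : bernstein b N v - h (\row_i v i) =
    walk_mean s (flatten (nseq N (enum 'I_k)))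
      (fun J => h (\row_i (b * (2 * ((J i)%:R / N%:R) - 1))) + - h (\row_i v i)) (fun=> 0%N).
  by rewrite walk_meanD walk_mean_cst.
pose q i J : R := 2 * M * kap / N%:R ^+ 2 * ((J i)%:R - N%:R * s i) ^+ 2.
have q0 i (J : 'I_k -> nat) : 0 <= q i J.
  by rewrite mulr_ge0 ?sqr_ge0// divr_ge0 ?exprn_ge0// mulr_ge0 ?(ltW kap0)// mulr_ge0.
have le (J : 'I_k -> nat) : `|h (\row_i (b * (2 * ((J i)%:R / N%:R) - 1))) + - h (\row_i v i)| <=
    e / 2 + \sum_i q i J.
  have [/forallP near|] := boolP [forall i, `|v i - b * (2 * ((J i)%:R / N%:R) - 1)| <= delta].
    rewrite distrC ler_wpDr ?sumr_ge0//.
    by apply: hd => i; rewrite !mxE.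
  rewrite negb_forall => /existsP[i]; rewrite -ltNge => far.
  apply: (@le_trans _ _ (2 * M)).
    rewrite (le_trans (ler_normB _ _))//.
    have -> : 2 * M = M + M by ring.
    exact: lerD.
  apply: (@le_trans _ _ (q i J)); last first.
    by rewrite (bigD1 i)//= addrCA lerDl addr_ge0 ?(ltW e20)// sumr_ge0.
  have far2 : delta / 2 <= `|2 * b * ((J i)%:R / N%:R - s i)|.
    have := lin _ (vr i).
    have -> : 2 * b * ((J i)%:R / N%:R - s i) =
        (b * (2 * ((J i)%:R / N%:R) - 1) - v i) - (b * sin (b^-1 * v i) - v i).
      by rewrite /s; field; rewrite gt_eqF.
    move: far; rewrite distrC; set A := _ - v i; set B := _ - v i => far near.
    have := ler_normD (A - B) B; rewrite subrK; lra.
  have far3 : delta / 2 * (N%:R / (2 * b)) <= `|(J i)%:R - N%:R * s i|.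
    have -> : (J i)%:R - N%:R * s i = 2 * b * ((J i)%:R / N%:R - s i) * (N%:R / (2 * b)).
      by field; rewrite !gt_eqF.
    rewrite normrM [`|_ / _|]ger0_norm; last by rewrite divr_ge0 ?(ltW N0)// mulr_ge0 ?(ltW b0).
    by rewrite ler_pM2r// divr_gt0// mulr_gt0.
  have -> : 2 * M = 2 * M * kap / N%:R ^+ 2 * (delta / 2 * (N%:R / (2 * b))) ^+ 2.
    by rewrite /kap; field; rewrite !gt_eqF.
  rewrite /q -[X in _ <= _ * X]real_normK ?num_real// ler_wpM2l//.
    by rewrite divr_ge0 ?exprn_ge0// mulr_ge0 ?(ltW kap0)// mulr_ge0.
  rewrite ler_sqr ?nnegrE// mulr_ge0 ?(ltW d20)// divr_ge0 ?(ltW N0)// mulr_ge0//.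
apply: (le_trans (walk_mean_norm_le _ _ (fun i => s01 b^-1 v i) le)).
rewrite walk_meanD walk_mean_cst walk_mean_sum [leRHS]splitr lerD2l.
apply: (@le_trans _ _ (\sum_(i < k) 2 * M * kap / N%:R)).
  apply: ler_sum => i _; rewrite walk_meanZ walk_mean_sqr count_walk.
  rewrite add0r subrr expr0n add0r.
  have -> : 2 * M * kap / N%:R ^+ 2 * (N%:R * (s i * (1 - s i))) = 2 * M * kap / N%:R * (s i * (1 - s i)).
    by field; rewrite gt_eqF.
  apply: ler_piMr; first by rewrite divr_ge0 ?(ltW N0)// mulr_ge0 ?(ltW kap0)// mulr_ge0.
  have /andP[sge sle] := s01 b^-1 v i; rewrite -/(s i) in sge sle.
  by apply: (@le_trans _ _ (s i)) => //; rewrite ler_piMr// gerBl.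
rewrite sumr_const card_ord -[leLHS]mulr_natl mulrA ler_pdivrMr//.
by move: hm; rewrite ler_pdivrMr// [leRHS]mulrC.
Qed.

Context (d d' : measure_display) (W : measurableType d)
  (W' : measurableType d') (P : probability W R) (P' : probability W' R)
  (x : nat -> 'I_k -> W -> R) (y : 'I_k -> W' -> R) (C : R).
Hypothesis sx : forall n i, sqint P (x n i) /\ nrm P (x n i) <= C.
Hypothesis sy : forall i, sqint P' (y i) /\ nrm P' (y i) <= C.
Hypothesis cvg_cos : forall (a : 'I_k -> R) c,
  mean P (fun w => cos (c + \sum_i a i * x n i w)) @[n --> \oo] -->
  mean P' (fun w => cos (c + \sum_i a i * y i w)).

Let mx n i : measurable_fun setT (x n i). Proof. by have [[]] := sx n i. Qed.
Let my i : measurable_fun setT (y i). Proof. by have [[]] := sy i. Qed.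

Let tb b N : test_function P P' x y (bernstein b N).
Proof. exact: (test_walk_mean mx my cvg_cos). Qed.

(** Approximations on growing boxes with shrinking errors converge pointwise, which also yields the
    measurability of [h] composed with the vectors. *)
Let approx (m : nat) : {bN : R * nat | forall v, (forall i, `|v i| <= m.+1%:R) ->
  `|bernstein bN.1 bN.2 v - h (\row_i v i)| <= m.+1%:R^-1}.
Proof.
apply: cid; have [|b [N hb]] := @bernstein_approx m.+1%:R m.+1%:R^-1 (ltr0Sn _ _).
  by rewrite invr_gt0.
by exists (b, N).
Qed.

Let cvg_approx (v : 'I_k -> R) :
  bernstein (sval (approx m)).1 (sval (approx m)).2 v @[m --> \oo] --> h (\row_i v i).
Proof.
apply/cvgrPdist_le => e e0; near=> m.
have vm i : `|v i| <= m.+1%:R.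
  apply: (@le_trans _ _ (\sum_j `|v j|)); first by rewrite (bigD1 i)//= lerDl sumr_ge0.
  apply: (@le_trans _ _ m%:R); last by rewrite ler_nat.
  by near: m; exact: nbhs_infty_ger.
rewrite distrC; apply: (le_trans ((svalP (approx m)) v vm)).
rewrite -[e]invrK lef_pV2 ?posrE ?invr_gt0//.
apply: (@le_trans _ _ m%:R); last by rewrite ler_nat.
by near: m; exact: nbhs_infty_ger.
Unshelve. all: by end_near. Qed.

Lemma weak_L1 n : L1 P (fun w => h (\row_i x n i w)).
Proof.
apply: (@L1_bounded _ _ _ _ M) => [|w]; last exact: hM.
apply: (measurable_fun_cvg (fun m => test_measurable_x (tb (sval (approx m)).1 (sval (approx m)).2) n)).
by move=> w _; exact: cvg_approx.
Qed.

Lemma weak_limit_L1 : L1 P' (fun w => h (\row_i y i w)).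
Proof.
apply: (@L1_bounded _ _ _ _ M) => [|w]; last exact: hM.
apply: (measurable_fun_cvg (fun m => test_measurable_y (tb (sval (approx m)).1 (sval (approx m)).2))).
by move=> w _; exact: cvg_approx.
Qed.

(** Outside the box of radius [r] the difference is at most [2 M], and hence at most [2 M / r^2]
    times a squared coordinate; the uniform second moments bound the mean. *)
Let tail (d0 : measure_display) (V : measurableType d0) (Q : probability V R)
  (z : 'I_k -> V -> R) (f : ('I_k -> R) -> R) (r e : R) : 0 < r ->
  (forall i, sqint Q (z i) /\ nrm Q (z i) <= C) ->
  L1 Q (fun w => f (z ^~ w)) -> L1 Q (fun w => h (\row_i z i w)) ->
  0 <= e -> (forall v, `|f v| <= M) ->
  (forall v, (forall i, `|v i| <= r) -> `|f v - h (\row_i v i)| <= e) ->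
  `|mean Q (fun w => f (z ^~ w)) - mean Q (fun w => h (\row_i z i w))| <=
  e + 2 * M * (k%:R * C ^+ 2) / r ^+ 2.
Proof.
move=> r0 sz if_ ih e0 fM fh; rewrite -(meanB if_ ih).
have i2 : L1 Q (fun w => \sum_i 2 * M / r ^+ 2 * z i w ^+ 2).
  by apply: L1_sum => i; apply: L1Z; have [[]] := sz i.
have r20 : 0 < r ^+ 2 by rewrite exprn_gt0.
have c0 : 0 <= 2 * M / r ^+ 2 by rewrite divr_ge0 ?(ltW r20)// mulr_ge0.
have t0 i w : 0 <= 2 * M / r ^+ 2 * z i w ^+ 2 by rewrite mulr_ge0// sqr_ge0.
apply: (le_trans (@mean_norm_le _ _ _ _ _ (fun w => e + \sum_i 2 * M / r ^+ 2 * z i w ^+ 2)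
  (L1B if_ ih) (L1D (L1_cst Q e) i2) _)) => [w|].
  have [/forallP near|] := boolP [forall i, `|z i w| <= r].
    by rewrite (le_trans (fh _ near))// lerDl sumr_ge0.
  rewrite negb_forall => /existsP[i]; rewrite -ltNge => far.
  apply: (@le_trans _ _ (2 * M)).
    rewrite (le_trans (ler_normB _ _))//.
    have -> : 2 * M = M + M by ring.
    exact: lerD.
  rewrite (bigD1 i)//= addrCA; apply: ler_wpDr; first by rewrite addr_ge0// sumr_ge0.
  rewrite mulrAC ler_pdivlMr// ler_wpM2l ?mulr_ge0//.
  by rewrite -[leRHS]real_normK ?num_real// ler_sqr ?nnegrE ?(ltW r0)// ltW.
rewrite (meanD (L1_cst Q e) i2) mean_cst lerD2l mean_sum; last first.
  by move=> i; apply: L1Z; have [[]] := sz i.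
apply: (@le_trans _ _ (\sum_(i < k) 2 * M / r ^+ 2 * C ^+ 2)).
  apply: ler_sum => i _; have [[_ i1] ni] := sz i.
  rewrite (meanZ _ i1) ler_wpM2l// -sqr_nrm ler_sqr ?nnegrE ?nrm_ge0//.
  exact: le_trans (nrm_ge0 _ _) ni.
by rewrite sumr_const card_ord -mulr_natl; set a := k%:R; rewrite le_eqVlt; apply/orP; left; apply/eqP; ring.
Qed.

Lemma weak_convergence :
  mean P (fun w => h (\row_i x n i w)) @[n --> \oo] --> mean P' (fun w => h (\row_i y i w)).
Proof.
apply/cvgrPdist_le => e e0.
(* Five errors: an approximation and a tail term for each of the two laws, and the convergence for
   the fixed Bernstein polynomial. The radius [r] below makes a tail at most [e / 5]. *)
have e50 : 0 < e / 5 by rewrite divr_gt0.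
pose T := 2 * M * (k%:R * C ^+ 2).
have T0 : 0 <= T by apply: mulr_ge0; [exact: mulr_ge0|apply: mulr_ge0 => //; exact: sqr_ge0].
pose r : R := 1 + T / (e / 5).
have r1 : 1 <= r by rewrite lerDl divr_ge0// ltW.
have r0 : 0 < r by exact: lt_le_trans r1.
have Tr : T / r ^+ 2 <= e / 5.
  rewrite ler_pdivrMr ?exprn_gt0//; apply: (@le_trans _ _ (e / 5 * r)).
    by rewrite -ler_pdivrMl// mulrC /r lerDr.
  by rewrite ler_pM2l// expr2 ler_peMr// ltW.
have [b [N hb]] := bernstein_approx r0 e50.
have := test_mean_cvg (tb b N) => /cvgrPdist_le/(_ _ e50); apply: filterS => n.
have tx := test_measurable_x (tb b N) n; have ty := test_measurable_y (tb b N).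
have ix : L1 P (fun w => bernstein b N ((x n)^~ w)).
  by apply: (@L1_bounded _ _ _ _ M) => // w; exact: bernstein_bounded.
have iy : L1 P' (fun w => bernstein b N (y^~ w)).
  by apply: (@L1_bounded _ _ _ _ M) => // w; exact: bernstein_bounded.
have := tail r0 (sx n) ix (weak_L1 n) (ltW e50) (bernstein_bounded b N) hb.
have := tail r0 sy iy weak_limit_L1 (ltW e50) (bernstein_bounded b N) hb.
rewrite -/T; set A := mean P' _; set B := mean P' _; set A' := mean P _; set B' := mean P _.
by rewrite !ler_norml => /andP[? ?] /andP[? ?] /andP[? ?]; apply/andP; split; lra.
Qed.

End weak_convergence.

(** * The scaling limit *)

Section scaling_limit.
Context (d dS dB : measure_display) (W : measurableType d) (S : measurableType dS)
  (WB : measurableType dB) (R : realType) (P : probability W R) (pi : probability S R)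
  (PB : probability WB R) (K : R -> R.-pker S ~> S) (F : R -> set (set W)) (X : R -> W -> S)
  (Ainv : perp1 pi -> perp1 pi) (B : perp1 pi -> R -> WB -> R) (gamma : R).
Hypothesis emp : ergodic_markov_process P pi K F X.
Hypothesis ga : generator_assumption K Ainv.
Hypothesis bfB : brownian_field PB (form Ainv) B.

Let Z := lamperti gamma B.
Let U n := lamperti gamma (additive_functional X n : perp1 pi -> R -> W -> R).
Let kap t := expR (- `|gamma| * t) / Num.sqrt (2 * `|gamma|).
Let tau t := expR (2 * `|gamma| * t).

(** The Lamperti transform evaluates [B] at the positive times [tau t] only, where the two-sided
    covariance reduces to the minimum obtained for the functionals. *)
Lemma cvg_mean_cos_lamperti (k : nat) (f : 'I_k -> perp1 pi) (t : 'I_k -> R)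
    (a : 'I_k -> R) c :
  mean P (fun w => cos (c + \sum_i a i * U n (f i) (t i) w)) @[n --> \oo] -->
  mean PB (fun w => cos (c + \sum_i a i * Z (f i) (t i) w)).
Proof.
(* The sign compensates the one in the cosine limit, which is stated for the negated
   coefficients. *)
pose b i := - (a i * kap (t i)).
have h := @cvg_mean_cos_additive_functional _ _ _ _ _ _ _ _ _ _ _ emp ga k f
  (fun i => tau (t i)) b c (fun i => expR_ge0 _).
rewrite (@eq_mean _ _ _ _ _ (fun w => cos (c + \sum_i (a i * kap (t i)) * B (f i) (tau (t i)) w))); last first.
  by move=> w; congr (cos (_ + _)); apply: eq_bigr => i _; rewrite mulrA.
rewrite (gaussian_cos_sum (bf_gaussian bfB)).
set v := \sum_i _; set v' := \sum_i _ in h.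
have -> : v = v'.
  apply: eq_bigr => i _; apply: eq_bigr => j _.
  rewrite (brownian_mean bfB) /two_sided_cov mulr_gt0 ?expR_gt0// !(ger0_norm (expR_ge0 _)).
  by rewrite /b mulrNN.
apply: (cvg_eqn h) => n; apply: eq_mean => w; congr (cos (_ + _)).
by apply: eq_bigr => i _; rewrite /b opprK mulrA.
Qed.

Lemma cvg_fdd_lamperti : cvg_fdd P PB U Z.
Proof.
move=> k f t _ h ch [M hM].
have k0 t' : 0 <= kap t' by rewrite divr_ge0 ?expR_ge0 ?sqrtr_ge0.
have sZ i : sqint PB (Z (f i) (t i)).
  exact: sqintZ (gaussian_sqint (bf_gaussian bfB) _ _).
pose C := \sum_i (kap (t i) * (4 * nrm pi (Ainv (f i)) + tau (t i) * nrm pi (f i)) +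
  nrm PB (Z (f i) (t i))).
have c0 i : 0 <= kap (t i) * (4 * nrm pi (Ainv (f i)) + tau (t i) * nrm pi (f i)).
  apply: mulr_ge0 => //; apply: addr_ge0; first by apply: mulr_ge0 => //; exact: nrm_ge0.
  by apply: mulr_ge0; [exact: expR_ge0|exact: nrm_ge0].
have cC i : kap (t i) * (4 * nrm pi (Ainv (f i)) + tau (t i) * nrm pi (f i)) +
    nrm PB (Z (f i) (t i)) <= C.
  rewrite /C (bigD1 i)//= lerDl sumr_ge0// => j _.
  by apply: addr_ge0; [exact: c0|exact: nrm_ge0].
have sU n i : sqint P (U n (f i) (t i)) /\ nrm P (U n (f i) (t i)) <= C.
  have [h1 h2] := additive_functional_sqint emp ga n (f i) (expR_ge0 (2 * `|gamma| * t i)).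
  split; first exact: sqintZ.
  apply: le_trans (cC i); apply: ler_wpDr; first exact: nrm_ge0.
  have -> : nrm P (U n (f i) (t i)) = `|kap (t i)| *
    nrm P (additive_functional X n (f i) (tau (t i))) by exact: nrmZ.
  by rewrite (ger0_norm (k0 _)) ler_wpM2l.
have sZ' i : sqint PB (Z (f i) (t i)) /\ nrm PB (Z (f i) (t i)) <= C.
  by split => //; apply: le_trans (cC i); rewrite lerDr.
have cv a c := @cvg_mean_cos_lamperti k f t a c.
have wc := weak_convergence ch hM sU sZ' cv.
have iU := weak_L1 ch hM sU sZ' cv; have iZ := weak_limit_L1 ch hM sU sZ' cv.
rewrite (expectation_mean iZ).
under eq_fun do rewrite (expectation_mean (iU _)).
by apply: cvg_EFin; [exact: nearW|exact: wc].
Qed.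

End scaling_limit.

(** Second moments are read off from the equality of laws with [B]; integrability of the products is
    transferred along with their means. *)
Lemma innovation_two_sided_cov (d d' : measure_display) (W : measurableType d)
  (W' : measurableType d') (R : realType) (P : probability W R) (P' : probability W' R)
  (E : lmodType R) (Y : E -> R -> W -> R) (B : E -> R -> W' -> R)
  (q : E -> E -> R) (G : E -> E) :
  (forall f t, measurable_fun setT (innovation Y G f t)) ->
  eq_fdd P P' (innovation Y G) B -> brownian_field P' q B ->
  has_two_sided_cov P q (innovation Y G).
Proof.
move=> mI law bfB f g s t.
have sB f' t' : sqint P' (B f' t') := gaussian_sqint (bf_gaussian bfB) f' t'.
have mB f' t' : measurable_fun setT (B f' t') by case: (sB f' t').
have law' : eq_fdd P' P B (innovation Y G) by move=> k h u A mA; rewrite law.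
have [i e] := eq_fdd_mean_mul mB mI law' (sqintM (sB f s) (sB g t)).
by rewrite (expectation_mean i) -e (brownian_mean bfB).
Qed.

Theorem theorem2p10 (R : realType) (d dS dB : measure_display)
  (W : measurableType d) (S : measurableType dS) (WB : measurableType dB)
  (P : probability W R) (pi : probability S R) (PB : probability WB R)
  (K : R -> R.-pker S ~> S) (F : R -> set (set W)) (X : R -> W -> S)
  (Ainv : perp1 pi -> perp1 pi) (B : perp1 pi -> R -> WB -> R) (gamma : R) :
  measure_is_complete P ->
  ergodic_markov_process P pi K F X ->
  generator_assumption K Ainv ->
  brownian_field PB (fun f g : perp1 pi => - 2 * L2dot pi f (Ainv g)) B ->
  gamma < 0 ->
  let Z := lamperti gamma B in
  let p := fun f : perp1 pi =>
    Num.sqrt (`|gamma|^-1 * L2dot pi f (- Ainv f)) in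
  let Gamma := fun f : perp1 pi => - `|gamma| *: f in
  let U := fun n : nat => lamperti gamma (additive_functional X n) in
  let C := fun f : perp1 pi => - 2 *: Ainv f in
  [/\ (* 1 *)
      [/\ ou_process PB Z, char_seminorm PB Z p, char_operator PB Z Gamma &
          forall (d' : measure_display) (W' : measurableType d')
            (P' : probability W' R) (Y : perp1 pi -> R -> W' -> R),
            ou_process P' Y -> char_seminorm P' Y p ->
            char_operator P' Y Gamma -> eq_fdd PB P' Z Y],
      (* 2 *)
      deterministic_component PB Z (fun _ _ _ => 0),
      (* 3 *)
      eq_fdd PB PB (innovation Z Gamma) B &
      (* 4 *)
      [/\ cvg_fdd P PB U Z,
          char_operator PB Z (fun f : perp1 pi => gamma *: f) &
          has_two_sided_cov PB (fun f g : perp1 pi => L2dot pi f (C g))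
            (innovation Z (fun f : perp1 pi => gamma *: f))]].
Proof.
move=> _ emp ga bfB gamma0 Z p Gamma U C.
have c0 : gamma != 0 by rewrite lt_eqF.
have k0 : 0 < `|gamma| by rewrite normr_gt0.
have gammaE : gamma = - `|gamma| by rewrite ltr0_norm// opprK.
have gp : gaussian_process PB Z by exact: lamperti_gaussian bfB.
have lin : linear_process PB Z by exact: lamperti_linear bfB.
have cZ f w : continuous (fun t => Z f t w) :=
  @lamperti_continuous _ _ _ _ _ B _ gamma bfB f w.
have cov f g s t := lamperti_cov c0 bfB f g s t.
have hG f : Gamma f = - `|gamma| *: f by [].
have ouZ := ou_process_of_cov k0 gp lin cov.
have dotN (f g : perp1 pi) (a : R) : L2dot pi f (a *: g) = a * L2dot pi f g.
  rewrite -(meanZ a (sqintM (L2_sqint f) (L2_sqint g))); apply: eq_mean => x.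
  by rewrite (_ : (a *: g) x = a * g x)//; ring.
have pZ : char_seminorm PB Z p.
  rewrite (_ : p = fun f => nrm PB (Z f 0)); first exact: ou_char_seminorm gp cov.
  apply/funext => f; rewrite (nrm_process cov) /p -scaleN1r dotN.
  by congr Num.sqrt; field; rewrite gt_eqF.
have opZ := ou_char_operator k0 gp lin cov hG.
have law := eq_fdd_innovation k0 gp lin cov cZ hG bfB.
have gE : (fun f : perp1 pi => gamma *: f) = Gamma by apply/funext => f; rewrite /Gamma -gammaE.
split.
- split => // d' W' P' Y oY pY gY.
  exact: (ou_process_unique k0 hG ouZ pZ opZ oY pY gY).
- exact: ou_deterministic_component k0 gp cov.
- exact: law.
split; first exact: cvg_fdd_lamperti emp ga bfB.
  by rewrite gE.
rewrite gE (_ : (fun f g : perp1 pi => L2dot pi f (C g)) = (fun f g => - 2 * L2dot pi f (Ainv g))).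
  apply: innovation_two_sided_cov law bfB => f t.
  apply: (@measurable_innovation _ _ _ _ _ _ _ Gamma k0 gp cZ (Num.truncn `|t|).+1).
  exact: ltW (truncnS_gt _).
by apply/funext => f; apply/funext => g; rewrite dotN.
Qed.
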